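(* Let $k\ge1$ be an odd integer, let $\chi$ be a non-principal even primitive Dirichlet character modulo $q$, and let $a,x>0$. Then \begin{align*} \sum_{n=1}^\infty\sigma_{k,\chi}(n) K_0(a\sqrt{nx})=&- \frac{ L(-k,\chi) }{4}\left( \log \left(\frac{8\pi}{a^2} \right) +\frac{ L'(-k,\chi)}{ L(-k,\chi)} -2\gamma \right)+\frac{ L(-k,\chi) }{4} \log x\\ &+(-1)^{\frac{k-1}{2}}\frac{k!\,q^k}{2 ({2\pi })^{k+1} } \tau(\chi) \sum_{n=1}^\infty \bar{\sigma}_{k, \bar{\chi}}(n) \left(\frac{1}{n^{k+1}}-\frac{1}{(n+ \frac{a^2qx}{16\pi^2} )^{k+1} } \right), \end{align*} where $\gamma$ is Euler's constant.
   Context: For a Dirichlet character $\chi$ and $z\in\mathbb{C}$: $\sigma_{z,\chi}(n)=\sum_{d\mid n}d^z\chi(d)$ and $\bar{\sigma}_{z,\chi}(n)=\sum_{d\mid n}d^z\chi(n/d)$. $\tau(\chi)=\sum_{h=1}^q\chi(h)e^{2\pi i h/q}$ is the Gauss sum, $L(s,\chi)$ the Dirichlet $L$-function, and $K_0$ the modified Bessel function of the second kind of order $0$. *)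

(* Defs.v *)
From Stdlib Require Import Reals Lra Lia Arith List.
From Coquelicot Require Import Coquelicot.
Open Scope R_scope.

Definition cexp (z : C) : C := (exp (Re z) * cos (Im z), exp (Re z) * sin (Im z)).
Definition ncpow (n : nat) (s : C) : C := cexp (Cmult s (RtoC (ln (INR n)))).

Definition is_dirichlet_character (q : nat) (chi : nat -> C) : Prop :=
  (1 <= q)%nat /\
  (forall n, chi (n + q)%nat = chi n) /\
  (forall m n, chi (m * n)%nat = Cmult (chi m) (chi n)) /\
  chi 1%nat = RtoC 1 /\
  (forall n, chi n = RtoC 0 <-> Nat.gcd n q <> 1%nat).

Definition is_principal (q : nat) (chi : nat -> C) : Prop :=
  forall n, Nat.gcd n q = 1%nat -> chi n = RtoC 1.

Definition is_even_char (q : nat) (chi : nat -> C) : Prop := chi (q - 1)%nat = RtoC 1.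

(* primitive: for every proper divisor d of q, chi is not trivial on the
   residues a coprime to q with a = 1 (mod d), i.e. chi is not induced mod d *)
Definition is_primitive_char (q : nat) (chi : nat -> C) : Prop :=
  forall d, Nat.divide d q -> (d < q)%nat ->
    exists a, Nat.gcd a q = 1%nat /\ (a mod d = 1 mod d)%nat /\ chi a <> RtoC 1.

Definition conj_char (chi : nat -> C) : nat -> C := fun n => Cconj (chi n).

Fixpoint csum1 (N : nat) (f : nat -> C) : C :=
  match N with
  | O => RtoC 0
  | S M => Cplus (csum1 M f) (f N)
  end.

Definition gauss_sum (q : nat) (chi : nat -> C) : C :=
  csum1 q (fun h => Cmult (chi h) (cexp (0, 2 * PI * INR h / INR q))).

Definition sigma_chi (k : nat) (chi : nat -> C) (n : nat) : C :=
  csum1 n (fun d => if Nat.eqb (n mod d) 0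
                    then Cmult (RtoC (INR d ^ k)) (chi d) else RtoC 0).

Definition sigmabar_chi (k : nat) (chi : nat -> C) (n : nat) : C :=
  csum1 n (fun d => if Nat.eqb (n mod d) 0
                    then Cmult (RtoC (INR d ^ k)) (chi (n / d)%nat) else RtoC 0).

Definition euler_gamma : R :=
  real (Lim_seq (fun n => sum_f_R0 (fun j => / INR (j + 1)) n - ln (INR (n + 1)))).

Definition besselK0 (x : R) : R :=
  RInt_gen (fun t => exp (- x * cosh t)) (at_point 0) (Rbar_locally p_infty).

(* Lf is (the) analytic continuation of L(s,chi): entire, and equal to the
   Dirichlet series sum_{n>=1} chi(n) n^{-s} for Re s > 1. *)
Definition is_L_function (chi : nat -> C) (Lf : C -> C) : Prop :=
  (forall z : C, ex_derive (K := C_AbsRing) (V := C_NormedModule) Lf z) /\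
  (forall s : C, 1 < Re s ->
     is_series (K := C_AbsRing) (V := C_NormedModule)
       (fun n => Cmult (chi (S n)) (ncpow (S n) (Copp s))) (Lf s)).

(* Main.v *)
Require Import Defs.
From Stdlib Require Import Reals Lra Lia Arith List Factorial Permutation.
From Coquelicot Require Import Coquelicot.
Open Scope R_scope.

(** With [c = a^2 x / 4] one has [K_0(a sqrt(n x)) = 1/2 int exp(-c e^X - n e^(-X)) dX] over the real
    line, so the left-hand side is [1/2 int exp(-c e^X) G(e^(-X)) dX] where [G(v) = sum sigma(n) e^(-n v)].
    Lipschitz's summation formula, twisted by [chi] through the Gauss sum, expands
    [sum chi(d) d^k e^(-d m v)] over the points [m v + i b_n], [b_n = 2 pi n / q]; summing over [m] and
    applying Lipschitz's formula once more in the other direction turns [G(v)] into a combination of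
    [conj(chi(n)) b_n^(-k-1) h_k(2 pi b_n / v)], with [h_k(w) + 1 = w^(k+1)/k! sum_d d^k e^(-d w)].
    The integral of [exp(-y e^X) h_k(e^X)] is elementary: up to the constant [gamma + H_k] it equals
    [ln y] minus a sum over [d], which regroups into the series over [sigmabar].
    The logarithms [ln b_n] reassemble into [L'(-k, chi)], because [L(s, chi)] at and near [s = -k] is a
    Mellin transform of the same twisted theta series.  That the given entire [Lf] agrees there with the
    Mellin transform is analytic continuation from [Re s > 1], carried out along the half-plane. *)

(** * Fourier uniqueness on the circle *)

(* Coquelicot's canonical structures hide [R] from [ring] and [field]. *)
Ltac eqR := match goal with |- @eq _ ?a ?b => change (@eq R a b) end.

Ltac plusR := repeat match goal with |- context [@plus ?G ?a ?b] => change (@plus G a b) with (Rplus a b) end; eqR.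

(** The obstacle throughout is to exchange sums and integrals with hardly any decay to spare when k
    = 1. Every exchange is an instance of one tail estimate, [integral_series], and decay is
    rationed in halves: a cubic decay shared by two variables leaves 3/2 to each, whence the
    recurring weight [z32] of order n^(-3/2). Integrals over (0, oo) are written with t = e^X, so
    that scalings become translations and majorants become e^(-d |X|). The two parities act in
    different places: chi even folds the frequencies n and -n into one real part, k odd makes
    (-i)^(k+1) real. The theta series behind L carries n^(k+1) instead of n^k: its Mellin transform
    at z is L(z - k - 1) Gamma(z), so s = -k becomes z = 1, an interior point of Re z > 0 where
    Gamma = 1 and Gamma' = -gamma. The harmonic number produced there cancels the one in the kernel
    integral. Continuation works without power series: vanishing passes from a circle to a larger
    concentric one by Goursat on rectangles in logarithmic coordinates, combined with uniqueness of
    Fourier coefficients. *)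

Lemma continuous_mult_R (f g : R -> R) x :
  continuous f x -> continuous g x -> continuous (fun t => f t * g t) x.
Proof. intros Hf Hg. apply (continuous_mult (K:=R_AbsRing) f g x Hf Hg). Qed.

Lemma continuous_plus_R (f g : R -> R) x :
  continuous f x -> continuous g x -> continuous (fun t => f t + g t) x.
Proof. intros Hf Hg. apply (continuous_plus (V:=R_NormedModule) f g x Hf Hg). Qed.

Lemma continuous_of_derivable (f : R -> R) x : ex_derive f x -> continuous f x.
Proof. intros H. apply (ex_derive_continuous (K:=R_AbsRing) (V:=R_NormedModule) f x H). Qed.

Lemma ex_RInt_continuous_all (f : R -> R) a b :
  (forall x, continuous f x) -> ex_RInt f a b.
Proof. intros H. apply (ex_RInt_continuous (V:=R_CompleteNormedModule)). auto. Qed.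

Lemma continuous_pow_R (f : R -> R) n x :
  continuous f x -> continuous (fun t => f t ^ n) x.
Proof.
  intros H; induction n as [|n IH]; simpl.
  - apply continuous_const.
  - now apply continuous_mult_R.
Qed.

(** With [cos_ge_inside], this shapes the peak kernel e + cos(2 pi (x - x0)). For x and x0 in [0, 1]
    the difference can approach a full period, so the far side of the period has to be excluded as
    well. *)
Lemma cos_le_outside (y d : R) :
  0 < d <= 1/2 -> d <= Rabs y <= 1 - d -> cos (2 * PI * y) <= cos (2 * PI * d).
Proof.
  intros Hd Hy.
  assert (HP := PI_RGT_0).
  assert (E : cos (2 * PI * y) = cos (2 * PI * Rabs y)).
  { unfold Rabs; destruct (Rcase_abs y); auto.
    rewrite <- cos_neg. f_equal. ring. }
  rewrite E. clear E. set (z := Rabs y) in *.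
  destruct (Rle_dec z (1/2)).
  - apply cos_decr_1; nra.
  - replace (cos (2 * PI * z)) with (cos (2 * PI * (1 - z))).
    + apply cos_decr_1; nra.
    + replace (2 * PI * (1 - z)) with (- (2 * PI * z) + 2 * PI) by ring.
      rewrite cos_plus, cos_2PI, sin_2PI, cos_neg. ring.
Qed.

Lemma cos_ge_inside (y d : R) :
  0 < d <= 1/2 -> Rabs y <= d -> cos (2 * PI * d) <= cos (2 * PI * y).
Proof.
  intros Hd Hy.
  assert (HP := PI_RGT_0). assert (H0 := Rabs_pos y).
  assert (E : cos (2 * PI * y) = cos (2 * PI * Rabs y)).
  { unfold Rabs; destruct (Rcase_abs y); auto.
    rewrite <- cos_neg. f_equal. ring. }
  rewrite E. apply cos_decr_1; nra.
Qed.

(** One more factor of the kernel only mixes the frequencies n - 1, n and n + 1, so the vanishing of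
    all moments survives it. Cosine and sine moments feed each other and share the induction. *)
Lemma fourier_kernel_moments (h : R -> R) (x0 e : R) :
  (forall x, continuous h x) ->
  (forall n : Z, RInt (fun x => h x * cos (2 * PI * IZR n * x)) 0 1 = 0) ->
  (forall n : Z, RInt (fun x => h x * sin (2 * PI * IZR n * x)) 0 1 = 0) ->
  forall N (n : Z),
    RInt (fun x => h x * (e + cos (2 * PI * (x - x0))) ^ N * cos (2 * PI * IZR n * x)) 0 1 = 0 /\
    RInt (fun x => h x * (e + cos (2 * PI * (x - x0))) ^ N * sin (2 * PI * IZR n * x)) 0 1 = 0.
Proof.
  intros Hh Hc Hs.
  set (Q := fun x => e + cos (2 * PI * (x - x0))).
  assert (HQ : forall x, continuous Q x).
  { intros x. apply continuous_of_derivable. unfold Q. auto_derive. trivial. }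
  assert (Hcos : forall a x, continuous (fun x => cos (a * x)) x).
  { intros. apply continuous_of_derivable. auto_derive. trivial. }
  assert (Hsin : forall a x, continuous (fun x => sin (a * x)) x).
  { intros. apply continuous_of_derivable. auto_derive. trivial. }
  assert (HI : forall N (f : R -> R), (forall x, continuous f x) ->
            ex_RInt (fun x => h x * Q x ^ N * f x) 0 1).
  { intros N f Hf. apply ex_RInt_continuous_all. intros x.
    apply continuous_mult_R; auto. apply continuous_mult_R; auto.
    now apply continuous_pow_R. }
  induction N as [|N IH]; intros n.
  - split; [etransitivity; [|apply (Hc n)] | etransitivity; [|apply (Hs n)]];
    apply RInt_ext; intros; simpl; ring.
  - set (A := fun n x => h x * Q x ^ N * cos (2 * PI * IZR n * x)).
    set (B := fun n x => h x * Q x ^ N * sin (2 * PI * IZR n * x)).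
    assert (HA : forall m, is_RInt (A m) 0 1 0).
    { intros m. assert (E : ex_RInt (A m) 0 1) by now apply HI.
      apply (RInt_correct (V:=R_CompleteNormedModule)) in E. now rewrite (proj1 (IH m) : RInt (A m) 0 1 = 0) in E. }
    assert (HB : forall m, is_RInt (B m) 0 1 0).
    { intros m. assert (E : ex_RInt (B m) 0 1) by now apply HI.
      apply (RInt_correct (V:=R_CompleteNormedModule)) in E. now rewrite (proj2 (IH m) : RInt (B m) 0 1 = 0) in E. }
    set (p := 2 * PI * x0).
    assert (HL : forall a b c (f g k : R -> R), is_RInt f 0 1 0 -> is_RInt g 0 1 0 -> is_RInt k 0 1 0 ->
              is_RInt (fun x => a * f x + b * g x + c * k x) 0 1 0).
    { intros a b c f g k0 Hf Hg Hk.
      replace 0 with (plus (plus (scal a 0) (scal b 0)) (scal c 0)) at 2 by (unfold plus, scal; simpl; unfold mult; simpl; ring).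
      apply (is_RInt_plus (V:=R_NormedModule) (fun x => a * f x + b * g x) (fun x => c * k0 x)).
      apply (is_RInt_plus (V:=R_NormedModule) (fun x => a * f x) (fun x => b * g x)).
      apply (is_RInt_scal (V:=R_NormedModule) f 0 1 a); auto.
      apply (is_RInt_scal (V:=R_NormedModule) g 0 1 b); auto.
      apply (is_RInt_scal (V:=R_NormedModule) k0 0 1 c); auto. }
    (* The product-to-sum formulas give five known moments: one at frequency n, and a cosine and a
       sine at each of n + 1 and n - 1. *)
    assert (HL5 : forall a b c d u (f g k l w : R -> R), is_RInt f 0 1 0 -> is_RInt g 0 1 0 -> is_RInt k 0 1 0 ->
              is_RInt l 0 1 0 -> is_RInt w 0 1 0 ->
              is_RInt (fun x => 1 * (a * f x + b * g x + c * k x) + d * l x + u * w x) 0 1 0).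
    { intros. apply (HL 1 d u (fun x => a * f x + b * g x + c * k x)); auto. }
    split; apply is_RInt_unique.
    + eapply is_RInt_ext; [| apply (HL5 e (cos p / 2) (cos p / 2) (sin p / 2) (- sin p / 2)
         (A n) (A (n+1)%Z) (A (n-1)%Z) (B (n+1)%Z) (B (n-1)%Z)); auto].
      intros x _. unfold A, B. rewrite plus_IZR, minus_IZR.
      change ((e + cos (2 * PI * (x - x0))) ^ S N) with ((e + cos (2 * PI * (x - x0))) * Q x ^ N).
      generalize (Q x ^ N); intros q0.
      replace (2 * PI * (x - x0)) with (2 * PI * x - p) by (unfold p; ring).
      replace (2 * PI * (IZR n + 1) * x) with (2 * PI * IZR n * x + 2 * PI * x) by ring.
      replace (2 * PI * (IZR n - 1) * x) with (2 * PI * IZR n * x - 2 * PI * x) by ring.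
      rewrite !cos_minus, !sin_minus, !cos_plus, !sin_plus. eqR. field.
    + eapply is_RInt_ext; [| apply (HL5 e (cos p / 2) (cos p / 2) (- sin p / 2) (sin p / 2)
         (B n) (B (n+1)%Z) (B (n-1)%Z) (A (n+1)%Z) (A (n-1)%Z)); auto].
      intros x _. unfold A, B. rewrite plus_IZR, minus_IZR.
      change ((e + cos (2 * PI * (x - x0))) ^ S N) with ((e + cos (2 * PI * (x - x0))) * Q x ^ N).
      generalize (Q x ^ N); intros q0.
      replace (2 * PI * (x - x0)) with (2 * PI * x - p) by (unfold p; ring).
      replace (2 * PI * (IZR n + 1) * x) with (2 * PI * IZR n * x + 2 * PI * x) by ring.
      replace (2 * PI * (IZR n - 1) * x) with (2 * PI * IZR n * x - 2 * PI * x) by ring.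
      rewrite !cos_minus, !sin_minus, !cos_plus, !sin_plus. eqR. field.
Qed.

(** Powers of a trigonometric polynomial that exceeds 1 only near [x0] concentrate there. If [h x0]
    were positive, the integral of h against them would grow geometrically, although it is 0. *)
Lemma fourier_uniqueness_nonpos (h : R -> R) :
  (forall x, continuous h x) ->
  (forall n : Z, RInt (fun x => h x * cos (2 * PI * IZR n * x)) 0 1 = 0) ->
  (forall n : Z, RInt (fun x => h x * sin (2 * PI * IZR n * x)) 0 1 = 0) ->
  forall x0, 0 < x0 < 1 -> h x0 <= 0.
Proof.
  intros Hh Hc Hs x0 Hx0.
  apply Rnot_lt_le. intros Hpos.
  set (s := h x0) in *.
  assert (Hd : exists d, 0 < d <= 1/4 /\ d <= x0 /\ d <= 1 - x0 /\
            forall x, Rabs (x - x0) <= d -> s / 2 <= h x).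
  { destruct (proj1 (filterlim_locally h (h x0)) (Hh x0) (mkposreal (s/2) ltac:(lra))) as [d Hd].
    exists (Rmin (Rmin (d/2) (1/4)) (Rmin x0 (1-x0))).
    assert (Hdp := cond_pos d).
    pose proof (Rmin_l (Rmin (d/2) (1/4)) (Rmin x0 (1-x0))).
    pose proof (Rmin_r (Rmin (d/2) (1/4)) (Rmin x0 (1-x0))).
    pose proof (Rmin_l (d/2) (1/4)). pose proof (Rmin_r (d/2) (1/4)).
    pose proof (Rmin_l x0 (1-x0)). pose proof (Rmin_r x0 (1-x0)).
    repeat split; try lra.
    - repeat apply Rmin_glb_lt; lra.
    - intros x Hx.
      assert (B : ball x0 d x). { unfold ball; simpl; unfold AbsRing_ball, abs, minus, plus, opp; simpl.
        change (Rabs (x - x0) < d). lra. }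
      specialize (Hd x B). unfold ball in Hd; simpl in Hd; unfold AbsRing_ball, abs, minus, plus, opp in Hd; simpl in Hd.
      change (Rabs (h x - h x0) < s / 2) in Hd. fold s in Hd.
      apply Rabs_def2 in Hd. lra. }
  destruct Hd as (d & Hd1 & Hd2 & Hd3 & Hd).
  (* With this [e] the kernel [Q] is at least 1 within distance d of [x0], at least 1 + [eta] within
     d/2, and at most 1 in absolute value on the rest of [0, 1]. *)
  set (e := 1 - cos (2 * PI * d)).
  set (Q := fun x => e + cos (2 * PI * (x - x0))).
  assert (HQ : forall x, continuous Q x).
  { intros x. apply continuous_of_derivable. unfold Q. auto_derive. trivial. }
  assert (HP := PI_RGT_0).
  set (eta := cos (2 * PI * (d/2)) - cos (2 * PI * d)).
  assert (Heta : 0 < eta).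
  { unfold eta. apply Rlt_0_minus. apply cos_decreasing_1; nra. }
  assert (Hcd : 0 <= cos (2 * PI * d)).
  { apply cos_ge_0; nra. }
  destruct (continuity_ab_maj (fun x => Rabs (h x)) 0 1) as (xm & Hxm & _); [lra| |].
  { intros x _. apply continuity_pt_filterlim. apply (continuous_comp h Rabs); auto. apply continuous_Rabs. }
  set (B := Rabs (h xm)) in *.
  assert (HB0 : 0 <= B) by apply Rabs_pos.
  assert (Hlow : forall N, d * (s / 2) * (1 + eta) ^ N <= B).
  { intros N.
    assert (HI : forall a b, ex_RInt (fun x => h x * Q x ^ N) a b).
    { intros. apply ex_RInt_continuous_all. intros; apply continuous_mult_R; auto. now apply continuous_pow_R. }
    assert (E0 : RInt (fun x => h x * Q x ^ N) 0 1 = 0).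
    { etransitivity; [| apply (proj1 (fourier_kernel_moments h x0 e Hh Hc Hs N 0%Z))].
      apply RInt_ext. intros x _. rewrite Rmult_0_r, Rmult_0_l, cos_0, Rmult_1_r. reflexivity. }
    (* On any piece of [0, 1] the integrand is nonnegative close to [x0] and bounded by [B] away
       from it, so the loss is uniform in N. *)
    assert (Hge1 : forall a b, 0 <= a <= b -> b <= 1 -> - B * (b - a) <= RInt (fun x => h x * Q x ^ N) a b).
    { intros a b Hab Hb1.
      replace (- B * (b - a)) with (RInt (fun _ => - B) a b) by (rewrite RInt_const; unfold scal; simpl; unfold mult; simpl; ring).
      apply RInt_le; auto; try lra. apply ex_RInt_const.
      intros x Hx.
      destruct (Rle_dec (Rabs (x - x0)) d) as [Hin|Hout].
      - specialize (Hd x Hin). assert (0 <= Q x ^ N).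
        { apply pow_le. unfold Q, e. assert (Hci := cos_ge_inside (x - x0) d ltac:(lra) Hin). lra. }
        nra.
      - assert (HQ1 : Rabs (Q x ^ N) <= 1).
        { rewrite <- RPow_abs. replace 1 with (1 ^ N) by apply pow1. apply pow_incr. split. apply Rabs_pos.
          assert (Hco : cos (2 * PI * (x - x0)) <= cos (2 * PI * d)).
          { apply cos_le_outside. lra. split. lra. apply Rabs_le. lra. }
          assert (Hb := COS_bound (2 * PI * (x - x0))).
          assert (Hb' := COS_bound (2 * PI * d)).
          apply Rabs_le. unfold Q, e. lra. }
        assert (Hh1 := Hxm x ltac:(lra)). cbv beta in Hh1. fold B in Hh1.
        assert (Rabs (h x * Q x ^ N) <= B * 1).
        { rewrite Rabs_mult. apply Rmult_le_compat; auto; apply Rabs_pos. }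
        apply Rabs_le_between in H. lra. }
    assert (Hge2 : d * (s / 2 * (1 + eta) ^ N) <= RInt (fun x => h x * Q x ^ N) (x0 - d/2) (x0 + d/2)).
    { replace (d * (s / 2 * (1 + eta) ^ N)) with (RInt (fun _ => s / 2 * (1 + eta) ^ N) (x0 - d/2) (x0 + d/2))
        by (rewrite RInt_const; unfold scal; simpl; unfold mult; simpl; field).
      apply RInt_le; auto; try lra. apply ex_RInt_const.
      intros x Hx. assert (Hx' : Rabs (x - x0) <= d / 2) by (apply Rabs_le; lra).
      apply Rmult_le_compat. lra. apply pow_le; lra. apply Hd; lra.
      apply pow_incr. split. lra. unfold eta, Q, e.
      assert (Hci := cos_ge_inside (x - x0) (d/2) ltac:(lra) Hx'). lra. }
    assert (H1 := Hge1 0 (x0 - d/2) ltac:(lra) ltac:(lra)).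
    assert (H2 := Hge1 (x0 + d/2) 1 ltac:(lra) ltac:(lra)).
    rewrite <- (RInt_Chasles (V:=R_CompleteNormedModule) _ 0 (x0 - d/2) 1) in E0; auto.
    rewrite <- (RInt_Chasles (V:=R_CompleteNormedModule) _ (x0 - d/2) (x0 + d/2) 1) in E0; auto.
    unfold plus in E0; simpl in E0. nra. }
  destruct (Pow_x_infinity (1 + eta)) with (b := B / (d * (s/2)) + 1) as (N & HN).
  { rewrite Rabs_pos_eq; lra. }
  specialize (HN N (le_n N)). rewrite Rabs_pos_eq in HN by (apply pow_le; lra).
  specialize (Hlow N).
  assert (0 < d * (s/2)) by nra.
  assert (d * (s/2) * (B / (d * (s/2)) + 1) <= d * (s/2) * (1 + eta) ^ N) by (apply Rmult_le_compat_l; lra).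
  replace (d * (s/2) * (B / (d * (s/2)) + 1)) with (B + d * (s/2)) in H0 by (field; lra).
  lra.
Qed.

Lemma fourier_uniqueness (h : R -> R) :
  (forall x, continuous h x) ->
  (forall n : Z, RInt (fun x => h x * cos (2 * PI * IZR n * x)) 0 1 = 0) ->
  (forall n : Z, RInt (fun x => h x * sin (2 * PI * IZR n * x)) 0 1 = 0) ->
  forall x, 0 <= x <= 1 -> h x = 0.
Proof.
  intros Hh Hc Hs.
  assert (Hint : forall x, 0 < x < 1 -> h x = 0).
  { intros x Hx. apply Rle_antisym.
    - now apply fourier_uniqueness_nonpos.
    - cut (- h x <= 0); [lra|].
      assert (Hopp : forall f : R -> R, (forall x, continuous f x) -> RInt (fun x => h x * f x) 0 1 = 0 ->
                RInt (fun x => - h x * f x) 0 1 = 0).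
      { intros f Hf E.
        assert (HI : is_RInt (fun x => h x * f x) 0 1 0).
        { rewrite <- E at 2. apply (RInt_correct (V:=R_CompleteNormedModule)).
          apply ex_RInt_continuous_all. intros; now apply continuous_mult_R. }
        apply (is_RInt_opp (V:=R_NormedModule)) in HI. apply is_RInt_unique.
        rewrite <- Ropp_0 at 2. eapply is_RInt_ext; [|exact HI].
        intros; unfold opp; simpl; eqR; ring. }
      apply (fourier_uniqueness_nonpos (fun x => - h x)); auto.
      + intros y. apply (continuous_opp (V:=R_NormedModule) h y (Hh y)).
      + intros n. apply (Hopp (fun x => cos (2 * PI * IZR n * x))); auto.
        intros; apply continuous_of_derivable; auto_derive; trivial.
      + intros n. apply (Hopp (fun x => sin (2 * PI * IZR n * x))); auto.
        intros; apply continuous_of_derivable; auto_derive; trivial. }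
  intros x Hx.
  (* A nonzero value at an endpoint would persist at a nearby interior point. *)
  destruct (Req_dec (h x) 0) as [E|E]; auto. exfalso.
  destruct (proj1 (filterlim_locally h (h x)) (Hh x) (mkposreal (Rabs (h x)) (Rabs_pos_lt _ E))) as [d Hd].
  assert (Hdp := cond_pos d).
  assert (Hy : exists y, 0 < y < 1 /\ Rabs (y - x) < d).
  { set (m := Rmin (d/2) (1/4)).
    pose proof (Rmin_l (d/2) (1/4)). pose proof (Rmin_r (d/2) (1/4)).
    assert (0 < m) by (apply Rmin_glb_lt; lra). fold m in H, H0.
    destruct (Rle_dec x (1/2)).
    - exists (x + m). split. lra. replace (x + m - x) with m by ring. rewrite Rabs_pos_eq; lra.
    - exists (x - m). split. lra. replace (x - m - x) with (-m) by ring. rewrite Rabs_Ropp, Rabs_pos_eq; lra. }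
  destruct Hy as (y & Hy & Hyx). specialize (Hd y Hyx). simpl in Hd.
  unfold ball in Hd; simpl in Hd; unfold AbsRing_ball, abs, minus, plus, opp in Hd; simpl in Hd.
  rewrite (Hint y Hy) in Hd. replace (0 + - h x) with (- h x) in Hd by ring.
  rewrite Rabs_Ropp in Hd. lra.
Qed.

(** * Complex differentiation *)

Lemma Cmod_le_abs (z : C) : Cmod z <= Rabs (Re z) + Rabs (Im z).
Proof.
  unfold Cmod. pose proof (Rabs_pos (Re z)). pose proof (Rabs_pos (Im z)).
  apply Rsqr_incr_0_var; [|lra].
  rewrite Rsqr_sqrt by (simpl; nra).
  unfold Rsqr. change (fst z) with (Re z). change (snd z) with (Im z).
  rewrite <- (pow2_abs (Re z)), <- (pow2_abs (Im z)). nra.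
Qed.

Lemma Im_le_Cmod (z : C) : Rabs (Im z) <= Cmod z.
Proof. eapply Rle_trans; [|apply Rmax_Cmod]. apply Rmax_r. Qed.

Lemma C_ext (z w : C) : Re z = Re w -> Im z = Im w -> z = w.
Proof. destruct z, w; simpl; intros; subst; reflexivity. Qed.

(** The derivative in Frechet form: without a quotient, the condition also makes sense at w = z, and
    the error bounds can be added and multiplied directly. *)
Definition Cdiff (f : C -> C) (z l : C) : Prop :=
  forall eps, 0 < eps -> exists d, 0 < d /\ forall w, Cmod (w - z) < d ->
    Cmod (f w - f z - l * (w - z)) <= eps * Cmod (w - z).

Lemma Cdiff_is_derive (f : C -> C) (z l : C) :
  is_derive (K := C_AbsRing) (V := C_NormedModule) f z l -> Cdiff f z l.
Proof.
  intros [_ H] eps Heps.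
  specialize (H z (fun P HP => HP) (mkposreal eps Heps)).
  destruct H as [d Hd]. exists d. split. apply cond_pos.
  intros w Hw. specialize (Hd w Hw). simpl in Hd.
  unfold norm, minus, plus, opp, scal in Hd; simpl in Hd; unfold mult, abs in Hd; simpl in Hd.
  replace (f w - f z - l * (w - z))%C with (f w + - f z + - ((w + - z) * l))%C by ring.
  exact Hd.
Qed.

Lemma Cdiff_cont (f : C -> C) z l : Cdiff f z l ->
  forall eps, 0 < eps -> exists d, 0 < d /\ forall w, Cmod (w - z) < d -> Cmod (f w - f z) < eps.
Proof.
  intros H eps Heps. destruct (H 1 Rlt_0_1) as (d & Hd & Hf).
  assert (Hl := Cmod_ge_0 l).
  exists (Rmin d (eps / (Cmod l + 2))). split.
  - apply Rmin_glb_lt; auto. apply Rdiv_lt_0_compat; lra.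
  - intros w Hw.
    assert (H1 : Cmod (w - z) < d) by (eapply Rlt_le_trans; [apply Hw|apply Rmin_l]).
    assert (H2 : Cmod (w - z) < eps / (Cmod l + 2)) by (eapply Rlt_le_trans; [apply Hw|apply Rmin_r]).
    replace (f w - f z)%C with ((f w - f z - l * (w - z)) + l * (w - z))%C by ring.
    eapply Rle_lt_trans; [apply Cmod_triangle|]. rewrite Cmod_mult.
    specialize (Hf w H1).
    assert (H3 : Cmod (w - z) * (Cmod l + 2) < eps).
    { apply (Rmult_lt_compat_r (Cmod l + 2)) in H2; [|lra].
      replace (eps / (Cmod l + 2) * (Cmod l + 2)) with eps in H2 by (field; lra). exact H2. }
    assert (H4 := Cmod_ge_0 (w - z)). nra.
Qed.

Lemma Cdiff_ext (f g : C -> C) z l d : 0 < d ->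
  (forall w, Cmod (w - z) < d -> f w = g w) -> Cdiff f z l -> Cdiff g z l.
Proof.
  intros Hd E H eps Heps. destruct (H eps Heps) as (d' & Hd' & Hf).
  exists (Rmin d d'). split. now apply Rmin_glb_lt.
  intros w Hw. rewrite <- (E w), <- (E z).
  - apply Hf. eapply Rlt_le_trans; [apply Hw|apply Rmin_r].
  - replace (z - z)%C with (RtoC 0) by ring. now rewrite Cmod_0.
  - eapply Rlt_le_trans; [apply Hw|apply Rmin_l].
Qed.

Lemma Cdiff_unique (f : C -> C) z l m : Cdiff f z l -> Cdiff f z m -> l = m.
Proof.
  intros Hl Hm.
  destruct (Ceq_dec l m) as [E|E]; auto. exfalso.
  assert (Hp : 0 < Cmod (l - m)).
  { apply Cmod_gt_0. intros E'. apply E. replace l with (l - m + m)%C by ring. rewrite E'. ring. }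
  destruct (Hl (Cmod (l - m) / 3)) as (d1 & Hd1 & H1); [lra|].
  destruct (Hm (Cmod (l - m) / 3)) as (d2 & Hd2 & H2); [lra|].
  set (d := Rmin d1 d2 / 2). assert (Hd : 0 < d) by (unfold d; pose proof (Rmin_glb_lt _ _ _ Hd1 Hd2); lra).
  assert (Hd' : Cmod (z + d - z) = d).
  { replace (z + d - z)%C with (RtoC d) by ring. rewrite Cmod_R, Rabs_pos_eq; lra. }
  specialize (H1 (z + d)%C). specialize (H2 (z + d)%C). rewrite Hd' in H1, H2.
  pose proof (Rmin_l d1 d2). pose proof (Rmin_r d1 d2).
  specialize (H1 ltac:(unfold d in *; lra)). specialize (H2 ltac:(unfold d in *; lra)).
  assert (H3 : Cmod ((l - m) * d) <= 2 * (Cmod (l - m) / 3) * d).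
  { replace ((l - m) * d)%C with ((f (z + d) - f z - m * (z + d - z)) + - (f (z + d) - f z - l * (z + d - z)))%C by ring.
    eapply Rle_trans; [apply Cmod_triangle|]. rewrite Cmod_opp. lra. }
  rewrite Cmod_mult, Cmod_R, (Rabs_pos_eq d) in H3 by lra. nra.
Qed.

Lemma Cdiff_const c z : Cdiff (fun _ => c) z 0.
Proof.
  intros eps Heps. exists 1. split. lra. intros w _.
  replace (c - c - 0 * (w - z))%C with (RtoC 0) by ring. rewrite Cmod_0.
  apply Rmult_le_pos. lra. apply Cmod_ge_0.
Qed.

Lemma Cdiff_id z : Cdiff (fun w => w) z 1.
Proof.
  intros eps Heps. exists 1. split. lra. intros w _.
  replace (w - z - 1 * (w - z))%C with (RtoC 0) by ring. rewrite Cmod_0.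
  apply Rmult_le_pos. lra. apply Cmod_ge_0.
Qed.

Lemma Cdiff_plus f g z l m :
  Cdiff f z l -> Cdiff g z m -> Cdiff (fun w => f w + g w)%C z (l + m).
Proof.
  intros Hf Hg eps Heps.
  destruct (Hf (eps/2)) as (d1 & Hd1 & H1); [lra|].
  destruct (Hg (eps/2)) as (d2 & Hd2 & H2); [lra|].
  exists (Rmin d1 d2). split. now apply Rmin_glb_lt. intros w Hw.
  specialize (H1 w (Rlt_le_trans _ _ _ Hw (Rmin_l _ _))).
  specialize (H2 w (Rlt_le_trans _ _ _ Hw (Rmin_r _ _))).
  replace (f w + g w - (f z + g z) - (l + m) * (w - z))%C with
    ((f w - f z - l * (w - z)) + (g w - g z - m * (w - z)))%C by ring.
  eapply Rle_trans; [apply Cmod_triangle|]. lra.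
Qed.

Lemma Cdiff_mult f g z l m :
  Cdiff f z l -> Cdiff g z m -> Cdiff (fun w => f w * g w)%C z (l * g z + f z * m).
Proof.
  intros Hf Hg eps Heps.
  assert (A1 := Cmod_ge_0 (f z)). assert (A2 := Cmod_ge_0 (g z)). assert (A3 := Cmod_ge_0 l).
  set (e1 := eps / (3 * (Cmod (g z) + 1))).
  set (e2 := eps / (3 * (Cmod (f z) + 1))).
  assert (He1 : 0 < e1) by (apply Rdiv_lt_0_compat; lra).
  assert (He2 : 0 < e2) by (apply Rdiv_lt_0_compat; lra).
  (* The mixed term (f w - f z)(g w - g z) is bounded by the local Lipschitz constant [Cmod l + e1]
     of f times the plain continuity of g. Each of the three error terms gets a third of eps, and
     the + 1 guards against vanishing denominators. *)
  set (e3 := eps / (3 * (Cmod l + e1 + 1))).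
  assert (He3 : 0 < e3) by (apply Rdiv_lt_0_compat; lra).
  destruct (Hf e1 He1) as (d1 & Hd1 & H1).
  destruct (Hg e2 He2) as (d2 & Hd2 & H2).
  destruct (Cdiff_cont g z m Hg e3 He3) as (d3 & Hd3 & H3).
  exists (Rmin d1 (Rmin d2 d3)). split. repeat apply Rmin_glb_lt; auto. intros w Hw.
  assert (Hw1 : Cmod (w - z) < d1) by (eapply Rlt_le_trans; [apply Hw|apply Rmin_l]).
  assert (Hw2 : Cmod (w - z) < d2) by (eapply Rlt_le_trans; [apply Hw|eapply Rle_trans; [apply Rmin_r|apply Rmin_l]]).
  assert (Hw3 : Cmod (w - z) < d3) by (eapply Rlt_le_trans; [apply Hw|eapply Rle_trans; [apply Rmin_r|apply Rmin_r]]).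
  specialize (H1 w Hw1). specialize (H2 w Hw2). specialize (H3 w Hw3).
  set (W := Cmod (w - z)) in *. assert (HW : 0 <= W) by apply Cmod_ge_0.
  assert (H4 : Cmod (f w - f z) <= (Cmod l + e1) * W).
  { replace (f w - f z)%C with ((f w - f z - l * (w - z)) + l * (w - z))%C by ring.
    eapply Rle_trans; [apply Cmod_triangle|]. rewrite Cmod_mult. fold W. lra. }
  replace (f w * g w - f z * g z - (l * g z + f z * m) * (w - z))%C with
    ((f w - f z - l * (w - z)) * g z + f z * (g w - g z - m * (w - z)) + (f w - f z) * (g w - g z))%C by ring.
  eapply Rle_trans; [apply Cmod_triangle|].
  eapply Rle_trans; [apply Rplus_le_compat_r, Cmod_triangle|].
  rewrite !Cmod_mult.
  assert (B1 : e1 * Cmod (g z) <= eps / 3).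
  { unfold e1. apply (Rmult_le_reg_r (3 * (Cmod (g z) + 1))); [lra|].
    field_simplify; [|lra]. nra. }
  assert (B2 : e2 * Cmod (f z) <= eps / 3).
  { unfold e2. apply (Rmult_le_reg_r (3 * (Cmod (f z) + 1))); [lra|].
    field_simplify; [|lra]. nra. }
  assert (B3 : e3 * (Cmod l + e1) <= eps / 3).
  { unfold e3. apply (Rmult_le_reg_r (3 * (Cmod l + e1 + 1))); [lra|].
    field_simplify; [|lra]. nra. }
  assert (C1 : Cmod (f w - f z - l * (w - z)) * Cmod (g z) <= eps / 3 * W) by nra.
  assert (C2 : Cmod (f z) * Cmod (g w - g z - m * (w - z)) <= eps / 3 * W) by nra.
  assert (C3 : Cmod (f w - f z) * Cmod (g w - g z) <= eps / 3 * W).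
  { apply Rle_trans with ((Cmod l + e1) * W * e3).
    - apply Rmult_le_compat; try apply Cmod_ge_0; auto. lra.
    - nra. }
  lra.
Qed.

Lemma Cdiff_comp f g z l m :
  Cdiff f (g z) l -> Cdiff g z m -> Cdiff (fun w => f (g w)) z (l * m).
Proof.
  intros Hf Hg eps Heps.
  assert (A1 := Cmod_ge_0 m). assert (A3 := Cmod_ge_0 l).
  set (e1 := eps / (2 * (Cmod l + 1))).
  assert (He1 : 0 < e1) by (apply Rdiv_lt_0_compat; lra).
  set (e2 := eps / (2 * (Cmod m + e1 + 1))).
  assert (He2 : 0 < e2) by (apply Rdiv_lt_0_compat; lra).
  destruct (Hf e2 He2) as (d2 & Hd2 & H2).
  destruct (Hg e1 He1) as (d1 & Hd1 & H1).
  destruct (Cdiff_cont g z m Hg d2 Hd2) as (d3 & Hd3 & H3).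
  exists (Rmin d1 d3). split. now apply Rmin_glb_lt. intros w Hw.
  specialize (H1 w (Rlt_le_trans _ _ _ Hw (Rmin_l _ _))).
  specialize (H3 w (Rlt_le_trans _ _ _ Hw (Rmin_r _ _))).
  specialize (H2 (g w) H3).
  set (W := Cmod (w - z)) in *. assert (HW : 0 <= W) by apply Cmod_ge_0.
  assert (H4 : Cmod (g w - g z) <= (Cmod m + e1) * W).
  { replace (g w - g z)%C with ((g w - g z - m * (w - z)) + m * (w - z))%C by ring.
    eapply Rle_trans; [apply Cmod_triangle|]. rewrite Cmod_mult. fold W. lra. }
  replace (f (g w) - f (g z) - l * m * (w - z))%C with
    ((f (g w) - f (g z) - l * (g w - g z)) + l * (g w - g z - m * (w - z)))%C by ring.
  eapply Rle_trans; [apply Cmod_triangle|]. rewrite Cmod_mult.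
  assert (B1 : Cmod l * e1 <= eps / 2).
  { unfold e1. apply (Rmult_le_reg_r (2 * (Cmod l + 1))); [lra|].
    field_simplify; [|lra]. nra. }
  assert (B3 : e2 * (Cmod m + e1) <= eps / 2).
  { unfold e2. apply (Rmult_le_reg_r (2 * (Cmod m + e1 + 1))); [lra|].
    field_simplify; [|lra]. nra. }
  assert (C1 : Cmod (f (g w) - f (g z) - l * (g w - g z)) <= eps / 2 * W).
  { eapply Rle_trans; [apply H2|]. 
    apply Rle_trans with (e2 * ((Cmod m + e1) * W)); [apply Rmult_le_compat_l; lra|nra]. }
  assert (C2 : Cmod l * Cmod (g w - g z - m * (w - z)) <= eps / 2 * W).
  { apply Rle_trans with (Cmod l * (e1 * W)); [apply Rmult_le_compat_l; lra|nra]. }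
  lra.
Qed.

(** * Goursat's theorem for rectangles *)

Definition CInt (g : R -> C) (a b : R) : C :=
  (RInt (fun x => Re (g x)) a b, RInt (fun x => Im (g x)) a b).

Definition Ccont (g : R -> C) (x : R) : Prop :=
  continuous (fun t => Re (g t)) x /\ continuous (fun t => Im (g t)) x.

Lemma continuous_eps (f : R -> R) x :
  (forall eps, 0 < eps -> exists d, 0 < d /\ forall y, Rabs (y - x) < d -> Rabs (f y - f x) < eps) ->
  continuous f x.
Proof.
  intros H. apply filterlim_locally. intros eps.
  destruct (H eps (cond_pos eps)) as (d & Hd & Hf).
  exists (mkposreal d Hd). intros y Hy. apply Hf. exact Hy.
Qed.

Lemma continuous_eps_inv (f : R -> R) x : continuous f x ->
  forall eps, 0 < eps -> exists d, 0 < d /\ forall y, Rabs (y - x) < d -> Rabs (f y - f x) < eps.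
Proof.
  intros H eps Heps.
  destruct (proj1 (filterlim_locally f (f x)) H (mkposreal eps Heps)) as [d Hd].
  exists d. split. apply cond_pos. intros y Hy. apply (Hd y Hy).
Qed.

Lemma Ccont_eps (g : R -> C) x :
  (forall eps, 0 < eps -> exists d, 0 < d /\ forall y, Rabs (y - x) < d -> Cmod (g y - g x) < eps) ->
  Ccont g x.
Proof.
  intros H; split; apply continuous_eps; intros eps Heps; destruct (H eps Heps) as (d & Hd & Hg);
    exists d; (split; [exact Hd|]); intros y Hy; specialize (Hg y Hy);
    (eapply Rle_lt_trans; [|apply Hg]).
  - apply (re_le_Cmod (g y - g x)%C).
  - apply (Im_le_Cmod (g y - g x)%C).
Qed.

Lemma CInt_plus (f g : R -> C) a b : a <= b ->
  (forall x, a <= x <= b -> Ccont f x) -> (forall x, a <= x <= b -> Ccont g x) ->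
  CInt (fun x => f x + g x)%C a b = (CInt f a b + CInt g a b)%C.
Proof.
  intros Hab Hf Hg.
  assert (HI : forall h : R -> R, (forall x, a <= x <= b -> continuous h x) -> ex_RInt h a b).
  { intros h Hh. apply (ex_RInt_continuous (V:=R_CompleteNormedModule)).
    rewrite Rmin_left, Rmax_right by lra. exact Hh. }
  apply C_ext; simpl.
  - apply (RInt_plus (V:=R_CompleteNormedModule) (fun x => Re (f x)) (fun x => Re (g x)));
      apply HI; intros x Hx; [exact (proj1 (Hf x Hx))|exact (proj1 (Hg x Hx))].
  - apply (RInt_plus (V:=R_CompleteNormedModule) (fun x => Im (f x)) (fun x => Im (g x)));
      apply HI; intros x Hx; [exact (proj2 (Hf x Hx))|exact (proj2 (Hg x Hx))].
Qed.

Lemma CInt_Chasles (f : R -> C) a b c : a <= b <= c ->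
  (forall x, a <= x <= c -> Ccont f x) ->
  (CInt f a b + CInt f b c)%C = CInt f a c.
Proof.
  intros Habc Hf.
  assert (HI : forall (h : R -> R) u v, u <= v -> (forall x, u <= x <= v -> continuous h x) -> ex_RInt h u v).
  { intros h u v Huv Hh. apply (ex_RInt_continuous (V:=R_CompleteNormedModule)).
    rewrite Rmin_left, Rmax_right by lra. exact Hh. }
  apply C_ext.
  - apply (RInt_Chasles (V:=R_CompleteNormedModule) (fun x => Re (f x)));
      (apply HI; [lra|]; intros x Hx; exact (proj1 (Hf x ltac:(lra)))).
  - apply (RInt_Chasles (V:=R_CompleteNormedModule) (fun x => Im (f x)));
      (apply HI; [lra|]; intros x Hx; exact (proj2 (Hf x ltac:(lra)))).
Qed.

(** The factor 2 comes from estimating real and imaginary parts separately; Goursat's argument only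
    needs a bound linear in the length. *)
Lemma CInt_bound (f : R -> C) a b M : a <= b ->
  (forall x, a <= x <= b -> Ccont f x) -> (forall x, a <= x <= b -> Cmod (f x) <= M) ->
  Cmod (CInt f a b) <= 2 * M * (b - a).
Proof.
  intros Hab Hf HM.
  assert (HI : forall h : R -> R, (forall x, a <= x <= b -> continuous h x) ->
     (forall x, a <= x <= b -> Rabs (h x) <= M) -> Rabs (RInt h a b) <= M * (b - a)).
  { intros h Hh Hb. rewrite Rmult_comm. apply abs_RInt_le_const; auto.
    apply (ex_RInt_continuous (V:=R_CompleteNormedModule)).
    rewrite Rmin_left, Rmax_right by lra. exact Hh. }
  eapply Rle_trans; [apply Cmod_le_abs|]. simpl.
  assert (H1 : Rabs (RInt (fun x => Re (f x)) a b) <= M * (b - a)).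
  { apply HI; intros x Hx. exact (proj1 (Hf x Hx)). eapply Rle_trans; [apply re_le_Cmod|]; auto. }
  assert (H2 : Rabs (RInt (fun x => Im (f x)) a b) <= M * (b - a)).
  { apply HI; intros x Hx. exact (proj2 (Hf x Hx)). eapply Rle_trans; [apply Im_le_Cmod|]; auto. }
  lra.
Qed.

Lemma CInt_ext (f g : R -> C) a b : a <= b ->
  (forall x, a <= x <= b -> f x = g x) -> CInt f a b = CInt g a b.
Proof.
  intros Hab H. apply C_ext; simpl; apply RInt_ext; rewrite Rmin_left, Rmax_right by lra;
    intros; rewrite H; auto; lra.
Qed.

Lemma CInt_affine (p q : C) a b :
  CInt (fun x => p + q * x)%C a b = (p * (b - a) + q * ((b * b - a * a) / 2))%C.
Proof.
  assert (H : forall u v : R, RInt (fun x => u + v * x) a b = u * (b - a) + v * ((b * b - a * a) / 2)).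
  { intros u v. apply is_RInt_unique.
    replace (u * (b - a) + v * ((b * b - a * a) / 2)) with
      (minus (u * b + v * (b * b) / 2) (u * a + v * (a * a) / 2)) by (unfold minus, plus, opp; simpl; field).
    apply (is_RInt_derive (V:=R_CompleteNormedModule) (fun x => u * x + v * (x * x) / 2)).
    - intros x _. auto_derive; trivial. field.
    - intros x _. apply continuous_of_derivable. auto_derive; trivial. }
  destruct p as [p1 p2], q as [q1 q2].
  apply C_ext; simpl.
  - rewrite <- Rplus_0_r at 1.
    transitivity (RInt (fun x => p1 + q1 * x) a b).
    { rewrite Rplus_0_r. apply RInt_ext; intros; simpl; eqR; ring. }
    rewrite H. field.
  - transitivity (RInt (fun x => p2 + q2 * x) a b).
    { apply RInt_ext; intros; simpl; eqR; ring. }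
    rewrite H. field.
Qed.

Definition rect_int (f : C -> C) (a b c d : R) : C :=
  (CInt (fun x => f (x, c)) a b + Ci * CInt (fun y => f (b, y)) c d
   - CInt (fun x => f (x, d)) a b - Ci * CInt (fun y => f (a, y)) c d)%C.

Definition Ccont2 (f : C -> C) (z : C) : Prop :=
  forall eps, 0 < eps -> exists d, 0 < d /\ forall w, Cmod (w - z) < d -> Cmod (f w - f z) < eps.

Lemma Ccont2_h f x y : Ccont2 f (x, y) -> Ccont (fun t => f (t, y)) x.
Proof.
  intros H. apply Ccont_eps. intros eps Heps. destruct (H eps Heps) as (d & Hd & Hf).
  exists d. split; auto. intros t Ht. apply Hf.
  replace ((t, y) - (x, y))%C with (RtoC (t - x)) by (apply C_ext; simpl; ring).
  now rewrite Cmod_R.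
Qed.

Lemma Ccont2_v f x y : Ccont2 f (x, y) -> Ccont (fun t => f (x, t)) y.
Proof.
  intros H. apply Ccont_eps. intros eps Heps. destruct (H eps Heps) as (d & Hd & Hf).
  exists d. split; auto. intros t Ht. apply Hf.
  replace ((x, t) - (x, y))%C with (Ci * RtoC (t - y))%C by (apply C_ext; simpl; ring).
  rewrite Cmod_mult, Cmod_R, Cmod_Ci. lra.
Qed.

Lemma rect_int_quarter f a m b c n d : a <= m <= b -> c <= n <= d ->
  (forall x y, a <= x <= b -> c <= y <= d -> Ccont2 f (x, y)) ->
  rect_int f a b c d = (rect_int f a m c n + rect_int f m b c n + rect_int f a m n d + rect_int f m b n d)%C.
Proof.
  intros H1 H2 Hf. unfold rect_int.
  rewrite <- (CInt_Chasles (fun x => f (x, c)) a m b); auto.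
  2:{ intros; apply Ccont2_h, Hf; lra. }
  rewrite <- (CInt_Chasles (fun x => f (x, d)) a m b); auto.
  2:{ intros; apply Ccont2_h, Hf; lra. }
  rewrite <- (CInt_Chasles (fun y => f (a, y)) c n d); auto.
  2:{ intros; apply Ccont2_v, Hf; lra. }
  rewrite <- (CInt_Chasles (fun y => f (b, y)) c n d); auto.
  2:{ intros; apply Ccont2_v, Hf; lra. }
  ring.
Qed.

(** An affine function integrates to zero around a rectangle, so only the first-order remainder
    counts. It is at most e S with S the half perimeter; the perimeter 2 S and the factor 2 of
    [CInt_bound] give 4 e S^2. *)
Lemma rect_int_local f a b c d (z l : C) e : a <= b -> c <= d -> 0 <= e ->
  a <= Re z <= b -> c <= Im z <= d ->
  (forall x y, a <= x <= b -> c <= y <= d -> Ccont2 f (x, y)) ->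
  (forall x y, a <= x <= b -> c <= y <= d ->
     Cmod (f (x, y) - f z - l * ((x, y) - z)) <= e * Cmod ((x, y) - z)) ->
  Cmod (rect_int f a b c d) <= 4 * e * ((b - a) + (d - c)) ^ 2.
Proof.
  intros Hab Hcd He Hz1 Hz2 Hf Hl.
  set (g := fun w => (f w - f z - l * (w - z))%C).
  set (p := (f z - l * z)%C).
  assert (Hg : forall x y, a <= x <= b -> c <= y <= d -> Ccont2 g (x, y)).
  { intros x y Hx Hy eps Heps. assert (A := Cmod_ge_0 l).
    destruct (Hf x y Hx Hy (eps/2)) as (d1 & Hd1 & H1); [lra|].
    exists (Rmin d1 (eps / (2 * (Cmod l + 1)))). split.
    - apply Rmin_glb_lt; auto. apply Rdiv_lt_0_compat; lra.
    - intros w Hw. specialize (H1 w (Rlt_le_trans _ _ _ Hw (Rmin_l _ _))).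
      assert (H2 := Rlt_le_trans _ _ _ Hw (Rmin_r _ _)).
      unfold g. replace (f w - f z - l * (w - z) - (f (x, y) - f z - l * ((x, y) - z)))%C with
        ((f w - f (x, y)) + - (l * (w - (x, y))))%C by ring.
      eapply Rle_lt_trans; [apply Cmod_triangle|]. rewrite Cmod_opp, Cmod_mult.
      assert (Cmod (w - (x, y)) * (2 * (Cmod l + 1)) < eps).
      { apply (Rmult_lt_compat_r (2 * (Cmod l + 1))) in H2; [|lra].
        replace (eps / (2 * (Cmod l + 1)) * (2 * (Cmod l + 1))) with eps in H2 by (field; lra). exact H2. }
      assert (B := Cmod_ge_0 (w - (x, y))). nra. }
  set (aff := fun w => (p + l * w)%C).
  assert (Ha : forall w, Ccont2 aff w).
  { intros w eps Heps. refine (Cdiff_cont aff w (0 + (0 * w + l * 1))%C _ eps Heps).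
    apply (Cdiff_plus (fun _ => p) (fun w => l * w)%C). apply Cdiff_const.
    apply (Cdiff_mult (fun _ => l) (fun w => w)). apply Cdiff_const. apply Cdiff_id. }
  assert (E : forall w, f w = (g w + aff w)%C) by (intros w; unfold g, aff, p; ring).
  assert (Es : rect_int f a b c d = (rect_int g a b c d + rect_int aff a b c d)%C).
  { unfold rect_int.
    rewrite (CInt_ext (fun x => f (x, c)) (fun x => g (x, c) + aff (x, c))%C a b), CInt_plus by
      (auto; intros; apply Ccont2_h; auto; apply Hg; lra).
    rewrite (CInt_ext (fun x => f (x, d)) (fun x => g (x, d) + aff (x, d))%C a b), CInt_plus by
      (auto; intros; apply Ccont2_h; auto; apply Hg; lra).
    rewrite (CInt_ext (fun y => f (b, y)) (fun y => g (b, y) + aff (b, y))%C c d), CInt_plus by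
      (auto; intros; apply Ccont2_v; auto; apply Hg; lra).
    rewrite (CInt_ext (fun y => f (a, y)) (fun y => g (a, y) + aff (a, y))%C c d), CInt_plus by
      (auto; intros; apply Ccont2_v; auto; apply Hg; lra).
    ring. }
  assert (Ea : rect_int aff a b c d = RtoC 0).
  { unfold rect_int, aff.
    assert (Eh : forall y, CInt (fun x => p + l * (x, y))%C a b = CInt (fun x => (p + l * Ci * y) + l * x)%C a b).
    { intros y. apply CInt_ext; auto. intros x _.
      replace ((x, y) : C) with (RtoC x + Ci * RtoC y)%C by (apply C_ext; simpl; ring). ring. }
    assert (Ev : forall x, CInt (fun y => p + l * (x, y))%C c d = CInt (fun y => (p + l * x) + (l * Ci) * y)%C c d).
    { intros x. apply CInt_ext; auto. intros y _.
      replace ((x, y) : C) with (RtoC x + Ci * RtoC y)%C by (apply C_ext; simpl; ring). ring. }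
    rewrite !Eh, !Ev, !CInt_affine.
    assert (Ci2 : (Ci * Ci = -1)%C) by (apply C_ext; simpl; ring).
    transitivity ((Ci * Ci + 1) * l * (((b * b - a * a) * 0 + (d * d - c * c) * Ci * 0 
        + (b - a) * (c - d) * Ci * 0) + (b-a) * 0))%C; [|ring].
    replace (Ci * ((p + l * b) * (d - c) + l * Ci * ((d * d - c * c) / 2)))%C with
      (Ci * (p + l * b) * (d - c) + (Ci * Ci) * l * ((d * d - c * c) / 2))%C by ring.
    replace (Ci * ((p + l * a) * (d - c) + l * Ci * ((d * d - c * c) / 2)))%C with
      (Ci * (p + l * a) * (d - c) + (Ci * Ci) * l * ((d * d - c * c) / 2))%C by ring.
    rewrite Ci2. ring. }
  rewrite Es, Ea, Cplus_0_r.
  set (S := (b - a) + (d - c)).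
  assert (HS : 0 <= S) by (unfold S; lra).
  assert (Hb : forall x y, a <= x <= b -> c <= y <= d -> Cmod (g (x, y)) <= e * S).
  { intros x y Hx Hy. eapply Rle_trans; [apply Hl; auto|]. apply Rmult_le_compat_l; auto.
    eapply Rle_trans; [apply Cmod_le_abs|]. destruct z as [z1 z2]; simpl in *. unfold S.
    apply Rplus_le_compat; apply Rabs_le; lra. }
  assert (Heo : 0 <= e * S) by nra.
  unfold rect_int.
  assert (T1 : Cmod (CInt (fun x => g (x, c)) a b) <= 2 * (e * S) * (b - a)).
  { apply CInt_bound; auto; intros. apply Ccont2_h, Hg; lra. apply Hb; lra. }
  assert (T2 : Cmod (CInt (fun x => g (x, d)) a b) <= 2 * (e * S) * (b - a)).
  { apply CInt_bound; auto; intros. apply Ccont2_h, Hg; lra. apply Hb; lra. }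
  assert (T3 : Cmod (CInt (fun y => g (a, y)) c d) <= 2 * (e * S) * (d - c)).
  { apply CInt_bound; auto; intros. apply Ccont2_v, Hg; lra. apply Hb; lra. }
  assert (T4 : Cmod (CInt (fun y => g (b, y)) c d) <= 2 * (e * S) * (d - c)).
  { apply CInt_bound; auto; intros. apply Ccont2_v, Hg; lra. apply Hb; lra. }
  unfold Cminus.
  eapply Rle_trans; [apply Cmod_triangle|].
  eapply Rle_trans; [apply Rplus_le_compat_r, Cmod_triangle|].
  eapply Rle_trans; [apply Rplus_le_compat_r, Rplus_le_compat_r, Cmod_triangle|].
  rewrite !Cmod_opp, !Cmod_mult, Cmod_Ci.
  apply Rle_trans with (4 * (e * S) * ((b - a) + (d - c))); [lra|].
  fold S. right. ring.
Qed.

Lemma nested_intervals (u : nat -> R) (r : nat -> R) :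
  (forall n, u n <= u (S n)) -> (forall n, u (S n) + r (S n) <= u n + r n) -> (forall n, 0 <= r n) ->
  exists x, forall n, u n <= x <= u n + r n.
Proof.
  intros Hu Hr Hp.
  assert (M1 : forall n m, (n <= m)%nat -> u n <= u m).
  { intros n m H; induction H; [lra|]. eapply Rle_trans; eauto. }
  assert (M2 : forall n m, (n <= m)%nat -> u m + r m <= u n + r n).
  { intros n m H; induction H; [lra|]. eapply Rle_trans; eauto. }
  assert (M3 : forall n m, u m <= u n + r n).
  { intros n m. destruct (le_lt_dec n m).
    - specialize (M2 n m l). specialize (Hp m). lra.
    - specialize (M1 m n ltac:(lia)). specialize (Hp n). lra. }
  destruct (completeness (fun y => exists n, y = u n)) as [x [Hx1 Hx2]].
  - exists (u O + r O). intros y (n & ->). auto.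
  - exists (u O). now exists O.
  - exists x. intros n. split.
    + apply Hx1. now exists n.
    + apply Hx2. intros y (m & ->). auto.
Qed.

(** The threshold is quadratic in the size, hence divided by 4 under quartering: a bad rectangle has
    a quarter that is bad for the same [e]. [next_corner] tests three quarters and falls back on the
    fourth. *)
Definition bad_rect f e (p : R * R) (w h : R) : Prop :=
  e * (w + h) ^ 2 < Cmod (rect_int f (fst p) (fst p + w) (snd p) (snd p + h)).

Lemma bad_rect_dec f e p w h : {bad_rect f e p w h} + {~ bad_rect f e p w h}.
Proof. apply Rlt_dec. Qed.

Definition next_corner f e (p : R * R) (w h : R) : R * R :=
  let w' := w / 2 in let h' := h / 2 in
  if bad_rect_dec f e p w' h' then p
  else if bad_rect_dec f e (fst p + w', snd p) w' h' then (fst p + w', snd p)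
  else if bad_rect_dec f e (fst p, snd p + h') w' h' then (fst p, snd p + h')
  else (fst p + w', snd p + h').

Fixpoint corner f e (p : R * R) (w h : R) (n : nat) : R * R :=
  match n with
  | O => p
  | S n => next_corner f e (corner f e p w h n) (w / 2 ^ n) (h / 2 ^ n)
  end.

Lemma next_corner_range f e p w h : 0 <= w -> 0 <= h ->
  fst p <= fst (next_corner f e p w h) <= fst p + w / 2 /\
  snd p <= snd (next_corner f e p w h) <= snd p + h / 2.
Proof.
  intros Hw Hh. unfold next_corner.
  destruct bad_rect_dec; [|destruct bad_rect_dec; [|destruct bad_rect_dec]]; simpl; lra.
Qed.

Lemma next_corner_bad f e p w h : 0 <= w -> 0 <= h ->
  (forall x y, fst p <= x <= fst p + w -> snd p <= y <= snd p + h -> Ccont2 f (x, y)) ->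
  bad_rect f e p w h -> bad_rect f e (next_corner f e p w h) (w / 2) (h / 2).
Proof.
  intros Hw Hh Hf H. unfold next_corner.
  destruct bad_rect_dec as [|H1]; [auto|destruct bad_rect_dec as [|H2]; [auto|destruct bad_rect_dec as [|H3]; [auto|]]].
  destruct (bad_rect_dec f e (fst p + w / 2, snd p + h / 2) (w/2) (h/2)) as [|H4]; auto. exfalso.
  unfold bad_rect in *. simpl in *.
  apply Rnot_lt_le in H1, H2, H3, H4.
  rewrite (rect_int_quarter f (fst p) (fst p + w / 2) (fst p + w) (snd p) (snd p + h / 2) (snd p + h)) in H; try lra; auto.
  replace (fst p + w / 2 + w / 2) with (fst p + w) in * by field.
  replace (snd p + h / 2 + h / 2) with (snd p + h) in * by field.
  apply (Rlt_irrefl (e * ((w + h) * ((w + h) * 1)))).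
  eapply Rlt_le_trans; [apply H|].
  eapply Rle_trans; [apply Cmod_triangle|].
  eapply Rle_trans; [apply Rplus_le_compat_r, Cmod_triangle|].
  eapply Rle_trans; [apply Rplus_le_compat_r, Rplus_le_compat_r, Cmod_triangle|].
  apply Rle_trans with (4 * (e * ((w / 2 + h / 2) * ((w / 2 + h / 2) * 1)))); [lra|].
  right. field.
Qed.

Lemma goursat (f : C -> C) a b c d : a <= b -> c <= d ->
  (forall x y, a <= x <= b -> c <= y <= d -> exists l, Cdiff f (x, y) l) ->
  rect_int f a b c d = RtoC 0.
Proof.
  intros Hab Hcd Hf.
  assert (Hc : forall x y, a <= x <= b -> c <= y <= d -> Ccont2 f (x, y)).
  { intros x y Hx Hy. destruct (Hf x y Hx Hy) as [l Hl]. intros eps Heps. eapply Cdiff_cont; eauto. }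
  assert (Hmain : forall e, 0 < e -> ~ bad_rect f e (a, c) (b - a) (d - c)).
  { intros e He Hbad.
    set (w := b - a). set (h := d - c).
    set (u := corner f e (a, c) w h).
    assert (Hw : forall n, 0 <= w / 2 ^ n).
    { intros n. apply Rdiv_le_0_compat. unfold w; lra. apply pow_lt; lra. }
    assert (Hh : forall n, 0 <= h / 2 ^ n).
    { intros n. apply Rdiv_le_0_compat. unfold h; lra. apply pow_lt; lra. }
    assert (H2 : forall v n, v / 2 ^ S n = v / 2 ^ n / 2).
    { intros v n. simpl. field. apply pow_nonzero; lra. }
    assert (Hu : forall n, bad_rect f e (u n) (w / 2 ^ n) (h / 2 ^ n) /\
        a <= fst (u n) /\ fst (u n) + w / 2 ^ n <= b /\ c <= snd (u n) /\ snd (u n) + h / 2 ^ n <= d).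
    { induction n as [|n IH].
      - unfold u; simpl. replace (w / 1) with w by field. replace (h / 1) with h by field.
        unfold w, h. split; [exact Hbad|]. lra.
      - destruct IH as (IH & I1 & I2 & I3 & I4).
        destruct (next_corner_range f e (u n) (w / 2 ^ n) (h / 2 ^ n) (Hw n) (Hh n)) as (R1 & R2).
        change (next_corner f e (u n) (w / 2 ^ n) (h / 2 ^ n)) with (u (S n)) in R1, R2.
        rewrite !H2. split.
        + apply (next_corner_bad f e (u n)); auto. intros; apply Hc; lra.
        + lra. }
    assert (Hr : forall n, (fst (u n) <= fst (u (S n)) /\ fst (u (S n)) + w / 2 ^ S n <= fst (u n) + w / 2 ^ n) /\
                           (snd (u n) <= snd (u (S n)) /\ snd (u (S n)) + h / 2 ^ S n <= snd (u n) + h / 2 ^ n)).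
    { intros n. destruct (next_corner_range f e (u n) (w / 2 ^ n) (h / 2 ^ n) (Hw n) (Hh n)) as (R1 & R2).
      change (next_corner f e (u n) (w / 2 ^ n) (h / 2 ^ n)) with (u (S n)) in R1, R2.
      rewrite !H2. lra. }
    destruct (nested_intervals (fun n => fst (u n)) (fun n => w / 2 ^ n)) as [x Hx]; auto; try apply Hr.
    destruct (nested_intervals (fun n => snd (u n)) (fun n => h / 2 ^ n)) as [y Hy]; auto; try apply Hr.
    assert (Hxab : a <= x <= b). { specialize (Hx O). destruct (Hu O) as (_ & ?). lra. }
    assert (Hycd : c <= y <= d). { specialize (Hy O). destruct (Hu O) as (_ & ?). lra. }
    destruct (Hf x y Hxab Hycd) as [l Hl].
    (* The quarter cancels the constant 4 of [rect_int_local]. *)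
    destruct (Hl (e / 4)) as (dl & Hdl & Hloc); [lra|].
    assert (HN : exists n, w / 2 ^ n + h / 2 ^ n < dl).
    { destruct (Pow_x_infinity 2) with (b := (w + h) / dl + 1) as (N & HN).
      { rewrite Rabs_pos_eq; lra. }
      exists N. specialize (HN N (le_n N)). rewrite Rabs_pos_eq in HN by (apply pow_le; lra).
      assert (0 < 2 ^ N) by (apply pow_lt; lra).
      apply (Rmult_lt_reg_r (2 ^ N)); auto.
      replace ((w / 2 ^ N + h / 2 ^ N) * 2 ^ N) with (w + h) by (field; lra).
      assert (dl * ((w + h) / dl + 1) <= dl * 2 ^ N) by (apply Rmult_le_compat_l; lra).
      replace (dl * ((w + h) / dl + 1)) with (w + h + dl) in H0 by (field; lra). lra. }
    destruct HN as [n Hn]. destruct (Hu n) as (Hbadn & I1 & I2 & I3 & I4).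
    specialize (Hx n). specialize (Hy n). specialize (Hw n). specialize (Hh n). cbv beta in Hx, Hy.
    unfold bad_rect in Hbadn.
    apply (Rlt_not_le _ _ Hbadn).
    eapply Rle_trans; [apply (rect_int_local f _ _ _ _ (x, y) l (e / 4)); simpl; try lra|].
    - intros; apply Hc; lra.
    - intros x' y' Hx' Hy'. apply Hloc.
      eapply Rle_lt_trans; [apply Cmod_le_abs|]. simpl.
      eapply Rle_lt_trans; [|apply Hn]. apply Rplus_le_compat; apply Rabs_le; lra.
    - right. ring_simplify. field. apply pow_nonzero; lra. }
  apply Cmod_eq_0. apply Rle_antisym; [|apply Cmod_ge_0].
  apply Rnot_lt_le. intros Hpos.
  set (G := Cmod (rect_int f a b c d)) in *.
  set (S := (b - a) + (d - c)).
  assert (0 <= S) by (unfold S; lra).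
  (* This choice makes e S^2 smaller than [G]; the + 1 covers a degenerate rectangle with S = 0. *)
  apply (Hmain (G / (2 * (S ^ 2 + 1)))).
  - apply Rdiv_lt_0_compat; simpl; nra.
  - unfold bad_rect; simpl fst; simpl snd. replace (a + (b - a)) with b by ring. replace (c + (d - c)) with d by ring.
    fold G. fold S. assert (0 <= S ^ 2) by (simpl; nra).
    apply (Rmult_lt_reg_r (2 * (S ^ 2 + 1))); [lra|].
    replace (G / (2 * (S ^ 2 + 1)) * S ^ 2 * (2 * (S ^ 2 + 1))) with (G * S ^ 2) by (field; lra).
    nra.
Qed.

(** * The identity theorem on a half-plane *)

Lemma cexp_plus (z w : C) : cexp (z + w) = (cexp z * cexp w)%C.
Proof.
  destruct z as [a b], w as [c d]. unfold cexp; simpl.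
  rewrite exp_plus, cos_plus, sin_plus. apply C_ext; simpl; ring.
Qed.

Lemma cexp_0 : cexp 0 = 1%C.
Proof. unfold cexp; simpl. rewrite exp_0, cos_0, sin_0. apply C_ext; simpl; ring. Qed.

Lemma cexp_R (x : R) : cexp (RtoC x) = RtoC (exp x).
Proof. unfold cexp; simpl. rewrite cos_0, sin_0. apply C_ext; simpl; ring. Qed.

Lemma Cmod_cexp z : Cmod (cexp z) = exp (Re z).
Proof.
  unfold Cmod, cexp; simpl.
  replace (exp (Re z) * cos (Im z) * (exp (Re z) * cos (Im z) * 1) +
     exp (Re z) * sin (Im z) * (exp (Re z) * sin (Im z) * 1)) with
    (exp (Re z) * exp (Re z) * (Rsqr (sin (Im z)) + Rsqr (cos (Im z)))) by (unfold Rsqr; ring).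
  rewrite sin2_cos2, Rmult_1_r. apply sqrt_square. left; apply exp_pos.
Qed.

Lemma exp_m1_bound x : Rabs (exp x - 1) <= Rabs x * exp (Rabs x).
Proof.
  assert (H1 := exp_ineq1_le x). assert (H2 := exp_ineq1_le (-x)).
  assert (H3 := exp_pos x). rewrite exp_Ropp in H2.
  assert (H4 : exp x * (1 + - x) <= 1).
  { apply (Rmult_le_compat_l (exp x)) in H2; [|lra]. rewrite Rinv_r in H2; lra. }
  destruct (Rle_dec 0 x).
  - rewrite !(Rabs_pos_eq x) by lra. rewrite Rabs_pos_eq; lra.
  - rewrite (Rabs_left x) by lra. assert (1 <= exp (- x)).
    { rewrite <- exp_0. left; apply exp_increasing; lra. }
    rewrite Rabs_left1; nra.
Qed.

Lemma exp_taylor1_bound x : Rabs (exp x - 1 - x) <= x ^ 2 * exp (Rabs x).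
Proof.
  assert (H1 := exp_ineq1_le x). assert (H2 := exp_ineq1_le (-x)).
  assert (H3 := exp_pos x). rewrite exp_Ropp in H2.
  assert (H4 : exp x * (1 + - x) <= 1).
  { apply (Rmult_le_compat_l (exp x)) in H2; [|lra]. rewrite Rinv_r in H2; lra. }
  rewrite Rabs_pos_eq by lra.
  apply Rle_trans with (x * (exp x - 1)); [lra|].
  eapply Rle_trans; [apply Rle_abs|]. rewrite Rabs_mult.
  eapply Rle_trans; [apply Rmult_le_compat_l; [apply Rabs_pos|apply exp_m1_bound]|].
  rewrite <- pow2_abs. right; ring.
Qed.

Lemma Rabs_sin_le y : Rabs (sin y) <= Rabs y.
Proof.
  destruct (Rtotal_order y 0) as [H|[->|H]].
  - rewrite <- (Rabs_Ropp (sin y)), <- sin_neg, <- (Rabs_Ropp y). set (z := - y).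
    assert (0 < z) by (unfold z; lra). assert (H1 := sin_lt_x z H0).
    destruct (Rle_dec z PI).
    + rewrite !Rabs_pos_eq; try lra. apply sin_ge_0; lra.
    + assert (Hb := SIN_bound z). assert (HP := PI2_1). rewrite (Rabs_pos_eq z) by lra. apply Rabs_le. lra.
  - rewrite sin_0. lra.
  - assert (H1 := sin_lt_x y H).
    destruct (Rle_dec y PI).
    + rewrite !Rabs_pos_eq; try lra. apply sin_ge_0; lra.
    + assert (Hb := SIN_bound y). assert (HP := PI2_1). rewrite (Rabs_pos_eq y) by lra. apply Rabs_le. lra.
Qed.

Lemma one_minus_cos_bound y : 0 <= 1 - cos y <= y ^ 2 / 2.
Proof.
  assert (Hb := COS_bound y). split; [lra|].
  replace y with (2 * (y / 2)) at 1 by field. rewrite cos_2a_sin.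
  assert (H := Rabs_sin_le (y / 2)).
  assert (H2 : sin (y/2) * sin (y/2) <= (y/2) * (y/2)).
  { apply Rsqr_le_abs_1 in H. exact H. }
  simpl. lra.
Qed.

Lemma sin_taylor_bound y : Rabs (sin y - y) <= y ^ 2.
Proof.
  assert (Hpos : forall z, 0 < z -> Rabs (sin z - z) <= z ^ 2).
  { intros z Hz.
    destruct (MVT_gen (fun t => sin t - t) 0 z (fun t => cos t - 1)) as (c & Hc & E).
    - intros x _. auto_derive; trivial. ring.
    - intros x _. apply continuity_pt_filterlim. change (continuous (fun t => sin t - t) x).
      apply continuous_of_derivable. auto_derive; trivial.
    - rewrite Rmin_left, Rmax_right in Hc by lra.
      rewrite sin_0 in E. replace (sin z - z) with ((cos c - 1) * (z - 0)) by lra.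
      assert (B := one_minus_cos_bound c). assert (B' := COS_bound c).
      rewrite Rabs_mult, Rminus_0_r, (Rabs_pos_eq z), Rabs_left1 by lra.
      assert (1 - cos c <= c). { destruct (Rle_dec c 2); simpl in B; nra. }
      simpl. nra. }
  destruct (Rtotal_order y 0) as [H|[->|H]].
  - rewrite <- Rabs_Ropp. replace (- (sin y - y)) with (sin (- y) - (- y)) by (rewrite sin_neg; ring).
    replace (y ^ 2) with ((- y) ^ 2) by ring. apply Hpos. lra.
  - rewrite sin_0, Rminus_0_r, Rabs_R0. simpl; lra.
  - auto.
Qed.

Lemma exp_le a b : a <= b -> exp a <= exp b.
Proof. intros [H| ->]; [left; now apply exp_increasing|lra]. Qed.

Lemma exp_le_1 a : a <= 0 -> exp a <= 1.
Proof. intros H. rewrite <- exp_0. now apply exp_le. Qed.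

Lemma cexp_taylor_bound w : Cmod (cexp w - 1 - w) <= 5 * Cmod w ^ 2 * exp (Cmod w).
Proof.
  destruct w as [x y]. set (m := Cmod (x, y)).
  assert (Hx : Rabs x <= m) by apply (re_le_Cmod (x, y)).
  assert (Hy : Rabs y <= m) by apply (Im_le_Cmod (x, y)).
  assert (He : exp (Rabs x) <= exp m) by now apply exp_le.
  assert (He0 : exp x <= exp (Rabs x)) by apply exp_le, Rle_abs.
  assert (He1 : 1 <= exp m).
  { rewrite <- exp_0. apply exp_le. apply Cmod_ge_0. }
  assert (P1 := exp_pos x). assert (P2 := exp_pos (Rabs x)).
  assert (A1 := Rabs_pos x). assert (A2 := Rabs_pos y).
  eapply Rle_trans; [apply Cmod_le_abs|]. unfold cexp; simpl.
  assert (T1 : Rabs (exp x * cos y + - (1) + - x) <= 2 * m ^ 2 * exp m).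
  { replace (exp x * cos y + - (1) + - x) with ((exp x - 1 - x) + - (exp x * (1 - cos y))) by ring.
    eapply Rle_trans; [apply Rabs_triang|]. rewrite Rabs_Ropp, Rabs_mult, (Rabs_pos_eq (exp x)) by lra.
    destruct (one_minus_cos_bound y) as [B0 B]. rewrite (Rabs_pos_eq (1 - cos y)) by auto.
    assert (B1 := exp_taylor1_bound x).
    assert (x ^ 2 <= m ^ 2) by (rewrite <- pow2_abs; apply pow_incr; lra).
    assert (y ^ 2 <= m ^ 2) by (rewrite <- (pow2_abs y); apply pow_incr; lra).
    assert (0 <= x ^ 2) by apply pow2_ge_0. assert (0 <= y ^ 2) by apply pow2_ge_0.
    assert (x ^ 2 * exp (Rabs x) <= m ^ 2 * exp m) by (apply Rmult_le_compat; lra).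
    assert (exp x * (1 - cos y) <= exp m * m ^ 2) by (apply Rmult_le_compat; lra).
    lra. }
  assert (T2 : Rabs (exp x * sin y + - 0 + - y) <= 2 * m ^ 2 * exp m).
  { replace (exp x * sin y + - 0 + - y) with ((exp x - 1) * sin y + (sin y - y)) by ring.
    eapply Rle_trans; [apply Rabs_triang|]. rewrite Rabs_mult.
    assert (B1 := exp_m1_bound x). assert (B2 := Rabs_sin_le y). assert (B3 := sin_taylor_bound y).
    assert (y ^ 2 <= m ^ 2) by (rewrite <- (pow2_abs y); apply pow_incr; lra).
    assert (Rabs (exp x - 1) <= m * exp m).
    { eapply Rle_trans; [apply B1|]. apply Rmult_le_compat; lra. }
    assert (Rabs (exp x - 1) * Rabs (sin y) <= m * exp m * m).
    { apply Rmult_le_compat; try apply Rabs_pos; lra. }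
    assert (0 <= m ^ 2) by apply pow2_ge_0. nra. }
  fold m. rewrite !Rmult_1_r. change (m * m) with (m * m). 
  assert (0 <= m ^ 2 * exp m) by (apply Rmult_le_pos; [apply pow2_ge_0|lra]).
  simpl in *. lra.
Qed.

Lemma Cdiff_cexp z : Cdiff cexp z (cexp z).
Proof.
  intros eps Heps.
  assert (Hz := exp_pos (Re z)).
  set (K := 5 * exp (Re z) * exp 1).
  assert (HK : 0 < K) by (unfold K; pose proof (exp_pos 1); nra).
  exists (Rmin 1 (eps / K)). split.
  - apply Rmin_glb_lt; [lra|]. now apply Rdiv_lt_0_compat.
  - intros w Hw. set (h := (w - z)%C) in *.
    assert (H1 := Rlt_le_trans _ _ _ Hw (Rmin_l _ _)).
    assert (H2 := Rlt_le_trans _ _ _ Hw (Rmin_r _ _)).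
    replace w with (z + h)%C by (unfold h; ring). rewrite cexp_plus.
    replace (cexp z * cexp h - cexp z - cexp z * h)%C with (cexp z * (cexp h - 1 - h))%C by ring.
    rewrite Cmod_mult, Cmod_cexp.
    assert (H0 := Cmod_ge_0 h).
    assert (B := cexp_taylor_bound h).
    assert (He : exp (Cmod h) <= exp 1) by (apply exp_le; lra).
    assert (Hk : Cmod h * K <= eps).
    { apply Rlt_le in H2. apply (Rmult_le_compat_r K) in H2; [|lra].
      replace (eps / K * K) with eps in H2 by (field; lra). exact H2. }
    apply Rle_trans with (exp (Re z) * (5 * Cmod h ^ 2 * exp 1)).
    + apply Rmult_le_compat_l; [lra|]. eapply Rle_trans; [apply B|].
      apply Rmult_le_compat_l; auto. pose proof (pow2_ge_0 (Cmod h)). lra.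
    + replace (exp (Re z) * (5 * Cmod h ^ 2 * exp 1)) with (Cmod h * K * Cmod h) by (unfold K; ring).
      now apply Rmult_le_compat_r.
Qed.

Lemma Cdiff_cexp_affine (p q z : C) : Cdiff (fun w => cexp (p + q * w)) z (cexp (p + q * z) * q).
Proof.
  apply (Cdiff_comp cexp (fun w => p + q * w)%C). apply Cdiff_cexp.
  assert (E : (0 + (0 * z + q * 1))%C = q) by ring.
  apply (eq_ind _ (Cdiff (fun w => p + q * w)%C z)) with (2 := E).
  apply (Cdiff_plus (fun _ => p)). apply Cdiff_const.
  apply (Cdiff_mult (fun _ => q) (fun w => w)). apply Cdiff_const. apply Cdiff_id.
Qed.

(** * Polar coordinates and concentric circles *)

Lemma polar_angle (u v : R) : u * u + v * v = 1 ->
  exists t, 0 <= t <= 1 /\ cos (2 * PI * t) = u /\ sin (2 * PI * t) = v.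
Proof.
  intros H. assert (HP := PI_RGT_0).
  assert (Hu : -1 <= u <= 1) by nra.
  assert (Hac := acos_bound u).
  assert (Hs : sin (acos u) = sqrt (v * v)).
  { rewrite sin_acos by auto. f_equal. unfold Rsqr. lra. }
  destruct (Rle_dec 0 v) as [Hv|Hv].
  - exists (acos u / (2 * PI)).
    replace (2 * PI * (acos u / (2 * PI))) with (acos u) by (field; lra).
    split; [|split].
    + split. apply Rdiv_le_0_compat; lra.
      apply (Rmult_le_reg_r (2 * PI)); [lra|]. field_simplify; lra.
    + now apply cos_acos.
    + rewrite Hs. now apply sqrt_square.
  - exists (1 - acos u / (2 * PI)).
    replace (2 * PI * (1 - acos u / (2 * PI))) with (- acos u + 2 * PI) by (field; lra).
    rewrite cos_plus, sin_plus, cos_2PI, sin_2PI, cos_neg, sin_neg, cos_acos, Hs by auto.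
    split; [|split].
    + assert (0 <= acos u / (2 * PI) <= 1); [|lra]. split. apply Rdiv_le_0_compat; lra.
      apply (Rmult_le_reg_r (2 * PI)); [lra|]. field_simplify; lra.
    + ring.
    + replace (v * v) with ((- v) * (- v)) by ring. rewrite sqrt_square by lra. ring.
Qed.

Lemma sin_2PI_Z (n : Z) : sin (2 * PI * IZR n) = 0.
Proof. apply sin_eq_0_1. exists (2 * n)%Z. rewrite mult_IZR. ring. Qed.

Lemma cos_2PI_Z (n : Z) : cos (2 * PI * IZR n) = 1.
Proof.
  replace (2 * PI * IZR n) with (2 * (IZR n * PI)) by ring.
  rewrite cos_2a_sin, sin_eq_0_1; [ring|]. now exists n.
Qed.

(** The map w -> z0 + e^(2 pi w) turns the annulus between radii e^(2 pi s1) and e^(2 pi s2) into a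
    rectangle of height 1. Goursat there expresses every Fourier coefficient of U on the outer
    circle by the one on the inner circle, which is zero. *)
Lemma circle_zero (U : C -> C) (z0 s1 s2 : R) : s1 <= s2 ->
  (forall w, Re w <= s2 -> exists l, Cdiff U (z0 + cexp (2 * PI * w)) l) ->
  (forall w, Re w = s1 -> U (z0 + cexp (2 * PI * w))%C = 0%C) ->
  forall t, 0 <= t <= 1 -> U (z0 + cexp (2 * PI * (s2, t)))%C = 0%C.
Proof.
  intros Hs HU HU0.
  set (V := fun y : R => U (z0 + cexp (2 * PI * (s2, y)))%C).
  set (tp := RtoC (2 * PI)).
  assert (Etp : forall w : C, (2 * PI * w)%C = (0 + tp * w)%C) by (intros; unfold tp; rewrite RtoC_mult; ring).
  assert (HUd : forall w, Re w <= s2 -> exists l, Cdiff (fun w => U (z0 + cexp (2 * PI * w))%C) w l).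
  { intros w Hw. destruct (HU w Hw) as [l Hl].
    exists (l * (0 + cexp (0 + tp * w) * tp))%C.
    apply (Cdiff_comp U (fun w => z0 + cexp (2 * PI * w))%C); auto.
    apply (Cdiff_plus (fun _ => RtoC z0)). apply Cdiff_const.
    apply (Cdiff_ext (fun w => cexp (0 + tp * w)) _ _ _ 1); [lra| |apply Cdiff_cexp_affine].
    intros w' _. now rewrite Etp. }
  assert (HVc : forall y, Ccont V y).
  { intros y. destruct (HUd (s2, y)) as [l Hl]; [simpl; lra|].
    apply (Ccont2_v (fun w => U (z0 + cexp (2 * PI * w))%C)). intros eps Heps.
    exact (Cdiff_cont _ _ _ Hl eps Heps). }
  assert (HZ : forall n : Z, CInt (fun y => V y * (cos (2 * PI * IZR n * y), (- sin (2 * PI * IZR n * y))%R))%C 0 1 = 0%C).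
  { intros n.
    (* The exponential weight is entire for every sign of n, so negative frequencies need no
       separate treatment. The constant in its exponent gives it modulus 1 on Re w = s2, where it is
       e^(-2 pi i n y). *)
    set (g := fun w : C => (U (z0 + cexp (2 * PI * w)) * cexp (RtoC (2 * PI * IZR n * s2) + RtoC (- (2 * PI * IZR n)) * w))%C).
    assert (G : rect_int g s1 s2 0 1 = 0%C).
    { apply goursat; auto; [lra|]. intros x y Hx Hy.
      destruct (HUd (x, y)) as [l Hl]; [simpl; lra|].
      eexists. apply (Cdiff_mult (fun w => U (z0 + cexp (2 * PI * w))%C)); [exact Hl|].
      apply Cdiff_cexp_affine. }
    unfold rect_int in G.
    (* The integrand has period i, so the horizontal sides cancel. *)
    assert (E1 : CInt (fun x => g (x, 1)) s1 s2 = CInt (fun x => g (x, 0)) s1 s2).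
    { apply CInt_ext; auto. intros x _. unfold g. f_equal; [f_equal; f_equal|].
      - unfold cexp; simpl.
        replace ((2 * PI - 0 * 0) * 1 + (2 * 0 + 0 * PI) * x) with (2 * PI) by ring.
        replace ((2 * PI - 0 * 0) * 0 + (2 * 0 + 0 * PI) * x) with 0 by ring.
        rewrite cos_2PI, sin_2PI, cos_0, sin_0. apply C_ext; simpl; f_equal; f_equal; ring.
      - rewrite !cexp_plus. f_equal.
        replace (RtoC (- (2 * PI * IZR n)) * (x, 1%R))%C with
          (RtoC (- (2 * PI * IZR n)) * (x, 0%R) + (0%R, (2 * PI * IZR (- n))%R))%C
          by (rewrite opp_IZR; apply C_ext; simpl; ring).
        rewrite cexp_plus. unfold cexp at 2; simpl. rewrite cos_2PI_Z, sin_2PI_Z, exp_0.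
        apply C_ext; simpl; ring. }
    assert (E2 : CInt (fun y => g (s1, y)) 0 1 = 0%C).
    { rewrite (CInt_ext _ (fun y => 0 + 0 * y)%C); [|lra|].
      - rewrite CInt_affine. ring.
      - intros y _. unfold g. rewrite HU0 by reflexivity. ring. }
    rewrite E1, E2 in G.
    assert (E3 : CInt (fun y => g (s2, y)) 0 1 = 0%C).
    { set (I1 := CInt (fun y => g (s2, y)) 0 1) in *.
      replace I1 with (- Ci * (CInt (fun x => g (x, 0%R)) s1 s2 + Ci * I1 - CInt (fun x => g (x, 0%R)) s1 s2 - Ci * 0))%C
        by (apply C_ext; simpl; ring).
      rewrite G. ring. }
    rewrite <- E3. apply CInt_ext; [lra|]. intros y _. unfold g, V. f_equal.
    unfold cexp; simpl.
    replace (2 * PI * IZR n * s2 + (- (2 * PI * IZR n) * s2 - 0 * y)) with 0 by ring.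
    replace (0 + (- (2 * PI * IZR n) * y + 0 * s2)) with (- (2 * PI * IZR n * y)) by ring.
    rewrite exp_0, cos_neg, sin_neg. apply C_ext; simpl; ring. }
  assert (Hcos : forall (n : Z) x, continuous (fun y => cos (2 * PI * IZR n * y)) x).
  { intros. apply continuous_of_derivable. auto_derive. trivial. }
  assert (Hsin : forall (n : Z) x, continuous (fun y => sin (2 * PI * IZR n * y)) x).
  { intros. apply continuous_of_derivable. auto_derive. trivial. }
  assert (HI : forall f g : R -> R, (forall x, continuous f x) -> (forall x, continuous g x) ->
     is_RInt (fun y => f y * g y) 0 1 (RInt (fun y => f y * g y) 0 1)).
  { intros f g Hf Hg. apply (RInt_correct (V:=R_CompleteNormedModule)). apply ex_RInt_continuous_all.
    intros; now apply continuous_mult_R. }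
  assert (HR : forall y, continuous (fun t => Re (V t)) y) by (intros y; exact (proj1 (HVc y))).
  assert (HIm : forall y, continuous (fun t => Im (V t)) y) by (intros y; exact (proj2 (HVc y))).
  assert (Q1 : forall n, RInt (fun y => Re (V y) * cos (2 * PI * IZR n * y)) 0 1
                       + RInt (fun y => Im (V y) * sin (2 * PI * IZR n * y)) 0 1 = 0).
  { intros n. assert (E := f_equal Re (HZ n)). simpl in E. etransitivity; [|exact E]. symmetry.
    apply is_RInt_unique. eapply is_RInt_ext; [|apply (is_RInt_plus (V:=R_NormedModule) _ _ _ _ _ _ (HI _ _ HR (Hcos n)) (HI _ _ HIm (Hsin n)))].
    intros y _. unfold plus, Re, Im; simpl. eqR. ring. }
  assert (Q2 : forall n, RInt (fun y => Im (V y) * cos (2 * PI * IZR n * y)) 0 1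
                       - RInt (fun y => Re (V y) * sin (2 * PI * IZR n * y)) 0 1 = 0).
  { intros n. assert (E := f_equal Im (HZ n)). simpl in E. etransitivity; [|exact E]. symmetry.
    apply is_RInt_unique. eapply is_RInt_ext; [|apply (is_RInt_minus (V:=R_NormedModule) _ _ _ _ _ _ (HI _ _ HIm (Hcos n)) (HI _ _ HR (Hsin n)))].
    intros y _. unfold minus, plus, opp, Re, Im; simpl. eqR. ring. }
  assert (Ec : forall (f : R -> R) n, RInt (fun y => f y * cos (2 * PI * IZR (- n) * y)) 0 1 = RInt (fun y => f y * cos (2 * PI * IZR n * y)) 0 1).
  { intros f n. apply RInt_ext. intros y _. rewrite opp_IZR.
    replace (2 * PI * - IZR n * y) with (- (2 * PI * IZR n * y)) by ring. now rewrite cos_neg. }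
  assert (Es : forall (f : R -> R) n, (forall x, continuous f x) -> RInt (fun y => f y * sin (2 * PI * IZR (- n) * y)) 0 1 = - RInt (fun y => f y * sin (2 * PI * IZR n * y)) 0 1).
  { intros f n Hf. apply is_RInt_unique.
    eapply is_RInt_ext; [|apply (is_RInt_opp (V:=R_NormedModule) _ _ _ _ (HI _ _ Hf (Hsin n)))].
    intros y _. rewrite opp_IZR.
    replace (2 * PI * - IZR n * y) with (- (2 * PI * IZR n * y)) by ring. rewrite sin_neg.
    unfold opp; simpl; eqR; ring. }
  (* The complex coefficients at n and -n amount to four real linear equations for the cosine and
     sine moments of Re V and Im V. *)
  intros t Ht. change (V t = 0%C). apply C_ext; simpl.
  - apply (fourier_uniqueness (fun y => Re (V y))); auto; intros n;
      pose proof (Q1 n) as A1; pose proof (Q1 (-n)%Z) as A2; pose proof (Q2 n) as A3; pose proof (Q2 (-n)%Z) as A4;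
      rewrite Ec, Es in A2, A4 by auto; lra.
  - apply (fourier_uniqueness (fun y => Im (V y))); auto; intros n;
      pose proof (Q1 n) as A1; pose proof (Q1 (-n)%Z) as A2; pose proof (Q2 n) as A3; pose proof (Q2 (-n)%Z) as A4;
      rewrite Ec, Es in A2, A4 by auto; lra.
Qed.

(* A circle around a real point [z0] far to the right reaches any prescribed point of the half-plane. *)
Lemma halfplane_identity (U : C -> C) (M : R) :
  (forall z, 0 < Re z -> exists l, Cdiff U z l) ->
  (forall z, M < Re z -> U z = 0%C) ->
  forall z, 0 < Re z -> U z = 0%C.
Proof.
  intros HU HM z Hz. destruct z as [x y]. simpl in Hz.
  (* The first summand makes |z|^2 < 2 x z0, that is |z - z0| < z0, so the disc through z stays in
     Re > 0. The others put the unit disc around [z0] into Re > M. *)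
  set (z0 := (x * x + y * y) / x + Rabs M + 2).
  assert (HxM := Rle_abs M). assert (HM0 := Rabs_pos M).
  assert (Hq : 0 <= (x * x + y * y) / x) by (apply Rdiv_le_0_compat; nra).
  assert (Hz0 : 2 <= z0) by (unfold z0; lra).
  assert (Hzz : x * x + y * y < 2 * x * z0).
  { unfold z0. replace (2 * x * ((x * x + y * y) / x + Rabs M + 2)) with
      (2 * (x * x + y * y) + 2 * x * (Rabs M + 2)) by (field; lra). nra. }
  set (r := Cmod ((x, y) - RtoC z0)%C).
  assert (Hr2 : r * r = (x - z0) * (x - z0) + y * y).
  { unfold r, Cmod. rewrite sqrt_sqrt; simpl; [ring|].
    apply Rplus_le_le_0_compat; rewrite Rmult_1_r; apply Rle_0_sqr. }
  assert (Hr0 : 0 <= r) by apply Cmod_ge_0.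
  assert (Hrz : r < z0) by nra.
  destruct (Req_dec r 0) as [E|E].
  { assert (x = z0) by nra. apply HM. simpl. unfold z0 in *; lra. }
  assert (Hr : 0 < r) by lra.
  assert (HP := PI_RGT_0).
  destruct (polar_angle ((x - z0) / r) (y / r)) as (t & Ht & Hc & Hs).
  { apply (Rmult_eq_reg_r (r * r)); [|nra].
    transitivity ((x - z0) * (x - z0) + y * y); [field; lra|lra]. }
  set (s2 := ln r / (2 * PI)).
  (* The inner radius is at most 1; if z itself is that close to [z0], the two circles coincide. *)
  set (s1 := Rmin s2 0).
  assert (Es2 : 2 * PI * s2 = ln r) by (unfold s2; field; lra).
  assert (Ez : (x, y) = (z0 + cexp (2 * PI * (s2, t)))%C).
  { unfold cexp; simpl.
    replace ((2 * PI - 0 * 0) * s2 - (2 * 0 + 0 * PI) * t) with (2 * PI * s2) by ring.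
    replace ((2 * PI - 0 * 0) * t + (2 * 0 + 0 * PI) * s2) with (2 * PI * t) by ring.
    rewrite Es2, exp_ln, Hc, Hs by auto. apply C_ext; simpl; field; lra. }
  assert (Hre : forall w, Re (z0 + cexp (2 * PI * w))%C >= z0 - exp (2 * PI * Re w)).
  { intros [w1 w2]. unfold cexp; simpl.
    replace ((2 * PI - 0 * 0) * w1 - (2 * 0 + 0 * PI) * w2) with (2 * PI * w1) by ring.
    assert (B := COS_bound ((2 * PI - 0 * 0) * w2 + (2 * 0 + 0 * PI) * w1)).
    assert (P := exp_pos (2 * PI * w1)). nra. }
  rewrite Ez. apply (circle_zero U z0 s1 s2); auto.
  - apply Rmin_l.
  - intros w Hw. apply HU. specialize (Hre w).
    assert (exp (2 * PI * Re w) <= r).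
    { rewrite <- (exp_ln r Hr), <- Es2. apply exp_le. nra. }
    lra.
  - intros w Hw. apply HM. specialize (Hre w).
    assert (exp (2 * PI * Re w) <= 1).
    { rewrite <- exp_0. apply exp_le. rewrite Hw. assert (A := Rmin_r s2 0). fold s1 in A. nra. }
    unfold z0 in *. lra.
Qed.

(** * Dominated exchange of sums and integrals *)

Lemma is_series_partial_le (c : nat -> R) N : (forall n, 0 <= c n) -> ex_series c -> sum_n c N <= Series c.
Proof.
  intros Hc [l Hl]. rewrite (is_series_unique _ _ Hl).
  apply (is_lim_seq_incr_compare (sum_n c) l); auto.
  intros n. rewrite sum_Sn. unfold plus; simpl. specialize (Hc (S n)). lra.
Qed.

Lemma sum_n_diff_le (f c : nat -> R) N M : (N <= M)%nat -> (forall n, Rabs (f n) <= c n) ->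
  Rabs (sum_n f M - sum_n f N) <= sum_n c M - sum_n c N.
Proof.
  intros HNM Hc. induction HNM as [|M HNM IH].
  - replace (sum_n f N - sum_n f N) with 0 by ring. rewrite Rabs_R0. lra.
  - rewrite !sum_Sn. unfold plus; simpl.
    replace (sum_n f M + f (S M) - sum_n f N) with ((sum_n f M - sum_n f N) + f (S M)) by ring.
    eapply Rle_trans; [apply Rabs_triang|]. specialize (Hc (S M)). lra.
Qed.

Lemma series_tail_le (f c : nat -> R) l N : (forall n, Rabs (f n) <= c n) -> ex_series c ->
  is_series f l -> Rabs (l - sum_n f N) <= Series c - sum_n c N.
Proof.
  intros Hc Hex Hf.
  assert (Hc0 : forall n, 0 <= c n) by (intros n; eapply Rle_trans; [apply Rabs_pos|apply Hc]).
  assert (HL : is_lim_seq (fun M => Rabs (sum_n f M - sum_n f N)) (Rabs (l - sum_n f N))).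
  { apply (is_lim_seq_abs _ (Finite _)). apply is_lim_seq_minus'; [exact Hf|apply is_lim_seq_const]. }
  apply (is_lim_seq_le_loc _ _ (Rabs (l - sum_n f N)) (Series c - sum_n c N)
     ) with (2 := HL) (3 := is_lim_seq_const _).
  exists N. intros M HM.
  eapply Rle_trans; [apply sum_n_diff_le; eauto|].
  pose proof (is_series_partial_le c M Hc0 Hex). lra.
Qed.

Lemma is_series_of_tail (l : nat -> R) L (K : R) (c : nat -> R) : ex_series c ->
  (forall N, Rabs (L - sum_n l N) <= K * (Series c - sum_n c N)) -> is_series l L.
Proof.
  intros [s Hs] H. rewrite (is_series_unique _ _ Hs) in H.
  assert (H0 : is_lim_seq (fun N => K * (s - sum_n c N)) 0).
  { replace 0 with (K * (s - s)) by ring.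
    apply (is_lim_seq_scal_l (fun N => s - sum_n c N) K (s - s)).
    apply is_lim_seq_minus'; [apply is_lim_seq_const|exact Hs]. }
  assert (H1 : is_lim_seq (fun N => L - sum_n l N) 0).
  { apply is_lim_seq_abs_0. eapply is_lim_seq_le_le; [|apply is_lim_seq_const|apply H0].
    intros n; split; [apply Rabs_pos|apply H]. }
  assert (H2 : is_lim_seq (fun N => L - (L - sum_n l N)) (L - 0)).
  { apply is_lim_seq_minus'; [apply is_lim_seq_const|exact H1]. }
  rewrite Rminus_0_r in H2. change (is_lim_seq (sum_n l) L). eapply is_lim_seq_ext; [|apply H2]. intros n; simpl; ring.
Qed.

(** A linear functional, given as a relation, that is continuous for the sup norm weighted by w. It
    covers infinite sums, integrals over [0, 1] and integrals over the line, so that double sums and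
    sums of integrals are exchanged by the same argument. *)
Definition is_integral {X : Type} (w : X -> R) (I : (X -> R) -> R -> Prop) (K : R) : Prop :=
  (forall f g l m, I f l -> I g m -> I (fun x => f x + g x) (l + m)) /\
  (forall c f l, I f l -> I (fun x => c * f x) (c * l)) /\
  (forall f l B, I f l -> (forall x, Rabs (f x) <= B * w x) -> Rabs l <= K * B) /\
  (forall x, 0 <= w x) /\
  (forall f g l, (forall x, f x = g x) -> I f l -> I g l).

(** The tail of the series at x is at most w x times the tail of c, and the functional turns this
    into a tail bound for the values [l n]. That F has an integral is assumed, so nothing like
    completeness is asked of I. *)
Lemma integral_series {X : Type} (w : X -> R) I K : is_integral w I K ->
  forall (f : nat -> X -> R) (l c : nat -> R) (F : X -> R) (L : R),
  (forall n, I (f n) (l n)) -> (forall n x, Rabs (f n x) <= c n * w x) -> ex_series c ->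
  (forall x, is_series (fun n => f n x) (F x)) -> I F L -> is_series l L.
Proof.
  intros (Hplus & Hscal & Hb & Hw & Hext) f l c F L Hf Hc Hex HF HL.
  apply (is_series_of_tail l L K c Hex). intros N.
  assert (HS : I (fun x => sum_n (fun n => f n x) N) (sum_n l N)).
  { induction N as [|N IH].
    - rewrite sum_O. apply (Hext (f O)); [|apply Hf]. intros x. now rewrite sum_O.
    - rewrite sum_Sn. apply (Hext (fun x => sum_n (fun n => f n x) N + f (S N) x)).
      + intros x. now rewrite sum_Sn.
      + now apply Hplus. }
  apply (Hb (fun x => F x + -1 * sum_n (fun n => f n x) N)).
  - replace (L - sum_n l N) with (L + -1 * sum_n l N) by ring. apply Hplus; auto.
  - intros x. replace (F x + -1 * sum_n (fun n => f n x) N) with (F x - sum_n (fun n => f n x) N) by ring.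
    assert (Hex' : ex_series (fun n => c n * w x)) by (apply ex_series_scal_r; exact Hex).
    eapply Rle_trans; [apply (series_tail_le (fun n => f n x) (fun n => c n * w x)); auto|].
    rewrite Series_scal_r. right.
    assert (E : sum_n (fun n => c n * w x) N = sum_n c N * w x).
    { apply (sum_n_mult_r (K:=R_AbsRing) (w x) c N). }
    rewrite E. ring.
Qed.

Lemma is_integral_series (w : nat -> R) : (forall n, 0 <= w n) -> ex_series w ->
  is_integral w (fun f l => is_series f l) (Series w).
Proof.
  intros Hw Hex. split; [|split; [|split; [|split]]]; auto.
  - intros f g l m Hf Hg. apply (is_series_plus (V:=R_NormedModule) f g l m Hf Hg).
  - intros c f l Hf. apply (is_series_scal (V:=R_NormedModule) c f l Hf).
  - intros f l B Hf HB. rewrite <- (is_series_unique _ _ Hf).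
    assert (Hex' : ex_series (fun n => B * w n)) by (apply (ex_series_scal (V:=R_NormedModule)); exact Hex).
    eapply Rle_trans; [apply Series_Rabs|].
    + apply (ex_series_le (V:=R_CompleteNormedModule) (fun n => Rabs (f n)) (fun n => B * w n)); auto.
      intros n. unfold norm; simpl. unfold abs; simpl. rewrite Rabs_Rabsolu. apply HB.
    + eapply Rle_trans; [apply (Series_le _ (fun n => B * w n)); auto|].
      * intros n; split; [apply Rabs_pos|apply HB].
      * rewrite Series_scal_l. right; ring.
  - intros f g l E Hf. eapply is_series_ext; [|exact Hf]. exact E.
Qed.

Lemma continuous_series (f : nat -> R -> R) (c : nat -> R) (F : R -> R) :
  (forall n x, continuous (f n) x) -> (forall n x, Rabs (f n x) <= c n) -> ex_series c ->
  (forall x, is_series (fun n => f n x) (F x)) -> forall x, continuous F x.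
Proof.
  intros Hf Hc Hex HF x. apply continuous_eps. intros eps Heps.
  assert (Ht : exists N, Series c - sum_n c N < eps / 3).
  { destruct Hex as [s Hs]. rewrite (is_series_unique _ _ Hs).
    assert (H := proj2 (is_lim_seq_spec (sum_n c) s) Hs (mkposreal (eps/3) ltac:(lra))).
    destruct H as [N HN]. exists N. specialize (HN N (le_n N)). simpl in HN.
    apply Rabs_def2 in HN. lra. }
  destruct Ht as [N HN].
  assert (HS : continuous (fun y => sum_n (fun n => f n y) N) x).
  { clear HN. induction N as [|N IH].
    - apply (continuous_ext (f O)); auto. intros y; now rewrite sum_O.
    - apply (continuous_ext (fun y => sum_n (fun n => f n y) N + f (S N) y)).
      intros y; now rewrite sum_Sn. now apply continuous_plus_R. }
  destruct (continuous_eps_inv _ _ HS (eps / 3)) as (d & Hd & H); [lra|].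
  exists d. split; auto. intros y Hy. specialize (H y Hy). cbv beta in H.
  pose proof (series_tail_le (fun n => f n x) c (F x) N (fun n => Hc n x) Hex (HF x)) as T1.
  pose proof (series_tail_le (fun n => f n y) c (F y) N (fun n => Hc n y) Hex (HF y)) as T2.
  apply Rabs_le_between in T1, T2. apply Rabs_def2 in H. apply Rabs_def1; lra.
Qed.

Definition is_int01 (f : R -> R) (l : R) : Prop :=
  (forall x, continuous f x) /\ is_RInt f 0 1 l.

Lemma is_integral_int01 : is_integral (fun _ => 1) is_int01 1.
Proof.
  split; [|split; [|split; [|split]]].
  - intros f g l m [Hf If] [Hg Ig]. split.
    + intros; now apply continuous_plus_R.
    + apply (is_RInt_plus (V:=R_NormedModule) f g 0 1 l m If Ig).
  - intros c f l [Hf If]. split.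
    + intros. apply continuous_mult_R; auto. apply continuous_const.
    + apply (is_RInt_scal (V:=R_NormedModule) f 0 1 c l If).
  - intros f l B [Hf If] HB. rewrite <- (is_RInt_unique _ _ _ _ If).
    eapply Rle_trans; [apply abs_RInt_le_const with (M := B)|]; try lra.
    + now exists l.
    + intros t _. specialize (HB t). lra.
  - intros; lra.
  - intros f g l E [Hf If]. split.
    + intros x. eapply continuous_ext; [apply E|apply Hf].
    + eapply is_RInt_ext; [|apply If]. intros; apply E.
Qed.

Lemma int01_exists (f : R -> R) : (forall x, continuous f x) -> is_int01 f (RInt f 0 1).
Proof.
  intros Hf. split; auto. apply (RInt_correct (V:=R_CompleteNormedModule)).
  now apply ex_RInt_continuous_all.
Qed.

(** The integral over the whole line, both ends tending to infinity independently. Continuity is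
    built in so that all finite integrals exist and split. *)
Definition isI (f : R -> R) (l : R) : Prop :=
  (forall x, continuous f x) /\
  forall eps, 0 < eps -> exists M, forall a b, a <= - M -> M <= b -> Rabs (RInt f a b - l) <= eps.

Lemma isI_unique f l m : isI f l -> isI f m -> l = m.
Proof.
  intros [_ Hl] [_ Hm]. apply Rminus_diag_uniq.
  destruct (Req_dec (l - m) 0) as [E|E]; auto. exfalso.
  assert (Hp := Rabs_pos_lt _ E).
  destruct (Hl (Rabs (l - m) / 3)) as [M1 H1]; [lra|].
  destruct (Hm (Rabs (l - m) / 3)) as [M2 H2]; [lra|].
  set (M := Rmax M1 M2). pose proof (Rmax_l M1 M2). pose proof (Rmax_r M1 M2). fold M in H, H0.
  specialize (H1 (-M) M ltac:(lra) ltac:(lra)). specialize (H2 (-M) M ltac:(lra) ltac:(lra)).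
  assert (Rabs (l - m) <= 2 * (Rabs (l - m) / 3)); [|lra].
  replace (l - m) with ((RInt f (-M) M - m) - (RInt f (-M) M - l)) at 1 by ring.
  eapply Rle_trans; [apply Rabs_triang|]. rewrite Rabs_Ropp. lra.
Qed.

Lemma isI_ext f g l : (forall x, f x = g x) -> isI f l -> isI g l.
Proof.
  intros E [Hc H]. split.
  - intros x. eapply continuous_ext; [apply E|apply Hc].
  - intros eps Heps. destruct (H eps Heps) as [M HM]. exists M. intros a b Ha Hb.
    rewrite <- (RInt_ext f g); auto.
Qed.

Lemma isI_plus f g l m : isI f l -> isI g m -> isI (fun x => f x + g x) (l + m).
Proof.
  intros [Hf If] [Hg Ig]. split.
  - intros; now apply continuous_plus_R.
  - intros eps Heps. destruct (If (eps/2)) as [M1 H1]; [lra|]. destruct (Ig (eps/2)) as [M2 H2]; [lra|].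
    exists (Rmax M1 M2). intros a b Ha Hb. pose proof (Rmax_l M1 M2). pose proof (Rmax_r M1 M2).
    assert (E : RInt (fun x => f x + g x) a b = RInt f a b + RInt g a b).
    { apply (RInt_plus (V:=R_CompleteNormedModule) f g); now apply ex_RInt_continuous_all. }
    rewrite E. replace (RInt f a b + RInt g a b - (l + m)) with ((RInt f a b - l) + (RInt g a b - m)) by ring.
    specialize (H1 a b ltac:(lra) ltac:(lra)). specialize (H2 a b ltac:(lra) ltac:(lra)).
    eapply Rle_trans; [apply Rabs_triang|]. lra.
Qed.

Lemma isI_scal c f l : isI f l -> isI (fun x => c * f x) (c * l).
Proof.
  intros [Hf If]. split.
  - intros. apply continuous_mult_R; auto. apply continuous_const.
  - intros eps Heps. assert (A := Rabs_pos c).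
    destruct (If (eps / (Rabs c + 1))) as [M H]; [apply Rdiv_lt_0_compat; lra|].
    exists M. intros a b Ha Hb. specialize (H a b Ha Hb).
    assert (E : RInt (fun x => c * f x) a b = c * RInt f a b).
    { apply (RInt_scal (V:=R_CompleteNormedModule) f). now apply ex_RInt_continuous_all. }
    rewrite E, <- Rmult_minus_distr_l, Rabs_mult.
    apply Rle_trans with ((Rabs c + 1) * (eps / (Rabs c + 1))).
    + apply Rmult_le_compat; try lra; apply Rabs_pos.
    + right; field; lra.
Qed.

(** In the variable t = e^x this is the invariance of dt/t under scaling; all rescalings by n, by
    b_n or by y go through it. *)
Lemma isI_shift f l s : isI f l -> isI (fun x => f (x + s)) l.
Proof.
  intros [Hf If]. split.
  - intros x. apply (continuous_comp (fun x => x + s) f); auto.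
    apply continuous_of_derivable. auto_derive; trivial.
  - intros eps Heps. destruct (If eps Heps) as [M H].
    exists (M + Rabs s). intros a b Ha Hb. pose proof (Rle_abs s). pose proof (Rle_abs (-s)).
    rewrite Rabs_Ropp in H1.
    assert (E : RInt (fun x => f (x + s)) a b = RInt f (a + s) (b + s)).
    { assert (E := RInt_comp_lin (V:=R_CompleteNormedModule) f 1 s a b).
      rewrite !Rmult_1_l in E. rewrite <- E.
      - apply RInt_ext. intros x _. unfold scal; simpl; unfold mult; simpl. rewrite Rmult_1_l. eqR. rewrite Rmult_1_l. reflexivity.
      - now apply ex_RInt_continuous_all. }
    rewrite E. apply H; lra.
Qed.

Lemma isI_primitive (f F : R -> R) (A B : R) :
  (forall x, is_derive F x (f x)) -> (forall x, continuous f x) ->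
  (forall eps, 0 < eps -> exists M, forall x, M <= x -> Rabs (F x - B) <= eps /\ Rabs (F (- x) - A) <= eps) ->
  isI f (B - A).
Proof.
  intros HF Hf HL. split; auto. intros eps Heps.
  destruct (HL (eps/2)) as [M HM]; [lra|]. exists M. intros a b Ha Hb.
  assert (E : RInt f a b = F b - F a).
  { apply is_RInt_unique. apply (is_RInt_derive (V:=R_CompleteNormedModule) F f); auto. }
  rewrite E. destruct (HM b Hb) as [H1 _]. destruct (HM (-a)) as [_ H2]; [lra|].
  rewrite Ropp_involutive in H2.
  replace (F b - F a - (B - A)) with ((F b - B) - (F a - A)) by ring.
  eapply Rle_trans; [apply Rabs_triang|]. rewrite Rabs_Ropp. lra.
Qed.

(** The majorant for integrals over the line: in t = e^x it is t^d near 0 and t^(-d) near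
    infinity. *)
Definition env (d : R) (x : R) : R := exp (- (d * Rabs x)).

Lemma env_pos d x : 0 < env d x.
Proof. apply exp_pos. Qed.

Lemma env_le_1 d x : 0 <= d -> env d x <= 1.
Proof. intros. unfold env. rewrite <- exp_0. apply exp_le. pose proof (Rabs_pos x). nra. Qed.

Lemma RInt_tail_right (f : R -> R) C d p q : 0 < d -> 0 <= p <= q -> (forall x, continuous f x) ->
  (forall x, Rabs (f x) <= C * env d x) -> Rabs (RInt f p q) <= C / d * exp (- (d * p)).
Proof.
  intros Hd Hpq Hf HC.
  assert (HC0 : 0 <= C).
  { specialize (HC 0). pose proof (env_pos d 0). pose proof (Rabs_pos (f 0)).
    apply Rnot_lt_le; intros ?. nra. }
  assert (HI : is_RInt (fun x => C * exp (- (d * x))) p q (minus (- (C / d) * exp (- (d * q))) (- (C / d) * exp (- (d * p))))).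
  { apply (is_RInt_derive (V:=R_CompleteNormedModule) (fun x => - (C / d) * exp (- (d * x)))).
    - intros x _. auto_derive; trivial. field. lra.
    - intros x _. apply continuous_of_derivable. auto_derive; trivial. }
  eapply Rle_trans; [apply abs_RInt_le; [lra|now apply ex_RInt_continuous_all]|].
  eapply Rle_trans; [apply (RInt_le _ (fun x => C * exp (- (d * x)))); [lra| | |]|].
  - apply ex_RInt_continuous_all. intros x. apply (continuous_comp f Rabs); auto. apply continuous_Rabs.
  - eexists; apply HI.
  - intros x Hx. specialize (HC x). unfold env in HC. rewrite (Rabs_pos_eq x) in HC by lra. exact HC.
  - rewrite (is_RInt_unique _ _ _ _ HI). unfold minus, plus, opp; simpl.
    pose proof (exp_pos (- (d * q))). assert (0 <= C / d) by (apply Rdiv_le_0_compat; lra). nra.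
Qed.

Lemma RInt_reflect (f : R -> R) p q : (forall x, continuous f x) -> RInt (fun x => f (- x)) p q = RInt f (- q) (- p).
Proof.
  intros Hf.
  assert (Hr : forall x, continuous (fun x => f (- x)) x).
  { intros x. apply (continuous_comp (fun x => - x) f); auto.
    apply continuous_of_derivable. auto_derive; trivial. }
  apply is_RInt_unique.
  assert (H : is_RInt f (- p) (- q) (- RInt f (- q) (- p))).
  { apply (is_RInt_swap (V:=R_NormedModule)). apply (RInt_correct (V:=R_CompleteNormedModule)).
    now apply ex_RInt_continuous_all. }
  replace (- p) with (-1 * p + 0) in H at 1 by ring. replace (- q) with (-1 * q + 0) in H at 1 by ring.
  apply (is_RInt_comp_lin (V:=R_NormedModule)) in H.
  apply (is_RInt_opp (V:=R_NormedModule)) in H.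
  rewrite <- (Ropp_involutive (RInt f (- q) (- p))).
  eapply is_RInt_ext; [|exact H].
  intros x _. unfold opp, scal; simpl; unfold mult; simpl.
  replace (-1 * x + 0) with (- x) by ring. eqR. ring.
Qed.

Lemma RInt_tail_left (f : R -> R) C d p q : 0 < d -> 0 <= p <= q -> (forall x, continuous f x) ->
  (forall x, Rabs (f x) <= C * env d x) -> Rabs (RInt f (- q) (- p)) <= C / d * exp (- (d * p)).
Proof.
  intros Hd Hpq Hf HC. rewrite <- RInt_reflect by auto.
  apply RInt_tail_right; auto.
  - intros x. apply (continuous_comp (fun x => - x) f); auto.
    apply continuous_of_derivable. auto_derive; trivial.
  - intros x. specialize (HC (-x)). unfold env in *. now rewrite Rabs_Ropp in HC.
Qed.

Lemma RInt_env_bound (f : R -> R) C d a b : 0 < d -> a <= 0 <= b -> (forall x, continuous f x) ->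
  (forall x, Rabs (f x) <= C * env d x) -> Rabs (RInt f a b) <= 2 / d * C.
Proof.
  intros Hd Hab Hf HC.
  rewrite <- (RInt_Chasles (V:=R_CompleteNormedModule) f a 0 b) by now apply ex_RInt_continuous_all.
  eapply Rle_trans; [apply Rabs_triang|].
  pose proof (RInt_tail_right f C d 0 b Hd ltac:(lra) Hf HC) as H1.
  pose proof (RInt_tail_left f C d 0 (-a) Hd ltac:(lra) Hf HC) as H2.
  rewrite Ropp_involutive in H2. rewrite Ropp_0 in H2 at 1. rewrite Rmult_0_r, Ropp_0, exp_0, Rmult_1_r in H1, H2.
  replace (2 / d * C) with (C / d + C / d) by (field; lra). lra.
Qed.

Lemma isI_bound f l C d : 0 < d -> isI f l -> (forall x, Rabs (f x) <= C * env d x) -> Rabs l <= 2 / d * C.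
Proof.
  intros Hd [Hf If] HC. apply le_epsilon. intros eps Heps.
  destruct (If eps Heps) as [M HM].
  set (N := Rmax M 0). pose proof (Rmax_l M 0). pose proof (Rmax_r M 0). fold N in H, H0.
  specialize (HM (-N) N ltac:(lra) ltac:(lra)).
  pose proof (RInt_env_bound f C d (-N) N Hd ltac:(lra) Hf HC).
  apply Rabs_le_between in HM, H1. apply Rabs_le. lra.
Qed.

Lemma is_integral_isI d : 0 < d -> is_integral (env d) isI (2 / d).
Proof.
  intros Hd. split; [|split; [|split; [|split]]].
  - intros; now apply isI_plus.
  - intros; now apply isI_scal.
  - intros; now apply (isI_bound f l B d).
  - intros; left; apply env_pos.
  - apply isI_ext.
Qed.

Lemma isI_exists f C d : 0 < d -> (forall x, continuous f x) -> (forall x, Rabs (f x) <= C * env d x) ->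
  exists l, isI f l.
Proof.
  intros Hd Hf HC.
  assert (HC0 : 0 <= C).
  { specialize (HC 0). pose proof (env_pos d 0). pose proof (Rabs_pos (f 0)).
    apply Rnot_lt_le; intros ?. nra. }
  assert (HM : forall eps, 0 < eps -> exists M, 0 <= M /\ 2 * (C / d * exp (- (d * M))) <= eps).
  { intros eps Heps. set (K := 2 * (C / d) + 1).
    assert (0 <= C / d) by (apply Rdiv_le_0_compat; lra).
    assert (HK : 0 < K) by (unfold K; lra).
    exists (Rmax 0 (- ln (eps / K) / d)). split. apply Rmax_l.
    assert (exp (- (d * Rmax 0 (- ln (eps / K) / d))) <= eps / K).
    { rewrite <- (exp_ln (eps / K)) at 2 by now apply Rdiv_lt_0_compat. apply exp_le.
      pose proof (Rmax_r 0 (- ln (eps / K) / d)).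
      apply (Rmult_le_compat_l d) in H0; [|lra].
      replace (d * (- ln (eps / K) / d)) with (- ln (eps / K)) in H0 by (field; lra). lra. }
    apply Rle_trans with (2 * (C / d) * (eps / K)).
    - rewrite <- Rmult_assoc. apply Rmult_le_compat_l; lra.
    - apply (Rmult_le_reg_r K); auto. replace (2 * (C / d) * (eps / K) * K) with (2 * (C / d) * eps) by (field; lra).
      unfold K. nra. }
  assert (HT : forall M a b a' b', 0 <= M -> a <= - M -> a' <= a -> M <= b -> b <= b' ->
     Rabs (RInt f a' b' - RInt f a b) <= 2 * (C / d * exp (- (d * M)))).
  { intros M a b a' b' H0 H1 H2 H3 H4.
    rewrite <- (RInt_Chasles (V:=R_CompleteNormedModule) f a' a b') by now apply ex_RInt_continuous_all.
    rewrite <- (RInt_Chasles (V:=R_CompleteNormedModule) f a b b') by now apply ex_RInt_continuous_all.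
    unfold plus; simpl.
    replace (RInt f a' a + (RInt f a b + RInt f b b') - RInt f a b) with (RInt f a' a + RInt f b b') by ring.
    eapply Rle_trans; [apply Rabs_triang|].
    pose proof (RInt_tail_right f C d b b' Hd ltac:(lra) Hf HC) as T1.
    pose proof (RInt_tail_left f C d (-a) (-a') Hd ltac:(lra) Hf HC) as T2.
    rewrite !Ropp_involutive in T2.
    assert (0 <= C / d) by (apply Rdiv_le_0_compat; lra).
    assert (exp (- (d * b)) <= exp (- (d * M))) by (apply exp_le; nra).
    assert (exp (- (d * - a)) <= exp (- (d * M))) by (apply exp_le; nra).
    assert (C / d * exp (- (d * b)) <= C / d * exp (- (d * M))) by now apply Rmult_le_compat_l.
    assert (C / d * exp (- (d * - a)) <= C / d * exp (- (d * M))) by now apply Rmult_le_compat_l.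
    lra. }
  assert (Hcv : ex_finite_lim_seq (fun n => RInt f (- INR n) (INR n))).
  { apply ex_lim_seq_cauchy_corr. intros eps.
    destruct (HM (eps / 3)) as (M & HM0 & HMe). { pose proof (cond_pos eps); lra. }
    destruct (nfloor_ex M HM0) as [N0 HN0]. exists (S N0).
    assert (Hlt : forall n m, (S N0 <= n)%nat -> (n <= m)%nat ->
       Rabs (RInt f (- INR m) (INR m) - RInt f (- INR n) (INR n)) < eps).
    { intros n m Hn Hm. apply le_INR in Hn, Hm. rewrite S_INR in Hn.
      eapply Rle_lt_trans; [apply (HT M); try lra|]. pose proof (cond_pos eps); lra. }
    intros n m Hn Hm. destruct (le_lt_dec n m).
    - rewrite Rabs_minus_sym. apply Hlt; auto.
    - apply Hlt; auto; lia. }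
  destruct Hcv as [l Hl]. exists l. split; auto. intros eps Heps.
  destruct (HM (eps / 2)) as (M & HM0 & HMe); [lra|]. exists M. intros a b Ha Hb.
  assert (HL : is_lim_seq (fun n => Rabs (RInt f (- INR n) (INR n) - RInt f a b)) (Rabs (l - RInt f a b))).
  { apply (is_lim_seq_abs _ (Finite _)). apply is_lim_seq_minus'; [exact Hl|apply is_lim_seq_const]. }
  rewrite Rabs_minus_sym.
  apply (is_lim_seq_le_loc _ _ (Rabs (l - RInt f a b)) eps) with (2 := HL) (3 := is_lim_seq_const _).
  destruct (nfloor_ex (Rmax b (-a))) as [N0 HN0].
  { eapply Rle_trans; [|apply Rmax_l]; lra. }
  exists (S N0). intros n Hn. apply le_INR in Hn. rewrite S_INR in Hn.
  pose proof (Rmax_l b (-a)). pose proof (Rmax_r b (-a)).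
  eapply Rle_trans; [apply (HT M); try lra|]. lra.
Qed.

(** * Complex-valued sums and integrals, by components *)

Definition csums (a : nat -> C) (l : C) : Prop :=
  is_series (fun n => Re (a n)) (Re l) /\ is_series (fun n => Im (a n)) (Im l).

Definition CI {X : Type} (I : (X -> R) -> R -> Prop) (f : X -> C) (l : C) : Prop :=
  I (fun x => Re (f x)) (Re l) /\ I (fun x => Im (f x)) (Im l).

Lemma integral_csums {X : Type} (w : X -> R) I K : is_integral w I K ->
  forall (f : nat -> X -> C) (l : nat -> C) (c : nat -> R) (F : X -> C) (L : C),
  (forall n, CI I (f n) (l n)) -> (forall n x, Cmod (f n x) <= c n * w x) -> ex_series c ->
  (forall x, csums (fun n => f n x) (F x)) -> CI I F L -> csums l L.
Proof.
  intros HI f l c F L Hf Hc Hex HF [HL1 HL2]. split.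
  - apply (integral_series w I K HI (fun n x => Re (f n x)) _ c (fun x => Re (F x))); auto.
    + intros n; apply (Hf n).
    + intros n x. eapply Rle_trans; [apply re_le_Cmod|apply Hc].
    + intros x; apply (HF x).
  - apply (integral_series w I K HI (fun n x => Im (f n x)) _ c (fun x => Im (F x))); auto.
    + intros n; apply (Hf n).
    + intros n x. eapply Rle_trans; [apply Im_le_Cmod|apply Hc].
    + intros x; apply (HF x).
Qed.

Lemma CI_plus {X : Type} (w : X -> R) I K (f g : X -> C) l m : is_integral w I K ->
  CI I f l -> CI I g m -> CI I (fun x => f x + g x)%C (l + m)%C.
Proof. intros (Hp & _) [H1 H2] [H3 H4]. split; simpl; now apply Hp. Qed.

Lemma CI_scal {X : Type} (w : X -> R) I K (f : X -> C) l c : is_integral w I K ->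
  CI I f l -> CI I (fun x => c * f x)%C (c * l)%C.
Proof.
  intros (Hp & Hs & _ & _ & He) [H1 H2]. destruct c as [c1 c2]. split; simpl.
  - apply (He (fun x => c1 * Re (f x) + (- c2) * Im (f x))).
    + intros x; unfold Re, Im; ring.
    + replace (c1 * fst l - c2 * snd l) with (c1 * Re l + (- c2) * Im l) by (unfold Re, Im; ring).
      apply Hp; now apply Hs.
  - apply (He (fun x => c1 * Im (f x) + c2 * Re (f x))).
    + intros x; unfold Re, Im; ring.
    + apply Hp; now apply Hs.
Qed.

Lemma CI_ext {X : Type} (w : X -> R) I K (f g : X -> C) l : is_integral w I K ->
  (forall x, f x = g x) -> CI I f l -> CI I g l.
Proof.
  intros (_ & _ & _ & _ & He) E [H1 H2]. split.
  - apply (He (fun x => Re (f x))); auto. intros; now rewrite E.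
  - apply (He (fun x => Im (f x))); auto. intros; now rewrite E.
Qed.

Lemma CI_bound {X : Type} (w : X -> R) I K (f : X -> C) l B : is_integral w I K ->
  CI I f l -> (forall x, Cmod (f x) <= B * w x) -> Cmod l <= 2 * (K * B).
Proof.
  intros (_ & _ & Hb & _) [H1 H2] HB.
  apply (Hb _ _ B) in H1. 2:{ intros x; eapply Rle_trans; [apply re_le_Cmod|apply HB]. }
  apply (Hb _ _ B) in H2. 2:{ intros x; eapply Rle_trans; [apply Im_le_Cmod|apply HB]. }
  eapply Rle_trans; [apply Cmod_le_abs|]. lra.
Qed.

Lemma CI_real {X : Type} (w : X -> R) I K (f : X -> R) l c : is_integral w I K ->
  I f l -> CI I (fun x => c * RtoC (f x))%C (c * RtoC l)%C.
Proof.
  intros HI H. apply (CI_scal w I K); auto.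
  destruct HI as (_ & Hs & _ & _ & He). split; simpl; auto.
  apply (He (fun x => 0 * f x)); [intros; ring|]. assert (E := Hs 0 f l H). rewrite (Rmult_0_l l) in E. exact E.
Qed.

Lemma series_dom_exists (f c : nat -> R) : (forall n, Rabs (f n) <= c n) -> ex_series c -> exists l, is_series f l.
Proof.
  intros H Hex. apply (ex_series_le (V:=R_CompleteNormedModule) f c); auto.
Qed.

Lemma csums_dom_exists (a : nat -> C) (c : nat -> R) : (forall n, Cmod (a n) <= c n) -> ex_series c ->
  exists l, csums a l.
Proof.
  intros H Hex.
  destruct (series_dom_exists (fun n => Re (a n)) c) as [l1 H1]; auto.
  { intros; eapply Rle_trans; [apply re_le_Cmod|apply H]. }
  destruct (series_dom_exists (fun n => Im (a n)) c) as [l2 H2]; auto.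
  { intros; eapply Rle_trans; [apply Im_le_Cmod|apply H]. }
  exists (l1, l2). now split.
Qed.

Lemma series_unique (f : nat -> R) l m : is_series f l -> is_series f m -> l = m.
Proof. intros H1 H2. rewrite <- (is_series_unique _ _ H1). now apply is_series_unique. Qed.

Lemma csums_unique a l m : csums a l -> csums a m -> l = m.
Proof. intros [H1 H2] [H3 H4]. apply C_ext; eapply series_unique; eauto. Qed.

Lemma csums_ext a b l : (forall n, a n = b n) -> csums a l -> csums b l.
Proof.
  intros E [H1 H2]. split; (eapply is_series_ext; [|eassumption]); intros n; simpl; now rewrite E.
Qed.

Lemma csums_plus a b l m : csums a l -> csums b m -> csums (fun n => a n + b n)%C (l + m)%C.
Proof.
  intros [H1 H2] [H3 H4]. split.
  - apply (is_series_plus (V:=R_NormedModule) _ _ _ _ H1 H3).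
  - apply (is_series_plus (V:=R_NormedModule) _ _ _ _ H2 H4).
Qed.

Lemma csums_scal a c l : csums a l -> csums (fun n => c * a n)%C (c * l)%C.
Proof.
  intros [H1 H2]. destruct c as [c1 c2].
  pose proof (fun x => is_series_scal (V:=R_NormedModule) x _ _ H1) as S1.
  pose proof (fun x => is_series_scal (V:=R_NormedModule) x _ _ H2) as S2.
  split; simpl.
  - replace (c1 * fst l - c2 * snd l) with (c1 * Re l + (- c2) * Im l) by (unfold Re, Im; ring).
    eapply is_series_ext; [|apply (is_series_plus (V:=R_NormedModule) _ _ _ _ (S1 c1) (S2 (- c2)))].
    intros n. unfold plus, scal, Re, Im; simpl; unfold mult; simpl. eqR. ring.
  - eapply is_series_ext; [|apply (is_series_plus (V:=R_NormedModule) _ _ _ _ (S2 c1) (S1 c2))].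
    intros n. unfold plus, scal, Re, Im; simpl; unfold mult; simpl. eqR. ring.
Qed.

Lemma csums_real a c l : is_series a l -> csums (fun n => c * RtoC (a n))%C (c * RtoC l)%C.
Proof.
  intros H. apply csums_scal. split; auto. simpl.
  assert (E := is_series_scal (V:=R_NormedModule) 0 _ _ H).
  change (scal 0 l) with (0 * l) in E. rewrite (Rmult_0_l l) in E.
  eapply is_series_ext; [|apply E]. intros n. unfold scal; simpl; unfold mult; simpl. eqR; ring.
Qed.

(** * Exponentials against powers, and summable weights *)

Lemma pow_exp_le j x : 0 <= x -> x ^ j <= INR (fact j) * exp x.
Proof.
  revert x; induction j as [|j IH]; intros x Hx.
  - simpl. assert (H := exp_ineq1_le x). lra.
  - set (F := fun x => INR (fact (S j)) * exp x - x ^ S j).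
    assert (HF : F 0 <= F x).
    { destruct Hx as [Hx| <-]; [|lra].
      destruct (MVT_gen F 0 x (fun x => INR (fact (S j)) * exp x - INR (S j) * x ^ j)) as (c & Hc & E).
      - intros y _. unfold F. auto_derive; trivial. simpl Nat.pred.
        change (INR (fact (S j)) * (1 * exp y) + - (1 * (INR (S j) * y ^ j)) = INR (fact (S j)) * exp y - INR (S j) * y ^ j).
        ring.
      - intros y _. apply continuity_pt_filterlim. change (continuous F y). apply continuous_of_derivable.
        unfold F. auto_derive; trivial.
      - rewrite Rmin_left, Rmax_right in Hc by lra.
        assert (0 <= INR (fact (S j)) * exp c - INR (S j) * c ^ j).
        { specialize (IH c ltac:(lra)). rewrite fact_simpl, mult_INR.
          assert (0 <= INR (S j)) by apply pos_INR. nra. }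
        nra. }
    unfold F in HF. rewrite exp_0, pow_i in HF by lia.
    assert (0 < INR (fact (S j))) by apply INR_fact_lt_0. lra.
Qed.

Lemma pow_exp_bound j x : 0 <= x -> x ^ j * exp (- x) <= INR (fact j).
Proof.
  intros Hx. assert (H := pow_exp_le j x Hx). assert (P := exp_pos (- x)).
  apply (Rmult_le_compat_r (exp (- x))) in H; [|lra].
  rewrite Rmult_assoc, <- exp_plus in H. replace (x + - x) with 0 in H by ring.
  rewrite exp_0, Rmult_1_r in H. exact H.
Qed.

Lemma exp_neg_le j x : 0 < x -> exp (- x) <= INR (fact j) / x ^ j.
Proof.
  intros Hx. assert (H := pow_exp_bound j x ltac:(lra)). assert (P := pow_lt x j Hx).
  apply (Rmult_le_reg_l (x ^ j)); auto. replace (x ^ j * (INR (fact j) / x ^ j)) with (INR (fact j)) by (field; lra).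
  exact H.
Qed.

(** The weight (n + 1)^(-3/2): summable, yet light enough that z32 m times z32 n dominates terms
    with joint decay of order 3 in m and n, and that n^(-2) may lose a factor sqrt n to an
    integral. *)
Definition z32 (n : nat) : R := / (INR (S n) * sqrt (INR (S n))).

Lemma INR_S_pos n : 0 < INR (S n).
Proof. apply lt_0_INR. lia. Qed.

Lemma z32_pos n : 0 < z32 n.
Proof.
  apply Rinv_0_lt_compat. apply Rmult_lt_0_compat; [|apply sqrt_lt_R0]; apply INR_S_pos.
Qed.

(** Comparison with the telescoping differences 2 (n^(-1/2) - (n + 1)^(-1/2)). *)
Lemma ex_series_z32 : ex_series z32.
Proof.
  assert (Ht : is_series (fun n => 2 * (/ sqrt (INR (S n)) - / sqrt (INR (S (S n))))) 2).
  { assert (E : forall N, sum_n (fun n => 2 * (/ sqrt (INR (S n)) - / sqrt (INR (S (S n))))) N = 2 * (1 - / sqrt (INR (S (S N))))).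
    { induction N as [|N IH].
      - rewrite sum_O. simpl (INR 1). rewrite sqrt_1. eqR. field. apply Rgt_not_eq, sqrt_lt_R0, INR_S_pos.
      - rewrite sum_Sn, IH. plusR. ring. }
    change (is_lim_seq (sum_n (fun n => 2 * (/ sqrt (INR (S n)) - / sqrt (INR (S (S n)))))) 2).
    apply (is_lim_seq_ext (fun N => 2 * (1 - / sqrt (INR (S (S N)))))); [intros; now rewrite E|].
    replace 2 with (2 * (1 - 0)) at 1 by ring.
    apply (is_lim_seq_scal_l _ 2 (1 - 0)). apply is_lim_seq_minus'; [apply is_lim_seq_const|].
    apply (is_lim_seq_inv _ p_infty); [|discriminate].
    apply (filterlim_comp _ _ _ (fun N => INR (S (S N))) sqrt _ (Rbar_locally p_infty)); [|apply filterlim_sqrt_p].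
    apply (is_lim_seq_ext (fun n => INR (n + 2)) _ p_infty); [intros; f_equal; lia|].
    apply -> (is_lim_seq_incr_n INR 2). apply is_lim_seq_INR. }
  apply ex_series_incr_1.
  apply (ex_series_le (V:=R_CompleteNormedModule) _ (fun n => 2 * (/ sqrt (INR (S n)) - / sqrt (INR (S (S n)))))); [|eexists; apply Ht].
  intros n. change (Rabs (z32 (S n)) <= 2 * (/ sqrt (INR (S n)) - / sqrt (INR (S (S n))))).
  assert (P := z32_pos (S n)). rewrite Rabs_pos_eq by lra. unfold z32.
  set (p := INR (S n)). assert (Ep : INR (S (S n)) = p + 1) by (rewrite S_INR; reflexivity).
  rewrite Ep. assert (Hp : 0 < p) by apply INR_S_pos.
  set (a := sqrt p). set (b := sqrt (p + 1)).
  assert (Ha : 0 < a) by (apply sqrt_lt_R0; lra).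
  assert (Hb : 0 < b) by (apply sqrt_lt_R0; lra).
  assert (Ea : a * a = p) by (apply sqrt_sqrt; lra).
  assert (Eb : b * b = p + 1) by (apply sqrt_sqrt; lra).
  assert (Hab : a < b) by nra.
  assert (H1 : (b - a) * (b + a) = 1) by (ring_simplify; simpl; lra).
  assert (H2 : 1 <= (b - a) * (2 * b)) by nra.
  assert (H3 : 0 < a * b * (b * b)) by (repeat apply Rmult_lt_0_compat; lra).
  apply (Rmult_le_reg_r (a * b * (b * b))); auto.
  rewrite <- Eb.
  replace (/ (b * b * b) * (a * b * (b * b))) with a by (field; lra).
  apply Rle_trans with (2 * (b - a) * (b * b)); [nra|].
  right. field; lra.
Qed.

Lemma inv_sq_le_z32 n : / INR (S n) ^ 2 <= z32 n.
Proof.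
  unfold z32. set (p := INR (S n)).
  assert (Hp : 1 <= p). { unfold p. rewrite S_INR. pose proof (pos_INR n). lra. }
  assert (Hs : sqrt p <= p).
  { rewrite <- (sqrt_square p) at 2 by lra. apply sqrt_le_1; nra. }
  assert (0 < sqrt p) by (apply sqrt_lt_R0; lra).
  apply Rinv_le_contravar; simpl; nra.
Qed.

Lemma inv_pow_le_z32 n j : (2 <= j)%nat -> / INR (S n) ^ j <= z32 n.
Proof.
  intros Hj. eapply Rle_trans; [|apply inv_sq_le_z32].
  assert (Hp : 1 <= INR (S n)). { rewrite S_INR. pose proof (pos_INR n). lra. }
  apply Rinv_le_contravar; [apply pow_lt; lra|]. now apply Rle_pow.
Qed.

Lemma ex_series_inv_pow j : (2 <= j)%nat -> ex_series (fun n => / INR (S n) ^ j).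
Proof.
  intros Hj. apply (ex_series_le (V:=R_CompleteNormedModule) _ z32); [|apply ex_series_z32].
  intros n. change (Rabs (/ INR (S n) ^ j) <= z32 n).
  rewrite Rabs_pos_eq. apply inv_pow_le_z32; auto. left; apply Rinv_0_lt_compat, pow_lt, INR_S_pos.
Qed.

(** * Lipschitz's summation formula *)

Definition Rderiv (F : R -> C) (x : R) (l : C) : Prop :=
  is_derive (fun t => Re (F t)) x (Re l) /\ is_derive (fun t => Im (F t)) x (Im l).

Lemma Rderiv_plus F G x l m : Rderiv F x l -> Rderiv G x m -> Rderiv (fun t => F t + G t)%C x (l + m)%C.
Proof.
  intros [H1 H2] [H3 H4]. split.
  - apply (is_derive_plus (V:=R_NormedModule) _ _ _ _ _ H1 H3).
  - apply (is_derive_plus (V:=R_NormedModule) _ _ _ _ _ H2 H4).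
Qed.

Lemma Rderiv_scal c F x l : Rderiv F x l -> Rderiv (fun t => c * F t)%C x (c * l)%C.
Proof.
  intros [H1 H2]. destruct c as [c1 c2].
  assert (P1 : forall a, is_derive (fun t => a * Re (F t)) x (a * Re l)).
  { intros a. apply (is_derive_scal (fun t => Re (F t)) x a). exact H1. }
  assert (P2 : forall a, is_derive (fun t => a * Im (F t)) x (a * Im l)).
  { intros a. apply (is_derive_scal (fun t => Im (F t)) x a). exact H2. }
  split.
  - apply (is_derive_minus (V:=R_NormedModule) _ _ _ _ _ (P1 c1) (P2 c2)).
  - apply (is_derive_plus (V:=R_NormedModule) _ _ _ _ _ (P2 c1) (P1 c2)).
Qed.

Lemma Rderiv_mult (f : R -> R) F x d l : is_derive f x d -> Rderiv F x l ->
  Rderiv (fun t => RtoC (f t) * F t)%C x (RtoC d * F x + RtoC (f x) * l)%C.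
Proof.
  intros Hf [H1 H2]. split.
  - apply (is_derive_ext (fun t => f t * Re (F t))); [intros t; unfold Re, Im; simpl; ring|].
    evar_last; [apply (is_derive_mult (K:=R_AbsRing) f (fun t => Re (F t)) x _ _ Hf H1); apply Rmult_comm|].
    simpl. unfold mult, Re, Im; simpl. plusR. ring.
  - apply (is_derive_ext (fun t => f t * Im (F t))); [intros t; unfold Re, Im; simpl; ring|].
    evar_last; [apply (is_derive_mult (K:=R_AbsRing) f (fun t => Im (F t)) x _ _ Hf H2); apply Rmult_comm|].
    simpl. unfold mult, Re, Im; simpl. plusR. ring.
Qed.

Lemma Rderiv_cexp (s : C) x : Rderiv (fun t => cexp (- (s * RtoC t)))%C x (- (s * cexp (- (s * RtoC x))))%C.
Proof.
  destruct s as [s1 s2]. split; unfold cexp; simpl; auto_derive; trivial; unfold Rminus; ring.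
Qed.

Lemma Rderiv_eq F x l m : l = m -> Rderiv F x l -> Rderiv F x m.
Proof. intros ->; auto. Qed.

(** The incomplete Gamma integral of t^k e^(-s t) from x to infinity, unrolled by integration by
    parts; its value at 0 is k!/s^(k+1). *)
Fixpoint gamma_prim (k : nat) (s : C) (x : R) : C :=
  match k with
  | O => / s * cexp (- (s * RtoC x))
  | S j => / s * (RtoC (x ^ k) * cexp (- (s * RtoC x))) + RtoC (INR k) / s * gamma_prim j s x
  end%C.

Lemma Rderiv_gamma_prim k (s : C) x : s <> 0%C ->
  Rderiv (gamma_prim k s) x (- (RtoC (x ^ k) * cexp (- (s * RtoC x))))%C.
Proof.
  intros Hs. induction k as [|k IH].
  - eapply Rderiv_eq; [|apply (Rderiv_scal (/ s)%C _ _ _ (Rderiv_cexp s x))].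
    simpl pow. field. exact Hs.
  - assert (Hp : is_derive (fun t => t ^ S k) x (INR (S k) * x ^ k)).
    { auto_derive; trivial. simpl Nat.pred. change (1 * (INR (S k) * x ^ k) = INR (S k) * x ^ k). ring. }
    eapply Rderiv_eq; [|apply (Rderiv_plus _ _ _ _ _
      (Rderiv_scal (/ s)%C _ _ _ (Rderiv_mult _ _ _ _ _ Hp (Rderiv_cexp s x)))
      (Rderiv_scal (RtoC (INR (S k)) / s)%C _ _ _ IH))].
    rewrite RtoC_mult. field. exact Hs.
Qed.

Lemma gamma_prim_0 k (s : C) : s <> 0%C -> gamma_prim k s 0 = (RtoC (INR (fact k)) / s ^ S k)%C.
Proof.
  intros Hs. induction k as [|k IH].
  - simpl. replace (- (s * 0))%C with (RtoC 0) by ring. rewrite cexp_0. field. exact Hs.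
  - change (gamma_prim (S k) s 0) with (/ s * (RtoC (0 ^ S k) * cexp (- (s * RtoC 0))) + RtoC (INR (S k)) / s * gamma_prim k s 0)%C.
    rewrite IH, pow_i by lia. rewrite fact_simpl, mult_INR, RtoC_mult.
    change (s ^ S (S k))%C with (s * s ^ S k)%C. field. split; auto. now apply Cpow_nz.
Qed.

Lemma pow_exp_lim j t : 0 < t -> is_lim_seq (fun n => INR n ^ j * exp (- (INR n * t))) 0.
Proof.
  intros Ht. apply is_lim_seq_incr_1.
  set (K := INR (fact (S j)) / t ^ S j).
  apply (is_lim_seq_le_le (fun _ => 0) _ (fun n => K * / INR (S n))).
  - intros n. assert (Hn := INR_S_pos n). set (p := INR (S n)) in *. clearbody p. split.
    + apply Rmult_le_pos; [apply pow_le; lra|left; apply exp_pos].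
    + eapply Rle_trans; [apply Rmult_le_compat_l; [apply pow_le; lra|apply (exp_neg_le (S j)); nra]|].
      right. unfold K. rewrite Rpow_mult_distr. rewrite <- !tech_pow_Rmult. field.
      repeat split; try apply pow_nonzero; lra.
  - apply is_lim_seq_const.
  - replace 0 with (K * 0) by ring. apply (is_lim_seq_scal_l _ K 0).
    apply (is_lim_seq_inv _ p_infty); [|discriminate].
    apply (is_lim_seq_incr_1 INR p_infty). apply is_lim_seq_INR.
Qed.

Lemma gamma_prim_lim k s : 0 < Re s -> is_lim_seq (fun n => Cmod (gamma_prim k s (INR n))) 0.
Proof.
  intros Hs.
  assert (Hs0 : s <> 0%C) by (intros ->; simpl in Hs; lra).
  assert (Hm : 0 < Cmod s) by now apply Cmod_gt_0.
  assert (HE : forall n, Cmod (cexp (- (s * RtoC (INR n)))) = exp (- (INR n * Re s))).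
  { intros n. rewrite Cmod_cexp. f_equal. destruct s as [s1 s2]; simpl; ring. }
  induction k as [|k IH].
  - apply (is_lim_seq_ext (fun n => / Cmod s * (INR n ^ 0 * exp (- (INR n * Re s))))).
    + intros n. simpl gamma_prim. rewrite Cmod_mult, Cmod_inv, HE by auto. simpl; ring.
    + replace 0 with (/ Cmod s * 0) by ring. apply (is_lim_seq_scal_l _ _ 0). now apply pow_exp_lim.
  - apply (is_lim_seq_le_le (fun _ => 0) _ (fun n => / Cmod s * (INR n ^ S k * exp (- (INR n * Re s))) + INR (S k) / Cmod s * Cmod (gamma_prim k s (INR n)))).
    + intros n. split; [apply Cmod_ge_0|].
      change (gamma_prim (S k) s (INR n)) with (/ s * (RtoC (INR n ^ S k) * cexp (- (s * RtoC (INR n)))) + RtoC (INR (S k)) / s * gamma_prim k s (INR n))%C.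
      eapply Rle_trans; [apply Cmod_triangle|].
      unfold Cdiv. rewrite !Cmod_mult, Cmod_inv, HE, !Cmod_R by auto.
      rewrite !Rabs_pos_eq; [right; unfold Rdiv; ring|apply pos_INR|apply pow_le, pos_INR].
    + apply is_lim_seq_const.
    + replace 0 with (/ Cmod s * 0 + INR (S k) / Cmod s * 0) by ring.
      apply is_lim_seq_plus'.
      * apply (is_lim_seq_scal_l _ _ 0). now apply pow_exp_lim.
      * apply (is_lim_seq_scal_l _ _ 0). exact IH.
Qed.

Lemma gamma_prim_telescope k s : 0 < Re s ->
  csums (fun d => gamma_prim k s (INR d) - gamma_prim k s (INR (S d)))%C (gamma_prim k s 0).
Proof.
  intros Hs.
  assert (Hl := gamma_prim_lim k s Hs). apply is_lim_seq_incr_1 in Hl.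
  assert (HT : forall u : nat -> R, is_lim_seq (fun n => u (S n)) 0 -> is_series (fun d => u d - u (S d)) (u O)).
  { intros u Hu. change (is_lim_seq (sum_n (fun d => u d - u (S d))) (u O)).
    apply (is_lim_seq_ext (fun N => u O - u (S N))).
    - induction n as [|n IH]; [now rewrite sum_O|]. rewrite sum_Sn, <- IH. plusR. ring.
    - replace (u O) with (u O - 0) at 1 by ring. apply is_lim_seq_minus'; auto. apply is_lim_seq_const. }
  split.
  - apply (HT (fun d => Re (gamma_prim k s (INR d)))).
    apply is_lim_seq_abs_0. apply (is_lim_seq_le_le (fun _ => 0) _ (fun n => Cmod (gamma_prim k s (INR (S n))))); auto.
    + intros n; split; [apply Rabs_pos|apply re_le_Cmod].
    + apply is_lim_seq_const.
  - apply (HT (fun d => Im (gamma_prim k s (INR d)))).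
    apply is_lim_seq_abs_0. apply (is_lim_seq_le_le (fun _ => 0) _ (fun n => Cmod (gamma_prim k s (INR (S n))))); auto.
    + intros n; split; [apply Rabs_pos|apply Im_le_Cmod].
    + apply is_lim_seq_const.
Qed.

(** [is_int01] and the dominated exchange speak about all real arguments, while the bounds on
    [lip_term] hold for th in [0, 1] only. Composing with the clamp makes them global without
    changing anything on [0, 1]. *)
Definition clamp (x : R) : R := Rmax 0 (Rmin x 1).

Lemma clamp_range x : 0 <= clamp x <= 1.
Proof.
  unfold clamp. split; [apply Rmax_l|]. apply Rmax_lub; [lra|apply Rmin_r].
Qed.

Lemma clamp_id x : 0 <= x <= 1 -> clamp x = x.
Proof. intros H. unfold clamp. rewrite Rmin_left, Rmax_right; lra. Qed.

Lemma clamp_continuous x : continuous clamp x.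
Proof.
  apply continuous_eps. intros eps Heps. exists eps. split; auto. intros y Hy.
  apply Rabs_def2 in Hy. unfold clamp, Rmax, Rmin.
  apply Rabs_def1; repeat destruct Rle_dec; lra.
Qed.

Lemma ex_series_pow_exp k t : 0 < t -> ex_series (fun d => INR (S d) ^ k * exp (- (INR d * t))).
Proof.
  intros Ht. set (K := exp t * (INR (fact (k + 2)) / t ^ (k + 2))).
  apply (ex_series_le (V:=R_CompleteNormedModule) _ (fun d => K * / INR (S d) ^ 2)).
  - intros d. change (Rabs (INR (S d) ^ k * exp (- (INR d * t))) <= K * / INR (S d) ^ 2).
    assert (Hd := INR_S_pos d). assert (Hp := pow_lt _ k Hd). assert (He := exp_pos (- (INR d * t))).
    rewrite Rabs_pos_eq by nra.
    replace (exp (- (INR d * t))) with (exp t * exp (- (INR (S d) * t))).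
    2:{ rewrite <- exp_plus. f_equal. rewrite S_INR. ring. }
    apply Rle_trans with (INR (S d) ^ k * (exp t * (INR (fact (k + 2)) / (INR (S d) * t) ^ (k + 2)))).
    + apply Rmult_le_compat_l; [lra|]. apply Rmult_le_compat_l; [left; apply exp_pos|].
      apply exp_neg_le. nra.
    + right. unfold K. rewrite Rpow_mult_distr, !pow_add. field.
      repeat split; try apply pow_nonzero; lra.
  - apply (ex_series_scal (V:=R_NormedModule) K). apply ex_series_inv_pow. lia.
Qed.

Definition lip_term (k : nat) (t th : R) (d : nat) : R := (INR d + th) ^ k * exp (- ((INR d + th) * t)).

Lemma lip_term_bound k t th d : 0 < t -> 0 <= th <= 1 ->
  Rabs (lip_term k t th d) <= INR (S d) ^ k * exp (- (INR d * t)).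
Proof.
  intros Ht Hth. unfold lip_term. assert (Hd := pos_INR d).
  rewrite Rabs_pos_eq by (apply Rmult_le_pos; [apply pow_le; lra|left; apply exp_pos]).
  apply Rmult_le_compat; [apply pow_le; lra|left; apply exp_pos| |].
  - apply pow_incr. rewrite S_INR. lra.
  - apply exp_le. nra.
Qed.

Lemma lip_term_continuous k t d x : continuous (fun th => lip_term k t (clamp th) d) x.
Proof.
  apply (continuous_comp clamp (fun th => lip_term k t th d)); [apply clamp_continuous|].
  apply continuous_of_derivable. unfold lip_term. auto_derive; trivial.
Qed.

(** Unfolding: e^(-2 pi i m d) = 1, so the d-th term contributes the part of the Gamma integral at s
    = t + 2 pi i m that lies over [d, d + 1]. The pieces telescope to k!/s^(k+1). *)
Lemma lip_fourier_coeff k t (m : Z) : 0 < t ->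
  CI is_int01 (fun th => RtoC (Series (lip_term k t (clamp th))) * (cos (2 * PI * IZR m * th), (- sin (2 * PI * IZR m * th))%R))%C
    (RtoC (INR (fact k)) / (t, (2 * PI * IZR m)%R) ^ S k)%C.
Proof.
  intros Ht. set (s := (t, (2 * PI * IZR m)%R) : C).
  assert (Hs : 0 < Re s) by exact Ht.
  assert (Hs0 : s <> 0%C) by (intros E; rewrite E in Hs; simpl in Hs; lra).
  set (e := fun th : R => (cos (2 * PI * IZR m * th), (- sin (2 * PI * IZR m * th))%R) : C).
  assert (Hcos : forall x, continuous (fun th => cos (2 * PI * IZR m * th)) x).
  { intros; apply continuous_of_derivable; auto_derive; trivial. }
  assert (Hsin : forall x, continuous (fun th => - sin (2 * PI * IZR m * th)) x).
  { intros; apply continuous_of_derivable; auto_derive; trivial. }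
  set (f := fun d th => (RtoC (lip_term k t (clamp th) d) * e th)%C).
  assert (Hcont : forall g : R -> R, (forall x, continuous g x) -> forall x,
     continuous (fun th => Re (RtoC (g th) * e th)%C) x /\ continuous (fun th => Im (RtoC (g th) * e th)%C) x).
  { intros g Hg x. split.
    - apply (continuous_ext (fun th => g th * cos (2 * PI * IZR m * th))); [intros; simpl; ring|].
      now apply continuous_mult_R.
    - apply (continuous_ext (fun th => g th * (- sin (2 * PI * IZR m * th)))); [intros; simpl; ring|].
      now apply continuous_mult_R. }
  assert (He : forall th, Cmod (e th) = 1).
  { intros th. unfold e, Cmod; simpl. rewrite !Rmult_1_r.
    replace (cos (2 * PI * IZR m * th) * cos (2 * PI * IZR m * th) + - sin (2 * PI * IZR m * th) * - sin (2 * PI * IZR m * th))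
      with (Rsqr (sin (2 * PI * IZR m * th)) + Rsqr (cos (2 * PI * IZR m * th))) by (unfold Rsqr; ring).
    rewrite sin2_cos2. apply sqrt_1. }
  assert (Hf : forall d, CI is_int01 (f d) (gamma_prim k s (INR d) - gamma_prim k s (INR (S d)))%C).
  { intros d.
    assert (Eder : forall th, 0 < th < 1 -> f d th = (RtoC ((INR d + th) ^ k) * cexp (- (s * RtoC (INR d + th))))%C).
    { intros th Hth. unfold f. rewrite clamp_id by lra. unfold lip_term, e, s, cexp. simpl.
      replace (- (t * (INR d + th) - 2 * PI * IZR m * 0)) with (- ((INR d + th) * t)) by ring.
      replace (- (t * 0 + 2 * PI * IZR m * (INR d + th))) with (- (2 * PI * IZR m * th + 2 * PI * IZR (m * Z.of_nat d))).
      2:{ rewrite mult_IZR, <- INR_IZR_INZ. ring. }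
      rewrite cos_neg, sin_neg, cos_plus, sin_plus, cos_2PI_Z, sin_2PI_Z.
      apply C_ext; simpl; ring. }
    assert (HD := fun th => Rderiv_gamma_prim k s (INR d + th) Hs0).
    assert (Hsh : forall (u u' : R -> R), (forall x, is_derive u x (u' x)) -> (forall x, continuous u' x) ->
       is_RInt (fun th => u' (INR d + th)) 0 1 (u (INR (S d)) - u (INR d))).
    { intros u u' Hu Hu'. rewrite S_INR. replace (u (INR d)) with (u (INR d + 0)) by (f_equal; ring).
      apply (is_RInt_derive (V:=R_CompleteNormedModule) (fun th => u (INR d + th))).
      - intros th _. evar_last.
        + apply (is_derive_comp (K:=R_AbsRing) (V:=R_NormedModule) u (fun th => INR d + th)); [apply Hu|].
          auto_derive; trivial.
        + unfold scal; simpl; unfold mult; simpl. eqR; ring.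
      - intros th _. apply (continuous_comp (fun th => INR d + th) u'); [|apply Hu'].
        apply continuous_of_derivable; auto_derive; trivial. }
    split; (split; [intros x; apply (Hcont (fun th => lip_term k t (clamp th) d) (lip_term_continuous k t d) x)|]).
    - assert (HI := Hsh (fun x => Re (gamma_prim k s x)) (fun x => Re (- (RtoC (x ^ k) * cexp (- (s * RtoC x))))%C)
         (fun x => proj1 (Rderiv_gamma_prim k s x Hs0))).
      assert (Hc' : forall x, continuous (fun x => Re (- (RtoC (x ^ k) * cexp (- (s * RtoC x))))%C) x).
      { intros x. apply continuous_of_derivable. unfold cexp, s; simpl. auto_derive; trivial. }
      apply (is_RInt_opp (V:=R_NormedModule)) in HI; auto.
      apply (is_RInt_ext (V:=R_NormedModule) _ (fun th => Re (f d th))) in HI.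
      + evar_last; [apply HI|]. unfold opp; simpl. unfold Re. ring.
      + rewrite Rmin_left, Rmax_right by lra. intros th Hth. rewrite Eder by auto. unfold opp; simpl. eqR; ring.
    - assert (HI := Hsh (fun x => Im (gamma_prim k s x)) (fun x => Im (- (RtoC (x ^ k) * cexp (- (s * RtoC x))))%C)
         (fun x => proj2 (Rderiv_gamma_prim k s x Hs0))).
      assert (Hc' : forall x, continuous (fun x => Im (- (RtoC (x ^ k) * cexp (- (s * RtoC x))))%C) x).
      { intros x. apply continuous_of_derivable. unfold cexp, s; simpl. auto_derive; trivial. }
      apply (is_RInt_opp (V:=R_NormedModule)) in HI; auto.
      apply (is_RInt_ext (V:=R_NormedModule) _ (fun th => Im (f d th))) in HI.
      + evar_last; [apply HI|]. unfold opp; simpl. unfold Im. ring.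
      + rewrite Rmin_left, Rmax_right by lra. intros th Hth. rewrite Eder by auto. unfold opp; simpl. eqR; ring. }
  set (c := fun d => INR (S d) ^ k * exp (- (INR d * t))).
  assert (Hex : ex_series c) by now apply ex_series_pow_exp.
  assert (Hser : forall th, is_series (lip_term k t (clamp th)) (Series (lip_term k t (clamp th)))).
  { intros th. apply Series_correct. apply (series_dom_exists _ c); auto.
    intros d. apply lip_term_bound; auto. apply clamp_range. }
  assert (Hgc : forall x, continuous (fun th => Series (lip_term k t (clamp th))) x).
  { apply (continuous_series (fun d th => lip_term k t (clamp th) d) c); auto.
    - intros; apply lip_term_continuous.
    - intros d th. apply lip_term_bound; auto. apply clamp_range. }
  set (F := fun th => (RtoC (Series (lip_term k t (clamp th))) * e th)%C).
  assert (HF : CI is_int01 F (RInt (fun th => Re (F th)) 0 1, RInt (fun th => Im (F th)) 0 1)).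
  { split; simpl; apply int01_exists; intros x; apply (Hcont _ Hgc x). }
  assert (HS : csums (fun d => gamma_prim k s (INR d) - gamma_prim k s (INR (S d)))%C
     (RInt (fun th => Re (F th)) 0 1, RInt (fun th => Im (F th)) 0 1)).
  { apply (integral_csums _ _ _ is_integral_int01 f _ c F); auto.
    - intros d th. unfold f. rewrite Cmod_mult, He, Cmod_R, !Rmult_1_r.
      apply lip_term_bound; auto. apply clamp_range.
    - intros th. unfold f, F. rewrite Cmult_comm.
      eapply csums_ext; [|apply (csums_real _ (e th) _ (Hser th))]. intros d; apply Cmult_comm. }
  rewrite <- (gamma_prim_0 k s Hs0), (csums_unique _ _ _ (gamma_prim_telescope k s Hs) HS). exact HF.
Qed.

(** * The dual side of Lipschitz's formula *)

Definition ej (j : Z) (th : R) : C := (cos (2 * PI * IZR j * th), sin (2 * PI * IZR j * th)).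

Lemma ej_add i j th : ej (i + j) th = (ej i th * ej j th)%C.
Proof.
  unfold ej. rewrite plus_IZR.
  replace (2 * PI * (IZR i + IZR j) * th) with (2 * PI * IZR i * th + 2 * PI * IZR j * th) by ring.
  rewrite cos_plus, sin_plus. apply C_ext; simpl; ring.
Qed.

Lemma ej_opp j th : ej (- j) th = Cconj (ej j th).
Proof.
  unfold ej. rewrite opp_IZR.
  replace (2 * PI * - IZR j * th) with (- (2 * PI * IZR j * th)) by ring.
  now rewrite cos_neg, sin_neg.
Qed.

Lemma Cmod_ej j th : Cmod (ej j th) = 1.
Proof.
  unfold ej, Cmod; simpl. rewrite !Rmult_1_r.
  set (y := 2 * PI * IZR j * th).
  replace (cos y * cos y + sin y * sin y) with (Rsqr (sin y) + Rsqr (cos y)) by (unfold Rsqr; ring).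
  rewrite sin2_cos2. apply sqrt_1.
Qed.

Lemma ej_integral j : CI is_int01 (ej j) (if Z.eq_dec j 0 then 1%C else 0%C).
Proof.
  assert (Hc : forall x, continuous (fun th => cos (2 * PI * IZR j * th)) x).
  { intros; apply continuous_of_derivable; auto_derive; trivial. }
  assert (Hs : forall x, continuous (fun th => sin (2 * PI * IZR j * th)) x).
  { intros; apply continuous_of_derivable; auto_derive; trivial. }
  assert (HP := PI_RGT_0).
  split; (split; [auto|]).
  - destruct (Z.eq_dec j 0) as [->|Hj].
    + apply (is_RInt_ext (fun _ => 1)). { intros; simpl. now rewrite Rmult_0_r, Rmult_0_l, cos_0. }
      evar_last; [apply (is_RInt_const (V:=R_NormedModule))|]. unfold scal; simpl; unfold mult; simpl; ring.
    + assert (HJ : IZR j <> 0) by now apply not_0_IZR.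
      evar_last; [apply (is_RInt_derive (V:=R_CompleteNormedModule) (fun th => sin (2 * PI * IZR j * th) / (2 * PI * IZR j)) (fun th => cos (2 * PI * IZR j * th)))|].
      * intros x _. auto_derive; trivial. field. split; lra.
      * intros; apply Hc.
      * rewrite Rmult_1_r, Rmult_0_r, sin_2PI_Z, sin_0. unfold minus, plus, opp; simpl. field. split; lra.
  - destruct (Z.eq_dec j 0) as [->|Hj].
    + apply (is_RInt_ext (fun _ => 0)). { intros; simpl. now rewrite Rmult_0_r, Rmult_0_l, sin_0. }
      evar_last; [apply (is_RInt_const (V:=R_NormedModule))|]. unfold scal; simpl; unfold mult; simpl; ring.
    + assert (HJ : IZR j <> 0) by now apply not_0_IZR.
      evar_last; [apply (is_RInt_derive (V:=R_CompleteNormedModule) (fun th => - cos (2 * PI * IZR j * th) / (2 * PI * IZR j)) (fun th => sin (2 * PI * IZR j * th)))|].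
      * intros x _. auto_derive; trivial. field. split; lra.
      * intros; apply Hs.
      * rewrite Rmult_1_r, Rmult_0_r, cos_2PI_Z, cos_0. unfold minus, plus, opp; simpl. field. split; lra.
Qed.

Lemma is_series_single (n0 : nat) (a : R) : is_series (fun n => if Nat.eq_dec n n0 then a else 0) a.
Proof.
  change (is_lim_seq (sum_n (fun n => if Nat.eq_dec n n0 then a else 0)) a).
  assert (E : forall N, sum_n (fun n => if Nat.eq_dec n n0 then a else 0) N = if le_dec n0 N then a else 0).
  { induction N as [|N IH].
    - rewrite sum_O. destruct (Nat.eq_dec 0 n0), (le_dec n0 0); try lia; auto.
    - rewrite sum_Sn, IH. destruct (Nat.eq_dec (S N) n0), (le_dec n0 N), (le_dec n0 (S N)); try lia; plusR; ring. }
  apply (is_lim_seq_ext_loc (fun _ => a)); [|apply is_lim_seq_const].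
  exists n0. intros N HN. rewrite E. destruct (le_dec n0 N); [auto|lia].
Qed.

Lemma csums_single (n0 : nat) (a : C) : csums (fun n => if Nat.eq_dec n n0 then a else 0%C) a.
Proof.
  split; (eapply is_series_ext; [|apply (is_series_single n0)]); intros n; simpl; destruct Nat.eq_dec; auto.
Qed.

Lemma csums_zero : csums (fun _ => 0%C) 0%C.
Proof.
  replace (RtoC 0) with (0 * 1)%C at 1 by ring.
  eapply csums_ext; [|apply (csums_scal _ 0%C _ (csums_single 0 1%C))]. intros; simpl. ring.
Qed.

Definition lip_freq (k : nat) (t : R) (j : Z) : C := (/ (t, (2 * PI * IZR j)%R) ^ S k)%C.

Lemma Cconj_inv (z : C) : z <> 0%C -> Cconj (/ z) = (/ Cconj z)%C.
Proof.
  intros Hz. apply Cinv_conj. exact Hz.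
Qed.

Lemma Cconj_pow (z : C) n : Cconj (z ^ n) = (Cconj z ^ n)%C.
Proof. induction n as [|n IH]; simpl; [apply C_ext; simpl; ring|]. now rewrite Cmult_conj, IH. Qed.

Lemma freq_neq_0 (t y : R) : 0 < t -> ((t, y) : C) <> 0%C.
Proof. intros Ht E. injection E; intros; lra. Qed.

Lemma lip_freq_conj k t j : 0 < t -> lip_freq k t (- j) = Cconj (lip_freq k t j).
Proof.
  intros Ht. unfold lip_freq. rewrite Cconj_inv by (apply Cpow_nz, freq_neq_0; auto).
  rewrite Cconj_pow. f_equal. f_equal. rewrite opp_IZR. apply C_ext; simpl; ring.
Qed.

Lemma Cmod_inv_pow_le (z : C) j r : 0 < r <= Cmod z -> Cmod (/ z ^ j) <= / r ^ j.
Proof.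
  intros Hr. assert (Hz : z <> 0%C) by (apply Cmod_gt_0; lra).
  rewrite Cmod_inv by now apply Cpow_nz. rewrite Cmod_pow.
  apply Rinv_le_contravar; [apply pow_lt; lra|]. apply pow_incr. lra.
Qed.

Lemma lip_freq_bound k t n : (1 <= k)%nat -> 0 < t -> Cmod (lip_freq k t (Z.of_nat (S n))) <= / INR (S n) ^ 2.
Proof.
  intros Hk Ht. assert (Hn := INR_S_pos n).
  assert (H1 : 1 <= INR (S n)) by (rewrite S_INR; pose proof (pos_INR n); lra).
  eapply Rle_trans; [apply (Cmod_inv_pow_le _ _ (INR (S n)))|].
  - split; [lra|]. eapply Rle_trans; [|apply Im_le_Cmod]. change (INR (S n) <= Rabs (2 * PI * IZR (Z.of_nat (S n)))). rewrite <- INR_IZR_INZ.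
    assert (HP := PI2_1). rewrite Rabs_pos_eq; nra.
  - apply Rinv_le_contravar; [apply pow_lt; lra|]. apply Rle_pow; auto. lia.
Qed.

(** The frequencies n + 1 and -(n + 1) taken together, which makes the dual series real. Frequency 0
    is left out; it is the term / t^(k+1) subtracted in [lipschitz_formula]. *)
Definition lip_dual (k : nat) (t th : R) (n : nat) : R :=
  2 * Re (ej (Z.of_nat (S n)) th * lip_freq k t (Z.of_nat (S n)))%C.

Lemma lip_dual_bound k t th n : (1 <= k)%nat -> 0 < t -> Rabs (lip_dual k t th n) <= 2 * / INR (S n) ^ 2.
Proof.
  intros Hk Ht. unfold lip_dual. rewrite Rabs_mult, (Rabs_pos_eq 2) by lra.
  apply Rmult_le_compat_l; [lra|]. eapply Rle_trans; [apply re_le_Cmod|].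
  rewrite Cmod_mult, Cmod_ej, Rmult_1_l. now apply lip_freq_bound.
Qed.

Lemma lip_dual_coeff k t n m : 0 < t ->
  CI is_int01 (fun th => RtoC (lip_dual k t th n) * ej (- m) th)%C
    ((if Z.eq_dec (Z.of_nat (S n)) m then lip_freq k t m else 0%C) + (if Z.eq_dec (Z.of_nat (S n)) (- m) then lip_freq k t m else 0%C))%C.
Proof.
  intros Ht. set (N := Z.of_nat (S n)).
  apply (CI_ext _ _ _ (fun th => lip_freq k t N * ej (N + - m) th + lip_freq k t (- N) * ej (- N + - m) th)%C _ _ is_integral_int01).
  - intros th. rewrite !ej_add, lip_freq_conj, (ej_opp N) by auto. unfold lip_dual. fold N.
    destruct (ej N th) as [a b], (lip_freq k t N) as [c d], (ej (- m) th) as [e f].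
    apply C_ext; simpl; ring.
  - apply (CI_plus _ _ _ _ _ _ _ is_integral_int01).
    + destruct (Z.eq_dec N m) as [E|E].
      * replace (lip_freq k t m) with (lip_freq k t N * (if Z.eq_dec (N + - m) 0 then 1 else 0))%C.
        2:{ destruct Z.eq_dec; [rewrite E; ring|lia]. }
        apply (CI_scal _ _ _ _ _ _ is_integral_int01), ej_integral.
      * replace (RtoC 0) with (lip_freq k t N * (if Z.eq_dec (N + - m) 0 then 1 else 0))%C.
        2:{ destruct Z.eq_dec; [lia|ring]. }
        apply (CI_scal _ _ _ _ _ _ is_integral_int01), ej_integral.
    + destruct (Z.eq_dec N (- m)) as [E|E].
      * replace (lip_freq k t m) with (lip_freq k t (- N) * (if Z.eq_dec (- N + - m) 0 then 1 else 0))%C.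
        2:{ destruct Z.eq_dec; [|lia]. rewrite E, Z.opp_involutive; ring. }
        apply (CI_scal _ _ _ _ _ _ is_integral_int01), ej_integral.
      * replace (RtoC 0) with (lip_freq k t (- N) * (if Z.eq_dec (- N + - m) 0 then 1 else 0))%C.
        2:{ destruct Z.eq_dec; [lia|ring]. }
        apply (CI_scal _ _ _ _ _ _ is_integral_int01), ej_integral.
Qed.

(* Both sides have the same Fourier coefficients in [th]. *)
Lemma lipschitz_formula k t th : (1 <= k)%nat -> 0 < t -> 0 <= th <= 1 ->
  is_series (lip_dual k t th) (Series (lip_term k t th) / INR (fact k) - / t ^ S k).
Proof.
  intros Hk Ht Hth.
  set (c := fun n => 2 * / INR (S n) ^ 2).
  assert (Hex : ex_series c) by (apply (ex_series_scal (V:=R_NormedModule) 2), ex_series_inv_pow; lia).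
  assert (HH : forall x, is_series (lip_dual k t x) (Series (lip_dual k t x))).
  { intros x. apply Series_correct. apply (series_dom_exists _ c); auto. intros; now apply lip_dual_bound. }
  set (H := fun x => Series (lip_dual k t x)).
  assert (Hdc : forall n x, continuous (fun th => lip_dual k t th n) x).
  { intros n x. apply continuous_of_derivable. unfold lip_dual, ej. simpl. auto_derive; trivial. }
  assert (HHc : forall x, continuous H x).
  { apply (continuous_series (fun n th => lip_dual k t th n) c); auto. intros; now apply lip_dual_bound. }
  set (g := fun th => Series (lip_term k t (clamp th))).
  assert (Hgc : forall x, continuous g x).
  { apply (continuous_series (fun d th => lip_term k t (clamp th) d) (fun d => INR (S d) ^ k * exp (- (INR d * t)))).
    - intros; apply lip_term_continuous.
    - intros d x. apply lip_term_bound; auto. apply clamp_range.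
    - now apply ex_series_pow_exp.
    - intros x. apply Series_correct. apply (series_dom_exists _ (fun d => INR (S d) ^ k * exp (- (INR d * t)))); [|now apply ex_series_pow_exp].
      intros d. apply lip_term_bound; auto. apply clamp_range. }
  assert (Hf0 : INR (fact k) <> 0) by apply INR_fact_neq_0.
  assert (Hcoef : forall m, CI is_int01 (fun th => RtoC (H th) * ej (- m) th)%C
     (if Z.eq_dec m 0 then 0%C else lip_freq k t m)).
  { intros m.
    set (F := fun th => (RtoC (H th) * ej (- m) th)%C).
    assert (HF : CI is_int01 F (RInt (fun th => Re (F th)) 0 1, RInt (fun th => Im (F th)) 0 1)).
    { split; simpl; apply int01_exists; intros x; unfold F, ej; simpl.
      - apply (continuous_ext (fun th => H th * cos (2 * PI * IZR (- m) * th))); [intros; eqR; ring|].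
        apply continuous_mult_R; auto. apply continuous_of_derivable; auto_derive; trivial.
      - apply (continuous_ext (fun th => H th * sin (2 * PI * IZR (- m) * th))); [intros; eqR; ring|].
        apply continuous_mult_R; auto. apply continuous_of_derivable; auto_derive; trivial. }
    assert (HS' : csums (fun n => (if Z.eq_dec (Z.of_nat (S n)) m then lip_freq k t m else 0%C) + (if Z.eq_dec (Z.of_nat (S n)) (- m) then lip_freq k t m else 0%C))%C
       (RInt (fun th => Re (F th)) 0 1, RInt (fun th => Im (F th)) 0 1)).
    { apply (integral_csums _ _ _ is_integral_int01 (fun n th => (RtoC (lip_dual k t th n) * ej (- m) th)%C) _ c F); auto.
      - intros n; now apply lip_dual_coeff.
      - intros n x. rewrite Cmod_mult, Cmod_ej, Cmod_R, !Rmult_1_r. now apply lip_dual_bound.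
      - intros x. unfold F, H. rewrite Cmult_comm.
        eapply csums_ext; [|apply (csums_real _ (ej (- m) x) _ (HH x))]. intros n; apply Cmult_comm. }
    (* For m different from 0 exactly one index, n = |m| - 1, meets the frequency m; for m = 0 none
       does. *)
    assert (HS2 : csums (fun n => (if Z.eq_dec (Z.of_nat (S n)) m then lip_freq k t m else 0%C) + (if Z.eq_dec (Z.of_nat (S n)) (- m) then lip_freq k t m else 0%C))%C
       (if Z.eq_dec m 0 then 0%C else lip_freq k t m)).
    { destruct (Z.eq_dec m 0) as [->|Hm].
      - eapply csums_ext; [|apply csums_zero]. intros n.
        repeat match goal with |- context [Z.eq_dec ?a ?b] => destruct (Z.eq_dec a b) end; try lia; ring.
      - eapply csums_ext; [|apply (csums_single (Z.to_nat (Z.abs m) - 1) (lip_freq k t m))].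
        intros n. cbv beta. destruct (Nat.eq_dec n (Z.to_nat (Z.abs m) - 1));
        repeat match goal with |- context [Z.eq_dec ?a ?b] => destruct (Z.eq_dec a b) end; try lia; ring. }
    rewrite <- (csums_unique _ _ _ HS' HS2). exact HF. }
  set (h := fun x => g x / INR (fact k) - / t ^ S k - H x).
  assert (Hh : forall x, continuous h x).
  { intros x. unfold h. apply (continuous_minus (V:=R_NormedModule) (fun x => g x / INR (fact k) - / t ^ S k) H); auto.
    apply (continuous_minus (V:=R_NormedModule) (fun x => g x / INR (fact k)) (fun _ => / t ^ S k)).
    - apply continuous_mult_R; auto. apply continuous_const.
    - apply continuous_const. }
  assert (Hzero : forall m, CI is_int01 (fun th => RtoC (h th) * ej (- m) th)%C 0%C).
  { intros m.
    assert (A1 := lip_fourier_coeff k t m Ht).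
    assert (A2 := ej_integral (- m)).
    assert (A3 := Hcoef m).
    apply (CI_scal _ _ _ _ _ (/ RtoC (INR (fact k)))%C is_integral_int01) in A1.
    apply (CI_scal _ _ _ _ _ (- RtoC (/ t ^ S k))%C is_integral_int01) in A2.
    apply (CI_scal _ _ _ _ _ (- (1))%C is_integral_int01) in A3.
    assert (A4 := CI_plus _ _ _ _ _ _ _ is_integral_int01 (CI_plus _ _ _ _ _ _ _ is_integral_int01 A1 A2) A3).
    assert (Hfc : RtoC (INR (fact k)) <> 0%C) by (intros E; apply Hf0; now apply RtoC_inj in E).
    match type of A4 with CI _ _ ?l => replace l with (RtoC 0) in A4 end.
    - eapply (CI_ext _ _ _ _ _ _ is_integral_int01); [|apply A4].
      intros x. cbv beta. unfold h, g. rewrite !RtoC_minus, RtoC_div.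
      replace (cos (2 * PI * IZR m * x), (- sin (2 * PI * IZR m * x))%R) with (ej (- m) x) by (rewrite ej_opp; reflexivity).
      generalize (RtoC (/ t ^ S k)) (ej (- m) x) (RtoC (Series (lip_term k t (clamp x)))) (RtoC (H x)).
      intros c1 c2 c3 c4. field. exact Hfc.
      exact Hf0.
    - fold (lip_freq k t m). unfold Cdiv. fold (lip_freq k t m).
      destruct (Z.eq_dec m 0) as [->|Hm].
      + simpl Z.opp. destruct Z.eq_dec; [|lia]. unfold lip_freq.
        replace (t, (2 * PI * IZR 0)%R) with (RtoC t) by (apply C_ext; simpl; ring).
        rewrite <- RtoC_pow, <- (RtoC_inv (t ^ S k)) by (apply pow_nonzero; lra).
        generalize (RtoC (/ t ^ S k)). intros c1. field. exact Hfc.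
      + destruct (Z.eq_dec (- m) 0); [lia|]. generalize (RtoC (/ t ^ S k)) (lip_freq k t m).
        intros c1 c2. field. exact Hfc. }
  assert (Hres : h th = 0).
  { apply (fourier_uniqueness h Hh); auto.
    - intros n. destruct (Hzero n) as [[_ H1] _]. apply is_RInt_unique.
      eapply is_RInt_ext; [|apply H1]. intros x _. unfold ej. rewrite opp_IZR. simpl.
      replace (2 * PI * - IZR n * x) with (- (2 * PI * IZR n * x)) by ring. rewrite cos_neg. eqR; ring.
    - intros n. destruct (Hzero (- n)%Z) as [_ [_ H1]]. apply is_RInt_unique.
      eapply is_RInt_ext; [|apply H1]. intros x _. unfold ej. rewrite Z.opp_involutive. simpl. eqR; ring. }
  unfold h, g in Hres. rewrite clamp_id in Hres by auto.
  replace (Series (lip_term k t th) / INR (fact k) - / t ^ S k) with (H th) by lra. apply HH.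
Qed.

(** * Dirichlet characters and Gauss sums *)

Definition lsum (l : list nat) (f : nat -> C) : C := fold_right (fun h acc => (f h + acc)%C) 0%C l.

Lemma lsum_app l l' f : lsum (l ++ l') f = (lsum l f + lsum l' f)%C.
Proof. induction l as [|a l IH]; simpl; [ring|]. rewrite IH. ring. Qed.

Lemma lsum_perm l l' f : Permutation l l' -> lsum l f = lsum l' f.
Proof. induction 1; simpl; try congruence; try ring. Qed.

Lemma lsum_map l (g : nat -> nat) f : lsum (map g l) f = lsum l (fun h => f (g h)).
Proof. induction l as [|a l IH]; simpl; [auto|]. now rewrite IH. Qed.

Lemma lsum_ext l f g : (forall h, In h l -> f h = g h) -> lsum l f = lsum l g.
Proof.
  induction l as [|a l IH]; simpl; intros H; [auto|]. rewrite H, IH; auto.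
Qed.

Lemma csum1_lsum N f : csum1 N f = lsum (seq 1 N) f.
Proof.
  induction N as [|N IH]; [reflexivity|].
  rewrite seq_S, lsum_app. simpl. rewrite <- IH. ring.
Qed.

Lemma csum1_ext N f g : (forall h, (1 <= h <= N)%nat -> f h = g h) -> csum1 N f = csum1 N g.
Proof.
  intros H. rewrite !csum1_lsum. apply lsum_ext. intros h Hh. apply in_seq in Hh. apply H. lia.
Qed.

Lemma csum1_scal N c f : csum1 N (fun h => c * f h)%C = (c * csum1 N f)%C.
Proof. induction N as [|N IH]; simpl; [ring|]. rewrite IH. ring. Qed.

Lemma csum1_plus N f g : csum1 N (fun h => f h + g h)%C = (csum1 N f + csum1 N g)%C.
Proof. induction N as [|N IH]; simpl; [ring|]. rewrite IH. ring. Qed.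

Definition periodic (q : nat) (f : nat -> C) : Prop := forall n, f (n + q)%nat = f n.

Lemma periodic_mul q f j n : periodic q f -> f (n + j * q)%nat = f n.
Proof.
  intros H. induction j as [|j IH]; [f_equal; lia|].
  replace (n + S j * q)%nat with (n + j * q + q)%nat by lia. now rewrite H.
Qed.

Lemma periodic_mod q f n : (1 <= q)%nat -> periodic q f -> f (n mod q)%nat = f n.
Proof.
  intros Hq H. rewrite (Nat.div_mod_eq n q) at 2.
  replace (q * (n / q) + n mod q)%nat with (n mod q + (n / q) * q)%nat by lia.
  now rewrite periodic_mul.
Qed.

Lemma periodic_eqmod q f m n : (1 <= q)%nat -> periodic q f -> (m mod q = n mod q)%nat -> f m = f n.
Proof. intros Hq H E. rewrite <- (periodic_mod q f m), <- (periodic_mod q f n), E; auto. Qed.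

Lemma csum1_periodic q f : (1 <= q)%nat -> periodic q f -> csum1 q f = lsum (seq 0 q) f.
Proof.
  intros Hq H. rewrite csum1_lsum. destruct q as [|q]; [lia|].
  rewrite seq_S, lsum_app. simpl. rewrite <- (H O). simpl. ring.
Qed.

Lemma csum1_mul_unit q a f : (1 <= q)%nat -> Nat.gcd a q = 1%nat -> periodic q f ->
  csum1 q (fun h => f (a * h)%nat) = csum1 q f.
Proof.
  intros Hq Ha H.
  assert (H' : periodic q (fun h => f (a * h)%nat)).
  { intros n. rewrite Nat.mul_add_distr_l. now apply periodic_mul. }
  rewrite !csum1_periodic by auto.
  rewrite (lsum_ext _ _ (fun h => f ((a * h) mod q)%nat)) by (intros; now rewrite periodic_mod).
  rewrite <- (lsum_map (seq 0 q) (fun h => (a * h) mod q)%nat f).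
  apply lsum_perm. apply NoDup_Permutation_bis.
  - apply NoDup_map_NoDup_ForallPairs; [|apply seq_NoDup].
    intros x y Hx Hy E. apply in_seq in Hx, Hy.
    assert (forall u v, (u <= v)%nat -> (v < q)%nat -> (a * u) mod q = (a * v) mod q -> u = v)%nat.
    { intros u v Huv Hv Em.
      assert (D : Nat.divide q (a * (v - u))).
      { apply Nat.Lcm0.mod_divide.
        rewrite Nat.mul_sub_distr_l.
        assert (E1 := Nat.div_mod_eq (a * u) q). assert (E2 := Nat.div_mod_eq (a * v) q).
        assert (a * u <= a * v)%nat by nia.
        replace (a * v - a * u)%nat with ((a * v / q - a * u / q) * q)%nat by nia.
        apply Nat.Div0.mod_mul. }
      apply Nat.gauss in D; [|now rewrite Nat.gcd_comm].
      destruct D as [z Hz]. destruct z; [lia|]. nia. }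
    destruct (le_lt_dec x y); [apply H0; auto; lia|]. symmetry; apply H0; auto; lia.
  - rewrite length_map. lia.
  - intros x Hx. apply in_map_iff in Hx. destruct Hx as (y & <- & Hy).
    apply in_seq. split; [lia|]. apply Nat.mod_upper_bound. lia.
Qed.

(** * Additive characters modulo q and Gauss sums *)

Definition ec (q m : nat) : C := cexp (0, 2 * PI * INR m / INR q).

Lemma ec_add q m n : ec q (m + n) = (ec q m * ec q n)%C.
Proof.
  unfold ec. rewrite <- cexp_plus. f_equal. rewrite plus_INR. apply C_ext; simpl; unfold Rdiv; ring.
Qed.

Lemma ec_q q : (1 <= q)%nat -> ec q q = 1%C.
Proof.
  intros Hq. apply le_INR in Hq. simpl in Hq. unfold ec, cexp; simpl.
  replace (2 * PI * INR q / INR q) with (2 * PI) by (field; lra).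
  rewrite exp_0, cos_2PI, sin_2PI. apply C_ext; simpl; ring.
Qed.

Lemma ec_periodic q : (1 <= q)%nat -> periodic q (ec q).
Proof. intros Hq n. rewrite ec_add, ec_q by auto. ring. Qed.

Lemma ec_0 q : ec q 0 = 1%C.
Proof.
  unfold ec, cexp; simpl. unfold Rdiv. rewrite Rmult_0_r, Rmult_0_l, exp_0, cos_0, sin_0.
  apply C_ext; simpl; ring.
Qed.

Lemma ec_conj q m : (1 <= q)%nat -> ec q ((q - 1) * m) = Cconj (ec q m).
Proof.
  intros Hq.
  assert (E : (ec q ((q - 1) * m) * ec q m)%C = 1%C).
  { rewrite <- ec_add. replace ((q - 1) * m + m)%nat with (0 + m * q)%nat by nia.
    rewrite (periodic_mul q (ec q)) by now apply ec_periodic. apply ec_0. }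
  assert (E2 : (ec q m * Cconj (ec q m))%C = 1%C).
  { rewrite <- Cmod2_conj. unfold ec. rewrite Cmod_cexp. simpl. rewrite exp_0. apply C_ext; simpl; ring. }
  transitivity (ec q ((q - 1) * m) * (ec q m * Cconj (ec q m)))%C; [rewrite E2; ring|].
  rewrite Cmult_assoc, E. ring.
Qed.

Lemma ej_ec q n h : (1 <= q)%nat -> ej (Z.of_nat n) (INR h / INR q) = ec q (n * h).
Proof.
  intros Hq. unfold ej, ec, cexp. rewrite <- INR_IZR_INZ, mult_INR. simpl.
  replace (2 * PI * (INR n * INR h) / INR q) with (2 * PI * INR n * (INR h / INR q)) by (unfold Rdiv; ring).
  rewrite exp_0. apply C_ext; simpl; ring.
Qed.

Lemma chi_periodic q chi : is_dirichlet_character q chi -> periodic q chi.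
Proof. intros (_ & H & _). exact H. Qed.

Lemma chi_pow q chi n j : is_dirichlet_character q chi -> chi (n ^ j)%nat = (chi n ^ j)%C.
Proof.
  intros (_ & _ & Hm & H1 & _). induction j as [|j IH]; simpl; [exact H1|]. now rewrite Hm, IH.
Qed.

(** By periodicity chi takes finitely many values, while a value of modulus above 1 would have
    unbounded powers among them. *)
Lemma chi_bound q chi n : is_dirichlet_character q chi -> Cmod (chi n) <= 1.
Proof.
  intros Hchi. assert (Hq : (1 <= q)%nat) by apply Hchi.
  assert (HB : exists B, forall n, Cmod (chi n) <= B).
  { assert (HN : forall N, exists B, forall n, (n < N)%nat -> Cmod (chi n) <= B).
    { induction N as [|N [B IH]]; [exists 0; intros; lia|].
      exists (Rmax B (Cmod (chi N))). intros m Hm.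
      destruct (Nat.eq_dec m N) as [->|]; [apply Rmax_r|].
      eapply Rle_trans; [apply IH; lia|apply Rmax_l]. }
    destruct (HN q) as [B HB]. exists B. intros m.
    rewrite <- (periodic_mod q chi) by (auto; now apply (chi_periodic q)).
    apply HB. apply Nat.mod_upper_bound. lia. }
  destruct HB as [B HB]. apply Rnot_lt_le. intros Hlt.
  destruct (Pow_x_infinity (Cmod (chi n))) with (b := B + 1) as (N & HN).
  { rewrite Rabs_pos_eq; [lra|apply Cmod_ge_0]. }
  specialize (HN N (le_n N)). rewrite Rabs_pos_eq in HN by (apply pow_le, Cmod_ge_0).
  rewrite <- Cmod_pow, <- (chi_pow q) in HN by auto. specialize (HB (n ^ N)%nat). lra.
Qed.

Lemma unit_inverse q n : (1 <= q)%nat -> Nat.gcd n q = 1%nat -> exists m, ((m * n) mod q = 1 mod q)%nat.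
Proof.
  intros Hq Hg. destruct (Nat.eq_dec n 0) as [->|Hn].
  - rewrite Nat.gcd_0_l in Hg. subst. exists O. reflexivity.
  - destruct (Nat.gcd_bezout_pos n q ltac:(lia)) as (u & v & E). rewrite Hg in E.
    exists u. rewrite E. apply Nat.Div0.mod_add.
Qed.

(** The values at n and at an inverse of n modulo q have product 1 and moduli at most 1, so both
    moduli are 1. *)
Lemma chi_unit q chi n : is_dirichlet_character q chi -> Nat.gcd n q = 1%nat ->
  (Cconj (chi n) * chi n)%C = 1%C.
Proof.
  intros Hchi Hg. assert (Hq : (1 <= q)%nat) by apply Hchi.
  destruct (unit_inverse q n Hq Hg) as [m Hm].
  assert (E : (chi m * chi n)%C = 1%C).
  { destruct Hchi as (_ & Hp & Hmul & H1 & _). rewrite <- Hmul, <- H1. now apply (periodic_eqmod q). }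
  assert (B1 := chi_bound q chi m Hchi). assert (B2 := chi_bound q chi n Hchi).
  assert (E' := f_equal Cmod E). rewrite Cmod_mult, Cmod_1 in E'.
  assert (P1 := Cmod_ge_0 (chi m)). assert (P2 := Cmod_ge_0 (chi n)).
  assert (Cmod (chi n) = 1) by nra.
  rewrite Cmult_comm, <- Cmod2_conj, H. apply C_ext; simpl; ring.
Qed.

Lemma q_ne_1 q chi : is_dirichlet_character q chi -> ~ is_principal q chi -> q <> 1%nat.
Proof.
  intros (_ & Hp & _ & H1 & _) Hnp ->. apply Hnp. intros n _.
  rewrite <- H1. apply (periodic_eqmod 1); auto.
Qed.

(** For n prime to q, replace h by n h. Otherwise the right side is 0, and primitivity supplies a
    unit whose multiplication fixes every e(n h / q) but scales the sum by a value of chi other than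
    1. *)
Lemma gauss_sum_separable q chi n : is_dirichlet_character q chi -> is_primitive_char q chi ->
  csum1 q (fun h => chi h * ec q (n * h))%C = (Cconj (chi n) * gauss_sum q chi)%C.
Proof.
  intros Hchi Hprim. assert (Hq : (1 <= q)%nat) by apply Hchi.
  pose proof Hchi as (_ & Hp & Hmul & H1 & Hz).
  destruct (Nat.eq_dec (Nat.gcd n q) 1) as [Hg|Hg].
  - assert (Hper : periodic q (fun h => chi h * ec q h)%C).
    { intros h. rewrite Hp, (ec_periodic q Hq h). reflexivity. }
    assert (E := csum1_mul_unit q n _ Hq Hg Hper). cbv beta in E.
    unfold gauss_sum. fold (ec q).
    change (csum1 q (fun h => chi h * cexp (0%R, (2 * PI * INR h / INR q)%R))%C) with (csum1 q (fun h => chi h * ec q h)%C).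
    rewrite <- E, <- csum1_scal. apply csum1_ext. intros h _. rewrite Hmul.
    transitivity ((Cconj (chi n) * chi n) * (chi h * ec q (n * h)))%C; [|ring].
    rewrite (chi_unit q chi n Hchi Hg). ring.
  - rewrite (proj2 (Hz n) Hg).
    replace (Cconj 0 * gauss_sum q chi)%C with (RtoC 0) by (apply C_ext; simpl; ring).
    set (d := Nat.gcd n q) in *.
    assert (Dn : Nat.divide d n) by apply Nat.gcd_divide_l.
    assert (Dq : Nat.divide d q) by apply Nat.gcd_divide_r.
    destruct Dn as [n' Hn']. destruct Dq as [q' Hq'].
    assert (Hd : (d <> 0)%nat) by (intros E; rewrite E in Hq'; lia).
    (* Here q' = q / d is a proper divisor. As n is a multiple of d, the number e(n h / q) depends
       on h modulo q' only, so a = 1 mod q' leaves it unchanged. *)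
    destruct (Hprim q') as (a & Ha1 & Ha2 & Ha3); [exists d; lia|nia|].
    set (S := csum1 q (fun h => chi h * ec q (n * h))%C).
    assert (Hper : periodic q (fun h => chi h * ec q (n * h))%C).
    { intros h. rewrite Hp, Nat.mul_add_distr_l, (periodic_mul q (ec q)) by now apply ec_periodic. reflexivity. }
    assert (E := csum1_mul_unit q a _ Hq Ha1 Hper). cbv beta in E. fold S in E.
    assert (E2 : csum1 q (fun h => chi (a * h)%nat * ec q (n * (a * h)))%C = (chi a * S)%C).
    { unfold S. rewrite <- csum1_scal. apply csum1_ext. intros h _. rewrite Hmul.
      rewrite (periodic_eqmod q (ec q) (n * (a * h)) (n * h) Hq (ec_periodic q Hq)); [ring|].
      assert (En : (n * (a * h) = d * (n' * (a * h)))%nat) by (rewrite Hn'; ring).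
      assert (En2 : (n * h = d * (n' * h))%nat) by (rewrite Hn'; ring).
      rewrite En, En2, Hq', (Nat.mul_comm q' d), !Nat.Div0.mul_mod_distr_l. f_equal.
      replace (n' * (a * h))%nat with (a * (n' * h))%nat by ring.
      rewrite Nat.Div0.mul_mod, Ha2, <- Nat.Div0.mul_mod. f_equal. ring. }
    rewrite E2 in E.
    assert (E3 : ((chi a - 1) * S)%C = 0%C) by (replace ((chi a - 1) * S)%C with (chi a * S - S)%C by ring; rewrite E; ring).
    destruct (Ceq_dec S 0%C) as [|HS]; auto. exfalso. apply Ha3.
    transitivity ((chi a - 1) * S / S + 1)%C; [field; exact HS|]. rewrite E3. field. exact HS.
Qed.

(** Conjugating e(n h / q) replaces n by (q - 1) n, and evenness says chi(q - 1) = 1. *)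
Lemma gauss_sum_separable_conj q chi n : is_dirichlet_character q chi -> is_primitive_char q chi -> is_even_char q chi ->
  csum1 q (fun h => chi h * Cconj (ec q (n * h)))%C = (Cconj (chi n) * gauss_sum q chi)%C.
Proof.
  intros Hchi Hprim Hev. assert (Hq : (1 <= q)%nat) by apply Hchi.
  transitivity (csum1 q (fun h => chi h * ec q ((q - 1) * n * h))%C).
  - apply csum1_ext. intros h _. rewrite <- Nat.mul_assoc, ec_conj by auto. reflexivity.
  - rewrite (gauss_sum_separable q chi); auto. destruct Hchi as (_ & _ & Hmul & _). rewrite Hmul.
    unfold is_even_char in Hev. rewrite Hev. f_equal. f_equal. ring.
Qed.

(** Separability at n = 0, where chi 0 = 0 because q is not 1. *)
Lemma chi_sum_zero q chi : is_dirichlet_character q chi -> is_primitive_char q chi -> ~ is_principal q chi ->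
  csum1 q chi = 0%C.
Proof.
  intros Hchi Hprim Hnp.
  assert (E := gauss_sum_separable q chi 0 Hchi Hprim).
  assert (Hq := q_ne_1 q chi Hchi Hnp).
  destruct Hchi as (H1q & _ & _ & _ & Hz).
  rewrite (proj2 (Hz O)) in E by (rewrite Nat.gcd_0_l; exact Hq).
  transitivity (csum1 q (fun h => chi h * ec q (0 * h))%C).
  - apply csum1_ext. intros h _. simpl. rewrite ec_0. ring.
  - rewrite E. apply C_ext; simpl; ring.
Qed.

(** * The twisted theta transformation *)

Definition Clim (u : nat -> C) (l : C) : Prop :=
  is_lim_seq (fun N => Re (u N)) (Re l) /\ is_lim_seq (fun N => Im (u N)) (Im l).

Lemma Clim_ext u v l : (forall n, u n = v n) -> Clim u l -> Clim v l.
Proof.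
  intros E [H1 H2]. split; (eapply is_lim_seq_ext; [|eassumption]); intros n; simpl; now rewrite E.
Qed.

Lemma csum1_sum_n (f : nat -> C) N :
  sum_n (fun n => Re (f (S n))) N = Re (csum1 (S N) f) /\ sum_n (fun n => Im (f (S n))) N = Im (csum1 (S N) f).
Proof.
  induction N as [|N [IH1 IH2]].
  - rewrite !sum_O. simpl. unfold Re, Im. split; ring.
  - rewrite !sum_Sn, IH1, IH2. split; reflexivity.
Qed.

Lemma csums_Clim (f : nat -> C) l : csums (fun n => f (S n)) l <-> Clim (fun N => csum1 N f) l.
Proof.
  assert (E1 : forall N, sum_n (fun n => Re (f (S n))) N = Re (csum1 (S N) f)) by (intros; apply csum1_sum_n).
  assert (E2 : forall N, sum_n (fun n => Im (f (S n))) N = Im (csum1 (S N) f)) by (intros; apply csum1_sum_n).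
  split; intros [H1 H2]; split.
  - apply is_lim_seq_incr_1. apply (is_lim_seq_ext _ _ _ E1). exact H1.
  - apply is_lim_seq_incr_1. apply (is_lim_seq_ext _ _ _ E2). exact H2.
  - apply is_lim_seq_incr_1 in H1. change (is_lim_seq (sum_n (fun n => Re (f (S n)))) (Re l)).
    eapply is_lim_seq_ext; [|exact H1]. intros; simpl; now rewrite E1.
  - apply is_lim_seq_incr_1 in H2. change (is_lim_seq (sum_n (fun n => Im (f (S n)))) (Im l)).
    eapply is_lim_seq_ext; [|exact H2]. intros; simpl; now rewrite E2.
Qed.

Lemma csum1_add M q f : csum1 (M + q) f = (csum1 M f + csum1 q (fun h => f (M + h)%nat))%C.
Proof.
  induction q as [|q IH]; simpl.
  - rewrite Nat.add_0_r. ring.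
  - rewrite Nat.add_succ_r. simpl. rewrite IH, <- Nat.add_succ_r. ring.
Qed.

Lemma csum1_blocks q N f : csum1 (q * N) f = csum1 N (fun j => csum1 q (fun h => f (q * (j - 1) + h)%nat)).
Proof.
  induction N as [|N IH].
  - rewrite Nat.mul_0_r. reflexivity.
  - replace (q * S N)%nat with (q * N + q)%nat by lia. rewrite csum1_add, IH. simpl.
    rewrite Nat.sub_0_r. reflexivity.
Qed.

Lemma Clim_subseq u l q : (1 <= q)%nat -> Clim u l -> Clim (fun N => u (q * N)%nat) l.
Proof.
  intros Hq [H1 H2].
  assert (Hf : filterlim (fun N => (q * N)%nat) eventually eventually).
  { apply eventually_subseq. intros n. nia. }
  split; [apply (is_lim_seq_subseq (fun N => Re (u N))) with (1 := Hf) in H1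
         |apply (is_lim_seq_subseq (fun N => Im (u N))) with (1 := Hf) in H2]; auto.
Qed.

Lemma csums_blocks q (f : nat -> C) l : (1 <= q)%nat -> csums (fun n => f (S n)) l ->
  csums (fun j => csum1 q (fun h => f (q * j + h)%nat)) l.
Proof.
  intros Hq H. apply csums_Clim in H. apply (Clim_subseq _ _ q Hq) in H.
  apply (csums_ext (fun j => csum1 q (fun h => f (q * (S j - 1) + h)%nat))).
  { intros j. apply csum1_ext. intros h _. f_equal. lia. }
  apply (csums_Clim (fun j => csum1 q (fun h => f (q * (j - 1) + h)%nat))).
  eapply Clim_ext; [|exact H]. intros N. apply csum1_blocks.
Qed.

Lemma csums_csum1 q (a : nat -> nat -> C) (l : nat -> C) :
  (forall h, (1 <= h <= q)%nat -> csums (a h) (l h)) -> csums (fun n => csum1 q (fun h => a h n)) (csum1 q l).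
Proof.
  induction q as [|q IH]; intros H; simpl.
  - apply csums_zero.
  - apply csums_plus; [apply IH; intros; apply H; lia|apply H; lia].
Qed.

Lemma csums_residues q (f : nat -> C) l (X : nat -> C) : (1 <= q)%nat -> csums (fun n => f (S n)) l ->
  (forall h, (1 <= h <= q)%nat -> csums (fun d => f (q * d + h)%nat) (X h)) -> l = csum1 q X.
Proof.
  intros Hq H HX. eapply csums_unique; [apply (csums_blocks q f l Hq H)|].
  now apply csums_csum1.
Qed.

Definition theta_term (chi : nat -> C) (k : nat) (t : R) (n : nat) : C :=
  (chi (S n) * RtoC (INR (S n) ^ k * exp (- (INR (S n) * t))))%C.

Definition rr (q k : nat) (t : R) (n : nat) : R :=
  Re (/ (t, (2 * PI * INR (S n) / INR q)%R) ^ S k)%C.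

Definition dual_term (q : nat) (chi : nat -> C) (k : nat) (t : R) (n : nat) : C :=
  (Cconj (chi (S n)) * RtoC (rr q k t n))%C.

Lemma pow_exp_term_bound k t n : 0 < t ->
  INR (S n) ^ k * exp (- (INR (S n) * t)) <= INR (fact (k + 2)) / t ^ (k + 2) * / INR (S n) ^ 2.
Proof.
  intros Ht. assert (Hn := INR_S_pos n). set (p := INR (S n)) in *. clearbody p.
  eapply Rle_trans; [apply Rmult_le_compat_l; [apply pow_le; lra|apply (exp_neg_le (k + 2)); nra]|].
  right. rewrite Rpow_mult_distr, !pow_add. field. repeat split; try apply pow_nonzero; lra.
Qed.

Lemma Cmod_theta_term q chi k t n : is_dirichlet_character q chi -> 0 < t ->
  Cmod (theta_term chi k t n) <= INR (S n) ^ k * exp (- (INR (S n) * t)).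
Proof.
  intros Hchi Ht. unfold theta_term. rewrite Cmod_mult, Cmod_R.
  assert (B := chi_bound q chi (S n) Hchi). assert (B0 := Cmod_ge_0 (chi (S n))).
  assert (P : 0 <= INR (S n) ^ k * exp (- (INR (S n) * t))).
  { apply Rmult_le_pos; [apply pow_le, pos_INR|left; apply exp_pos]. }
  rewrite Rabs_pos_eq by auto. nra.
Qed.

Lemma rr_bound q k t n : (1 <= q)%nat -> (1 <= k)%nat -> 0 < t -> Rabs (rr q k t n) <= INR q ^ S k * / INR (S n) ^ 2.
Proof.
  intros Hq Hk Ht. assert (HQ : 0 < INR q) by (apply lt_0_INR; lia).
  unfold rr. eapply Rle_trans; [apply re_le_Cmod|].
  assert (Hn := INR_S_pos n).
  assert (H1 : 1 <= INR (S n)) by (rewrite S_INR; pose proof (pos_INR n); lra).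
  assert (HP := PI2_1).
  eapply Rle_trans; [apply (Cmod_inv_pow_le _ _ (INR (S n) / INR q))|].
  - split; [apply Rdiv_lt_0_compat; lra|]. eapply Rle_trans; [|apply Im_le_Cmod].
    change (INR (S n) / INR q <= Rabs (2 * PI * INR (S n) / INR q)).
    rewrite Rabs_pos_eq by (apply Rdiv_le_0_compat; nra).
    apply Rmult_le_compat_r; [left; now apply Rinv_0_lt_compat|nra].
  - unfold Rdiv. rewrite Rpow_mult_distr, Rinv_mult, pow_inv, Rinv_inv, Rmult_comm.
    apply Rmult_le_compat_l; [apply pow_le; lra|].
    apply Rinv_le_contravar; [apply pow_lt; lra|]. apply Rle_pow; auto. lia.
Qed.

Lemma dual_term_bound q chi k t n : is_dirichlet_character q chi -> (1 <= k)%nat -> 0 < t ->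
  Cmod (dual_term q chi k t n) <= INR q ^ S k * / INR (S n) ^ 2.
Proof.
  intros Hchi Hk Ht. unfold dual_term. rewrite Cmod_mult, Cmod_conj, Cmod_R.
  assert (B := chi_bound q chi (S n) Hchi). assert (B0 := Cmod_ge_0 (chi (S n))).
  assert (Br := rr_bound q k t n (proj1 Hchi) Hk Ht).
  pose proof (Rabs_pos (rr q k t n)). nra.
Qed.

(** The theta series is split into residues h modulo q, each a Lipschitz sum with shift h/q and
    parameter q t. On the dual side the sum over h becomes a Gauss sum, which extracts conj(chi
    n). *)
Lemma theta_transform q chi k t : is_dirichlet_character q chi -> ~ is_principal q chi ->
  is_even_char q chi -> is_primitive_char q chi -> (1 <= k)%nat -> 0 < t ->
  exists G, csums (dual_term q chi k t) G /\
    csums (theta_term chi k t) (RtoC (2 * INR (fact k) / INR q) * gauss_sum q chi * G)%C.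
Proof.
  intros Hchi Hnp Hev Hprim Hk Ht.
  assert (Hq : (1 <= q)%nat) by apply Hchi.
  assert (HQ : 0 < INR q) by (apply lt_0_INR; lia).
  assert (Hqt : 0 < INR q * t) by nra.
  set (tau := gauss_sum q chi).
  assert (Hth : forall h, (1 <= h <= q)%nat -> 0 <= INR h / INR q <= 1).
  { intros h [H1 H2]. apply le_INR in H1, H2. simpl in H1. split.
    - apply Rdiv_le_0_compat; lra.
    - apply (Rmult_le_reg_r (INR q)); auto. field_simplify; lra. }
  set (X := fun h => Series (lip_term k (INR q * t) (INR h / INR q))).
  assert (HA : csums (fun n => csum1 q (fun h => chi h * RtoC (lip_dual k (INR q * t) (INR h / INR q) n)))%C
     (csum1 q (fun h => chi h * RtoC (X h / INR (fact k) - / (INR q * t) ^ S k))%C)).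
  { apply (csums_csum1 q (fun h n => chi h * RtoC (lip_dual k (INR q * t) (INR h / INR q) n))%C
       (fun h => chi h * RtoC (X h / INR (fact k) - / (INR q * t) ^ S k))%C).
    intros h Hh. apply csums_real. apply lipschitz_formula; auto. }
  (* The zero frequency is the same for all residues and dies because chi sums to 0 over a
     period. *)
  assert (EA : csum1 q (fun h => chi h * RtoC (X h / INR (fact k) - / (INR q * t) ^ S k))%C
      = (RtoC (/ INR (fact k)) * csum1 q (fun h => chi h * RtoC (X h)))%C).
  { transitivity (RtoC (/ INR (fact k)) * csum1 q (fun h => chi h * RtoC (X h)) + (- RtoC (/ (INR q * t) ^ S k)) * csum1 q chi)%C.
    - rewrite <- !csum1_scal, <- csum1_plus. apply csum1_ext. intros h _.
      unfold Rminus, Rdiv. rewrite RtoC_plus, RtoC_opp, RtoC_mult. ring.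
    - rewrite (chi_sum_zero q chi) by auto. ring. }
  rewrite EA in HA.
  set (W := csum1 q (fun h => chi h * RtoC (X h))%C) in *.
  (* The frequencies n + 1 and -(n + 1) carry the same factor conj(chi) tau since chi is even, so
     their coefficients add up to twice a real part. *)
  assert (Hterm : forall n, csum1 q (fun h => chi h * RtoC (lip_dual k (INR q * t) (INR h / INR q) n))%C
     = (RtoC (2 * / INR q ^ S k) * tau * dual_term q chi k t n)%C).
  { intros n. set (w := lip_freq k (INR q * t) (Z.of_nat (S n))).
    transitivity (w * csum1 q (fun h => chi h * ec q (S n * h)) + Cconj w * csum1 q (fun h => chi h * Cconj (ec q (S n * h))))%C.
    - rewrite <- !csum1_scal, <- csum1_plus. apply csum1_ext. intros h _.
      unfold lip_dual. fold w. rewrite (ej_ec q (S n) h Hq).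
      destruct (ec q (S n * h)) as [e1 e2], w as [w1 w2], (chi h) as [c1 c2]. apply C_ext; simpl; ring.
    - rewrite gauss_sum_separable, gauss_sum_separable_conj by auto. fold tau.
      unfold dual_term, rr.
      assert (Ew : w = (RtoC (/ INR q ^ S k) * / (t, (2 * PI * INR (S n) / INR q)%R) ^ S k)%C).
      { unfold w, lip_freq. rewrite <- INR_IZR_INZ.
        replace (INR q * t, (2 * PI * INR (S n))%R) with (RtoC (INR q) * (t, (2 * PI * INR (S n) / INR q)%R))%C.
        2:{ apply C_ext; unfold RtoC; cbn [Re Im fst snd Cmult]; field; lra. }
        rewrite Cpow_mult_l, <- RtoC_pow, RtoC_inv by (apply pow_nonzero; lra).
        assert (N1 : ((t, (2 * PI * INR (S n) / INR q)%R) ^ S k)%C <> 0%C) by (apply Cpow_nz, freq_neq_0; auto).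
        assert (N2 : RtoC (INR q ^ S k) <> 0%C).
        { intros E. apply RtoC_inj in E. revert E. apply pow_nonzero. lra. }
        revert N1 N2. generalize ((t, (2 * PI * INR (S n) / INR q)%R) ^ S k)%C (RtoC (INR q ^ S k)).
        intros u v Hu Hv. field. split; auto. }
      rewrite Ew. generalize (/ (t, (2 * PI * INR (S n) / INR q)%R) ^ S k)%C. intros u.
      rewrite RtoC_mult. generalize (/ INR q ^ S k); intros v.
      destruct u as [u1 u2], (chi (S n)) as [c1 c2], tau as [t1 t2]. apply C_ext; simpl; ring. }
  assert (HA2 : csums (fun n => RtoC (2 * / INR q ^ S k) * tau * dual_term q chi k t n)%C (RtoC (/ INR (fact k)) * W)%C).
  { eapply csums_ext; [|exact HA]. exact Hterm. }
  destruct (csums_dom_exists (dual_term q chi k t) (fun n => (INR q) ^ S k * / INR (S n) ^ 2)) as [G HG].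
  { intros n. now apply dual_term_bound. }
  { apply (ex_series_scal (V:=R_NormedModule) (INR q ^ S k)), ex_series_inv_pow. lia. }
  exists G. split; auto.
  assert (EW : (RtoC (/ INR (fact k)) * W)%C = (RtoC (2 * / INR q ^ S k) * tau * G)%C).
  { eapply csums_unique; [exact HA2|]. now apply csums_scal. }
  set (f := fun n => (chi n * RtoC (INR n ^ k * exp (- (INR n * t))))%C).
  destruct (csums_dom_exists (theta_term chi k t) (fun n => INR (fact (k + 2)) / t ^ (k + 2) * / INR (S n) ^ 2)) as [Y HY].
  { intros n. eapply Rle_trans; [apply (Cmod_theta_term q); auto|]. now apply pow_exp_term_bound. }
  { apply (ex_series_scal (V:=R_NormedModule) (INR (fact (k + 2)) / t ^ (k + 2))), ex_series_inv_pow. lia. }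
  assert (EY : Y = csum1 q (fun h => (chi h * RtoC (INR q ^ k)) * RtoC (X h))%C).
  { apply (csums_residues q f); auto. intros h Hh.
    eapply csums_ext; [|apply (csums_real (lip_term k (INR q * t) (INR h / INR q)) (chi h * RtoC (INR q ^ k))%C (X h))].
    - intros d. unfold f. rewrite <- Cmult_assoc, <- RtoC_mult. f_equal.
      + symmetry. rewrite (Nat.mul_comm q d), Nat.add_comm. apply periodic_mul. now apply chi_periodic.
      + f_equal. unfold lip_term. rewrite plus_INR, mult_INR, <- Rmult_assoc, <- Rpow_mult_distr.
        f_equal; [f_equal; field; lra|]. f_equal. field. lra.
    - apply Series_correct. apply (series_dom_exists _ (fun d => INR (S d) ^ k * exp (- (INR d * (INR q * t))))).
      + intros d. apply lip_term_bound; auto.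
      + now apply ex_series_pow_exp. }
  replace (RtoC (2 * INR (fact k) / INR q) * tau * G)%C with Y; [exact HY|].
  assert (Hf0 : INR (fact k) <> 0) by apply INR_fact_neq_0.
  rewrite EY. transitivity (RtoC (INR q ^ k) * W)%C.
  { unfold W. rewrite <- csum1_scal. apply csum1_ext. intros; ring. }
  transitivity (RtoC (INR q ^ k * INR (fact k)) * (RtoC (/ INR (fact k)) * W))%C.
  { rewrite Cmult_assoc, <- RtoC_mult. f_equal. f_equal. field. exact Hf0. }
  rewrite EW, !Cmult_assoc, <- RtoC_mult. f_equal. f_equal. f_equal.
  rewrite <- tech_pow_Rmult. field. split; try apply pow_nonzero; lra.
Qed.

Lemma exp_m1_small_tail k : exists T, 0 < T /\ forall l,
  is_series (fun n => INR (S (S n)) ^ k * exp (- (INR (S n) * T))) l -> l < 1.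
Proof.
  set (K := 2 ^ k * INR (fact (k + 2)) * Series (fun n => / INR (S n) ^ 2)).
  assert (HK : 0 <= K).
  { unfold K. apply Rmult_le_pos; [apply Rmult_le_pos; [apply pow_le; lra|apply pos_INR]|].
    assert (Hp : forall n, 0 <= / INR (S n) ^ 2) by (intros; left; apply Rinv_0_lt_compat, pow_lt, INR_S_pos).
    eapply Rle_trans; [apply (Hp O)|].
    rewrite <- (sum_O (fun n => / INR (S n) ^ 2)). apply is_series_partial_le; auto.
    apply ex_series_inv_pow. lia. }
  (* The tail is at most K / T^(k+2), and T = K + 2 is at least 1, so this is at most K / T < 1. *)
  exists (K + 2). split; [lra|]. intros l Hl.
  set (T := K + 2) in *.
  assert (HT : 1 <= T) by (unfold T; lra).
  set (c := 2 ^ k * INR (fact (k + 2)) / T ^ (k + 2)).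
  assert (H2 := is_series_scal (V:=R_NormedModule) c _ _ (Series_correct _ (ex_series_inv_pow 2 (le_n 2)))).
  assert (Hle : l <= c * Series (fun n => / INR (S n) ^ 2)).
  { rewrite <- (is_series_unique _ _ Hl), <- Series_scal_l.
    apply Series_le; [|eexists; exact H2]. intros n. split.
    - apply Rmult_le_pos; [apply pow_le, pos_INR|left; apply exp_pos].
    - assert (Hn := INR_S_pos n). apply Rle_trans with (2 ^ k * (INR (S n) ^ k * exp (- (INR (S n) * T)))).
      + rewrite <- Rmult_assoc, <- Rpow_mult_distr. apply Rmult_le_compat_r; [left; apply exp_pos|].
        apply pow_incr. split; [apply pos_INR|]. rewrite (S_INR (S n)), S_INR. pose proof (pos_INR n). lra.
      + unfold c. replace (2 ^ k * INR (fact (k + 2)) / T ^ (k + 2) * / INR (S n) ^ 2) with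
          (2 ^ k * (INR (fact (k + 2)) / T ^ (k + 2) * / INR (S n) ^ 2)) by (unfold Rdiv; ring).
        apply Rmult_le_compat_l; [apply pow_le; lra|]. apply pow_exp_term_bound. lra. }
  assert (Hp : T <= T ^ (k + 2)).
  { rewrite <- (pow_1 T) at 1. apply Rle_pow; auto. lia. }
  eapply Rle_lt_trans; [apply Hle|].
  replace (c * Series (fun n => / INR (S n) ^ 2)) with (K / T ^ (k + 2)) by (unfold c, K, Rdiv; ring).
  apply (Rmult_lt_reg_r (T ^ (k + 2))); [lra|]. 
  replace (K / T ^ (k + 2) * T ^ (k + 2)) with K by (field; apply pow_nonzero; lra). unfold T in *; lra.
Qed.

(** If tau vanished, [theta_transform] would make the theta series zero for every t, but for large t
    its first term outweighs all the others. *)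
Lemma gauss_sum_neq_0 q chi : is_dirichlet_character q chi -> ~ is_principal q chi ->
  is_even_char q chi -> is_primitive_char q chi -> gauss_sum q chi <> 0%C.
Proof.
  intros Hchi Hnp Hev Hprim E.
  destruct (exp_m1_small_tail 1) as (T & HT & Htail).
  destruct (theta_transform q chi 1 T) as (G & _ & HS); auto.
  rewrite E in HS. replace (RtoC (2 * INR (fact 1) / INR q) * 0 * G)%C with (RtoC 0) in HS by ring.
  destruct HS as [HS _].
  destruct Hchi as (Hq & Hp & Hm & H1 & Hz). pose proof (conj Hq (conj Hp (conj Hm (conj H1 Hz)))) as Hchi.
  assert (Hs2 := is_series_scal (V:=R_NormedModule) (exp T) _ _ HS).
  (* After multiplication by e^T the first term is 1, so the remaining ones would have to sum to
     -1. *)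
  set (b := fun n => exp T * Re (theta_term chi 1 T n)).
  set (a := fun n => b (S n)).
  assert (Hb0 : b O = 1).
  { unfold b, theta_term. rewrite H1.
    replace (INR 1 ^ 1 * exp (- (INR 1 * T))) with (exp (- T)) by (simpl; rewrite !Rmult_1_l; reflexivity).
    simpl. replace (exp T * (1 * exp (- T) - 0 * 0)) with (exp T * exp (- T)) by ring.
    rewrite <- exp_plus, Rplus_opp_r. apply exp_0. }
  assert (Ha : is_series a (- 1)).
  { apply (is_series_incr_1 (V:=R_NormedModule) b (-1)).
    change (plus (-1) (b O)) with (-1 + b O). rewrite Hb0. replace (-1 + 1) with (exp T * 0) by ring. exact Hs2. }
  assert (Hb : forall n, Rabs (a n) <= INR (S (S n)) ^ 1 * exp (- (INR (S n) * T))).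
  { intros n. unfold a, b. rewrite Rabs_mult, (Rabs_pos_eq (exp T)) by (left; apply exp_pos).
    replace (- (INR (S n) * T)) with (T + - (INR (S (S n)) * T)) by (rewrite (S_INR (S n)); ring).
    rewrite exp_plus. rewrite <- Rmult_assoc, (Rmult_comm _ (exp T)), Rmult_assoc.
    apply Rmult_le_compat_l; [left; apply exp_pos|].
    eapply Rle_trans; [apply re_le_Cmod|]. now apply (Cmod_theta_term q). }
  assert (Hex : ex_series (fun n => INR (S (S n)) ^ 1 * exp (- (INR (S n) * T)))).
  { assert (Hx := ex_series_pow_exp 1 T HT). now apply ex_series_incr_1 in Hx. }
  assert (Hl := Htail _ (Series_correct _ Hex)).
  assert (Hr : Rabs (-1) <= Series (fun n => INR (S (S n)) ^ 1 * exp (- (INR (S n) * T)))).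
  { rewrite <- (is_series_unique _ _ Ha).
    eapply Rle_trans; [apply Series_Rabs|].
    - apply (ex_series_le (V:=R_CompleteNormedModule) _ (fun n => INR (S (S n)) ^ 1 * exp (- (INR (S n) * T)))); auto.
      intros n. change (Rabs (Rabs (a n)) <= INR (S (S n)) ^ 1 * exp (- (INR (S n) * T))).
      rewrite Rabs_Rabsolu. apply Hb.
    - apply Series_le; auto. intros n; split; [apply Rabs_pos|apply Hb]. }
  rewrite Rabs_left in Hr by lra. lra.
Qed.

(** * Mellin transforms and the L-function *)

(** A total functional, so that Mellin transforms are functions of z without side conditions;
    wherever [isI] holds it returns the integral. *)
Definition II (f : R -> R) : R := real (Lim_seq (fun n => RInt f (- INR n) (INR n))).

Lemma isI_II f l : isI f l -> II f = l.
Proof.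
  intros [_ H]. unfold II. rewrite (is_lim_seq_unique _ l); auto.
  apply is_lim_seq_spec. intros eps.
  destruct (H (eps / 2)) as [M HM]. { pose proof (cond_pos eps); lra. }
  destruct (nfloor_ex (Rmax M 0)) as [N HN]; [apply Rmax_r|].
  exists (S N). intros n Hn. apply le_INR in Hn. rewrite S_INR in Hn.
  pose proof (Rmax_l M 0). pose proof (cond_pos eps).
  eapply Rle_lt_trans; [apply HM; lra|lra].
Qed.

Definition CII (f : R -> C) : C := (II (fun x => Re (f x)), II (fun x => Im (f x))).

Lemma CI_CII f l : CI isI f l -> CII f = l.
Proof. intros [H1 H2]. apply C_ext; simpl; now apply isI_II. Qed.

Lemma CI_unique f l m : CI isI f l -> CI isI f m -> l = m.
Proof. intros H1 H2. apply CI_CII in H1, H2. congruence. Qed.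

Lemma CI_exists (f : R -> C) B d : 0 < d -> (forall x, Ccont f x) -> (forall x, Cmod (f x) <= B * env d x) ->
  CI isI f (CII f).
Proof.
  intros Hd Hc HB.
  destruct (isI_exists (fun x => Re (f x)) B d) as [l1 H1]; auto.
  { intros x; exact (proj1 (Hc x)). }
  { intros x. eapply Rle_trans; [apply re_le_Cmod|apply HB]. }
  destruct (isI_exists (fun x => Im (f x)) B d) as [l2 H2]; auto.
  { intros x; exact (proj2 (Hc x)). }
  { intros x. eapply Rle_trans; [apply Im_le_Cmod|apply HB]. }
  assert (H : CI isI f (l1, l2)) by now split.
  rewrite (CI_CII _ _ H). exact H.
Qed.

Lemma Ccont_mult f g x : Ccont f x -> Ccont g x -> Ccont (fun t => f t * g t)%C x.
Proof.
  intros [H1 H2] [H3 H4]. split.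
  - apply (continuous_minus (V:=R_NormedModule) (fun t => Re (f t) * Re (g t)) (fun t => Im (f t) * Im (g t)));
      now apply continuous_mult_R.
  - apply (continuous_plus_R (fun t => Re (f t) * Im (g t)) (fun t => Im (f t) * Re (g t)));
      now apply continuous_mult_R.
Qed.

Lemma Ccont_const c x : Ccont (fun _ => c) x.
Proof. split; apply continuous_const. Qed.

Lemma Ccont_real (f : R -> R) x : continuous f x -> Ccont (fun t => RtoC (f t)) x.
Proof. intros H; split; simpl; [exact H|apply continuous_const]. Qed.

Lemma Ccont_pow f n x : Ccont f x -> Ccont (fun t => f t ^ n)%C x.
Proof.
  intros H. induction n as [|n IH]; simpl; [apply Ccont_const|now apply Ccont_mult].
Qed.

Lemma Ccont_cexp (z : C) x : Ccont (fun X => cexp (z * RtoC X)) x.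
Proof.
  destruct z as [a b]. split; unfold cexp; simpl; apply continuous_of_derivable; auto_derive; trivial.
Qed.

Lemma Ccont_plus f g x : Ccont f x -> Ccont g x -> Ccont (fun t => f t + g t)%C x.
Proof. intros [H1 H2] [H3 H4]. split; simpl; now apply continuous_plus_R. Qed.

Lemma env_two (g B1 B2 d x : R) : g <= B1 * exp (d * x) -> g <= B2 * exp (- (d * x)) ->
  0 <= B1 -> 0 <= B2 -> g <= (B1 + B2) * env d x.
Proof.
  intros H1 H2 P1 P2. unfold env. destruct (Rle_dec 0 x) as [Hx|Hx].
  - rewrite Rabs_pos_eq by lra. assert (P := exp_pos (- (d * x))). nra.
  - rewrite Rabs_left by lra. replace (- (d * - x)) with (d * x) by ring.
    assert (P := exp_pos (d * x)). nra.
Qed.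

Lemma abs_exp_bound (d x : R) j : 0 < d -> Rabs x ^ j <= INR (fact j) / d ^ j * exp (d * Rabs x).
Proof.
  intros Hd. assert (H := pow_exp_le j (d * Rabs x)).
  assert (A := Rabs_pos x). specialize (H ltac:(nra)). rewrite Rpow_mult_distr in H.
  assert (P := pow_lt d j Hd).
  apply (Rmult_le_reg_l (d ^ j)); auto.
  replace (d ^ j * (INR (fact j) / d ^ j * exp (d * Rabs x))) with (INR (fact j) * exp (d * Rabs x)) by (field; lra).
  exact H.
Qed.

(** N = 0 gives boundedness at -oo, and large N beats any e^(z X) at +oo. This is what a Mellin
    transform on all of Re z > 0 requires. *)
Definition rapid (phi : R -> C) : Prop :=
  (forall x, Ccont phi x) /\
  forall N : nat, exists B, 0 <= B /\ forall x, Cmod (phi x) <= B * exp (- (INR N * x)).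

(** In the variable t = e^X this is the integral of phi t^(z-1) dt; [mellin'] has the extra factor
    ln t = X. *)
Definition mellin (phi : R -> C) (z : C) : C := CII (fun X => phi X * cexp (z * RtoC X))%C.

Definition mellin' (phi : R -> C) (z : C) : C := CII (fun X => phi X * cexp (z * RtoC X) * RtoC X)%C.

Lemma Cmod_cexp_real (z : C) X : Cmod (cexp (z * RtoC X)) = exp (Re z * X).
Proof. rewrite Cmod_cexp. f_equal. destruct z; simpl; ring. Qed.

Lemma rapid_env phi (z : C) : rapid phi -> 0 < Re z -> exists B d, 0 < d /\ 0 <= B /\
  forall X, Cmod (phi X * cexp (z * RtoC X))%C <= B * env d X.
Proof.
  intros [_ Hb] Hz. destruct (Hb O) as (B0 & P0 & H0).
  destruct (nfloor_ex (2 * Re z)) as [N HN]; [lra|].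
  destruct (Hb (S N)) as (B1 & P1 & H1).
  exists (B0 + B1), (Re z). split; auto. split; [lra|]. intros X.
  rewrite Cmod_mult, Cmod_cexp_real.
  assert (PX := exp_pos (Re z * X)).
  specialize (H0 X). rewrite Rmult_0_l, Ropp_0, exp_0, Rmult_1_r in H0.
  assert (Q1 : Cmod (phi X) * exp (Re z * X) <= B0 * exp (Re z * X)) by nra.
  assert (PB := Cmod_ge_0 (phi X)).
  destruct (Rle_dec 0 X) as [Hx|Hx].
  - unfold env. rewrite Rabs_pos_eq by auto.
    specialize (H1 X). rewrite S_INR in H1.
    apply Rle_trans with (B1 * exp (- (Re z * X))).
    + apply Rle_trans with (B1 * exp (- ((INR N + 1) * X)) * exp (Re z * X)).
      * apply Rmult_le_compat_r; lra.
      * rewrite Rmult_assoc, <- exp_plus. apply Rmult_le_compat_l; auto. apply exp_le. nra.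
    + assert (P := exp_pos (- (Re z * X))). nra.
  - unfold env. rewrite Rabs_left by lra. replace (- (Re z * - X)) with (Re z * X) by ring. nra.
Qed.

Lemma mellin_correct phi z : rapid phi -> 0 < Re z ->
  CI isI (fun X => phi X * cexp (z * RtoC X))%C (mellin phi z).
Proof.
  intros Hphi Hz. destruct (rapid_env phi z Hphi Hz) as (B & d & Hd & HB & H).
  apply (CI_exists _ B d); auto. intros x. apply Ccont_mult; [apply Hphi|apply Ccont_cexp].
Qed.

Lemma env_half d x : env (d / 2) x * env (d / 2) x = env d x.
Proof. unfold env. rewrite <- exp_plus. f_equal. field. Qed.

Lemma mellin'_correct phi z : rapid phi -> 0 < Re z ->
  CI isI (fun X => phi X * cexp (z * RtoC X) * RtoC X)%C (mellin' phi z).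
Proof.
  intros Hphi Hz. destruct (rapid_env phi z Hphi Hz) as (B & d & Hd & HB & H).
  apply (CI_exists _ (B * (2 / d)) (d / 2)); [lra| |].
  - intros x. apply Ccont_mult; [apply Ccont_mult; [apply Hphi|apply Ccont_cexp]|].
    apply Ccont_real. apply continuous_id.
  - intros x. rewrite Cmod_mult, Cmod_R.
    assert (H1 := abs_exp_bound (d / 2) x 1 ltac:(lra)). rewrite pow_1 in H1. simpl fact in H1. simpl INR in H1.
    apply Rle_trans with (B * env d x * (1 / (d / 2) ^ 1 * exp (d / 2 * Rabs x))).
    + apply Rmult_le_compat; [apply Cmod_ge_0|apply Rabs_pos|apply H|exact H1].
    + right. rewrite <- env_half. unfold env at 2. 
      replace (B * (env (d / 2) x * exp (- (d / 2 * Rabs x))) * (1 / (d / 2) ^ 1 * exp (d / 2 * Rabs x))) with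
        (B * env (d / 2) x * (2 / d) * (exp (- (d / 2 * Rabs x)) * exp (d / 2 * Rabs x))) by (field; lra).
      rewrite <- exp_plus, Rplus_opp_l, exp_0. ring.
Qed.

(** Differentiation under the integral by the second-order bound on e^(h X) - 1 - h X. Of the decay
    rate d, one quarter absorbs X^2, another one e^(|h X|), and the remaining half keeps the
    integral finite. *)
Lemma mellin_diff phi z : rapid phi -> 0 < Re z -> Cdiff (mellin phi) z (mellin' phi z).
Proof.
  intros Hphi Hz. destruct (rapid_env phi z Hphi Hz) as (B & d & Hd & HB & H).
  set (K := 5 * B * (INR (fact 2) / (d / 4) ^ 2)).
  assert (HK : 0 <= K).
  { unfold K. apply Rmult_le_pos; [lra|]. apply Rdiv_le_0_compat; [apply pos_INR|apply pow_lt; lra]. }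
  set (K2 := 2 * (2 / (d / 2) * K)).
  assert (HK2 : 0 <= K2).
  { unfold K2. assert (0 < 2 / (d / 2)) by (apply Rdiv_lt_0_compat; lra). nra. }
  intros eps Heps.
  exists (Rmin (Rmin (d / 4) (Re z)) (eps / (K2 + 1))). split.
  - repeat apply Rmin_glb_lt; try lra. apply Rdiv_lt_0_compat; lra.
  - intros w Hw.
    assert (Hw1 : Cmod (w - z) < d / 4) by (eapply Rlt_le_trans; [apply Hw|eapply Rle_trans; [apply Rmin_l|apply Rmin_l]]).
    assert (Hw2 : Cmod (w - z) < Re z) by (eapply Rlt_le_trans; [apply Hw|eapply Rle_trans; [apply Rmin_l|apply Rmin_r]]).
    assert (Hw3 : Cmod (w - z) < eps / (K2 + 1)) by (eapply Rlt_le_trans; [apply Hw|apply Rmin_r]).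
    set (h := (w - z)%C) in *. assert (H0 := Cmod_ge_0 h).
    assert (Hwz : 0 < Re w).
    { assert (A := re_le_Cmod h). apply Rabs_le_between in A. unfold h in A. simpl in A. unfold h in Hw2.
      unfold Re in *. lra. }
    assert (HI := CI_plus _ _ _ _ _ _ _ (is_integral_isI (d/2) ltac:(lra))
       (CI_plus _ _ _ _ _ _ _ (is_integral_isI (d/2) ltac:(lra)) (mellin_correct phi w Hphi Hwz)
          (CI_scal _ _ _ _ _ (- (1))%C (is_integral_isI (d/2) ltac:(lra)) (mellin_correct phi z Hphi Hz)))
       (CI_scal _ _ _ _ _ (- h)%C (is_integral_isI (d/2) ltac:(lra)) (mellin'_correct phi z Hphi Hz))).
    replace (mellin phi w + - (1) * mellin phi z + - h * mellin' phi z)%C with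
      (mellin phi w - mellin phi z - mellin' phi z * h)%C in HI by ring.
    apply Rle_trans with (2 * (2 / (d / 2) * (K * Cmod h ^ 2))).
    + apply (CI_bound _ _ _ _ _ _ (is_integral_isI (d/2) ltac:(lra)) HI).
      intros X.
      replace (phi X * cexp (w * X) + - (1) * (phi X * cexp (z * X)) + - h * (phi X * cexp (z * X) * X))%C with
        ((phi X * cexp (z * X)) * (cexp (h * X) - 1 - h * X))%C.
      2:{ replace (w * X)%C with (z * X + h * X)%C by (unfold h; ring). rewrite cexp_plus. ring. }
      rewrite Cmod_mult.
      assert (T := cexp_taylor_bound (h * X)%C). rewrite Cmod_mult, Cmod_R in T.
      assert (A := Rabs_pos X).
      apply Rle_trans with (B * env d X * (5 * (Cmod h * Rabs X) ^ 2 * exp (d / 4 * Rabs X))).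
      * apply Rmult_le_compat; try apply Cmod_ge_0; auto.
        eapply Rle_trans; [apply T|]. apply Rmult_le_compat_l; [pose proof (pow2_ge_0 (Cmod h * Rabs X)); lra|].
        apply exp_le. apply Rmult_le_compat_r; lra.
      * assert (H2 := abs_exp_bound (d / 4) X 2 ltac:(lra)).
        rewrite Rpow_mult_distr.
        apply Rle_trans with (B * env d X * (5 * (Cmod h ^ 2 * (INR (fact 2) / (d / 4) ^ 2 * exp (d / 4 * Rabs X))) * exp (d / 4 * Rabs X))).
        -- apply Rmult_le_compat_l; [apply Rmult_le_pos; [auto|left; apply env_pos]|].
           apply Rmult_le_compat_r; [left; apply exp_pos|]. apply Rmult_le_compat_l; [lra|].
           apply Rmult_le_compat_l; [apply pow2_ge_0|exact H2].
        -- right. rewrite <- env_half. unfold env at 2. unfold K.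
           replace (- (d / 2 * Rabs X)) with (- (d / 4 * Rabs X) + - (d / 4 * Rabs X)) by field.
           rewrite exp_plus.
           set (e := exp (- (d / 4 * Rabs X))). set (e' := exp (d / 4 * Rabs X)).
           assert (E : e * e' = 1) by (unfold e, e'; rewrite <- exp_plus, Rplus_opp_l; apply exp_0).
           transitivity (5 * B * (INR (fact 2) / (d / 4) ^ 2) * Cmod h ^ 2 * env (d / 2) X * (e * e') * (e * e')); [ring|].
           rewrite E. ring.
    + replace (2 * (2 / (d / 2) * (K * Cmod h ^ 2))) with (K2 * Cmod h * Cmod h) by (unfold K2; ring).
      apply Rmult_le_compat_r; auto.
      apply Rlt_le in Hw3. apply (Rmult_le_compat_r (K2 + 1)) in Hw3; [|lra].
      replace (eps / (K2 + 1) * (K2 + 1)) with eps in Hw3 by (field; lra). nra.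
Qed.

Lemma Re_sum_n (a : nat -> C) N : Re (sum_n (G:=C_AbelianMonoid) a N) = sum_n (fun n => Re (a n)) N.
Proof. induction N as [|N IH]; [now rewrite !sum_O|]. rewrite !sum_Sn, <- IH. reflexivity. Qed.

Lemma Im_sum_n (a : nat -> C) N : Im (sum_n (G:=C_AbelianMonoid) a N) = sum_n (fun n => Im (a n)) N.
Proof. induction N as [|N IH]; [now rewrite !sum_O|]. rewrite !sum_Sn, <- IH. reflexivity. Qed.

Lemma is_series_csums (a : nat -> C) l :
  is_series (K := C_AbsRing) (V := C_NormedModule) a l <-> csums a l.
Proof.
  split.
  - intros H.
    assert (H' := proj1 (filterlim_locally (U:=C_UniformSpace) (sum_n (G:=C_AbelianMonoid) a) l) H).
    split.
    + change (is_lim_seq (sum_n (fun n => Re (a n))) (Re l)). apply is_lim_seq_spec. intros eps.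
      destruct (H' eps) as [N HN]. exists N. intros n Hn. rewrite <- Re_sum_n. apply (HN n Hn).
    + change (is_lim_seq (sum_n (fun n => Im (a n))) (Im l)). apply is_lim_seq_spec. intros eps.
      destruct (H' eps) as [N HN]. exists N. intros n Hn. rewrite <- Im_sum_n. apply (HN n Hn).
  - intros [H1 H2].
    apply (proj2 (filterlim_locally (U:=C_UniformSpace) (sum_n (G:=C_AbelianMonoid) a) l)). intros eps.
    change (is_lim_seq (sum_n (fun n => Re (a n))) (Re l)) in H1.
    change (is_lim_seq (sum_n (fun n => Im (a n))) (Im l)) in H2.
    apply is_lim_seq_spec in H1, H2. destruct (H1 eps) as [N1 HN1]. destruct (H2 eps) as [N2 HN2].
    exists (max N1 N2). intros n Hn. split.
    + specialize (HN1 n ltac:(lia)). rewrite <- Re_sum_n in HN1. exact HN1.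
    + specialize (HN2 n ltac:(lia)). rewrite <- Im_sum_n in HN2. exact HN2.
Qed.

Definition Cser (a : nat -> C) : C := (Series (fun n => Re (a n)), Series (fun n => Im (a n))).

Lemma csums_Cser a l : csums a l -> Cser a = l.
Proof. intros [H1 H2]. apply C_ext; simpl; now apply is_series_unique. Qed.

Lemma Cser_correct a (c : nat -> R) : (forall n, Cmod (a n) <= c n) -> ex_series c -> csums a (Cser a).
Proof.
  intros H Hex. destruct (csums_dom_exists a c H Hex) as [l Hl]. now rewrite (csums_Cser _ _ Hl).
Qed.

Lemma Cmod_csums_le a l (c : nat -> R) : (forall n, Cmod (a n) <= c n) -> ex_series c -> csums a l ->
  Cmod l <= 2 * Series c.
Proof.
  intros H Hex [H1 H2].
  assert (Hs : forall (f : nat -> R) m, (forall n, Rabs (f n) <= c n) -> is_series f m -> Rabs m <= Series c).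
  { intros f m Hf Hm. rewrite <- (is_series_unique _ _ Hm).
    eapply Rle_trans; [apply Series_Rabs|].
    - apply (ex_series_le (V:=R_CompleteNormedModule) _ c); auto.
      intros n. change (Rabs (Rabs (f n)) <= c n). rewrite Rabs_Rabsolu. apply Hf.
    - apply Series_le; auto. intros n; split; [apply Rabs_pos|apply Hf]. }
  apply Hs in H1. 2:{ intros n. eapply Rle_trans; [apply re_le_Cmod|apply H]. }
  apply Hs in H2. 2:{ intros n. eapply Rle_trans; [apply Im_le_Cmod|apply H]. }
  eapply Rle_trans; [apply Cmod_le_abs|]. lra.
Qed.

Lemma Ccont_series (f : nat -> R -> C) (c : nat -> R) (F : R -> C) :
  (forall n x, Ccont (f n) x) -> (forall n x, Cmod (f n x) <= c n) -> ex_series c ->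
  (forall x, csums (fun n => f n x) (F x)) -> forall x, Ccont F x.
Proof.
  intros Hf Hc Hex HF x. split.
  - apply (continuous_series (fun n x => Re (f n x)) c); auto.
    + intros n y; exact (proj1 (Hf n y)).
    + intros n y. eapply Rle_trans; [apply re_le_Cmod|apply Hc].
    + intros y; exact (proj1 (HF y)).
  - apply (continuous_series (fun n x => Im (f n x)) c); auto.
    + intros n y; exact (proj2 (Hf n y)).
    + intros n y. eapply Rle_trans; [apply Im_le_Cmod|apply Hc].
    + intros y; exact (proj2 (HF y)).
Qed.

(** * The Gamma kernel and the theta kernel *)

Lemma exp_INR_mult n x : exp (INR n * x) = exp x ^ n.
Proof.
  induction n as [|n IH]; [simpl; rewrite Rmult_0_l; apply exp_0|].
  rewrite S_INR, Rmult_plus_distr_r, Rmult_1_l, exp_plus, IH. simpl; ring.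
Qed.

Definition phiG (X : R) : C := RtoC (exp (- exp X)).

Lemma exp_exp_bound N X : exp (- exp X) <= INR (fact N) * exp (- (INR N * X)).
Proof.
  assert (H := pow_exp_bound N (exp X) (Rlt_le _ _ (exp_pos X))).
  rewrite <- exp_INR_mult in H. assert (P := exp_pos (- (INR N * X))).
  apply (Rmult_le_compat_r (exp (- (INR N * X)))) in H; [|lra].
  replace (exp (INR N * X) * exp (- exp X) * exp (- (INR N * X))) with
    (exp (- exp X) * (exp (INR N * X) * exp (- (INR N * X)))) in H by ring.
  rewrite <- exp_plus, Rplus_opp_r, exp_0, Rmult_1_r in H. exact H.
Qed.

Lemma continuous_exp_exp x : continuous (fun X => exp (- exp X)) x.
Proof. apply continuous_of_derivable; auto_derive; trivial. Qed.

Lemma rapid_phiG : rapid phiG.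
Proof.
  split.
  - intros x. apply Ccont_real, continuous_exp_exp.
  - intros N. exists (INR (fact N)). split; [apply pos_INR|]. intros x. unfold phiG.
    rewrite Cmod_R, Rabs_pos_eq by (left; apply exp_pos). apply exp_exp_bound.
Qed.

Lemma rr_continuous q k n X : Ccont (fun X => RtoC (rr q k (exp X) n)) X.
Proof.
  apply Ccont_real. unfold rr.
  set (b := 2 * PI * INR (S n) / INR q).
  apply (continuous_ext (fun X => Re ((/ (exp X, b)) ^ S k)%C)).
  - intros x. now rewrite Cpow_inv by apply (freq_neq_0 _ _ (exp_pos x)).
  - assert (Hc : Ccont (fun X => (/ (exp X, b))%C) X).
    { assert (P := exp_pos X).
      split; unfold Cinv; simpl; apply continuous_of_derivable; auto_derive; nra. }
    apply (Ccont_pow _ (S k)) in Hc. exact (proj1 Hc).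
Qed.

(** The theta series in its dual form, which is bounded uniformly in X and so controls X -> -oo.
    Decay at +oo is read off the original form, with which it agrees by [phiF_theta]. *)
Definition phiF (q : nat) (chi : nat -> C) (k : nat) (X : R) : C :=
  (RtoC (2 * INR (fact k) / INR q) * gauss_sum q chi * Cser (dual_term q chi k (exp X)))%C.

Lemma ex_series_dual_bound q k : ex_series (fun n => INR q ^ S k * / INR (S n) ^ 2).
Proof. apply (ex_series_scal (V:=R_NormedModule) (INR q ^ S k)), ex_series_inv_pow. lia. Qed.

Lemma dual_csums q chi k t : is_dirichlet_character q chi -> (1 <= k)%nat -> 0 < t ->
  csums (dual_term q chi k t) (Cser (dual_term q chi k t)).
Proof.
  intros Hchi Hk Ht. apply (Cser_correct _ (fun n => INR q ^ S k * / INR (S n) ^ 2)).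
  - intros n. now apply dual_term_bound.
  - apply ex_series_dual_bound.
Qed.

Lemma phiF_theta q chi k X : is_dirichlet_character q chi -> ~ is_principal q chi ->
  is_even_char q chi -> is_primitive_char q chi -> (1 <= k)%nat ->
  csums (theta_term chi k (exp X)) (phiF q chi k X).
Proof.
  intros Hchi Hnp Hev Hprim Hk.
  destruct (theta_transform q chi k (exp X)) as (G & HG & HT); auto. { apply exp_pos. }
  unfold phiF. now rewrite (csums_Cser _ _ HG).
Qed.

Lemma theta_decay q chi k N : is_dirichlet_character q chi -> exists B, 0 <= B /\
  forall X l, 0 <= X -> csums (theta_term chi k (exp X)) l -> Cmod l <= B * exp (- (INR N * X)).
Proof.
  intros Hchi. set (c := fun n => / INR (S n) ^ 2).
  assert (Hc : ex_series c) by (apply ex_series_inv_pow; lia).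
  assert (Hc0 : 0 <= Series c).
  { assert (Hp : forall n, 0 <= c n) by (intros; left; apply Rinv_0_lt_compat, pow_lt, INR_S_pos).
    eapply Rle_trans; [apply (Hp O)|]. rewrite <- (sum_O c). now apply is_series_partial_le. }
  set (M := (k + 2 + N)%nat).
  exists (2 * (INR (fact M) * Series c)). split.
  { pose proof (pos_INR (fact M)). nra. }
  intros X l HX Hl.
  rewrite Rmult_assoc.
  replace (INR (fact M) * Series c * exp (- (INR N * X))) with (Series (fun n => INR (fact M) * exp (- (INR N * X)) * c n))
    by (rewrite Series_scal_l; ring).
  apply (Cmod_csums_le _ _ (fun n => INR (fact M) * exp (- (INR N * X)) * c n)) with (3 := Hl).
  - intros n. eapply Rle_trans; [apply (Cmod_theta_term q); auto; apply exp_pos|].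
    assert (Hn := INR_S_pos n). set (p := INR (S n)) in *.
    assert (Hp1 : 1 <= p) by (unfold p; rewrite S_INR; pose proof (pos_INR n); lra).
    assert (Ht : 1 <= exp X) by (rewrite <- exp_0; now apply exp_le).
    assert (PE := exp_pos X).
    eapply Rle_trans; [apply Rmult_le_compat_l; [apply pow_le; lra|apply (exp_neg_le M); nra]|].
    unfold c. fold p. rewrite exp_Ropp, exp_INR_mult.
    assert (P1 : 0 < exp X ^ N) by (apply pow_lt; lra). assert (P2 : 0 < p ^ 2) by (apply pow_lt; lra).
    assert (P3 : 0 < p ^ k) by (apply pow_lt; lra).
    replace (INR (fact M) * / exp X ^ N * / p ^ 2) with (p ^ k * (INR (fact M) / (p ^ k * p ^ 2 * exp X ^ N))) by (field; lra).
    apply Rmult_le_compat_l; [lra|]. apply Rmult_le_compat_l; [apply pos_INR|].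
    apply Rinv_le_contravar; [apply Rmult_lt_0_compat; [apply Rmult_lt_0_compat|]; auto|].
    unfold M. rewrite Rpow_mult_distr, !pow_add.
    assert (Q1 : 1 <= p ^ N) by (apply pow_R1_Rle; lra).
    assert (Q2 : 1 <= exp X ^ k * exp X ^ 2) by (rewrite <- pow_add; apply pow_R1_Rle; lra).
    apply Rle_trans with (p ^ k * p ^ 2 * 1 * (1 * exp X ^ N)); [right; ring|].
    apply Rmult_le_compat; [| |apply Rmult_le_compat_l; [nra|lra]|apply Rmult_le_compat_r; lra]; nra.
  - apply (ex_series_scal (V:=R_NormedModule)). exact Hc.
Qed.

Lemma rapid_phiF q chi k : is_dirichlet_character q chi -> ~ is_principal q chi ->
  is_even_char q chi -> is_primitive_char q chi -> (1 <= k)%nat -> rapid (phiF q chi k).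
Proof.
  intros Hchi Hnp Hev Hprim Hk. split.
  - intros x. apply Ccont_mult; [apply Ccont_const|].
    apply (Ccont_series (fun n X => dual_term q chi k (exp X) n) (fun n => INR q ^ S k * / INR (S n) ^ 2)).
    + intros n X. apply Ccont_mult; [apply Ccont_const|apply rr_continuous].
    + intros n X. apply dual_term_bound; auto. apply exp_pos.
    + apply ex_series_dual_bound.
    + intros X. apply dual_csums; auto. apply exp_pos.
  - intros N.
    set (B0 := Cmod (RtoC (2 * INR (fact k) / INR q) * gauss_sum q chi)%C * (2 * Series (fun n => INR q ^ S k * / INR (S n) ^ 2))).
    assert (H0 : forall X, Cmod (phiF q chi k X) <= B0).
    { intros X. unfold phiF. rewrite Cmod_mult. apply Rmult_le_compat_l; [apply Cmod_ge_0|].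
      apply (Cmod_csums_le (dual_term q chi k (exp X))).
      - intros n. apply dual_term_bound; auto. apply exp_pos.
      - apply ex_series_dual_bound.
      - apply dual_csums; auto. apply exp_pos. }
    assert (P0 : 0 <= B0) by (eapply Rle_trans; [apply Cmod_ge_0|apply (H0 0)]).
    destruct (theta_decay q chi k N Hchi) as (B1 & P1 & H1).
    exists (B0 + B1). split; [lra|]. intros X. assert (PE := exp_pos (- (INR N * X))).
    destruct (Rle_dec 0 X) as [HX|HX].
    + specialize (H1 X _ HX (phiF_theta q chi k X Hchi Hnp Hev Hprim Hk)). nra.
    + specialize (H0 X). assert (1 <= exp (- (INR N * X))).
      { rewrite <- exp_0. apply exp_le. pose proof (pos_INR N). nra. }
      nra.
Qed.

Lemma CI_shift f l s : CI isI f l -> CI isI (fun x => f (x + s)) l.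
Proof.
  intros [H1 H2]. split; [apply (isI_shift (fun x => Re (f x)))|apply (isI_shift (fun x => Im (f x)))]; auto.
Qed.

(** Translating X by ln n turns the n-th term into chi(n) n^(k-z) times the Gamma integrand. The
    margin in Re z > k + 3 pays for a majorant with 1/n^2 in n and e^(-|X|) in X; the rest of Re z >
    0 is reached by continuation. *)
Lemma mellin_dirichlet q chi k Lf z : is_dirichlet_character q chi -> ~ is_principal q chi ->
  is_even_char q chi -> is_primitive_char q chi -> (1 <= k)%nat -> is_L_function chi Lf ->
  INR k + 3 < Re z -> mellin (phiF q chi k) z = (Lf (z - RtoC (INR k)) * mellin phiG z)%C.
Proof.
  intros Hchi Hnp Hev Hprim Hk [_ HL] Hz.
  assert (Hk0 := pos_INR k).
  assert (HS := HL (z - RtoC (INR k))%C). apply is_series_csums in HS.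
  2:{ unfold Re in *. simpl. lra. }
  apply (csums_scal _ (mellin phiG z)) in HS. rewrite Cmult_comm in HS.
  symmetry. eapply csums_unique; [exact HS|].
  set (s := Re z) in *.
  destruct (nfloor_ex (s + 1)) as [N HN]; [lra|].
  set (Bc := INR (fact (S N)) + 1).
  (* Used for p = s - 1 and p = s + 1 with e^Y = n e^X: the two exponents leave a factor e^X or
     e^(-X), as [env_two] wants. *)
  assert (Hbd : forall p Y, 0 <= p <= s + 1 -> exp (p * Y) * exp (- exp Y) <= Bc).
  { intros p Y Hp. destruct (Rle_dec 0 Y) as [HY|HY].
    - assert (HB := exp_exp_bound (S N) Y). rewrite S_INR in HB.
      assert (PE := exp_pos (p * Y)).
      apply Rle_trans with (exp (p * Y) * (INR (fact (S N)) * exp (- ((INR N + 1) * Y)))).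
      + apply Rmult_le_compat_l; lra.
      + replace (exp (p * Y) * (INR (fact (S N)) * exp (- ((INR N + 1) * Y)))) with
          (INR (fact (S N)) * (exp (p * Y) * exp (- ((INR N + 1) * Y)))) by ring.
        rewrite <- exp_plus. assert (exp (p * Y + - ((INR N + 1) * Y)) <= 1).
        { apply exp_le_1.
          assert (0 <= (INR N + 1 - p) * Y) by (apply Rmult_le_pos; lra). lra. }
        pose proof (pos_INR (fact (S N))). unfold Bc.
        assert (INR (fact (S N)) * exp (p * Y + - ((INR N + 1) * Y)) <= INR (fact (S N)) * 1) by (apply Rmult_le_compat_l; lra).
        lra.
    - assert (exp (p * Y) <= 1) by (rewrite <- exp_0; apply exp_le; nra).
      assert (exp (- exp Y) <= 1) by (rewrite <- exp_0; apply exp_le; pose proof (exp_pos Y); lra).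
      pose proof (exp_pos (p * Y)). pose proof (exp_pos (- exp Y)). pose proof (pos_INR (fact (S N))).
      assert (exp (p * Y) * exp (- exp Y) <= 1 * 1) by (apply Rmult_le_compat; lra).
      unfold Bc. lra. }
  assert (HBc : 0 <= Bc) by (unfold Bc; pose proof (pos_INR (fact (S N))); lra).
  apply (integral_csums _ _ _ (is_integral_isI 1 Rlt_0_1)
    (fun n X => theta_term chi k (exp X) n * cexp (z * RtoC X))%C _ (fun n => 2 * Bc * / INR (S n) ^ 2)
    (fun X => phiF q chi k X * cexp (z * RtoC X))%C).
  - intros n. assert (Hn := INR_S_pos n). set (ell := ln (INR (S n))).
    assert (Hel : exp ell = INR (S n)) by now apply exp_ln.
    assert (HG := CI_shift _ _ ell (mellin_correct phiG z rapid_phiG ltac:(fold s; lra))).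
    apply (CI_scal _ _ _ _ _ (chi (S n) * ncpow (S n) (- (z - RtoC (INR k))))%C (is_integral_isI 1 Rlt_0_1)) in HG.
    rewrite (Cmult_comm (mellin phiG z)).
    eapply (CI_ext _ _ _ _ _ _ (is_integral_isI 1 Rlt_0_1)); [|exact HG].
    intros X. cbv beta. unfold theta_term, phiG, ncpow. fold ell.
    rewrite <- Hel, <- exp_INR_mult, RtoC_mult, (exp_plus X ell), (Rmult_comm (exp X)).
    rewrite <- (cexp_R (INR k * ell)), RtoC_plus.
    replace (- (z - INR k) * ell)%C with (RtoC (INR k * ell) + - (z * ell))%C by (rewrite RtoC_mult; ring).
    rewrite Cmult_plus_distr_l, !cexp_plus.
    assert (E : (cexp (- (z * ell)) * cexp (z * ell))%C = 1%C).
    { rewrite <- cexp_plus. replace (- (z * ell) + z * ell)%C with (RtoC 0) by ring. apply cexp_0. }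
    transitivity (chi (S n) * cexp (RtoC (INR k * ell)) * RtoC (exp (- (exp ell * exp X))) * cexp (z * X) * (cexp (- (z * ell)) * cexp (z * ell)))%C; [ring|].
    rewrite E. ring.
  - intros n X. rewrite Cmod_mult, Cmod_cexp_real. fold s.
    assert (Hn := INR_S_pos n). set (ell := ln (INR (S n))).
    assert (Hel : exp ell = INR (S n)) by now apply exp_ln.
    assert (Hel0 : 0 <= ell).
    { unfold ell. rewrite <- ln_1. apply ln_le; [lra|]. rewrite S_INR. pose proof (pos_INR n). lra. }
    eapply Rle_trans; [apply Rmult_le_compat_r; [left; apply exp_pos|apply (Cmod_theta_term q); auto; apply exp_pos]|].
    rewrite <- Hel, <- !exp_INR_mult, <- (exp_plus ell X), <- exp_Ropp.
    replace (2 * Bc * exp (- (INR 2 * ell)) * env 1 X) with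
      ((Bc * exp (- (INR 2 * ell)) + Bc * exp (- (INR 2 * ell))) * env 1 X) by ring.
    set (Y := ell + X). assert (PB : 0 <= Bc * exp (- (INR 2 * ell))) by (pose proof (exp_pos (- (INR 2 * ell))); nra).
    apply env_two; auto.
    + replace (exp (INR k * ell) * exp (- exp Y) * exp (s * X)) with
        (exp ((s - 1) * Y) * exp (- exp Y) * exp ((INR k - s + 1) * ell) * exp (1 * X)).
      2:{ replace (exp ((s - 1) * Y) * exp (- exp Y) * exp ((INR k - s + 1) * ell) * exp (1 * X)) with
            (exp (- exp Y) * (exp ((s - 1) * Y) * exp ((INR k - s + 1) * ell) * exp (1 * X))) by ring.
          replace (exp (INR k * ell) * exp (- exp Y) * exp (s * X)) with
            (exp (- exp Y) * (exp (INR k * ell) * exp (s * X))) by ring.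
          rewrite <- !exp_plus. f_equal. f_equal. unfold Y. ring. }
      apply Rmult_le_compat_r; [left; apply exp_pos|].
      apply Rmult_le_compat; [apply Rmult_le_pos; left; apply exp_pos|left; apply exp_pos| |].
      * apply Hbd. lra.
      * apply exp_le. simpl INR. nra.
    + replace (exp (INR k * ell) * exp (- exp Y) * exp (s * X)) with
        (exp ((s + 1) * Y) * exp (- exp Y) * exp ((INR k - s - 1) * ell) * exp (- (1 * X))).
      2:{ replace (exp ((s + 1) * Y) * exp (- exp Y) * exp ((INR k - s - 1) * ell) * exp (- (1 * X))) with
            (exp (- exp Y) * (exp ((s + 1) * Y) * exp ((INR k - s - 1) * ell) * exp (- (1 * X)))) by ring.
          replace (exp (INR k * ell) * exp (- exp Y) * exp (s * X)) with
            (exp (- exp Y) * (exp (INR k * ell) * exp (s * X))) by ring.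
          rewrite <- !exp_plus. f_equal. f_equal. unfold Y. ring. }
      apply Rmult_le_compat_r; [left; apply exp_pos|].
      apply Rmult_le_compat; [apply Rmult_le_pos; left; apply exp_pos|left; apply exp_pos| |].
      * apply Hbd. lra.
      * apply exp_le. simpl INR. nra.
  - apply (ex_series_scal (V:=R_NormedModule) (2 * Bc)), ex_series_inv_pow. lia.
  - intros X. rewrite (Cmult_comm (phiF q chi k X)).
    eapply csums_ext; [|apply csums_scal; apply (phiF_theta q chi k X Hchi Hnp Hev Hprim Hk)].
    intros n. cbv beta. ring.
  - apply mellin_correct; [now apply rapid_phiF|]. fold s; lra.
Qed.

(** Equality and derivative at z = 1 of L(z - k - 1) Gamma(z) = M(z). The kernel has index k + 1,
    because with index k the point s = -k would be z = 0, on the boundary and at the pole of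
    Gamma. *)
Lemma mellin_L q chi k Lf (dL : C) : is_dirichlet_character q chi -> ~ is_principal q chi ->
  is_even_char q chi -> is_primitive_char q chi -> is_L_function chi Lf ->
  is_derive (K := C_AbsRing) (V := C_NormedModule) Lf (RtoC (- INR k)) dL ->
  mellin phiG 1 = 1%C ->
  Lf (RtoC (- INR k)) = mellin (phiF q chi (S k)) 1 /\
  dL = (mellin' (phiF q chi (S k)) 1 - Lf (RtoC (- INR k)) * mellin' phiG 1)%C.
Proof.
  intros Hchi Hnp Hev Hprim HL HdL HG1.
  assert (HrF : rapid (phiF q chi (S k))) by (apply rapid_phiF; auto; lia).
  set (c := RtoC (INR (S k))).
  assert (Hsh : forall z l, Cdiff Lf (z - c) l -> Cdiff (fun z => Lf (z - c)%C) z l).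
  { intros z l Hl.
    assert (E : (l * (1 + 0))%C = l) by ring.
    apply (eq_ind _ (Cdiff (fun z => Lf (z - c)%C) z)) with (2 := E).
    apply (Cdiff_comp Lf (fun z => z - c)%C); auto.
    apply (Cdiff_plus (fun z => z) (fun _ => - c)%C). apply Cdiff_id. apply Cdiff_const. }
  set (U := fun z => (Lf (z - c) * mellin phiG z + (- (1)) * mellin (phiF q chi (S k)) z)%C).
  assert (HU : forall z l, 0 < Re z -> Cdiff Lf (z - c) l -> Cdiff U z
     ((l * mellin phiG z + Lf (z - c) * mellin' phiG z) + (0 * mellin (phiF q chi (S k)) z + (- (1)) * mellin' (phiF q chi (S k)) z))%C).
  { intros z l Hz Hl. apply (Cdiff_plus (fun z => Lf (z - c) * mellin phiG z)%C).
    - apply (Cdiff_mult (fun z => Lf (z - c)%C) (mellin phiG)); auto. apply mellin_diff; auto. apply rapid_phiG.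
    - apply (Cdiff_mult (fun _ => (- (1))%C) (mellin (phiF q chi (S k)))); [apply Cdiff_const|]. now apply mellin_diff. }
  assert (HU0 : forall z, 0 < Re z -> U z = 0%C).
  { apply (halfplane_identity U (INR (S k) + 3)).
    - intros z Hz. destruct (proj1 HL (z - c)%C) as [l Hl]. apply Cdiff_is_derive in Hl. eexists. apply HU; eauto.
    - intros z Hz. unfold U. rewrite (mellin_dirichlet q chi (S k) Lf z); auto; [|lia]. fold c. ring. }
  assert (Ec : (1 - c)%C = RtoC (- INR k)).
  { unfold c. rewrite <- RtoC_minus. f_equal. rewrite S_INR. ring. }
  assert (H1 : 0 < Re 1%C) by (simpl; lra).
  assert (HdL' := Cdiff_is_derive _ _ _ HdL). rewrite <- Ec in HdL'.
  assert (D1 := HU 1%C dL H1 HdL'). assert (E1 := HU0 1%C H1). unfold U in E1.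
  rewrite Ec, HG1 in E1. rewrite Ec, HG1 in D1.
  (* U vanishes on a whole disc around 1, so its derivative there is 0; comparison with [D1] gives
     the formula for dL. *)
  assert (D2 : Cdiff U 1%C 0%C).
  { apply (Cdiff_ext (fun _ => 0%C) U 1%C 0%C (1/2)); [lra| |apply Cdiff_const].
    intros w Hw. symmetry. apply HU0. assert (A := re_le_Cmod (w - 1)%C). apply Rabs_le_between in A.
    unfold Re in *. simpl in A. lra. }
  assert (E2 := Cdiff_unique _ _ _ _ D1 D2).
  set (L := Lf (RtoC (- INR k))) in *. set (F1 := mellin (phiF q chi (S k)) 1) in *.
  set (F2 := mellin' (phiF q chi (S k)) 1) in *. set (G2 := mellin' phiG 1) in *.
  split.
  - transitivity (L * 1 + - (1) * F1 + F1)%C; [ring|]. rewrite E1. ring.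
  - transitivity (dL * 1 + L * G2 + (0 * F1 + - (1) * F2) + (F2 - L * G2))%C; [ring|]. rewrite E2. ring.
Qed.

(** * Euler's constant *)

Lemma env_small d eps : 0 < d -> 0 < eps -> exists M, 0 <= M /\ forall x, M <= Rabs x -> env d x <= eps.
Proof.
  intros Hd Heps. exists (Rmax 0 (- ln eps / d)). split; [apply Rmax_l|]. intros x Hx.
  unfold env. rewrite <- (exp_ln eps) by auto. apply exp_le.
  assert (H := Rle_trans _ _ _ (Rmax_r 0 (- ln eps / d)) Hx).
  apply (Rmult_le_compat_l d) in H; [|lra].
  replace (d * (- ln eps / d)) with (- ln eps) in H by (field; lra). lra.
Qed.

Lemma isI_primitive_env (f F : R -> R) B d : 0 < d -> (forall x, is_derive F x (f x)) ->
  (forall x, continuous f x) -> (forall x, Rabs (F x) <= B * env d x) -> isI f 0.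
Proof.
  intros Hd HF Hf HB. replace 0 with (0 - 0) by ring.
  assert (HB0 : 0 <= B).
  { specialize (HB 0). pose proof (env_pos d 0). pose proof (Rabs_pos (F 0)). apply Rnot_lt_le; intros ?. nra. }
  apply (isI_primitive f F 0 0); auto. intros eps Heps.
  destruct (env_small d (eps / (B + 1)) Hd) as (M & HM0 & HM); [apply Rdiv_lt_0_compat; lra|].
  assert (HE : forall x, M <= Rabs x -> Rabs (F x - 0) <= eps).
  { intros x Hx. rewrite Rminus_0_r. eapply Rle_trans; [apply HB|]. specialize (HM x Hx).
    apply Rle_trans with (B * (eps / (B + 1))); [apply Rmult_le_compat_l; lra|].
    apply Rle_trans with ((B + 1) * (eps / (B + 1))); [|right; field; lra].
    apply Rmult_le_compat_r; [left; apply Rdiv_lt_0_compat; lra|lra]. }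
  exists M. intros x Hx. split; apply HE; [|rewrite Rabs_Ropp]; rewrite Rabs_pos_eq; lra.
Qed.

Lemma isI_le f g l m : isI f l -> isI g m -> (forall x, f x <= g x) -> l <= m.
Proof.
  intros [Hf If] [Hg Ig] H. apply le_epsilon. intros eps Heps.
  destruct (If (eps / 2)) as [M1 H1]; [lra|]. destruct (Ig (eps / 2)) as [M2 H2]; [lra|].
  set (M := Rmax 0 (Rmax M1 M2)).
  pose proof (Rmax_l 0 (Rmax M1 M2)). pose proof (Rmax_r 0 (Rmax M1 M2)).
  pose proof (Rmax_l M1 M2). pose proof (Rmax_r M1 M2). fold M in H0, H3.
  specialize (H1 (-M) M ltac:(lra) ltac:(lra)). specialize (H2 (-M) M ltac:(lra) ltac:(lra)).
  assert (RInt f (-M) M <= RInt g (-M) M).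
  { apply RInt_le; try lra; try (now apply ex_RInt_continuous_all). intros; apply H. }
  apply Rabs_le_between in H1, H2. lra.
Qed.

(** The integrand of Gamma(N + 1) in logarithmic coordinates. Its integral is N!, and its first
    moment in X is Gamma'(N + 1). *)
Definition gker (N : nat) (X : R) : R := exp (- exp X) * exp (INR (S N) * X).

Lemma gker_pos N X : 0 < gker N X.
Proof. apply Rmult_lt_0_compat; apply exp_pos. Qed.

Lemma gker_env N : exists B, 0 <= B /\ forall X, gker N X <= B * env 1 X.
Proof.
  exists (1 + INR (fact (S (S N)))). split; [pose proof (pos_INR (fact (S (S N)))); lra|]. intros X.
  unfold gker, env. assert (HN := pos_INR N).
  assert (PF := pos_INR (fact (S (S N)))).
  destruct (Rle_dec 0 X) as [HX|HX].
  - rewrite Rabs_pos_eq by auto. assert (H := exp_exp_bound (S (S N)) X).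
    assert (PE := exp_pos (INR (S N) * X)).
    apply (Rmult_le_compat_r (exp (INR (S N) * X))) in H; [|lra].
    rewrite Rmult_assoc, <- (exp_plus (- (INR (S (S N)) * X))), (S_INR (S N)) in H.
    replace (- ((INR (S N) + 1) * X) + INR (S N) * X) with (- (1 * X)) in H by ring.
    pose proof (exp_pos (- (1 * X))). lra.
  - rewrite Rabs_left by lra. replace (- (1 * - X)) with X by ring.
    assert (exp (- exp X) <= 1) by (apply exp_le_1; pose proof (exp_pos X); lra).
    assert (exp (INR (S N) * X) <= exp X) by (apply exp_le; rewrite S_INR; nra).
    pose proof (exp_pos (- exp X)). pose proof (exp_pos (INR (S N) * X)).
    assert (exp (- exp X) * exp (INR (S N) * X) <= 1 * exp X) by (apply Rmult_le_compat; lra).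
    pose proof (exp_pos X). nra.
Qed.

Lemma gkerX_env N : exists B, 0 <= B /\ forall X, Rabs (X * gker N X) <= B * env (1 / 2) X.
Proof.
  destruct (gker_env N) as (B & PB & HB). exists (2 * B). split; [lra|]. intros X.
  rewrite Rabs_mult, (Rabs_pos_eq (gker N X)) by (left; apply gker_pos).
  assert (H1 := abs_exp_bound (1 / 2) X 1 ltac:(lra)). rewrite pow_1 in H1. simpl fact in H1. simpl INR in H1.
  specialize (HB X).
  apply Rle_trans with (1 / (1 / 2) ^ 1 * exp (1 / 2 * Rabs X) * (B * env 1 X)).
  - apply Rmult_le_compat; auto; [apply Rabs_pos|left; apply gker_pos].
  - right. rewrite <- (env_half 1). unfold env at 2.
    replace (1 / (1 / 2) ^ 1 * exp (1 / 2 * Rabs X) * (B * (env (1 / 2) X * exp (- (1 / 2 * Rabs X))))) with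
      (2 * B * env (1 / 2) X * (exp (1 / 2 * Rabs X) * exp (- (1 / 2 * Rabs X)))) by field.
    rewrite <- exp_plus, Rplus_opp_r, exp_0. ring.
Qed.

Lemma gker_continuous N X : continuous (gker N) X.
Proof. apply continuous_of_derivable. unfold gker. auto_derive; trivial. Qed.

Lemma gker_S N X : gker (S N) X = exp X * gker N X.
Proof.
  unfold gker. rewrite (S_INR (S N)), Rmult_plus_distr_r, exp_plus, Rmult_1_l. ring.
Qed.

Lemma gker_derive N X : is_derive (gker N) X (INR (S N) * gker N X - gker (S N) X).
Proof.
  rewrite gker_S. unfold gker. set (c := INR (S N)). auto_derive; trivial. ring.
Qed.

Lemma gker_step N : isI (fun X => gker (S N) X - INR (S N) * gker N X) 0.
Proof.
  destruct (gker_env N) as (B & PB & HB).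
  apply (isI_primitive_env _ (fun X => - gker N X) B 1); [lra| | |].
  - intros x. evar_last; [apply (is_derive_opp (V:=R_NormedModule) _ _ _ (gker_derive N x))|].
    unfold opp; simpl. ring.
  - intros x. apply (continuous_minus (V:=R_NormedModule) (gker (S N)) (fun X => INR (S N) * gker N X)).
    + apply gker_continuous.
    + apply continuous_mult_R; [apply continuous_const|apply gker_continuous].
  - intros x. rewrite Rabs_Ropp, Rabs_pos_eq by (left; apply gker_pos). apply HB.
Qed.

Lemma gker_integral N : isI (gker N) (INR (fact N)).
Proof.
  induction N as [|N IH].
  - assert (E0 : forall X : R, gker 0 X = exp (- exp X) * exp X).
    { intros X. unfold gker. replace (INR 1 * X) with X by (simpl; ring). reflexivity. }
    replace (INR (fact 0)) with (0 - - 1) by (simpl; ring).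
    apply (isI_primitive (gker 0) (fun X => - exp (- exp X)) (-1) 0).
    + intros x. auto_derive; trivial. rewrite E0. eqR. ring.
    + apply gker_continuous.
    + intros eps Heps. destruct (env_small 1 eps Rlt_0_1 Heps) as (M & HM0 & HM).
      exists M. intros x Hx. specialize (HM x). unfold env in HM. rewrite Rabs_pos_eq in HM by lra.
      specialize (HM Hx). rewrite Rmult_1_l in HM. split.
      * rewrite Rminus_0_r, Rabs_Ropp, Rabs_pos_eq by (left; apply exp_pos).
        assert (H := exp_exp_bound 1 x). simpl fact in H. simpl INR in H. rewrite !Rmult_1_l in H. lra.
      * replace (- exp (- exp (- x)) - -1) with (1 - exp (- exp (- x))) by ring.
        assert (H1 := exp_ineq1_le (- exp (- x))). assert (H2 : exp (- exp (- x)) <= 1) by (apply exp_le_1; pose proof (exp_pos (- x)); lra).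
        rewrite Rabs_pos_eq; lra.
  - rewrite fact_simpl, mult_INR.
    assert (H := isI_plus _ _ _ _ (gker_step N) (isI_scal (INR (S N)) _ _ IH)).
    rewrite Rplus_0_l in H. eapply isI_ext; [|exact H]. intros x; simpl. ring.
Qed.

Lemma gkerX_exists N : exists l, isI (fun X => X * gker N X) l.
Proof.
  destruct (gkerX_env N) as (B & PB & HB).
  apply (isI_exists _ B (1 / 2)); auto; [lra|].
  intros x. apply continuous_mult_R; [apply continuous_id|apply gker_continuous].
Qed.

(** Gamma'(N + 2) = (N + 1) Gamma'(N + 1) + N!, by integrating the derivative of X gker N. Divided
    by factorials, the recursion builds up harmonic numbers. *)
Lemma gkerX_step N l : isI (fun X => X * gker N X) l ->
  isI (fun X => X * gker (S N) X) (INR (S N) * l + INR (fact N)).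
Proof.
  intros Hl. destruct (gkerX_env N) as (B & PB & HB).
  assert (H0 : isI (fun X => X * gker (S N) X - INR (S N) * (X * gker N X) - gker N X) 0).
  { apply (isI_primitive_env _ (fun X => - (X * gker N X)) B (1 / 2)); [lra| | |].
    - intros x. evar_last.
      + apply (is_derive_opp (V:=R_NormedModule)).
        apply (is_derive_mult (K:=R_AbsRing) (fun X => X) (gker N) x _ _ (is_derive_id x) (gker_derive N x)). apply Rmult_comm.
      + unfold opp, mult, one; simpl. plusR. ring.
    - intros x. apply (continuous_minus (V:=R_NormedModule) (fun X => X * gker (S N) X - INR (S N) * (X * gker N X)) (gker N)); [|apply gker_continuous].
      apply (continuous_minus (V:=R_NormedModule) (fun X => X * gker (S N) X) (fun X => INR (S N) * (X * gker N X))).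
      + apply continuous_mult_R; [apply continuous_id|apply gker_continuous].
      + apply continuous_mult_R; [apply continuous_const|]. apply continuous_mult_R; [apply continuous_id|apply gker_continuous].
    - intros x. rewrite Rabs_Ropp. apply HB. }
  assert (H := isI_plus _ _ _ _ (isI_plus _ _ _ _ H0 (isI_scal (INR (S N)) _ _ Hl)) (gker_integral N)).
  rewrite Rplus_0_l in H. eapply isI_ext; [|exact H]. intros x; simpl. ring.
Qed.

Lemma sum_f_R0_harmonic_gker n l0 : isI (fun X => X * gker 0 X) l0 ->
  isI (fun X => X * gker (S n) X) (INR (fact (S n)) * (l0 + sum_f_R0 (fun j => / INR (j + 1)) n)).
Proof.
  intros H0. induction n as [|n IH].
  - assert (H := gkerX_step 0 l0 H0). simpl in *. replace (1 * (l0 + / 1)) with (1 * l0 + 1) by field. exact H.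
  - assert (H := gkerX_step (S n) _ IH).
    replace (INR (fact (S (S n))) * (l0 + sum_f_R0 (fun j => / INR (j + 1)) (S n))) with
      (INR (S (S n)) * (INR (fact (S n)) * (l0 + sum_f_R0 (fun j => / INR (j + 1)) n)) + INR (fact (S n))); auto.
    rewrite tech5, (fact_simpl (S n)), mult_INR. replace (S n + 1)%nat with (S (S n)) by lia.
    field. apply Rgt_not_eq, INR_S_pos.
Qed.

(* The tangent line of [ln] at [N] bounds the logarithmic moment from both sides. *)
Lemma gkerX_bounds N l : isI (fun X => X * gker (S N) X) l ->
  INR (fact (S N)) * ln (INR (S N)) <= l <= INR (fact (S N)) * (ln (INR (S N)) + / INR (S N)).
Proof.
  intros Hl. assert (Hn := INR_S_pos N). set (p := INR (S N)) in *.
  (* Both bounds on u touch at u = ln v, one linear in e^(-u) and one in e^u, so that integrating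
     them against [gker] needs only neighbouring factorials. *)
  assert (Hln : forall u v, 0 < v -> ln v + 1 - v * exp (- u) <= u <= ln v + (exp u - v) / v).
  { intros u v Hv. split.
    - assert (H := exp_ineq1_le (ln v - u)). unfold Rminus in H at 2. rewrite exp_plus, exp_ln in H by auto. lra.
    - assert (H := exp_ineq1_le (u - ln v)). unfold Rminus in H at 2. rewrite exp_plus, exp_Ropp, exp_ln in H by auto.
      replace ((exp u - v) / v) with (exp u * / v - 1) by (field; lra). lra. }
  split.
  - assert (HI := isI_plus _ _ _ _ (isI_scal (ln p + 1) _ _ (gker_integral (S N))) (isI_scal (- p) _ _ (gker_integral N))).
    assert (H := isI_le _ _ _ _ HI Hl). rewrite fact_simpl, mult_INR in *. fold p in H |- *.
    replace (p * INR (fact N) * ln p) with ((ln p + 1) * (p * INR (fact N)) + - p * INR (fact N)) by ring.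
    apply H. intros X. rewrite gker_S. destruct (Hln X p Hn) as [H1 _].
    assert (E : exp X * exp (- X) = 1) by (rewrite <- exp_plus, Rplus_opp_r; apply exp_0).
    assert (PG := gker_pos N X). assert (PE := exp_pos X).
    apply (Rmult_le_compat_r (exp X * gker N X)) in H1; [|nra].
    replace ((ln p + 1 - p * exp (- X)) * (exp X * gker N X)) with
      ((ln p + 1) * (exp X * gker N X) + - p * gker N X * (exp X * exp (- X))) in H1 by ring.
    rewrite E in H1. lra.
  - assert (HI := isI_plus _ _ _ _ (isI_scal (ln p - 1) _ _ (gker_integral (S N))) (isI_scal (/ p) _ _ (gker_integral (S (S N))))).
    assert (H := isI_le _ _ _ _ Hl HI). 
    replace (INR (fact (S N)) * (ln p + / p)) with ((ln p - 1) * INR (fact (S N)) + / p * INR (fact (S (S N)))).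
    2:{ rewrite (fact_simpl (S N)), mult_INR, (S_INR (S N)). fold p. field. lra. }
    apply H. intros X. rewrite (gker_S (S N)). destruct (Hln X p Hn) as [_ H1].
    assert (PG := gker_pos (S N) X).
    apply (Rmult_le_compat_r (gker (S N) X)) in H1; [|lra].
    replace ((ln p + (exp X - p) / p) * gker (S N) X) with ((ln p - 1) * gker (S N) X + / p * (exp X * gker (S N) X)) in H1 by (field; lra).
    exact H1.
Qed.

Lemma inv_INR_lim : is_lim_seq (fun n => / INR (S n)) 0.
Proof.
  apply (is_lim_seq_inv _ p_infty); [|discriminate].
  apply (is_lim_seq_incr_1 INR p_infty). apply is_lim_seq_INR.
Qed.

(** Gamma'(1) + H_(n+1) is the mean of X for the density gker (n + 1) divided by (n + 1)!, and that
    mean lies within 1/(n + 1) above ln(n + 1). This proves at once that the limit behind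
    [euler_gamma] exists and that Gamma'(1) = -gamma. *)
Lemma euler_gamma_lim :
  is_lim_seq (fun n => sum_f_R0 (fun j => / INR (j + 1)) n - ln (INR (n + 1))) euler_gamma /\
  isI (fun X => X * gker 0 X) (- euler_gamma).
Proof.
  destruct (gkerX_exists 0) as [l0 H0].
  assert (HL : is_lim_seq (fun n => sum_f_R0 (fun j => / INR (j + 1)) n - ln (INR (n + 1))) (- l0)).
  { apply (is_lim_seq_le_le (fun _ => - l0) _ (fun n => - l0 + / INR (S n))).
    - intros n. destruct (gkerX_bounds n _ (sum_f_R0_harmonic_gker n l0 H0)) as [B1 B2].
      assert (PF := INR_fact_lt_0 (S n)).
      apply Rmult_le_reg_l in B1; auto. apply Rmult_le_reg_l in B2; auto.
      replace (n + 1)%nat with (S n) by lia. lra.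
    - apply is_lim_seq_const.
    - replace (Finite (- l0)) with (Finite (- l0 + 0)) by (f_equal; ring).
      apply is_lim_seq_plus'; [apply is_lim_seq_const|apply inv_INR_lim]. }
  assert (E : euler_gamma = - l0) by (unfold euler_gamma; now rewrite (is_lim_seq_unique _ _ HL)).
  rewrite E, Ropp_involutive. auto.
Qed.

Lemma mellin_phiG_1 : mellin phiG 1 = 1%C.
Proof.
  apply CI_CII. 
  apply (CI_ext _ _ _ (fun X => 1 * RtoC (gker 0 X))%C _ _ (is_integral_isI 1 Rlt_0_1)).
  - intros X. unfold phiG, gker. simpl INR. rewrite RtoC_mult, <- RtoC_mult, <- cexp_R, Cmult_1_l, RtoC_mult. rewrite <- !cexp_R.
    f_equal. f_equal. rewrite Rmult_1_l. ring.
  - assert (H := CI_real _ _ _ _ _ 1%C (is_integral_isI 1 Rlt_0_1) (gker_integral 0)).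
    replace (1 * RtoC (INR (fact 0)))%C with (RtoC 1) in H by (simpl; ring). exact H.
Qed.

Lemma mellin'_phiG_1 : mellin' phiG 1 = RtoC (- euler_gamma).
Proof.
  apply CI_CII. replace (RtoC (- euler_gamma)) with (1 * RtoC (- euler_gamma))%C by ring.
  apply (CI_ext _ _ _ (fun X => 1 * RtoC (X * gker 0 X))%C _ _ (is_integral_isI 1 Rlt_0_1)).
  - intros X. unfold phiG, gker. simpl INR. rewrite Rmult_1_l, !RtoC_mult, <- !cexp_R.
    rewrite Cmult_1_l. ring_simplify. rewrite Cmult_1_l. ring.
  - apply (CI_real _ _ _ _ _ _ (is_integral_isI 1 Rlt_0_1)). apply euler_gamma_lim.
Qed.

(** * Value and derivative of L at -k *)

Lemma Rderiv_Cmult F G x l m : Rderiv F x l -> Rderiv G x m ->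
  Rderiv (fun t => F t * G t)%C x (l * G x + F x * m)%C.
Proof.
  intros [H1 H2] [H3 H4].
  assert (HM : forall f g a b, is_derive f x a -> is_derive g x b -> is_derive (fun t : R => f t * g t) x (a * g x + f x * b)).
  { intros f g a b Hf Hg. apply (is_derive_mult (K:=R_AbsRing) f g x a b Hf Hg). apply Rmult_comm. }
  split.
  - evar_last; [apply (is_derive_minus (V:=R_NormedModule) _ _ _ _ _ (HM _ _ _ _ H1 H3) (HM _ _ _ _ H2 H4))|].
    unfold minus, plus, opp, Re, Im; simpl. eqR. ring.
  - evar_last; [apply (is_derive_plus (V:=R_NormedModule) _ _ _ _ _ (HM _ _ _ _ H1 H4) (HM _ _ _ _ H2 H3))|].
    unfold minus, plus, opp, Re, Im; simpl. eqR. ring.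
Qed.

Lemma Rderiv_Ccont F x l : Rderiv F x l -> Ccont F x.
Proof. intros [H1 H2]. split; apply continuous_of_derivable; eexists; eassumption. Qed.

Lemma CI_primitive_env (f F : R -> C) B d : 0 < d -> (forall x, Rderiv F x (f x)) ->
  (forall x, Ccont f x) -> (forall x, Cmod (F x) <= B * env d x) -> CI isI f 0%C.
Proof.
  intros Hd HF Hf HB. split.
  - apply (isI_primitive_env _ (fun x => Re (F x)) B d); auto.
    + intros x; exact (proj1 (HF x)).
    + intros x; exact (proj1 (Hf x)).
    + intros x. eapply Rle_trans; [apply re_le_Cmod|apply HB].
  - apply (isI_primitive_env _ (fun x => Im (F x)) B d); auto.
    + intros x; exact (proj2 (HF x)).
    + intros x; exact (proj2 (Hf x)).
    + intros x. eapply Rle_trans; [apply Im_le_Cmod|apply HB].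
Qed.

(** 1/(t + i) with t = e^Y: the dual term at frequency b becomes a power of it after scaling t by
    b. *)
Definition ai (Y : R) : C := (/ (exp Y, 1%R))%C.

Lemma ai_inv Y : ((RtoC (exp Y) + Ci) * ai Y)%C = 1%C.
Proof.
  unfold ai. replace (RtoC (exp Y) + Ci)%C with ((exp Y, 1%R) : C) by (apply C_ext; simpl; ring).
  apply Cinv_r. apply freq_neq_0, exp_pos.
Qed.

Lemma Rderiv_ai Y : Rderiv ai Y (- (RtoC (exp Y) * (ai Y * ai Y)))%C.
Proof.
  assert (P := exp_pos Y).
  split; unfold ai, Cinv; simpl; auto_derive; try nra; field; nra.
Qed.

Lemma Rderiv_ai_pow j Y : Rderiv (fun Y => ai Y ^ j)%C Y (- (RtoC (INR j) * (RtoC (exp Y) * ai Y ^ S j)))%C.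
Proof.
  induction j as [|j IH].
  - apply (Rderiv_eq _ _ 0%C); [simpl; ring|].
    split; simpl; auto_derive; trivial.
  - eapply Rderiv_eq; [|apply (Rderiv_Cmult ai (fun Y => ai Y ^ j)%C Y _ _ (Rderiv_ai Y) IH)].
    rewrite S_INR, RtoC_plus. change (ai Y ^ S (S j))%C with (ai Y * (ai Y * ai Y ^ j))%C.
    change (ai Y ^ S j)%C with (ai Y * ai Y ^ j)%C. ring.
Qed.

Lemma ai_Ccont_pow j Y : Ccont (fun Y => ai Y ^ j)%C Y.
Proof. eapply Rderiv_Ccont. apply Rderiv_ai_pow. Qed.

Lemma Cmod_ai_1 Y : Cmod (ai Y) <= 1.
Proof.
  unfold ai. rewrite Cmod_inv by (apply freq_neq_0, exp_pos).
  apply Rle_trans with (/ 1); [|rewrite Rinv_1; lra].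
  apply Rinv_le_contravar; [lra|]. eapply Rle_trans; [|apply Im_le_Cmod].
  change (1 <= Rabs 1). rewrite Rabs_R1. lra.
Qed.

Lemma Cmod_ai_exp Y : Cmod (ai Y) <= exp (- Y).
Proof.
  unfold ai. rewrite Cmod_inv by (apply freq_neq_0, exp_pos). rewrite exp_Ropp.
  apply Rinv_le_contravar; [apply exp_pos|]. eapply Rle_trans; [|apply re_le_Cmod].
  apply Rle_abs.
Qed.

Definition Aj (j : nat) (Y : R) : C := (RtoC (exp Y) * ai Y ^ j)%C.

Lemma Aj_Ccont j Y : Ccont (Aj j) Y.
Proof.
  apply Ccont_mult; [|apply ai_Ccont_pow]. apply Ccont_real. apply continuous_of_derivable. auto_derive; trivial.
Qed.

Lemma Aj_env j Y : (2 <= j)%nat -> Cmod (Aj j Y) <= 2 * env 1 Y.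
Proof.
  intros Hj. unfold Aj. rewrite Cmod_mult, Cmod_R, Rabs_pos_eq, Cmod_pow by (left; apply exp_pos).
  assert (P := exp_pos Y). assert (A0 := Cmod_ge_0 (ai Y)).
  assert (A1 := Cmod_ai_1 Y). assert (A2 := Cmod_ai_exp Y).
  assert (Hp : Cmod (ai Y) ^ j <= Cmod (ai Y) ^ 2).
  { replace j with (2 + (j - 2))%nat by lia. rewrite pow_add.
    assert (Cmod (ai Y) ^ (j - 2) <= 1).
    { rewrite <- (pow1 (j - 2)). apply pow_incr. lra. }
    assert (0 <= Cmod (ai Y) ^ 2) by apply pow2_ge_0.
    assert (0 <= Cmod (ai Y) ^ (j - 2)) by (apply pow_le; lra). nra. }
  assert (E : exp Y * exp (- Y) = 1) by (rewrite <- exp_plus, Rplus_opp_r; apply exp_0).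
  assert (PN := exp_pos (- Y)).
  replace 2 with (1 + 1) by ring. apply env_two; try lra.
  - rewrite !Rmult_1_l. simpl in Hp. nra.
  - rewrite !Rmult_1_l. apply Rle_trans with (exp Y * (exp (- Y) * exp (- Y))); [|nra].
    apply Rmult_le_compat_l; [lra|]. eapply Rle_trans; [apply Hp|]. simpl. rewrite Rmult_1_r. nra.
Qed.

Lemma env_X (g : C) B d Y : 0 < d -> 0 <= B -> Cmod g <= B * env d Y -> Cmod (RtoC Y * g) <= B * (2 / d) * env (d / 2) Y.
Proof.
  intros Hd HB H. rewrite Cmod_mult, Cmod_R.
  assert (H1 := abs_exp_bound (d / 2) Y 1 ltac:(lra)). rewrite pow_1 in H1. simpl fact in H1. simpl INR in H1.
  apply Rle_trans with (1 / (d / 2) ^ 1 * exp (d / 2 * Rabs Y) * (B * env d Y)).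
  - apply Rmult_le_compat; auto; [apply Rabs_pos|apply Cmod_ge_0].
  - right. rewrite <- env_half. unfold env at 2.
    replace (1 / (d / 2) ^ 1 * exp (d / 2 * Rabs Y) * (B * (env (d / 2) Y * exp (- (d / 2 * Rabs Y))))) with
      (B * (2 / d) * env (d / 2) Y * (exp (d / 2 * Rabs Y) * exp (- (d / 2 * Rabs Y)))) by (field; lra).
    rewrite <- exp_plus, Rplus_opp_r, exp_0. ring.
Qed.

Lemma Ccont_X Y : Ccont (fun X => RtoC X) Y.
Proof. apply Ccont_real, continuous_id. Qed.

Lemma AjX_exists j : (2 <= j)%nat -> CI isI (fun Y => RtoC Y * Aj j Y)%C (CII (fun Y => RtoC Y * Aj j Y)%C).
Proof.
  intros Hj. apply (CI_exists _ (2 * (2 / 1)) (1 / 2)); [lra| |].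
  - intros x. apply Ccont_mult; [apply Ccont_X|apply Aj_Ccont].
  - intros x. apply env_X; try lra. now apply Aj_env.
Qed.

Lemma Cpow_diff_le (a b : C) j : Cmod a <= 1 -> Cmod b <= 1 -> Cmod (a ^ j - b ^ j) <= INR j * Cmod (a - b).
Proof.
  intros Ha Hb. induction j as [|j IH].
  - simpl. replace (1 - 1)%C with (RtoC 0) by ring. rewrite Cmod_0. lra.
  - change (a ^ S j)%C with (a * a ^ j)%C. change (b ^ S j)%C with (b * b ^ j)%C.
    replace (a * a ^ j - b * b ^ j)%C with ((a - b) * a ^ j + b * (a ^ j - b ^ j))%C by ring.
    eapply Rle_trans; [apply Cmod_triangle|]. rewrite !Cmod_mult, S_INR, Cmod_pow.
    assert (Cmod a ^ j <= 1) by (rewrite <- (pow1 j); apply pow_incr; split; [apply Cmod_ge_0|auto]).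
    assert (0 <= Cmod a ^ j) by apply pow_le, Cmod_ge_0.
    assert (P1 := Cmod_ge_0 (a - b)). assert (P2 := Cmod_ge_0 (a ^ j - b ^ j)). assert (P3 := Cmod_ge_0 b). nra.
Qed.

Lemma CI_primitive (f F : R -> C) (A B : C) :
  (forall x, Rderiv F x (f x)) -> (forall x, Ccont f x) ->
  (forall eps, 0 < eps -> exists M, forall x, M <= x -> Cmod (F x - B) <= eps /\ Cmod (F (- x) - A) <= eps) ->
  CI isI f (B - A)%C.
Proof.
  intros HF Hf HL. split.
  - apply (isI_primitive _ (fun x => Re (F x)) (Re A) (Re B)).
    + intros x; exact (proj1 (HF x)).
    + intros x; exact (proj1 (Hf x)).
    + intros eps Heps. destruct (HL eps Heps) as [M HM]. exists M. intros x Hx. destruct (HM x Hx) as [H1 H2].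
      split; [eapply Rle_trans; [apply (re_le_Cmod (F x - B)%C)|exact H1]|eapply Rle_trans; [apply (re_le_Cmod (F (- x)%R - A)%C)|exact H2]].
  - apply (isI_primitive _ (fun x => Im (F x)) (Im A) (Im B)).
    + intros x; exact (proj2 (HF x)).
    + intros x; exact (proj2 (Hf x)).
    + intros eps Heps. destruct (HL eps Heps) as [M HM]. exists M. intros x Hx. destruct (HM x Hx) as [H1 H2].
      split; [eapply Rle_trans; [apply (Im_le_Cmod (F x - B)%C)|exact H1]|eapply Rle_trans; [apply (Im_le_Cmod (F (- x)%R - A)%C)|exact H2]].
Qed.

(** -ai^j / j is a primitive, and [ai] runs from 1/i = -i at -oo to 0 at +oo. *)
Lemma Aj_integral j : (1 <= j)%nat -> CI isI (Aj (S j)) ((- Ci) ^ j / RtoC (INR j))%C.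
Proof.
  intros Hj. assert (HJ : 0 < INR j) by (apply lt_0_INR; lia).
  assert (HJc : RtoC (INR j) <> 0%C) by (intros E; apply RtoC_inj in E; lra).
  replace ((- Ci) ^ j / RtoC (INR j))%C with (0 - (- / RtoC (INR j)) * (- Ci) ^ j)%C by (field; auto).
  assert (Hci : Cmod (- Ci) <= 1) by (rewrite Cmod_opp, Cmod_Ci; lra).
  assert (Hc : Cmod (- / RtoC (INR j)) = / INR j) by (rewrite Cmod_opp, Cmod_inv, Cmod_R, Rabs_pos_eq; auto; lra).
  apply (CI_primitive _ (fun Y => (- / RtoC (INR j)) * ai Y ^ j)%C).
  - intros x. eapply Rderiv_eq; [|apply (Rderiv_scal (- / RtoC (INR j))%C _ _ _ (Rderiv_ai_pow j x))].
    unfold Aj. change (ai x ^ S j)%C with (ai x * ai x ^ j)%C. field. auto.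
  - apply Aj_Ccont.
  - intros eps Heps. destruct (env_small 1 eps Rlt_0_1 Heps) as (M & HM0 & HM).
    exists M. intros x Hx. specialize (HM x). unfold env in HM. rewrite Rabs_pos_eq in HM by lra.
    specialize (HM Hx). rewrite Rmult_1_l in HM. split.
    + replace (- / RtoC (INR j) * ai x ^ j - 0)%C with (- / RtoC (INR j) * ai x ^ j)%C by ring.
      rewrite Cmod_mult, Hc, Cmod_pow.
      assert (H1 : Cmod (ai x) ^ j <= exp (- x)).
      { replace j with (1 + (j - 1))%nat by lia. rewrite pow_add, pow_1.
        assert (Cmod (ai x) ^ (j - 1) <= 1).
        { rewrite <- (pow1 (j - 1)). apply pow_incr. split; [apply Cmod_ge_0|apply Cmod_ai_1]. }
        assert (0 <= Cmod (ai x) ^ (j - 1)) by apply pow_le, Cmod_ge_0.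
        assert (A2 := Cmod_ai_exp x). assert (A0 := Cmod_ge_0 (ai x)). nra. }
      assert (/ INR j <= 1).
      { rewrite <- Rinv_1. apply Rinv_le_contravar; [lra|]. apply le_INR in Hj. exact Hj. }
      assert (0 < / INR j) by now apply Rinv_0_lt_compat.
      assert (0 <= Cmod (ai x) ^ j) by apply pow_le, Cmod_ge_0. nra.
    + replace (- / RtoC (INR j) * ai (- x) ^ j - - / RtoC (INR j) * (- Ci) ^ j)%C with
        (- / RtoC (INR j) * (ai (- x) ^ j - (- Ci) ^ j))%C by ring.
      rewrite Cmod_mult, Hc.
      assert (H1 := Cpow_diff_le (ai (- x)) (- Ci)%C j (Cmod_ai_1 _) Hci).
      assert (H2 : Cmod (ai (- x) - - Ci) <= exp (- x)).
      { replace (ai (- x) - - Ci)%C with (RtoC (exp (- x)) * (Ci * ai (- x)))%C.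
        - rewrite !Cmod_mult, Cmod_R, Cmod_Ci, Rabs_pos_eq by (left; apply exp_pos).
          assert (A1 := Cmod_ai_1 (- x)). assert (P := exp_pos (- x)). nra.
        - assert (E := ai_inv (- x)).
          assert (Ci2 : (Ci * Ci = -1)%C) by (apply C_ext; simpl; ring).
          transitivity (Ci * ((RtoC (exp (- x)) + Ci) * ai (- x)) - (Ci * Ci) * ai (- x))%C; [ring|].
          rewrite E, Ci2. ring. }
      apply Rle_trans with (/ INR j * (INR j * exp (- x))).
      * apply Rmult_le_compat_l; [left; now apply Rinv_0_lt_compat|]. eapply Rle_trans; [apply H1|].
        apply Rmult_le_compat_l; lra.
      * rewrite <- Rmult_assoc, Rinv_l by lra. lra.
Qed.

(** The derivative of Y Aj j has integral 0. With e^Y ai = 1 - i ai it involves only Aj j, Y Aj j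
    and Y Aj (j + 1), which yields a recursion. *)
Lemma AjX_step j m : (2 <= j)%nat -> CI isI (fun Y => RtoC Y * Aj j Y)%C m ->
  CI isI (fun Y => RtoC Y * Aj (S j) Y)%C (- Ci / RtoC (INR j) * (RtoC (INR (j - 1)) * m - (- Ci) ^ (j - 1) / RtoC (INR (j - 1))))%C.
Proof.
  intros Hj Hm.
  assert (HJ : 0 < INR j) by (apply lt_0_INR; lia).
  assert (HJc : RtoC (INR j) <> 0%C) by (intros E; apply RtoC_inj in E; lra).
  assert (Ej : INR j = INR (j - 1) + 1) by (rewrite <- S_INR; f_equal; lia).
  assert (Hn := Aj_integral (j - 1) ltac:(lia)). replace (S (j - 1)) with j in Hn by lia.
  assert (Ci2 : (Ci * Ci = -1)%C) by (apply C_ext; simpl; ring).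
  set (g := fun Y => (Aj j Y + (- RtoC (INR (j - 1))) * (RtoC Y * Aj j Y) + Ci * RtoC (INR j) * (RtoC Y * Aj (S j) Y))%C).
  assert (HXc : forall i x, Ccont (fun Y => RtoC Y * Aj i Y)%C x).
  { intros i x. apply Ccont_mult; [apply Ccont_X|apply Aj_Ccont]. }
  assert (H0 : CI isI g 0%C).
  { apply (CI_primitive_env _ (fun Y => RtoC Y * Aj j Y)%C (2 * (2 / 1)) (1 / 2)); [lra| | |].
    - intros x.
      assert (De : Rderiv (fun Y => RtoC (exp Y)) x (RtoC (exp x))).
      { split; simpl; auto_derive; trivial; ring. }
      assert (DX : is_derive (fun Y : R => Y) x 1) by apply (is_derive_id (K:=R_AbsRing) x).
      eapply Rderiv_eq; [|apply (Rderiv_mult (fun Y => Y) (Aj j) x _ _ DX (Rderiv_Cmult _ _ _ _ _ De (Rderiv_ai_pow j x)))].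
      unfold g, Aj.
      assert (E := ai_inv x). set (e := RtoC (exp x)) in *. set (a := ai x) in *.
      assert (E2 : (e * a)%C = (1 - Ci * a)%C) by (rewrite <- E; ring).
      change (a ^ S j)%C with (a * a ^ j)%C.
      transitivity (e * a ^ j + RtoC x * (e * a ^ j) - RtoC x * RtoC (INR j) * e * a ^ j * (1 - Ci * a))%C.
      + rewrite <- E2. ring.
      + rewrite Ej, RtoC_plus. ring.
    - intros x. apply Ccont_plus; [apply Ccont_plus|]; [apply Aj_Ccont| |];
        (apply Ccont_mult; [apply Ccont_const|apply HXc]).
    - intros x. apply env_X; try lra. now apply Aj_env. }
  assert (HM := AjX_exists (S j) ltac:(lia)). set (M := CII (fun Y => RtoC Y * Aj (S j) Y)%C) in *.
  assert (Hs := CI_plus _ _ _ _ _ _ _ (is_integral_isI 1 Rlt_0_1)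
     (CI_plus _ _ _ _ _ _ _ (is_integral_isI 1 Rlt_0_1) Hn
        (CI_scal _ _ _ _ _ (- RtoC (INR (j - 1)))%C (is_integral_isI 1 Rlt_0_1) Hm))
     (CI_scal _ _ _ _ _ (Ci * RtoC (INR j))%C (is_integral_isI 1 Rlt_0_1) HM)).
  assert (Eq := CI_unique _ _ _ Hs H0). 
  set (n := ((- Ci) ^ (j - 1) / RtoC (INR (j - 1)))%C) in *.
  replace (- Ci / RtoC (INR j) * (RtoC (INR (j - 1)) * m - n))%C with M; [exact HM|].
  transitivity (- (Ci * Ci) * RtoC (INR j) / RtoC (INR j) * M)%C; [rewrite Ci2; field; auto|].
  transitivity (- Ci / RtoC (INR j) * ((n + - RtoC (INR (j - 1)) * m + Ci * RtoC (INR j) * M) + (RtoC (INR (j - 1)) * m - n)))%C; [field; auto|].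
  rewrite Eq. ring.
Qed.

Lemma isI_reflect f l : isI f l -> isI (fun x => f (- x)) l.
Proof.
  intros [Hf If]. split.
  - intros x. apply (continuous_comp (fun x => - x) f); auto. apply continuous_of_derivable; auto_derive; trivial.
  - intros eps Heps. destruct (If eps Heps) as [M HM]. exists M. intros a b Ha Hb.
    rewrite RInt_reflect by auto. apply HM; lra.
Qed.

(** The imaginary part of e^Y/(e^Y + i)^2 is even in Y, so its product with Y is odd. That the base
    moment is real is all that has to be known about it. *)
Lemma A2X_Im m : CI isI (fun Y => RtoC Y * Aj 2 Y)%C m -> Im m = 0.
Proof.
  intros [_ H]. assert (Hr := isI_reflect _ _ H).
  assert (Ho : isI (fun Y => Im (RtoC Y * Aj 2 Y)%C) (-1 * Im m)).
  { apply (isI_ext (fun Y => -1 * Im (RtoC (- Y) * Aj 2 (- Y))%C)); [|now apply isI_scal].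
    intros Y. unfold Aj, ai. cbn [Cpow]. unfold Cinv, Cmult, RtoC; simpl. rewrite exp_Ropp.
    assert (P := exp_pos Y). set (e := exp Y) in *. eqR. field.
    repeat split; nra. }
  assert (E := isI_unique _ _ _ H Ho). lra.
Qed.

Fixpoint harm (k : nat) : R := match k with O => 0 | S j => harm j + / INR (S j) end.

Lemma AjX_integral k m : CI isI (fun Y => RtoC Y * Aj 2 Y)%C m ->
  CI isI (fun Y => RtoC Y * Aj (S (S k)) Y)%C ((- Ci) ^ S k / RtoC (INR (S k)) * (Ci * m - RtoC (harm k)))%C.
Proof.
  intros Hm.
  assert (Ci2 : (Ci * Ci = -1)%C) by (apply C_ext; simpl; ring).
  induction k as [|k IH].
  - replace ((- Ci) ^ 1 / RtoC (INR 1) * (Ci * m - RtoC (harm 0)))%C with m; [exact Hm|].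
    simpl. replace (- Ci * 1 / 1 * (Ci * m - 0))%C with (- (Ci * Ci) * m)%C by field. rewrite Ci2. ring.
  - assert (H := AjX_step (S (S k)) _ ltac:(lia) IH).
    replace (S (S k) - 1)%nat with (S k) in H by lia.
    assert (N1 : RtoC (INR (S k)) <> 0%C) by (intros E; apply RtoC_inj in E; revert E; apply Rgt_not_eq, INR_S_pos).
    assert (N2 : RtoC (INR (S (S k))) <> 0%C) by (intros E; apply RtoC_inj in E; revert E; apply Rgt_not_eq, INR_S_pos).
    eapply eq_ind; [exact H|].
    change ((- Ci) ^ S (S k))%C with (- Ci * (- Ci) ^ S k)%C.
    change (harm (S k)) with (harm k + / INR (S k)). rewrite RtoC_plus, RtoC_inv by (apply Rgt_not_eq, INR_S_pos).
    revert N1 N2. generalize (RtoC (INR (S k))) (RtoC (INR (S (S k)))) ((- Ci) ^ S k)%C (RtoC (harm k)).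
    intros u v w h N1 N2. field. auto.
Qed.

Definition bn (q n : nat) : R := 2 * PI * INR (S n) / INR q.

Lemma bn_pos q n : (1 <= q)%nat -> 0 < bn q n.
Proof.
  intros Hq. unfold bn. apply Rdiv_lt_0_compat; [|apply lt_0_INR; lia].
  pose proof PI_RGT_0. pose proof (INR_S_pos n). nra.
Qed.

Lemma bn_ge q n : (1 <= q)%nat -> INR (S n) / INR q <= bn q n.
Proof.
  intros Hq. unfold bn. assert (HQ : 0 < INR q) by (apply lt_0_INR; lia).
  apply Rmult_le_compat_r; [left; now apply Rinv_0_lt_compat|].
  pose proof PI2_1. pose proof (INR_S_pos n). nra.
Qed.

Lemma rr_scale q k n X : (1 <= q)%nat ->
  rr q (S k) (exp X) n * exp X = / bn q n ^ S k * Re (Aj (S (S k)) (X - ln (bn q n))).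
Proof.
  intros Hq. assert (Hb := bn_pos q n Hq). unfold rr. fold (bn q n). set (b := bn q n) in *.
  assert (Ez : ((exp X, b) : C) = (RtoC b * (exp (X - ln b), 1%R))%C).
  { assert (E : exp X = b * exp (X - ln b)).
    { unfold Rminus. rewrite exp_plus, exp_Ropp, exp_ln by auto. field. lra. }
    apply C_ext; simpl; [rewrite E at 1|]; ring. }
  assert (Hne : ((exp (X - ln b), 1%R) : C) <> 0%C) by apply freq_neq_0, exp_pos.
  assert (Hbc : RtoC b <> 0%C) by (intros E; apply RtoC_inj in E; lra).
  rewrite Ez, Cpow_mult_l, <- RtoC_pow.
  assert (Ei : (/ (RtoC (b ^ S (S k)) * (exp (X - ln b), 1%R) ^ S (S k)))%C = (RtoC (/ b ^ S (S k)) * ai (X - ln b) ^ S (S k))%C).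
  { unfold ai. rewrite Cpow_inv by auto. rewrite RtoC_inv by (apply pow_nonzero; lra).
    assert (N1 : ((exp (X - ln b), 1%R) ^ S (S k))%C <> 0%C) by now apply Cpow_nz.
    assert (N2 : RtoC (b ^ S (S k)) <> 0%C) by (intros E; apply RtoC_inj in E; revert E; apply pow_nonzero; lra).
    revert N1 N2. generalize ((exp (X - ln b), 1%R) ^ S (S k))%C (RtoC (b ^ S (S k))). intros u v Hu Hv. field. auto. }
  rewrite Ei. unfold Aj.
  assert (E : exp X = b * exp (X - ln b)).
  { unfold Rminus. rewrite exp_plus, exp_Ropp, exp_ln by auto. field. lra. }
  rewrite E at 1. set (e := exp (X - ln b)).
  destruct (ai (X - ln b) ^ S (S k))%C as [u v]. 
  cbn [Re Im Cmult RtoC fst snd]. rewrite <- (tech_pow_Rmult b (S k)). field. split; [apply pow_nonzero|]; lra.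
Qed.

Lemma minus_Ci_even_pow j : ((- Ci) ^ (2 * j))%C = RtoC ((-1) ^ j).
Proof.
  induction j as [|j IH]; [reflexivity|].
  replace (2 * S j)%nat with (S (S (2 * j))) by lia.
  change ((- Ci) ^ S (S (2 * j)))%C with (- Ci * (- Ci * (- Ci) ^ (2 * j)))%C. rewrite IH.
  apply C_ext; simpl; ring.
Qed.

(** The value of (-i)^(k+1), real because k is odd. *)
Definition esign (k : nat) : R := (-1) ^ ((k + 1) / 2).

Lemma minus_Ci_pow_S k : Nat.Odd k -> ((- Ci) ^ S k)%C = RtoC (esign k).
Proof.
  intros [j Hj]. unfold esign. replace ((k + 1) / 2)%nat with (S j).
  - replace (S k) with (2 * S j)%nat by lia. apply minus_Ci_even_pow.
  - subst. replace (2 * j + 1 + 1)%nat with (S j * 2)%nat by lia. now rewrite Nat.div_mul.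
Qed.

Lemma ReA_integral k : Nat.Odd k -> isI (fun Y => Re (Aj (S (S k)) Y)) (esign k / INR (S k)).
Proof.
  intros Hk. destruct (Aj_integral (S k) ltac:(lia)) as [H _].
  rewrite minus_Ci_pow_S, <- RtoC_div in H by (auto; apply Rgt_not_eq, INR_S_pos). exact H.
Qed.

(** The base moment m enters as i m times a real factor. As m is real this is purely imaginary, and
    the real part keeps only the harmonic number. *)
Lemma ReAX_integral k : Nat.Odd k ->
  isI (fun Y => Y * Re (Aj (S (S k)) Y)) (- esign k / INR (S k) * harm k).
Proof.
  intros Hk. assert (Hm := AjX_exists 2 (le_n 2)). set (m := CII (fun Y => RtoC Y * Aj 2 Y)%C) in *.
  assert (Him := A2X_Im m Hm).
  destruct (AjX_integral k m Hm) as [H _].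
  rewrite minus_Ci_pow_S, <- RtoC_div in H by (auto; apply Rgt_not_eq, INR_S_pos).
  set (c := esign k / INR (S k)) in *.
  apply (isI_ext (fun Y => Re (RtoC Y * Aj (S (S k)) Y)%C)).
  - intros Y. unfold Re, Im. simpl. ring.
  - replace (- esign k / INR (S k) * harm k) with (Re (c * (Ci * m - harm k))%C); [exact H|].
    replace (- esign k / INR (S k) * harm k) with (- c * harm k) by (unfold c, Rdiv; ring).
    clearbody c. destruct m as [m1 m2]. simpl in Him |- *. subst m2. ring.
Qed.

(** Scaling by b_n is a shift of X by ln b_n, which adds ln b_n to the first moment: this is the
    origin of the logarithms in L'(-k). *)
Lemma rr_integral q k n : (1 <= q)%nat -> Nat.Odd k ->
  isI (fun X => rr q (S k) (exp X) n * exp X) (/ bn q n ^ S k * (esign k / INR (S k))) /\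
  isI (fun X => X * (rr q (S k) (exp X) n * exp X))
    (/ bn q n ^ S k * (esign k / INR (S k)) * (ln (bn q n) - harm k)).
Proof.
  intros Hq Hk. set (b := bn q n).
  assert (H1 := isI_shift _ _ (- ln b) (ReA_integral k Hk)).
  assert (H2 := isI_shift _ _ (- ln b) (ReAX_integral k Hk)).
  split.
  - eapply isI_ext; [|apply (isI_scal (/ b ^ S k) _ _ H1)].
    intros X. cbv beta. rewrite rr_scale by auto. reflexivity.
  - assert (H3 := isI_scal (/ b ^ S k) _ _ (isI_plus _ _ _ _ H2 (isI_scal (ln b) _ _ H1))).
    replace (/ b ^ S k * (esign k / INR (S k)) * (ln b - harm k)) with
      (/ b ^ S k * (- esign k / INR (S k) * harm k + ln b * (esign k / INR (S k)))) by (unfold Rdiv; ring).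
    eapply isI_ext; [|exact H3]. intros X. cbv beta. rewrite rr_scale by auto. fold b. unfold Rminus. ring.
Qed.

Lemma Rabs_rr_le q k t n r : 0 < r -> r <= Cmod (t, bn q n) -> Rabs (rr q k t n) <= / r ^ S k.
Proof.
  intros Hr H. unfold rr. fold (bn q n). eapply Rle_trans; [apply re_le_Cmod|].
  apply Cmod_inv_pow_le. lra.
Qed.

(** The case k = 1 offers just v^(-3) e^X. Spending v >= e^X so as to leave e^(X/2) or e^(-X/2)
    keeps b^(-5/2) or b^(-3/2), both summable in n. *)
Lemma inv_pow3_env (v b X : R) : 0 < b -> b <= v -> exp X <= v ->
  / v ^ 3 * exp X <= (/ (b * sqrt b) * / b + / (b * sqrt b)) * env (1 / 2) X.
Proof.
  intros Hb Hbv Hxv. assert (PX := exp_pos X).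
  set (y := exp (1 / 2 * X)). assert (Py : 0 < y) by apply exp_pos.
  assert (Ey : exp X = y * y) by (unfold y; rewrite <- exp_plus; f_equal; field).
  set (s := sqrt v). assert (Ps : 0 < s) by (apply sqrt_lt_R0; lra).
  assert (Es : v = s * s) by (unfold s; rewrite sqrt_sqrt; lra).
  set (be := sqrt b). assert (Pb : 0 < be) by (apply sqrt_lt_R0; lra).
  assert (Eb : b = be * be) by (unfold be; rewrite sqrt_sqrt; lra).
  assert (Hys : y <= s) by nra. assert (Hbs : be <= s) by nra.
  assert (Ey' : exp (- (1 / 2 * X)) = / y) by (unfold y; apply exp_Ropp).
  assert (P3 : be ^ 3 <= s ^ 3) by (apply pow_incr; lra).
  assert (P5 : be ^ 5 <= s ^ 5) by (apply pow_incr; lra).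
  assert (Q3 : 0 < be ^ 3) by (apply pow_lt; lra). assert (Q5 : 0 < be ^ 5) by (apply pow_lt; lra).
  apply env_two.
  - fold y. rewrite Ey, Es, Eb.
    replace (/ (be * be * be) * / (be * be) * y) with (/ be ^ 5 * y) by (field; lra).
    apply Rle_trans with (/ s ^ 5 * y).
    + replace (/ (s * s) ^ 3 * (y * y)) with (/ s ^ 5 * y * (y / s)) by (field; lra).
      assert (0 < / s ^ 5) by (apply Rinv_0_lt_compat, pow_lt; lra).
      assert (y / s <= 1) by (apply (Rmult_le_reg_r s); auto; field_simplify; lra).
      assert (0 < / s ^ 5 * y) by (apply Rmult_lt_0_compat; lra). nra.
    + apply Rmult_le_compat_r; [lra|]. now apply Rinv_le_contravar.
  - rewrite Ey', Ey, Es, Eb.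
    replace (/ (be * be * be)) with (/ be ^ 3) by (field; lra).
    apply Rle_trans with (/ s ^ 3 * / y).
    + replace (/ (s * s) ^ 3 * (y * y)) with (/ s ^ 3 * / y * (y / s) ^ 3) by (field; lra).
      assert (0 < / s ^ 3) by (apply Rinv_0_lt_compat, pow_lt; lra).
      assert (0 < / y) by now apply Rinv_0_lt_compat.
      assert (y / s <= 1) by (apply (Rmult_le_reg_r s); auto; field_simplify; lra).
      assert (0 <= y / s) by (apply Rdiv_le_0_compat; lra).
      assert ((y / s) ^ 3 <= 1) by (rewrite <- (pow1 3); apply pow_incr; lra).
      assert (0 < / s ^ 3 * / y) by (apply Rmult_lt_0_compat; lra). nra.
    + apply Rmult_le_compat_r; [left; now apply Rinv_0_lt_compat|]. now apply Rinv_le_contravar.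
  - apply Rmult_le_pos; left; apply Rinv_0_lt_compat; auto. apply Rmult_lt_0_compat; auto.
  - left; apply Rinv_0_lt_compat. apply Rmult_lt_0_compat; auto.
Qed.

Lemma rr_env q k : (1 <= q)%nat -> (1 <= k)%nat -> exists B, 0 <= B /\
  forall n X, Rabs (rr q (S k) (exp X) n * exp X) <= B * z32 n * env (1 / 2) X.
Proof.
  intros Hq Hk. assert (HQ : 1 <= INR q) by (apply le_INR in Hq; exact Hq).
  set (Q := INR q) in *. set (sq := sqrt Q).
  assert (Psq : 0 < sq) by (apply sqrt_lt_R0; lra).
  exists (Q ^ (k - 1) * (Q * sq * Q + Q * sq)). split.
  { apply Rmult_le_pos; [apply pow_le; lra|]. nra. }
  intros n X. assert (Hn := INR_S_pos n).
  set (v := Cmod (exp X, bn q n)). set (b := INR (S n) / Q).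
  assert (Hb : 0 < b) by (apply Rdiv_lt_0_compat; lra).
  assert (PX := exp_pos X).
  assert (Hbv : b <= v).
  { eapply Rle_trans; [apply (bn_ge q n Hq)|]. unfold v. eapply Rle_trans; [|apply Im_le_Cmod]. simpl. apply Rle_abs. }
  assert (Hxv : exp X <= v).
  { unfold v. eapply Rle_trans; [|apply re_le_Cmod]. simpl. apply Rle_abs. }
  rewrite Rabs_mult, (Rabs_pos_eq (exp X)) by lra.
  assert (Hr := Rabs_rr_le q (S k) (exp X) n v ltac:(lra) ltac:(unfold v; lra)).
  replace (S (S k)) with ((k - 1) + 3)%nat in Hr by lia. rewrite pow_add, Rinv_mult in Hr.
  assert (Hk1 : / v ^ (k - 1) <= Q ^ (k - 1)).
  { apply Rle_trans with (/ (/ Q) ^ (k - 1)).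
    - apply Rinv_le_contravar; [apply pow_lt, Rinv_0_lt_compat; lra|]. apply pow_incr. split.
      + left; apply Rinv_0_lt_compat; lra.
      + eapply Rle_trans; [|apply Hbv]. unfold b. rewrite <- (Rmult_1_l (/ Q)). apply Rmult_le_compat_r.
        * left; apply Rinv_0_lt_compat; lra.
        * rewrite S_INR. pose proof (pos_INR n). lra.
    - rewrite pow_inv, Rinv_inv. lra. }
  assert (H3 := inv_pow3_env v b X Hb Hbv Hxv).
  assert (Eb : / (b * sqrt b) = Q * sq * z32 n).
  { unfold b, z32, sq. rewrite sqrt_div_alt by lra. field.
    repeat split; try lra; apply Rgt_not_eq; try apply sqrt_lt_R0; lra. }
  assert (Hib : / b <= Q).
  { unfold b, Rdiv. rewrite Rinv_mult, Rinv_inv. 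
    assert (/ INR (S n) <= 1).
    { rewrite <- Rinv_1. apply Rinv_le_contravar; [lra|]. rewrite S_INR. pose proof (pos_INR n). lra. }
    nra. }
  assert (Pz := z32_pos n). assert (Pe := env_pos (1 / 2) X).
  apply Rle_trans with (Q ^ (k - 1) * (/ v ^ 3 * exp X)).
  { rewrite <- Rmult_assoc. apply Rmult_le_compat_r; [lra|]. eapply Rle_trans; [apply Hr|].
    apply Rmult_le_compat_r; auto. left; apply Rinv_0_lt_compat, pow_lt. lra. }
  rewrite !Rmult_assoc. apply Rmult_le_compat_l; [apply pow_le; lra|].
  eapply Rle_trans; [apply H3|]. rewrite Eb, <- Rmult_assoc. apply Rmult_le_compat_r; [lra|].
  assert (0 < Q * sq * z32 n) by (apply Rmult_lt_0_compat; [nra|lra]).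
  assert (Q * sq * z32 n * / b <= Q * sq * z32 n * Q) by (apply Rmult_le_compat_l; lra). nra.
Qed.

(** Terms of (q / 2 pi)^(k+1) L(k + 1, conj chi). *)
Definition lam (q : nat) (chi : nat -> C) (k : nat) (n : nat) : C := (Cconj (chi (S n)) * RtoC (/ bn q n ^ S k))%C.

(** Combined with [mellin_L], the first identity is the functional equation at s = -k and the second
    its logarithmic companion. *)
Lemma mellin_phiF_1 q chi k : is_dirichlet_character q chi -> ~ is_principal q chi ->
  is_even_char q chi -> is_primitive_char q chi -> Nat.Odd k ->
  exists L0 L1 : C, csums (lam q chi k) L0 /\
    csums (fun n => lam q chi k n * RtoC (ln (bn q n)))%C L1 /\
    mellin (phiF q chi (S k)) 1 = (RtoC (2 * INR (fact k) / INR q * esign k) * gauss_sum q chi * L0)%C /\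
    mellin' (phiF q chi (S k)) 1 =
      (RtoC (2 * INR (fact k) / INR q * esign k) * gauss_sum q chi * (L1 - RtoC (harm k) * L0))%C.
Proof.
  intros Hchi Hnp Hev Hprim Hk.
  assert (Hq : (1 <= q)%nat) by apply Hchi.
  assert (Hk1 : (1 <= k)%nat) by (destruct Hk; lia).
  assert (HQ : 0 < INR q) by (apply lt_0_INR; lia).
  assert (Hfk : INR (S k) <> 0) by apply Rgt_not_eq, INR_S_pos.
  set (D1 := (RtoC (2 * INR (fact (S k)) / INR q) * gauss_sum q chi)%C).
  set (ek := esign k / INR (S k)).
  destruct (rr_env q k Hq Hk1) as (B & PB & HB).
  assert (Hrap := rapid_phiF q chi (S k) Hchi Hnp Hev Hprim ltac:(lia)).
  assert (Hex : forall c, ex_series (fun n => c * z32 n)).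
  { intros c. apply (ex_series_scal (V:=R_NormedModule) c). apply ex_series_z32. }
  assert (Hce : forall X, cexp (1 * RtoC X) = RtoC (exp X)).
  { intros X. rewrite Cmult_1_l. apply cexp_R. }
  assert (Hser : forall X, csums (dual_term q chi (S k) (exp X)) (Cser (dual_term q chi (S k) (exp X)))).
  { intros X. apply dual_csums; [auto|lia|apply exp_pos]. }
  assert (Hch : forall n, Cmod (D1 * Cconj (chi (S n)))%C <= Cmod D1).
  { intros n. rewrite Cmod_mult, Cmod_conj. assert (A := chi_bound q chi (S n) Hchi).
    assert (A0 := Cmod_ge_0 D1). assert (A1 := Cmod_ge_0 (chi (S n))). nra. }
  assert (S0 : csums (fun n => (D1 * Cconj (chi (S n))) * RtoC (/ bn q n ^ S k * ek))%C (mellin (phiF q chi (S k)) 1)).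
  { apply (integral_csums _ _ _ (is_integral_isI (1/2) ltac:(lra))
      (fun n X => (D1 * Cconj (chi (S n))) * RtoC (rr q (S k) (exp X) n * exp X))%C _ (fun n => Cmod D1 * B * z32 n)
      (fun X => phiF q chi (S k) X * cexp (1 * RtoC X))%C); auto.
    - intros n. apply (CI_real _ _ _ _ _ _ (is_integral_isI (1/2) ltac:(lra))). now apply rr_integral.
    - intros n X. rewrite Cmod_mult, Cmod_R, !Rmult_assoc. apply Rmult_le_compat; auto; try apply Cmod_ge_0; try apply Rabs_pos.
      rewrite <- Rmult_assoc. apply HB.
    - intros X. rewrite Hce. unfold phiF. fold D1.
      replace (D1 * Cser (dual_term q chi (S k) (exp X)) * RtoC (exp X))%C with
        (D1 * RtoC (exp X) * Cser (dual_term q chi (S k) (exp X)))%C by ring.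
      eapply csums_ext; [|apply csums_scal; apply Hser]. intros n. unfold dual_term. cbv beta. rewrite RtoC_mult. ring.
    - apply mellin_correct; auto. simpl; lra. }
  assert (S1 : csums (fun n => (D1 * Cconj (chi (S n))) * RtoC (/ bn q n ^ S k * ek * (ln (bn q n) - harm k)))%C (mellin' (phiF q chi (S k)) 1)).
  { apply (integral_csums _ _ _ (is_integral_isI (1/2/2) ltac:(lra))
      (fun n X => (D1 * Cconj (chi (S n))) * RtoC (X * (rr q (S k) (exp X) n * exp X)))%C _ (fun n => Cmod D1 * (B * (2 / (1/2))) * z32 n)
      (fun X => phiF q chi (S k) X * cexp (1 * RtoC X) * RtoC X)%C); auto.
    - intros n. apply (CI_real _ _ _ _ _ _ (is_integral_isI (1/2/2) ltac:(lra))). now apply rr_integral.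
    - intros n X. rewrite Cmod_mult, !Rmult_assoc. apply Rmult_le_compat; auto; try apply Cmod_ge_0.
      rewrite RtoC_mult.
      replace (B * (2 / (1 / 2) * (z32 n * env (1 / 2 / 2) X))) with (B * z32 n * (2 / (1 / 2)) * env (1 / 2 / 2) X) by ring.
      apply env_X; [lra|pose proof (z32_pos n); nra|]. rewrite Cmod_R. apply HB.
    - intros X. rewrite Hce. unfold phiF. fold D1.
      replace (D1 * Cser (dual_term q chi (S k) (exp X)) * RtoC (exp X) * RtoC X)%C with
        (D1 * RtoC (exp X) * RtoC X * Cser (dual_term q chi (S k) (exp X)))%C by ring.
      eapply csums_ext; [|apply csums_scal; apply Hser]. intros n. unfold dual_term. cbv beta. rewrite !RtoC_mult. ring.
    - apply mellin'_correct; auto. simpl; lra. }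
  assert (Hlam : forall n, Cmod (lam q chi k n) <= INR q ^ S k * / INR (S n) ^ 2).
  { intros n. unfold lam. rewrite Cmod_mult, Cmod_conj, Cmod_R.
    assert (Hb := bn_pos q n Hq). assert (Hg := bn_ge q n Hq). assert (Hn := INR_S_pos n).
    assert (H1 : 1 <= INR (S n)) by (rewrite S_INR; pose proof (pos_INR n); lra).
    rewrite Rabs_pos_eq by (left; apply Rinv_0_lt_compat, pow_lt; lra).
    assert (H2 : / bn q n ^ S k <= INR q ^ S k * / INR (S n) ^ 2).
    { apply Rle_trans with (/ (INR (S n) / INR q) ^ S k).
      - apply Rinv_le_contravar; [apply pow_lt, Rdiv_lt_0_compat; lra|]. apply pow_incr. split; auto.
        apply Rdiv_le_0_compat; lra.
      - unfold Rdiv. rewrite Rpow_mult_distr, Rinv_mult, pow_inv, Rinv_inv, Rmult_comm.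
        apply Rmult_le_compat_l; [apply pow_le; lra|].
        apply Rinv_le_contravar; [apply pow_lt; lra|]. apply Rle_pow; auto. lia. }
    assert (A := chi_bound q chi (S n) Hchi). assert (A1 := Cmod_ge_0 (chi (S n))).
    assert (0 < / bn q n ^ S k) by (apply Rinv_0_lt_compat, pow_lt; lra). nra. }
  destruct (csums_dom_exists (lam q chi k) _ Hlam (ex_series_dual_bound q k)) as [L0 HL0].
  assert (Hek : ek <> 0).
  { unfold ek, esign. apply Rmult_integral_contrapositive. split; [apply pow_nonzero; lra|now apply Rinv_neq_0_compat]. }
  assert (ED : (D1 * RtoC ek)%C = (RtoC (2 * INR (fact k) / INR q * esign k) * gauss_sum q chi)%C).
  { unfold D1. replace (2 * INR (fact k) / INR q * esign k) with (2 * INR (fact (S k)) / INR q * ek).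
    - rewrite RtoC_mult. ring.
    - unfold ek. rewrite fact_simpl, mult_INR. field. split; lra. }
  set (D0 := (RtoC (2 * INR (fact k) / INR q * esign k) * gauss_sum q chi)%C) in *.
  assert (HD0 : D0 <> 0%C).
  { apply Cmod_gt_0. unfold D0. rewrite Cmod_mult.
    apply Rmult_lt_0_compat; apply Cmod_gt_0; [|now apply gauss_sum_neq_0].
    intros E. apply RtoC_inj in E. revert E.
    unfold Rdiv. repeat apply Rmult_integral_contrapositive_currified; try lra.
    - apply INR_fact_neq_0.
    - apply Rinv_neq_0_compat; lra.
    - apply pow_nonzero; lra. }
  (* The series with logarithms is not estimated directly: its convergence is inherited from [S1]
     after division by [D0], which is nonzero because tau is. *)
  exists L0, (/ D0 * mellin' (phiF q chi (S k)) 1 + RtoC (harm k) * L0)%C.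
  split; [exact HL0|]. split; [|split].
  - eapply csums_ext; [|apply (csums_plus _ _ _ _ (csums_scal _ (/ D0)%C _ S1) (csums_scal _ (RtoC (harm k)) _ HL0))].
    intros n. cbv beta. unfold lam. rewrite !RtoC_mult, RtoC_minus.
    replace (D1 * Cconj (chi (S n)) * (RtoC (/ bn q n ^ S k) * RtoC ek * (RtoC (ln (bn q n)) - RtoC (harm k))))%C with
      ((D1 * RtoC ek) * (Cconj (chi (S n)) * RtoC (/ bn q n ^ S k) * (RtoC (ln (bn q n)) - RtoC (harm k))))%C by ring.
    rewrite ED. field. exact HD0.
  - eapply csums_unique; [exact S0|]. eapply csums_ext; [|apply (csums_scal _ D0 _ HL0)].
    intros n. cbv beta. unfold lam. rewrite !RtoC_mult, <- ED. ring.
  - field. exact HD0.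
Qed.

(** * The kernel integral *)

Lemma is_series_telescope (u : nat -> R) (l : R) : is_lim_seq u l -> is_series (fun d => u (S d) - u d) (l - u O).
Proof.
  intros Hu. change (is_lim_seq (sum_n (fun d => u (S d) - u d)) (l - u O)).
  apply (is_lim_seq_ext (fun N => u (S N) - u O)).
  - induction n as [|n IH]; [now rewrite sum_O|]. rewrite sum_Sn, <- IH. plusR. ring.
  - apply is_lim_seq_minus'; [exact (proj1 (is_lim_seq_incr_1 u l) Hu)|apply is_lim_seq_const].
Qed.

(** The second fraction is what the d-th exponential of [hk] contributes to the kernel integral; the
    harmonic term makes the series converge. For k = 0 the sum is digamma(y + 1) + gamma. *)
Definition phi_term (k : nat) (y : R) (d : nat) : R :=
  / INR (S d) - INR (S d) ^ k / (INR (S d) + y) ^ S k.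

Definition phi_step (k : nat) (y : R) (d : nat) : R :=
  y * INR (S d) ^ k / (INR (S d) + y) ^ S (S k).

Lemma phi_term_S k y d : 0 < y -> phi_term (S k) y d = phi_term k y d + phi_step k y d.
Proof.
  intros Hy. unfold phi_term, phi_step. assert (Hd := INR_S_pos d). set (p := INR (S d)) in *.
  rewrite <- !tech_pow_Rmult. field. repeat split; try apply pow_nonzero; lra.
Qed.

Lemma pow_diff_bounds (a b : R) k : 0 <= b <= a ->
  INR (S k) * b ^ k * (a - b) <= a ^ S k - b ^ S k <= INR (S k) * a ^ k * (a - b).
Proof.
  intros Hab. induction k as [|k IH].
  - simpl. lra.
  - rewrite (S_INR (S k)). rewrite <- (tech_pow_Rmult a (S k)), <- (tech_pow_Rmult b (S k)).
    rewrite <- (tech_pow_Rmult a k) in *. rewrite <- (tech_pow_Rmult b k) in *.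
    assert (Pa : 0 <= a ^ k) by (apply pow_le; lra). assert (Pb : 0 <= b ^ k) by (apply pow_le; lra).
    assert (Hpow : b ^ k <= a ^ k) by (apply pow_incr; lra).
    set (c := INR (S k)) in *. assert (Hc : 0 <= c) by apply pos_INR.
    destruct IH as [I1 I2]. split.
    + apply Rle_trans with (b * (a * a ^ k - b * b ^ k) + (a - b) * (b * b ^ k)).
      * assert (b * (c * b ^ k * (a - b)) <= b * (a * a ^ k - b * b ^ k)) by (apply Rmult_le_compat_l; lra). nra.
      * assert (0 <= (a - b) * (a * a ^ k - b * b ^ k)) by (apply Rmult_le_pos; nra). nra.
    + apply Rle_trans with (a * (a * a ^ k - b * b ^ k) + (a - b) * (a * a ^ k)).
      * assert (0 <= (a - b) * (a * a ^ k - b * b ^ k)) by (apply Rmult_le_pos; nra). nra.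
      * assert (a * (a * a ^ k - b * b ^ k) <= a * (c * a ^ k * (a - b))) by (apply Rmult_le_compat_l; lra). nra.
Qed.

(** As a function of a real d, its derivative is y d^k / (d + y)^(k+2), the shape of [phi_step]. It
    grows from 0 to 1/(k + 1), so the sum of the steps is compared with that total. *)
Definition pfrac (k : nat) (y : R) (d : nat) : R := (INR d / (INR d + y)) ^ S k / INR (S k).

Lemma pfrac_lim k y : 0 < y -> is_lim_seq (pfrac k y) (/ INR (S k)).
Proof.
  intros Hy. unfold pfrac.
  assert (H1 : is_lim_seq (fun d => INR d / (INR d + y)) 1).
  { apply (is_lim_seq_ext (fun d => 1 - y * / (INR d + y))).
    - intros d. pose proof (pos_INR d). field. lra.
    - replace 1 with (1 - y * 0) at 1 by ring. apply is_lim_seq_minus'; [apply is_lim_seq_const|].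
      apply (is_lim_seq_scal_l _ y 0). apply (is_lim_seq_inv _ p_infty); [|discriminate].
      apply (is_lim_seq_plus _ _ p_infty y); [apply is_lim_seq_INR|apply is_lim_seq_const|reflexivity]. }
  assert (H2 : forall j, is_lim_seq (fun d => (INR d / (INR d + y)) ^ j) 1).
  { induction j as [|j IH]; simpl; [apply is_lim_seq_const|].
    replace 1 with (1 * 1) by ring. now apply is_lim_seq_mult'. }
  replace (/ INR (S k)) with (1 * / INR (S k)) by ring.
  apply is_lim_seq_mult'; [apply H2|apply is_lim_seq_const].
Qed.

Lemma pfrac_diff k y d : 0 < y -> 0 <= pfrac k y (S d) - pfrac k y d.
Proof.
  intros Hy. unfold pfrac. assert (Hd := pos_INR d). assert (Hk := INR_S_pos k).
  assert (H : 0 <= INR d / (INR d + y) <= INR (S d) / (INR (S d) + y)).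
  { split; [apply Rdiv_le_0_compat; lra|]. rewrite S_INR.
    apply (Rmult_le_reg_r ((INR d + y) * (INR d + 1 + y))); [nra|].
    field_simplify; nra. }
  apply (pow_incr _ _ (S k)) in H.
  apply -> Rminus_le_0. apply Rmult_le_compat_r; [left; now apply Rinv_0_lt_compat|lra].
Qed.

(** An integral comparison by differences of powers. The ratios of the denominators are extremal at
    the first index, which gives the two constants; both tend to 1 as y grows, as [phi_lim]
    needs. *)
Lemma phi_step_bounds k y d : 0 < y ->
  y / (1 + y) * (pfrac k y (S d) - pfrac k y d) <= phi_step k y d <=
  (y + 2) / (y + 1) * (pfrac k y (S (S d)) - pfrac k y (S d)).
Proof.
  intros Hy. assert (Hd := pos_INR d). assert (Hk := INR_S_pos k).
  unfold phi_step, pfrac. rewrite (S_INR (S d)), (S_INR d). set (p := INR d + 1).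
  replace (INR d) with (p - 1) by (unfold p; ring).
  assert (Hp : 1 <= p) by (unfold p; lra).
  set (a0 := (p - 1) / (p - 1 + y)). set (a1 := p / (p + y)). set (a2 := (p + 1) / (p + 1 + y)).
  assert (E01 : a1 - a0 = y / ((p + y) * (p - 1 + y))) by (unfold a1, a0; field; lra).
  assert (E12 : a2 - a1 = y / ((p + y) * (p + 1 + y))) by (unfold a2, a1; field; lra).
  assert (Ha0 : 0 <= a0) by (apply Rdiv_le_0_compat; lra).
  assert (Ha1 : 0 <= a1) by (apply Rdiv_le_0_compat; lra).
  assert (H01 : a0 <= a1).
  { cut (0 <= a1 - a0); [lra|]. rewrite E01. apply Rdiv_le_0_compat; nra. }
  assert (H12 : a1 <= a2).
  { cut (0 <= a2 - a1); [lra|]. rewrite E12. apply Rdiv_le_0_compat; nra. }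
  assert (Et : y * p ^ k / (p + y) ^ S (S k) = a1 ^ k * (y / (p + y) ^ 2)).
  { unfold a1, Rdiv. rewrite Rpow_mult_distr, pow_inv. rewrite <- !tech_pow_Rmult. field.
    split; try apply pow_nonzero; lra. }
  rewrite Et. assert (Pk : 0 <= a1 ^ k) by now apply pow_le.
  destruct (pow_diff_bounds a1 a0 k ltac:(lra)) as [_ B1].
  destruct (pow_diff_bounds a2 a1 k ltac:(lra)) as [B2 _].
  split.
  - apply Rle_trans with (y / (1 + y) * (a1 ^ k * (a1 - a0))).
    + apply Rmult_le_compat_l; [apply Rdiv_le_0_compat; lra|].
      apply (Rmult_le_reg_l (INR (S k))); auto.
      replace (INR (S k) * (a1 ^ S k / INR (S k) - a0 ^ S k / INR (S k))) with (a1 ^ S k - a0 ^ S k) by (field; lra). lra.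
    + rewrite E01. replace (y / (1 + y) * (a1 ^ k * (y / ((p + y) * (p - 1 + y))))) with
        (a1 ^ k * (y / (p + y) ^ 2 * (y * (p + y) / ((1 + y) * (p - 1 + y))))) by (field; lra).
      apply Rmult_le_compat_l; auto. rewrite <- (Rmult_1_r (y / (p + y) ^ 2)) at 2.
      apply Rmult_le_compat_l; [apply Rdiv_le_0_compat; [lra|apply pow_lt; lra]|].
      apply (Rmult_le_reg_r ((1 + y) * (p - 1 + y))); [nra|]. field_simplify; nra.
  - apply Rle_trans with ((y + 2) / (y + 1) * (a1 ^ k * (a2 - a1))).
    + rewrite E12. replace ((y + 2) / (y + 1) * (a1 ^ k * (y / ((p + y) * (p + 1 + y))))) with
        (a1 ^ k * (y / (p + y) ^ 2 * ((y + 2) * (p + y) / ((y + 1) * (p + 1 + y))))) by (field; lra).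
      apply Rmult_le_compat_l; auto. rewrite <- (Rmult_1_r (y / (p + y) ^ 2)) at 1.
      apply Rmult_le_compat_l; [apply Rdiv_le_0_compat; [lra|apply pow_lt; lra]|].
      apply (Rmult_le_reg_r ((y + 1) * (p + 1 + y))); [nra|]. field_simplify; nra.
    + apply Rmult_le_compat_l; [apply Rdiv_le_0_compat; lra|].
      apply (Rmult_le_reg_l (INR (S k))); auto.
      replace (INR (S k) * (a2 ^ S k / INR (S k) - a1 ^ S k / INR (S k))) with (a2 ^ S k - a1 ^ S k) by (field; lra). lra.
Qed.

Lemma phi_step_series k y : 0 < y -> exists V, is_series (phi_step k y) V /\
  y / (1 + y) * / INR (S k) <= V <= (y + 2) / (y + 1) * / INR (S k).
Proof.
  intros Hy. assert (Hk := INR_S_pos k).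
  assert (H0 := is_series_telescope _ _ (pfrac_lim k y Hy)).
  assert (H1 := is_series_telescope (fun d => pfrac k y (S d)) _ (proj1 (is_lim_seq_incr_1 _ _) (pfrac_lim k y Hy))).
  assert (E0 : pfrac k y 0 = 0) by (unfold pfrac; simpl INR; unfold Rdiv; rewrite Rmult_0_l, pow_i by lia; ring).
  rewrite E0, Rminus_0_r in H0.
  assert (S0 := is_series_scal (V:=R_NormedModule) (y / (1 + y)) _ _ H0).
  assert (S1 := is_series_scal (V:=R_NormedModule) ((y + 2) / (y + 1)) _ _ H1).
  assert (P0 : forall d, 0 <= y / (1 + y) * (pfrac k y (S d) - pfrac k y d)).
  { intros d. apply Rmult_le_pos; [apply Rdiv_le_0_compat; lra|now apply pfrac_diff]. }
  destruct (series_dom_exists (phi_step k y) (fun d => (y + 2) / (y + 1) * (pfrac k y (S (S d)) - pfrac k y (S d)))) as [V HV].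
  { intros d. destruct (phi_step_bounds k y d Hy) as [B1 B2]. specialize (P0 d). rewrite Rabs_pos_eq; lra. }
  { eexists; exact S1. }
  exists V. split; auto. rewrite <- (is_series_unique _ _ HV). split.
  - apply Rle_trans with (Series (fun d => y / (1 + y) * (pfrac k y (S d) - pfrac k y d))).
    + right. symmetry. apply is_series_unique. exact S0.
    + apply Series_le; [|eexists; exact HV]. intros d. split; [apply P0|]. now apply phi_step_bounds.
  - apply Rle_trans with (Series (fun d => (y + 2) / (y + 1) * (pfrac k y (S (S d)) - pfrac k y (S d)))).
    + apply Series_le; [|eexists; exact S1]. intros d. destruct (phi_step_bounds k y d Hy) as [B1 B2]. specialize (P0 d). lra.
    + replace (Series (fun d => (y + 2) / (y + 1) * (pfrac k y (S (S d)) - pfrac k y (S d)))) with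
        ((y + 2) / (y + 1) * (/ INR (S k) - pfrac k y 1)) by (symmetry; apply is_series_unique; exact S1).
      apply Rmult_le_compat_l; [apply Rdiv_le_0_compat; lra|].
      assert (0 <= pfrac k y 1).
      { unfold pfrac. apply Rdiv_le_0_compat; auto. apply pow_le. apply Rdiv_le_0_compat; simpl INR; lra. }
      lra.
Qed.

Lemma phi_series k y : 0 < y -> is_series (phi_term k y) (Series (phi_term k y)).
Proof.
  intros Hy. apply Series_correct. induction k as [|k [l IH]].
  - apply (ex_series_le (V:=R_CompleteNormedModule) _ (fun d => y * / INR (S d) ^ 2)).
    + intros d. change (Rabs (phi_term 0 y d) <= y * / INR (S d) ^ 2). unfold phi_term.
      assert (Hd := INR_S_pos d). set (p := INR (S d)) in *.
      replace (/ p - p ^ 0 / (p + y) ^ 1) with (y * / (p * (p + y))) by (simpl; field; lra).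
      rewrite Rabs_pos_eq by (apply Rmult_le_pos; [lra|left; apply Rinv_0_lt_compat; nra]).
      apply Rmult_le_compat_l; [lra|]. apply Rinv_le_contravar; simpl; nra.
    + apply (ex_series_scal (V:=R_NormedModule) y), ex_series_inv_pow. lia.
  - destruct (phi_step_series k y Hy) as (V & HV & _). exists (l + V).
    eapply is_series_ext; [|apply (is_series_plus (V:=R_NormedModule) _ _ _ _ IH HV)].
    intros d. rewrite phi_term_S by auto. reflexivity.
Qed.

Lemma phi_0_nat n : Series (phi_term 0 (INR (S n))) = sum_f_R0 (fun j => / INR (j + 1)) n.
Proof.
  apply is_series_unique.
  (* Raising y from m to m + 1 adds a telescoping series, which is how the harmonic numbers
     arise. *)
  assert (HT : forall m, is_series (fun d => / INR (S d + m) - / INR (S d + S m)) (/ INR (S m))).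
  { intros m. assert (H := is_series_telescope (fun d => - / INR (S d + m)) 0).
    replace (/ INR (S m)) with (0 - - / INR (S 0 + m)) by (simpl Nat.add; ring).
    eapply is_series_ext; [|apply H].
    - intros d. cbv beta. replace (S d + S m)%nat with (S (S d) + m)%nat by lia. eqR. ring.
    - replace (Finite 0) with (Finite (- 0)) by (f_equal; ring). apply (is_lim_seq_opp _ 0).
      apply (is_lim_seq_ext (fun d => / INR (S (d + m)))); [intros; f_equal|].
      apply (is_lim_seq_incr_n (fun d => / INR (S d)) m 0). apply inv_INR_lim. }
  induction n as [|n IH].
  - replace (sum_f_R0 (fun j => / INR (j + 1)) 0) with (/ INR 1) by reflexivity.
    eapply is_series_ext; [|apply (HT O)]. intros d. unfold phi_term.
    rewrite Nat.add_0_r, (plus_INR (S d) 1), pow_O, pow_1. pose proof (INR_S_pos d). pose proof (INR_S_pos 0).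
    eqR. field. lra.
  - rewrite tech5. replace (S n + 1)%nat with (S (S n)) by lia.
    eapply is_series_ext; [|apply (is_series_plus (V:=R_NormedModule) _ _ _ _ IH (HT (S n)))].
    intros d. unfold phi_term. rewrite !plus_INR, !pow_O, !pow_1.
    pose proof (INR_S_pos d). pose proof (INR_S_pos n). pose proof (INR_S_pos (S n)).
    plusR. field. lra.
Qed.

(** For k = 0 this is the definition of gamma, and each further index adds a series of steps
    squeezed to 1/(k + 1). *)
Lemma phi_lim k : is_lim_seq (fun n => Series (phi_term k (INR (S n))) - ln (INR (S n))) (euler_gamma + harm k).
Proof.
  induction k as [|k IH].
  - simpl harm. rewrite Rplus_0_r. eapply is_lim_seq_ext; [|apply euler_gamma_lim].
    intros n. cbv beta. rewrite phi_0_nat. replace (n + 1)%nat with (S n) by lia. reflexivity.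
  - assert (Hst : is_lim_seq (fun n => Series (phi_step k (INR (S n)))) (/ INR (S k))).
    { apply (is_lim_seq_le_le (fun n => (1 - / (1 + INR (S n))) * / INR (S k)) _ (fun n => (1 + / (1 + INR (S n))) * / INR (S k))).
      - intros n. assert (Hn := INR_S_pos n). destruct (phi_step_series k (INR (S n)) Hn) as (V & HV & B1 & B2).
        rewrite (is_series_unique _ _ HV).
        replace (1 - / (1 + INR (S n))) with (INR (S n) / (1 + INR (S n))) by (field; lra).
        replace (1 + / (1 + INR (S n))) with ((INR (S n) + 2) / (INR (S n) + 1)) by (field; lra). lra.
      - replace (Finite (/ INR (S k))) with (Finite ((1 - 0) * / INR (S k))) by (f_equal; ring).
        apply is_lim_seq_mult'; [|apply is_lim_seq_const]. apply is_lim_seq_minus'; [apply is_lim_seq_const|].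
        apply (is_lim_seq_ext (fun n => / INR (S (S n)))); [intros n; rewrite (S_INR (S n)); f_equal; ring|].
        apply (is_lim_seq_incr_1 (fun n => / INR (S n)) 0). apply inv_INR_lim.
      - replace (Finite (/ INR (S k))) with (Finite ((1 + 0) * / INR (S k))) by (f_equal; ring).
        apply is_lim_seq_mult'; [|apply is_lim_seq_const]. apply is_lim_seq_plus'; [apply is_lim_seq_const|].
        apply (is_lim_seq_ext (fun n => / INR (S (S n)))); [intros n; rewrite (S_INR (S n)); f_equal; ring|].
        apply (is_lim_seq_incr_1 (fun n => / INR (S n)) 0). apply inv_INR_lim. }
    assert (H := is_lim_seq_plus' _ _ _ _ IH Hst).
    replace (euler_gamma + harm (S k)) with (euler_gamma + harm k + / INR (S k)) by (unfold harm; ring).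
    eapply is_lim_seq_ext; [|exact H]. intros n. cbv beta. assert (Hn := INR_S_pos n).
    destruct (phi_step_series k (INR (S n)) Hn) as (V & HV & _).
    assert (E : Series (phi_term (S k) (INR (S n))) = Series (phi_term k (INR (S n))) + Series (phi_step k (INR (S n)))).
    { apply is_series_unique. rewrite (is_series_unique _ _ HV).
      eapply is_series_ext; [|apply (is_series_plus (V:=R_NormedModule) _ _ _ _ (phi_series k _ Hn) HV)].
      intros d. now rewrite phi_term_S by auto. }
    rewrite E. ring.
Qed.

(** * The kernel h_k and its integral *)

Definition eis_term (k : nat) (w : R) (d : nat) : R := INR (S d) ^ k * exp (- (INR (S d) * w)).

Definition hk (k : nat) (w : R) : R := w ^ S k * Series (eis_term k w) / INR (fact k) - 1.

Lemma eis_term_bound k w d : 0 < w -> 0 <= eis_term k w d <= INR (fact (k + 2)) / w ^ (k + 2) * / INR (S d) ^ 2.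
Proof.
  intros Hw. split; [apply Rmult_le_pos; [apply pow_le, pos_INR|left; apply exp_pos]|now apply pow_exp_term_bound].
Qed.

Lemma ex_series_eis_bound k w : ex_series (fun d => INR (fact (k + 2)) / w ^ (k + 2) * / INR (S d) ^ 2).
Proof. apply (ex_series_scal (V:=R_NormedModule) (INR (fact (k + 2)) / w ^ (k + 2))), ex_series_inv_pow. lia. Qed.

Lemma eis_series k w : 0 < w -> is_series (eis_term k w) (Series (eis_term k w)).
Proof.
  intros Hw. apply Series_correct, (series_dom_exists _ _) with (2 := ex_series_eis_bound k w).
  intros d. destruct (eis_term_bound k w d Hw). rewrite Rabs_pos_eq; lra.
Qed.

Lemma lip_term_0 k w : (1 <= k)%nat -> 0 < w -> Series (lip_term k w 0) = Series (eis_term k w).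
Proof.
  intros Hk Hw. rewrite Series_incr_1.
  - unfold lip_term at 1. simpl INR. rewrite Rplus_0_r, pow_i, Rmult_0_l, Rplus_0_l by lia.
    apply Series_ext. intros n. unfold lip_term, eis_term. now rewrite Rplus_0_r.
  - apply (series_dom_exists _ _) with (2 := ex_series_pow_exp k w Hw). intros d. apply lip_term_bound; lra.
Qed.

Lemma lip_freq_rr k w n : Re (lip_freq k w (Z.of_nat (S n))) = rr 1 k w n.
Proof.
  unfold lip_freq, rr. rewrite <- INR_IZR_INZ.
  replace (2 * PI * INR (S n) / INR 1) with (2 * PI * INR (S n)) by (simpl (INR 1); field). reflexivity.
Qed.

(** Lipschitz's formula without shift; its frequencies are those of [rr] at q = 1. This form shows
    the behaviour of [hk] as w -> 0, where the defining series is singular. *)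
Lemma hk_dual k w : (1 <= k)%nat -> 0 < w ->
  is_series (fun n => 2 * rr 1 k w n) (hk k w / w ^ S k).
Proof.
  intros Hk Hw. assert (H := lipschitz_formula k w 0 Hk Hw ltac:(lra)).
  rewrite lip_term_0 in H by auto.
  replace (hk k w / w ^ S k) with (Series (eis_term k w) / INR (fact k) - / w ^ S k).
  - eapply is_series_ext; [|exact H]. intros n. unfold lip_dual. rewrite <- lip_freq_rr.
    unfold ej. rewrite Rmult_0_r, cos_0, sin_0.
    change ((1, 0) : C) with (RtoC 1). now rewrite Cmult_1_l.
  - unfold hk. field. split; [apply INR_fact_neq_0|apply pow_nonzero; lra].
Qed.

Lemma rr1_bound k w n : (1 <= k)%nat -> 0 < w -> Rabs (2 * rr 1 k w n) <= 2 * / INR (S n) ^ 2.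
Proof.
  intros Hk Hw. rewrite Rabs_mult, (Rabs_pos_eq 2) by lra. apply Rmult_le_compat_l; [lra|].
  eapply Rle_trans; [apply rr_bound; auto|]. simpl (INR 1). rewrite pow1. lra.
Qed.

Lemma ex_series_2inv : ex_series (fun n => 2 * / INR (S n) ^ 2).
Proof. apply (ex_series_scal (V:=R_NormedModule) 2), ex_series_inv_pow. lia. Qed.

Lemma Rabs_series_le (f c : nat -> R) l : (forall n, Rabs (f n) <= c n) -> ex_series c -> is_series f l -> Rabs l <= Series c.
Proof.
  intros Hf Hex Hm. rewrite <- (is_series_unique _ _ Hm).
  eapply Rle_trans; [apply Series_Rabs|].
  - apply (ex_series_le (V:=R_CompleteNormedModule) _ c); auto.
    intros n. change (Rabs (Rabs (f n)) <= c n). rewrite Rabs_Rabsolu. apply Hf.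
  - apply Series_le; auto. intros n; split; [apply Rabs_pos|apply Hf].
Qed.

(** The dual series gives O(w^(k+1)) for small w and the defining series boundedness for w >= 1;
    both bounds of the conclusion follow from these. *)
Lemma hk_bounds k : (1 <= k)%nat -> exists B, 0 <= B /\ forall w, 0 < w -> Rabs (hk k w) <= B /\ Rabs (hk k w) <= B * w.
Proof.
  intros Hk.
  set (C1 := Series (fun n => 2 * / INR (S n) ^ 2)).
  set (C2 := INR (fact (k + 2)) * Series (fun n => / INR (S n) ^ 2) + 1).
  assert (H1 : forall w, 0 < w -> Rabs (hk k w) <= C1 * w ^ S k).
  { intros w Hw. assert (H := Rabs_series_le _ _ _ (fun n => rr1_bound k w n Hk Hw) ex_series_2inv (hk_dual k w Hk Hw)).
    fold C1 in H. assert (P := pow_lt w (S k) Hw).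
    unfold Rdiv in H. rewrite Rabs_mult, (Rabs_pos_eq (/ w ^ S k)) in H by (left; now apply Rinv_0_lt_compat).
    apply (Rmult_le_compat_r (w ^ S k)) in H; [|lra]. rewrite Rmult_assoc, Rinv_l, Rmult_1_r in H by lra. exact H. }
  assert (PC1 : 0 <= C1).
  { assert (H := H1 1 Rlt_0_1). rewrite pow1, Rmult_1_r in H. eapply Rle_trans; [apply Rabs_pos|exact H]. }
  assert (H2 : forall w, 1 <= w -> Rabs (hk k w) <= C2).
  { intros w Hw. unfold hk.
    assert (HS := Rabs_series_le (eis_term k w) (fun d => INR (fact (k + 2)) / w ^ (k + 2) * / INR (S d) ^ 2) _
       ltac:(intros d; destruct (eis_term_bound k w d ltac:(lra)); rewrite Rabs_pos_eq; lra)
       (ex_series_eis_bound k w) (eis_series k w ltac:(lra))).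
    rewrite Series_scal_l in HS. set (Z := Series (fun n => / INR (S n) ^ 2)) in *.
    assert (Hf1 : 1 <= INR (fact k)) by (apply (le_INR 1); apply lt_O_fact).
    assert (Pw : 0 < w ^ S k) by (apply pow_lt; lra).
    replace (w ^ S k * Series (eis_term k w) / INR (fact k) - 1) with (w ^ S k * Series (eis_term k w) * / INR (fact k) + -1) by (unfold Rdiv; ring).
    eapply Rle_trans; [apply Rabs_triang|]. rewrite (Rabs_left (-1)) by lra.
    rewrite !Rabs_mult, (Rabs_pos_eq (w ^ S k)), (Rabs_pos_eq (/ INR (fact k))) by (try lra; left; apply Rinv_0_lt_compat; lra).
    assert (Q : w ^ S k * Rabs (Series (eis_term k w)) <= INR (fact (k + 2)) * Z * / w).
    { apply Rle_trans with (w ^ S k * (INR (fact (k + 2)) / w ^ (k + 2) * Z)).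
      - apply Rmult_le_compat_l; lra.
      - right. replace (k + 2)%nat with (S (S k)) by lia. rewrite <- (tech_pow_Rmult w (S k)). field. split; lra. }
    assert (Z0 : 0 <= INR (fact (k + 2)) * Z * / w).
    { eapply Rle_trans; [|exact Q]. apply Rmult_le_pos; [lra|apply Rabs_pos]. }
    assert (Iw : / w <= 1) by (rewrite <- Rinv_1; apply Rinv_le_contravar; lra).
    assert (Iw0 : 0 < / w) by (apply Rinv_0_lt_compat; lra).
    assert (If : / INR (fact k) <= 1) by (rewrite <- Rinv_1; apply Rinv_le_contravar; lra).
    assert (If0 : 0 < / INR (fact k)) by (apply Rinv_0_lt_compat; lra).
    assert (PZ : 0 <= INR (fact (k + 2)) * Z).
    { replace (INR (fact (k + 2)) * Z) with (INR (fact (k + 2)) * Z * / w * w) by (field; lra). apply Rmult_le_pos; lra. }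
    assert (w ^ S k * Rabs (Series (eis_term k w)) * / INR (fact k) <= INR (fact (k + 2)) * Z * / w * 1).
    { apply Rmult_le_compat; try lra. apply Rmult_le_pos; [lra|apply Rabs_pos]. }
    unfold C2. fold Z. nra. }
  assert (PC2 : 0 <= C2) by (eapply Rle_trans; [apply Rabs_pos|apply (H2 1 (Rle_refl 1))]).
  exists (C1 + C2). split; [lra|]. intros w Hw. destruct (Rle_dec w 1) as [Hw1|Hw1].
  - specialize (H1 w Hw).
    assert (w ^ S k <= w).
    { rewrite <- tech_pow_Rmult. assert (w ^ k <= 1) by (rewrite <- (pow1 k); apply pow_incr; lra).
      assert (0 <= w ^ k) by (apply pow_le; lra). nra. }
    assert (0 <= w ^ S k) by (apply pow_le; lra). split; nra.
  - specialize (H2 w ltac:(lra)). split; nra.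
Qed.

Lemma hk_continuous k X : (1 <= k)%nat -> continuous (fun X => hk k (exp X)) X.
Proof.
  intros Hk.
  apply (continuous_ext (fun X => exp X ^ S k * Series (fun n => 2 * rr 1 k (exp X) n))).
  - intros x. rewrite (is_series_unique _ _ (hk_dual k (exp x) Hk (exp_pos x))). eqR. field.
    apply pow_nonzero, Rgt_not_eq, exp_pos.
  - apply continuous_mult_R.
    + apply continuous_pow_R. apply continuous_of_derivable. auto_derive; trivial.
    + apply (continuous_series (fun n X => 2 * rr 1 k (exp X) n) (fun n => 2 * / INR (S n) ^ 2)).
      * intros n x. apply continuous_mult_R; [apply continuous_const|]. exact (proj1 (rr_continuous 1 k n x)).
      * intros n x. apply rr1_bound; auto. apply exp_pos.
      * apply ex_series_2inv.
      * intros x. apply Series_correct. eexists. apply hk_dual; auto. apply exp_pos.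
Qed.

Lemma exp_scaled y X : 0 < y -> exp (- (y * exp X)) = exp (- exp (X + ln y)).
Proof. intros Hy. rewrite exp_plus, exp_ln by auto. f_equal. ring. Qed.

Lemma gamma_scaled k y : 0 < y ->
  isI (fun X => exp (- (y * exp X)) * exp X ^ S k) (INR (fact k) / y ^ S k).
Proof.
  intros Hy. assert (H := isI_scal (/ y ^ S k) _ _ (isI_shift _ _ (ln y) (gker_integral k))).
  replace (INR (fact k) / y ^ S k) with (/ y ^ S k * INR (fact k)) by (unfold Rdiv; ring).
  eapply isI_ext; [|exact H]. intros X. cbv beta. unfold gker. rewrite <- exp_scaled by auto.
  rewrite exp_INR_mult, exp_plus, exp_ln, Rpow_mult_distr by auto.
  assert (P := pow_lt y (S k) Hy). field. lra.
Qed.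

Definition Jfun (k : nat) (y X : R) : R := exp (- (y * exp X)) * hk k (exp X).

Lemma exp_decay y : 0 < y -> exists B, 0 <= B /\ forall X, exp (- (y * exp X)) <= B * exp (- X).
Proof.
  intros Hy. exists (/ y). split; [left; now apply Rinv_0_lt_compat|]. intros X.
  assert (P := exp_pos X). rewrite (exp_Ropp X).
  assert (H := exp_neg_le 1 (y * exp X) ltac:(nra)). rewrite pow_1 in H. simpl fact in H. simpl INR in H.
  eapply Rle_trans; [apply H|]. right. field. lra.
Qed.

Lemma Jfun_exists k y : (1 <= k)%nat -> 0 < y -> exists j, isI (Jfun k y) j.
Proof.
  intros Hk Hy. destruct (hk_bounds k Hk) as (B & PB & HB). destruct (exp_decay y Hy) as (B2 & PB2 & HB2).
  apply (isI_exists _ (B + B * B2) 1); [lra| |].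
  - intros x. apply continuous_mult_R; [|now apply hk_continuous]. apply continuous_of_derivable. auto_derive; trivial.
  - intros X. unfold Jfun. rewrite Rabs_mult, Rabs_pos_eq by (left; apply exp_pos).
    assert (P := exp_pos X). destruct (HB (exp X) P) as [H1 H2]. specialize (HB2 X).
    assert (P2 := exp_pos (- (y * exp X))).
    assert (exp (- (y * exp X)) <= 1) by (apply exp_le_1; nra).
    assert (PA := Rabs_pos (hk k (exp X))).
    apply env_two; try nra.
    + rewrite Rmult_1_l. nra.
    + rewrite Rmult_1_l. apply Rle_trans with (B2 * exp (- X) * B); [|right; ring].
      apply Rmult_le_compat; lra.
Qed.

Lemma Jfun_small k : (1 <= k)%nat -> exists B, forall y j, 0 < y -> isI (Jfun k y) j -> Rabs j <= B * / y.
Proof.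
  intros Hk. destruct (hk_bounds k Hk) as (B & PB & HB). exists B. intros y j Hy Hj.
  assert (HG := gamma_scaled 0 y Hy). simpl fact in HG. rewrite pow_1 in HG.
  assert (H1 := isI_scal B _ _ HG). assert (H2 := isI_scal (- B) _ _ HG).
  replace (INR 1 / y) with (/ y) in H1, H2 by (simpl; field; lra).
  assert (Hb : forall X, Rabs (Jfun k y X) <= B * (exp (- (y * exp X)) * exp X ^ 1)).
  { intros X. unfold Jfun. rewrite Rabs_mult, Rabs_pos_eq, pow_1 by (left; apply exp_pos).
    destruct (HB (exp X) (exp_pos X)) as [_ H3]. assert (P2 := exp_pos (- (y * exp X))). nra. }
  apply Rabs_le. split.
  - replace (- (B * / y)) with (- B * / y) by ring. apply (isI_le _ _ _ _ H2 Hj).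
    intros X. specialize (Hb X). apply Rabs_le_between in Hb. lra.
  - apply (isI_le _ _ _ _ Hj H1). intros X. specialize (Hb X). apply Rabs_le_between in Hb. lra.
Qed.

(** The two exponentials are translates of one function E. A primitive of their difference is the
    integral of E over a window of fixed signed length s1 - s2; it tends to that length at -oo,
    where E -> 1, and to 0 at +oo. *)
Lemma frullani y1 y2 : 0 < y1 -> 0 < y2 ->
  isI (fun X => exp (- (y1 * exp X)) - exp (- (y2 * exp X))) (ln y2 - ln y1).
Proof.
  intros H1 H2. set (s1 := ln y1). set (s2 := ln y2).
  set (E := fun X => exp (- exp X)).
  assert (HE : forall x, continuous E x) by apply continuous_exp_exp.
  assert (HI : forall a b, ex_RInt E a b) by (intros; now apply ex_RInt_continuous_all).
  set (F := fun X => RInt E (X + s2) (X + s1)).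
  set (K := Rabs (s1 - s2) * exp (Rabs s1 + Rabs s2)).
  assert (PK : 0 <= K) by (apply Rmult_le_pos; [apply Rabs_pos|left; apply exp_pos]).
  assert (Hmm : forall X t, Rmin (X + s2) (X + s1) <= t <= Rmax (X + s2) (X + s1) -> Rabs (t - X) <= Rabs s1 + Rabs s2).
  { intros X t Ht. pose proof (Rle_abs s1). pose proof (Rle_abs s2). pose proof (Rle_abs (- s1)). pose proof (Rle_abs (- s2)).
    rewrite Rabs_Ropp in H3, H4. pose proof (Rabs_pos s1). pose proof (Rabs_pos s2).
    apply Rabs_le. unfold Rmin, Rmax in Ht. destruct Rle_dec; lra. }
  assert (Hbd : forall (g : R -> R) a b M, (forall x, continuous g x) -> (forall t, Rmin a b <= t <= Rmax a b -> Rabs (g t) <= M) ->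
     Rabs (RInt g a b) <= Rabs (b - a) * M).
  { intros g a b M Hg HM. destruct (Rle_dec a b) as [Hab|Hab].
    - rewrite (Rabs_pos_eq (b - a)) by lra. apply abs_RInt_le_const; auto; [now apply ex_RInt_continuous_all|].
      intros t Ht. apply HM. rewrite Rmin_left, Rmax_right; lra.
    - rewrite <- (opp_RInt_swap (V:=R_CompleteNormedModule)) by now apply ex_RInt_continuous_all.
      unfold opp; simpl. rewrite Rabs_Ropp, (Rabs_left (b - a)) by lra. replace (- (b - a)) with (a - b) by ring.
      apply abs_RInt_le_const; [lra|now apply ex_RInt_continuous_all|].
      intros t Ht. apply HM. rewrite Rmin_right, Rmax_left; lra. }
  replace (s2 - s1) with (0 - (s1 - s2)) by ring.
  apply (isI_primitive _ F (s1 - s2) 0).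
  - intros x. set (Phi := fun X => RInt E 0 X).
    assert (HP : forall X, is_derive Phi X (E X)).
    { intros X. apply (is_derive_RInt (V:=R_NormedModule) E Phi 0 X); [|apply HE].
      exists (mkposreal 1 Rlt_0_1). intros y _. apply (RInt_correct (V:=R_CompleteNormedModule)). apply HI. }
    apply (is_derive_ext (fun X => Phi (X + s1) - Phi (X + s2))).
    + intros X. unfold Phi, F. rewrite <- (RInt_Chasles (V:=R_CompleteNormedModule) E 0 (X + s2) (X + s1)) by auto. plusR. ring.
    + rewrite !exp_scaled by auto. fold s1 s2.
      assert (HPs : forall s, is_derive (fun X => Phi (X + s)) x (exp (- exp (x + s)))).
      { intros s. evar_last.
        - apply (is_derive_comp (K:=R_AbsRing) (V:=R_NormedModule) Phi (fun X => X + s)); [apply HP|]. auto_derive; trivial.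
        - unfold scal; simpl; unfold mult; simpl. unfold E. eqR; ring. }
      apply (is_derive_minus (V:=R_NormedModule) _ _ _ _ _ (HPs s1) (HPs s2)).
  - intros x. apply continuous_of_derivable. auto_derive; trivial.
  - intros eps Heps. destruct (env_small 1 (eps / (K + 1)) Rlt_0_1) as (M & HM0 & HM); [apply Rdiv_lt_0_compat; lra|].
    exists M. intros x Hx. specialize (HM x). unfold env in HM. rewrite Rabs_pos_eq, Rmult_1_l in HM by lra. specialize (HM Hx).
    assert (Hsm : K * exp (- x) <= eps).
    { apply Rle_trans with (K * (eps / (K + 1))); [apply Rmult_le_compat_l; auto|].
      apply (Rmult_le_reg_r (K + 1)); [lra|]. replace (K * (eps / (K + 1)) * (K + 1)) with (K * eps) by (field; lra). nra. }
    assert (EK : Rabs (s1 - s2) * exp (- x + (Rabs s1 + Rabs s2)) = K * exp (- x)).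
    { unfold K. rewrite exp_plus. ring. }
    split.
    + rewrite Rminus_0_r. eapply Rle_trans; [|exact Hsm]. rewrite <- EK. unfold F.
      replace (s1 - s2) with (x + s1 - (x + s2)) by ring. apply Hbd; auto.
      intros t Ht. specialize (Hmm x t Ht). apply Rabs_le_between in Hmm.
      unfold E. rewrite Rabs_pos_eq by (left; apply exp_pos).
      assert (Hx1 := exp_exp_bound 1 t). simpl fact in Hx1. simpl INR in Hx1. rewrite !Rmult_1_l in Hx1.
      eapply Rle_trans; [exact Hx1|]. apply exp_le. lra.
    + eapply Rle_trans; [|exact Hsm]. rewrite <- EK. unfold F.
      assert (EF : RInt E (- x + s2) (- x + s1) - (s1 - s2) = RInt (fun t => E t - 1) (- x + s2) (- x + s1)).
      { symmetry. apply is_RInt_unique. 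
        assert (HH := is_RInt_minus (V:=R_NormedModule) _ _ _ _ _ _ (RInt_correct (V:=R_CompleteNormedModule) _ _ _ (HI (- x + s2) (- x + s1))) (is_RInt_const (- x + s2) (- x + s1) 1)).
        evar_last; [exact HH|]. unfold minus, plus, opp, scal; simpl; unfold mult; simpl. eqR. ring. }
      rewrite EF. replace (s1 - s2) with (- x + s1 - (- x + s2)) by ring. apply Hbd.
      * intros t. apply (continuous_minus (V:=R_NormedModule) E (fun _ => 1)); auto. apply continuous_const.
      * intros t Ht. specialize (Hmm (- x) t Ht). apply Rabs_le_between in Hmm.
        unfold E. assert (Hx1 := exp_ineq1_le (- exp t)). assert (P := exp_pos t).
        assert (exp (- exp t) <= 1) by (apply exp_le_1; lra).
        rewrite Rabs_left1 by lra. apply Rle_trans with (exp t); [lra|]. apply exp_le. lra.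
Qed.

Lemma exp_p_bound N p Y : 0 <= p <= INR N -> exp (p * Y) * exp (- exp Y) <= INR (fact N) + 1.
Proof.
  intros Hp. assert (PF := pos_INR (fact N)). assert (PE := exp_pos (p * Y)). assert (PE2 := exp_pos (- exp Y)).
  destruct (Rle_dec 0 Y) as [HY|HY].
  - assert (HB := exp_exp_bound N Y).
    apply Rle_trans with (exp (p * Y) * (INR (fact N) * exp (- (INR N * Y)))); [apply Rmult_le_compat_l; lra|].
    replace (exp (p * Y) * (INR (fact N) * exp (- (INR N * Y)))) with (INR (fact N) * (exp (p * Y) * exp (- (INR N * Y)))) by ring.
    rewrite <- exp_plus. assert (exp (p * Y + - (INR N * Y)) <= 1) by (apply exp_le_1; nra). nra.
  - assert (exp (p * Y) <= 1) by (apply exp_le_1; nra).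
    assert (exp (- exp Y) <= 1) by (apply exp_le_1; pose proof (exp_pos Y); lra). nra.
Qed.

Lemma z32_exp n : z32 n = exp (- (3 / 2 * ln (INR (S n)))).
Proof.
  unfold z32. assert (Hn := INR_S_pos n). set (p := INR (S n)) in *.
  rewrite exp_Ropp. f_equal. replace (3 / 2 * ln p) with (ln p + / 2 * ln p) by field.
  rewrite exp_plus, exp_ln by auto. f_equal. symmetry. rewrite <- (Rpower_sqrt p) by auto. reflexivity.
Qed.

Lemma exp_neg_lip a b : 0 <= a -> 0 <= b -> Rabs (exp (- a) - exp (- b)) <= Rabs (a - b).
Proof.
  assert (H : forall a b, 0 <= a -> a <= b -> Rabs (exp (- a) - exp (- b)) <= b - a).
  { intros u v Hu Huv. assert (exp (- v) <= exp (- u)) by (apply exp_le; lra).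
    rewrite Rabs_pos_eq by lra.
    assert (E : exp (- v) = exp (- u) * exp (- (v - u))) by (rewrite <- exp_plus; f_equal; ring).
    assert (H1 := exp_ineq1_le (- (v - u))). assert (P := exp_pos (- u)).
    assert (exp (- u) <= 1) by (apply exp_le_1; lra). nra. }
  intros Ha Hb. destruct (Rle_dec a b).
  - rewrite (Rabs_minus_sym a b), (Rabs_pos_eq (b - a)) by lra. now apply H.
  - rewrite Rabs_minus_sym, (Rabs_pos_eq (a - b)) by lra. apply H; lra.
Qed.

(** With u = d e^X the left side is u^(k + 3/2) e^(-u) times d^(-3/2) e^(-X/2), where d stands for
    the shifted index, and the factor in u is bounded. *)
Lemma eis_term_env k d X : exp X ^ S k * eis_term k (exp X) d <= (INR (fact (k + 2)) + 1) * z32 d * exp (- (1 / 2 * X)).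
Proof.
  unfold eis_term. rewrite z32_exp. assert (Hd := INR_S_pos d). set (l := ln (INR (S d))).
  assert (El : INR (S d) = exp l) by (unfold l; now rewrite exp_ln). rewrite El.
  rewrite <- !exp_INR_mult, <- (exp_plus l X). set (Y := l + X).
  assert (HB := exp_p_bound (k + 2) (INR k + 3 / 2) Y).
  rewrite plus_INR in HB. pose proof (pos_INR k). simpl (INR 2) in HB. specialize (HB ltac:(lra)).
  replace (exp (INR (S k) * X) * (exp (INR k * l) * exp (- exp Y))) with
    (exp ((INR k + 3 / 2) * Y) * exp (- exp Y) * (exp (- (3 / 2 * l)) * exp (- (1 / 2 * X)))).
  - rewrite (Rmult_assoc (INR (fact (k + 2)) + 1)). apply Rmult_le_compat_r; [|exact HB].
    left; apply Rmult_lt_0_compat; apply exp_pos.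
  - replace (exp ((INR k + 3 / 2) * Y) * exp (- exp Y) * (exp (- (3 / 2 * l)) * exp (- (1 / 2 * X)))) with
      (exp (- exp Y) * (exp ((INR k + 3 / 2) * Y) * (exp (- (3 / 2 * l)) * exp (- (1 / 2 * X))))) by ring.
    replace (exp (INR (S k) * X) * (exp (INR k * l) * exp (- exp Y))) with (exp (- exp Y) * (exp (INR (S k) * X) * exp (INR k * l))) by ring.
    rewrite <- !exp_plus. f_equal. f_equal. unfold Y. rewrite S_INR. field.
Qed.

(** For a single y the series in [hk] and its constant -1 both give divergent integrals at X -> -oo.
    In a difference of two values of y the exponential factor is O(e^X) there, so they separate into
    termwise Gamma integrals and a Frullani integral. *)
Lemma Jfun_difference k y1 y2 j1 j2 : (1 <= k)%nat -> 0 < y1 -> 0 < y2 ->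
  isI (Jfun k y1) j1 -> isI (Jfun k y2) j2 ->
  Series (phi_term k y2) - Series (phi_term k y1) = j1 - j2 + (ln y2 - ln y1).
Proof.
  intros Hk H1 H2 J1 J2.
  set (e := fun X => exp (- (y1 * exp X)) - exp (- (y2 * exp X))).
  assert (Hf0 := INR_fact_lt_0 k).
  assert (Hf1 : 1 <= INR (fact k)) by (apply (le_INR 1); apply lt_O_fact).
  set (f := fun d X => / INR (fact k) * (e X * (exp X ^ S k * eis_term k (exp X) d))).
  set (B := (INR (fact (k + 2)) + 1)). assert (PB : 0 <= B) by (unfold B; pose proof (pos_INR (fact (k + 2))); lra).
  assert (HS : is_series (fun d => INR (S d) ^ k / (INR (S d) + y1) ^ S k - INR (S d) ^ k / (INR (S d) + y2) ^ S k)
     (j1 - j2 + (ln y2 - ln y1))).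
  { apply (integral_series (env (1 / 2)) isI _ (is_integral_isI (1 / 2) ltac:(lra)) f _
       (fun d => (B * Rabs (y1 - y2) + B) * z32 d) (fun X => e X * (hk k (exp X) + 1))).
    - intros d. assert (Hd := INR_S_pos d). set (p := INR (S d)) in *.
      assert (G1 := isI_scal (p ^ k / INR (fact k)) _ _ (gamma_scaled k (p + y1) ltac:(lra))).
      assert (G2 := isI_scal (- (p ^ k / INR (fact k))) _ _ (gamma_scaled k (p + y2) ltac:(lra))).
      replace (p ^ k / (p + y1) ^ S k - p ^ k / (p + y2) ^ S k) with
        (p ^ k / INR (fact k) * (INR (fact k) / (p + y1) ^ S k) + - (p ^ k / INR (fact k)) * (INR (fact k) / (p + y2) ^ S k)).
      2:{ field. repeat split; try apply pow_nonzero; lra. }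
      eapply isI_ext; [|apply (isI_plus _ _ _ _ G1 G2)]. intros X. cbv beta. unfold f, e, eis_term. fold p.
      replace (- ((p + y1) * exp X)) with (- (y1 * exp X) + - (p * exp X)) by ring.
      replace (- ((p + y2) * exp X)) with (- (y2 * exp X) + - (p * exp X)) by ring.
      rewrite !exp_plus. field. lra.
    - intros d X. unfold f.
      assert (Et := eis_term_env k d X). fold B in Et.
      assert (P0 : 0 <= exp X ^ S k * eis_term k (exp X) d).
      { apply Rmult_le_pos; [apply pow_le; left; apply exp_pos|]. apply eis_term_bound, exp_pos. }
      assert (PX := exp_pos X). assert (Pz := z32_pos d). assert (PA := Rabs_pos (y1 - y2)).
      rewrite !Rabs_mult, (Rabs_pos_eq (/ INR (fact k))) by (left; now apply Rinv_0_lt_compat).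
      rewrite <- (Rabs_mult (exp X ^ S k)), (Rabs_pos_eq (exp X ^ S k * eis_term k (exp X) d)) by auto.
      set (g := exp X ^ S k * eis_term k (exp X) d) in *.
      assert (He1 : Rabs (e X) <= 1).
      { unfold e. assert (A1 := exp_pos (- (y1 * exp X))). assert (A2 := exp_pos (- (y2 * exp X))).
        assert (exp (- (y1 * exp X)) <= 1) by (apply exp_le_1; nra).
        assert (exp (- (y2 * exp X)) <= 1) by (apply exp_le_1; nra). apply Rabs_le. lra. }
      assert (He2 : Rabs (e X) <= Rabs (y1 - y2) * exp X).
      { unfold e. eapply Rle_trans; [apply exp_neg_lip; nra|].
        replace (y1 * exp X - y2 * exp X) with ((y1 - y2) * exp X) by ring.
        rewrite Rabs_mult, (Rabs_pos_eq (exp X)) by lra. lra. }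
      assert (PE := Rabs_pos (e X)).
      assert (If : / INR (fact k) <= 1) by (rewrite <- Rinv_1; apply Rinv_le_contravar; lra).
      assert (If0 : 0 < / INR (fact k)) by now apply Rinv_0_lt_compat.
      assert (T : forall u, 0 <= u -> Rabs (e X) <= u -> / INR (fact k) * (Rabs (e X) * g) <= u * (B * z32 d * exp (- (1 / 2 * X)))).
      { intros u Hu Hue. apply Rle_trans with (1 * (u * (B * z32 d * exp (- (1 / 2 * X))))); [|lra].
        apply Rmult_le_compat; try lra; [apply Rmult_le_pos; lra|]. apply Rmult_le_compat; lra. }
      replace ((B * Rabs (y1 - y2) + B) * z32 d) with (B * Rabs (y1 - y2) * z32 d + B * z32 d) by ring.
      apply env_two.
      + eapply Rle_trans; [apply (T (Rabs (y1 - y2) * exp X)); auto; nra|]. right.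
        replace (exp (1 / 2 * X)) with (exp X * exp (- (1 / 2 * X))) by (rewrite <- exp_plus; f_equal; field). ring.
      + eapply Rle_trans; [apply (T 1); auto; lra|]. right. ring.
      + apply Rmult_le_pos; [nra|lra].
      + nra.
    - apply (ex_series_scal (V:=R_NormedModule)), ex_series_z32.
    - intros X. unfold f. assert (PX := exp_pos X).
      assert (Hs := is_series_scal (V:=R_NormedModule) (/ INR (fact k) * (e X * exp X ^ S k)) _ _ (eis_series k (exp X) PX)).
      replace (e X * (hk k (exp X) + 1)) with (/ INR (fact k) * (e X * exp X ^ S k) * Series (eis_term k (exp X))).
      2:{ unfold hk. field. lra. }
      eapply is_series_ext; [|exact Hs]. intros d. unfold scal; simpl; unfold mult; simpl. eqR; ring.
    - assert (HH := isI_plus _ _ _ _ (isI_plus _ _ _ _ J1 (isI_scal (-1) _ _ J2)) (frullani y1 y2 H1 H2)).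
      replace (j1 - j2 + (ln y2 - ln y1)) with (j1 + -1 * j2 + (ln y2 - ln y1)) by ring.
      eapply isI_ext; [|exact HH]. intros X. cbv beta. unfold Jfun, e. ring. }
  eapply series_unique; [|exact HS].
  eapply is_series_ext; [|apply (is_series_minus (V:=R_NormedModule) _ _ _ _ (phi_series k y2 H2) (phi_series k y1 H1))].
  intros d. transitivity (phi_term k y2 d - phi_term k y1 d); [reflexivity|]. unfold phi_term. eqR. ring.
Qed.

(** [Jfun_difference] determines the integral up to a constant independent of y. Letting y run
    through the integers fixes it: the integral is O(1/y) by [Jfun_small], and [phi_lim] gives the
    rest. *)
Lemma Jfun_integral k y : (1 <= k)%nat -> 0 < y ->
  isI (Jfun k y) (ln y + euler_gamma + harm k - Series (phi_term k y)).
Proof.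
  intros Hk Hy. destruct (Jfun_exists k y Hk Hy) as [j Hj].
  replace (ln y + euler_gamma + harm k - Series (phi_term k y)) with j; auto.
  destruct (Jfun_small k Hk) as [B HB].
  set (u := fun n => Series (phi_term k (INR (S n))) - ln (INR (S n))).
  (* A constant sequence, squeezed between sequences with the limit gamma + H_k. *)
  assert (HL : is_lim_seq (fun n => j - ln y + Series (phi_term k y)) (euler_gamma + harm k)).
  { apply (is_lim_seq_le_le (fun n => u n - B * / INR (S n)) _ (fun n => u n + B * / INR (S n))).
    - intros n. assert (Hn := INR_S_pos n). destruct (Jfun_exists k (INR (S n)) Hk Hn) as [jn Hjn].
      assert (E := Jfun_difference k y (INR (S n)) j jn Hk Hy Hn Hj Hjn).
      specialize (HB _ _ Hn Hjn). apply Rabs_le_between in HB. unfold u. lra.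
    - replace (Finite (euler_gamma + harm k)) with (Finite (euler_gamma + harm k - B * 0)) by (f_equal; ring).
      apply is_lim_seq_minus'; [apply phi_lim|]. apply (is_lim_seq_scal_l _ B 0), inv_INR_lim.
    - replace (Finite (euler_gamma + harm k)) with (Finite (euler_gamma + harm k + B * 0)) by (f_equal; ring).
      apply is_lim_seq_plus'; [apply phi_lim|]. apply (is_lim_seq_scal_l _ B 0), inv_INR_lim. }
  assert (HC := is_lim_seq_const (j - ln y + Series (phi_term k y))).
  apply is_lim_seq_unique in HL, HC. rewrite HL in HC. injection HC; intros. lra.
Qed.

(** * The Eisenstein transformation *)

(** Multiplication by i exchanges the roles of the two lattice directions: m v + i b = i (v / 2 pi)
    conj(w + 2 pi i m) with w = 2 pi b / v. So the sum over m is again a Lipschitz dual series, and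
    i^(-k-1) is the real number [esign k]. *)
Lemma vertical_sum k b v : Nat.Odd k -> 0 < b -> 0 < v ->
  is_series (fun m => Re (/ ((INR (S m) * v)%R, b) ^ S k)%C) (esign k / 2 * / b ^ S k * hk k (2 * PI * b / v)).
Proof.
  intros Hk Hb Hv. assert (Hk1 : (1 <= k)%nat) by (destruct Hk; lia). assert (HP := PI_RGT_0).
  set (w := 2 * PI * b / v). assert (Hw : 0 < w) by (apply Rdiv_lt_0_compat; nra).
  assert (H := is_series_scal (V:=R_NormedModule) (esign k / 2 * (2 * PI / v) ^ S k) _ _ (hk_dual k w Hk1 Hw)).
  replace (esign k / 2 * / b ^ S k * hk k w) with (esign k / 2 * (2 * PI / v) ^ S k * (hk k w / w ^ S k)).
  - eapply is_series_ext; [|exact H]. intros m. assert (Hm := INR_S_pos m).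
    change (esign k / 2 * (2 * PI / v) ^ S k * (2 * rr 1 k w m) = Re (/ ((INR (S m) * v)%R, b) ^ S k)%C).
    unfold rr. replace (2 * PI * INR (S m) / INR 1) with (2 * PI * INR (S m)) by (simpl (INR 1); field).
    set (p := INR (S m)) in *. set (z := (w, (2 * PI * p)%R) : C).
    assert (Hz : z <> 0%C) by (apply freq_neq_0; auto).
    assert (Hzc : Cconj z <> 0%C) by (intros E; apply Hz; rewrite <- (Cconj_conj z), E; apply C_ext; simpl; ring).
    assert (Ez : (((p * v)%R, b) : C) = (Ci * (RtoC (v / (2 * PI)) * Cconj z))%C).
    { unfold z, w. apply C_ext; simpl; field; lra. }
    rewrite Ez.
    assert (Hci : Ci <> 0%C) by (apply Cmod_gt_0; rewrite Cmod_Ci; lra).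
    assert (Hr : RtoC (v / (2 * PI)) <> 0%C).
    { intros E. apply RtoC_inj in E. assert (0 < v / (2 * PI)) by (apply Rdiv_lt_0_compat; lra). lra. }
    rewrite <- (Cpow_inv (Ci * (RtoC (v / (2 * PI)) * Cconj z))%C) by (repeat apply Cmult_neq_0; auto).
    assert (Ei : (/ (Ci * (RtoC (v / (2 * PI)) * Cconj z)))%C = (- Ci * (RtoC (2 * PI / v) * Cconj (/ z)))%C).
    { rewrite Cconj_inv by auto. replace (RtoC (2 * PI / v)) with (/ RtoC (v / (2 * PI)))%C.
      - assert (Ec : (- Ci)%C = (/ Ci)%C).
        { assert (Ci2 : (Ci * Ci = -1)%C) by (apply C_ext; simpl; ring).
          transitivity (- (Ci * Ci) / Ci)%C; [field; auto|]. rewrite Ci2. field. auto. }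
        rewrite Ec. field. auto.
      - rewrite <- RtoC_inv by (apply Rgt_not_eq, Rdiv_lt_0_compat; lra). f_equal. field. lra. }
    rewrite Ei, !Cpow_mult_l, minus_Ci_pow_S, <- RtoC_pow, <- Cconj_pow, Cpow_inv by auto.
    destruct (/ z ^ S k)%C as [u1 u2]. cbn [Re Im Cmult RtoC fst snd Cconj]. field.
  - unfold w. unfold Rdiv. rewrite !Rpow_mult_distr, !pow_inv.
    field. repeat split; try apply pow_nonzero; lra.
Qed.

Lemma Cpow_diff_le_gen (a b : C) r j : Cmod a <= r -> Cmod b <= r ->
  Cmod (a ^ S j - b ^ S j) <= INR (S j) * r ^ j * Cmod (a - b).
Proof.
  intros Ha Hb. assert (Hr : 0 <= r) by (eapply Rle_trans; [apply Cmod_ge_0|apply Ha]).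
  induction j as [|j IH].
  - replace (a ^ 1 - b ^ 1)%C with (a - b)%C by (simpl; ring). rewrite pow_O. simpl INR. lra.
  - change (a ^ S (S j))%C with (a * a ^ S j)%C. change (b ^ S (S j))%C with (b * b ^ S j)%C.
    replace (a * a ^ S j - b * b ^ S j)%C with ((a - b) * a ^ S j + b * (a ^ S j - b ^ S j))%C by ring.
    eapply Rle_trans; [apply Cmod_triangle|]. rewrite !Cmod_mult, (S_INR (S j)), Cmod_pow.
    assert (Q : Cmod a ^ S j <= r ^ S j) by (apply pow_incr; split; [apply Cmod_ge_0|auto]).
    assert (P1 := Cmod_ge_0 (a - b)). assert (P2 := Cmod_ge_0 (a ^ S j - b ^ S j)). assert (P3 := Cmod_ge_0 b).
    assert (T1 : Cmod (a - b) * Cmod a ^ S j <= Cmod (a - b) * r ^ S j) by now apply Rmult_le_compat_l.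
    assert (T2 : Cmod b * Cmod (a ^ S j - b ^ S j) <= r * (INR (S j) * r ^ j * Cmod (a - b))) by now apply Rmult_le_compat.
    rewrite <- (tech_pow_Rmult r j) in T1 |- *. lra.
Qed.

Lemma Cmod_csum1_le q f M : (forall h, (1 <= h <= q)%nat -> Cmod (f h) <= M) -> Cmod (csum1 q f) <= INR q * M.
Proof.
  induction q as [|q IH]; intros H.
  - simpl. rewrite Cmod_0. lra.
  - change (csum1 (S q) f) with (csum1 q f + f (S q))%C. rewrite S_INR.
    eapply Rle_trans; [apply Cmod_triangle|].
    assert (Cmod (csum1 q f) <= INR q * M) by (apply IH; intros; apply H; lia).
    specialize (H (S q) ltac:(lia)). lra.
Qed.

Lemma csum1_conj q f : csum1 q (fun h => Cconj (f h)) = Cconj (csum1 q f).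
Proof. induction q as [|q IH]; simpl; [apply C_ext; simpl; ring|]. rewrite IH. now rewrite Cplus_conj. Qed.

Definition gval (q k : nat) (t : R) (N : nat) : R := Re (/ (t, (2 * PI * INR N / INR q)%R) ^ S k)%C.

(** A decay of order 3 in a quantity dominating both lattice coordinates is shared equally between
    them, and 3/2 is summable in each. *)
Lemma inv_cube_split s A B : 0 < A <= s -> 0 < B <= s -> / s ^ 3 <= / (A * sqrt A) * / (B * sqrt B).
Proof.
  intros HA HB. rewrite <- Rinv_mult.
  assert (Ps : 0 < sqrt s) by (apply sqrt_lt_R0; lra).
  assert (PA : 0 < sqrt A) by (apply sqrt_lt_R0; lra). assert (PB : 0 < sqrt B) by (apply sqrt_lt_R0; lra).
  assert (sqrt A <= sqrt s) by (apply sqrt_le_1; lra). assert (sqrt B <= sqrt s) by (apply sqrt_le_1; lra).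
  assert (Es : s = sqrt s * sqrt s) by (rewrite sqrt_sqrt; lra).
  apply Rinv_le_contravar; [repeat apply Rmult_lt_0_compat; lra|].
  replace (s ^ 3) with ((s * sqrt s) * (s * sqrt s)).
  - apply Rmult_le_compat; try (apply Rmult_le_pos; lra); apply Rmult_le_compat; lra.
  - replace (s * sqrt s * (s * sqrt s)) with (s * s * (sqrt s * sqrt s)) by ring. rewrite <- Es. ring.
Qed.

Lemma inv_scaled_z32 c n : 0 < c -> / ((c * INR (S n)) * sqrt (c * INR (S n))) = / (c * sqrt c) * z32 n.
Proof.
  intros Hc. assert (Hn := INR_S_pos n). unfold z32. rewrite sqrt_mult by lra. field.
  repeat split; try lra; apply Rgt_not_eq, sqrt_lt_R0; lra.
Qed.

Lemma gval_diff q k t j h : (1 <= q)%nat -> 0 < t -> (1 <= h <= q)%nat ->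
  Rabs (gval q k t (q * j + h) - gval q k t (q * j)) <= 2 * PI * INR (S k) * / Cmod (t, (2 * PI * INR j)%R) ^ (k + 2).
Proof.
  intros Hq Ht Hh. assert (HP := PI_RGT_0). assert (HQ : 0 < INR q) by (apply lt_0_INR; lia).
  assert (Hj := pos_INR j). destruct Hh as [Hh1 Hh2]. apply le_INR in Hh1, Hh2. simpl in Hh1.
  unfold gval. rewrite plus_INR, !mult_INR.
  replace (2 * PI * (INR q * INR j + INR h) / INR q) with (2 * PI * INR j + 2 * PI * (INR h / INR q)) by (field; lra).
  replace (2 * PI * (INR q * INR j) / INR q) with (2 * PI * INR j) by (field; lra).
  assert (Hhq : 0 <= INR h / INR q <= 1).
  { split; [apply Rdiv_le_0_compat; lra|]. apply (Rmult_le_reg_r (INR q)); auto. field_simplify; lra. }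
  set (z0 := (t, (2 * PI * INR j)%R) : C). set (z1 := (t, (2 * PI * INR j + 2 * PI * (INR h / INR q))%R) : C).
  assert (N0 : z0 <> 0%C) by (apply freq_neq_0; auto). assert (N1 : z1 <> 0%C) by (apply freq_neq_0; auto).
  assert (P0 : 0 < Cmod z0) by now apply Cmod_gt_0.
  assert (H01 : Cmod z0 <= Cmod z1).
  { assert (Hu : 0 <= 2 * PI * INR j) by nra. assert (Hd : 0 <= 2 * PI * (INR h / INR q)) by nra.
    unfold Cmod, z0, z1. cbn [fst snd]. revert Hu Hd.
    generalize (2 * PI * INR j) (2 * PI * (INR h / INR q)). intros u d Hu Hd.
    apply sqrt_le_1; nra. }
  set (r := / Cmod z0). assert (Pr : 0 < r) by now apply Rinv_0_lt_compat.
  assert (Ha : Cmod (/ z1) <= r) by (rewrite Cmod_inv by auto; apply Rinv_le_contravar; lra).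
  assert (Hb : Cmod (/ z0) <= r) by (rewrite Cmod_inv by auto; unfold r; lra).
  replace (Re (/ z1 ^ S k) - Re (/ z0 ^ S k)) with (Re ((/ z1) ^ S k - (/ z0) ^ S k)%C).
  2:{ rewrite !Cpow_inv by auto. reflexivity. }
  eapply Rle_trans; [apply re_le_Cmod|].
  eapply Rle_trans; [apply (Cpow_diff_le_gen _ _ r k Ha Hb)|].
  assert (Hd : Cmod (/ z1 - / z0) <= 2 * PI * (r * r)).
  { replace (/ z1 - / z0)%C with ((z0 - z1) * (/ z1 * / z0))%C by (field; auto).
    rewrite !Cmod_mult. apply Rmult_le_compat; try apply Cmod_ge_0.
    - apply Rmult_le_pos; apply Cmod_ge_0.
    - replace (z0 - z1)%C with (- Ci * RtoC (2 * PI * (INR h / INR q)))%C by (unfold z0, z1; apply C_ext; simpl; ring).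
      rewrite Cmod_mult, Cmod_opp, Cmod_Ci, Cmod_R, Rabs_pos_eq; nra.
    - apply Rmult_le_compat; auto; apply Cmod_ge_0. }
  replace (2 * PI * INR (S k) * / Cmod z0 ^ (k + 2)) with (INR (S k) * r ^ k * (2 * PI * (r * r))).
  - apply Rmult_le_compat_l; auto. apply Rmult_le_pos; [apply pos_INR|apply pow_le; lra].
  - unfold r. rewrite pow_add, Rinv_mult, pow_inv. simpl (Cmod z0 ^ 2). field. split; [lra|apply pow_nonzero; lra].
Qed.

Definition dual_seq (q : nat) (chi : nat -> C) (k : nat) (t : R) (N : nat) : C :=
  (Cconj (chi N) * RtoC (gval q k t N))%C.

(* The sum of [chi] over a block of [q] consecutive integers vanishes, which gains one power of decay:
   for [k = 1] the double series over lattice points is not absolutely convergent without this grouping. *)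
Lemma block_bound q chi k v : is_dirichlet_character q chi -> ~ is_principal q chi -> is_primitive_char q chi ->
  (1 <= k)%nat -> 0 < v -> exists B, 0 <= B /\ forall j m,
  Cmod (csum1 q (fun h => dual_seq q chi k (INR (S m) * v) (q * j + h))) <= B * z32 j * z32 m.
Proof.
  intros Hchi Hnp Hprim Hk Hv. assert (Hq : (1 <= q)%nat) by apply Hchi. assert (HP := PI_RGT_0).
  assert (HP2 := PI2_1).
  (* Chosen so that c1 (j + 1) bounds the modulus [s] of the lattice point from below: for j = 0
     because s >= v, for j >= 1 because s >= j >= (j + 1)/2. *)
  set (c1 := Rmin v 1 / 2). assert (Hc1 : 0 < c1).
  { unfold c1. assert (0 < Rmin v 1) by (apply Rmin_glb_lt; lra). lra. }
  set (B0 := 2 * PI * INR (S k) * (/ v ^ (k - 1) * (/ (c1 * sqrt c1) * / (v * sqrt v)))).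
  assert (PB0 : 0 <= B0).
  { unfold B0. apply Rmult_le_pos; [apply Rmult_le_pos; [lra|apply pos_INR]|].
    apply Rmult_le_pos; [left; apply Rinv_0_lt_compat, pow_lt; lra|].
    apply Rmult_le_pos; left; apply Rinv_0_lt_compat, Rmult_lt_0_compat; auto; apply sqrt_lt_R0; auto. }
  exists (INR q * B0). split; [apply Rmult_le_pos; [apply pos_INR|auto]|]. intros j m.
  assert (Hm := INR_S_pos m). set (t := INR (S m) * v). assert (Ht : 0 < t) by (unfold t; nra).
  assert (Htv : v <= t) by (unfold t; rewrite S_INR; pose proof (pos_INR m); nra).
  assert (E : csum1 q (fun h => dual_seq q chi k t (q * j + h)) =
    csum1 q (fun h => Cconj (chi (q * j + h)%nat) * RtoC (gval q k t (q * j + h) - gval q k t (q * j)))%C).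
  { transitivity (csum1 q (fun h => Cconj (chi (q * j + h)%nat) * RtoC (gval q k t (q * j + h) - gval q k t (q * j)))%C
       + RtoC (gval q k t (q * j)) * csum1 q (fun h => Cconj (chi h)))%C.
    - rewrite <- csum1_scal, <- csum1_plus. apply csum1_ext. intros h _. unfold dual_seq.
      replace (chi h) with (chi (q * j + h)%nat).
      + rewrite RtoC_minus. ring.
      + rewrite (Nat.mul_comm q j), Nat.add_comm. apply periodic_mul. now apply chi_periodic.
    - rewrite csum1_conj, (chi_sum_zero q chi) by auto. replace (Cconj 0) with (RtoC 0) by (apply C_ext; simpl; ring). ring. }
  rewrite E. rewrite !Rmult_assoc. apply Cmod_csum1_le. intros h Hh.
  rewrite Cmod_mult, Cmod_conj, Cmod_R.
  assert (Bc := chi_bound q chi (q * j + h) Hchi). assert (Bc0 := Cmod_ge_0 (chi (q * j + h)%nat)).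
  assert (Hd := gval_diff q k t j h Hq Ht Hh). assert (Hd0 := Rabs_pos (gval q k t (q * j + h) - gval q k t (q * j))).
  eapply Rle_trans; [apply Rle_trans with (1 * Rabs (gval q k t (q * j + h) - gval q k t (q * j))); [apply Rmult_le_compat_r; lra|rewrite Rmult_1_l; apply Hd]|].
  set (s := Cmod (t, (2 * PI * INR j)%R)).
  assert (Hst : t <= s) by (unfold s; eapply Rle_trans; [|apply re_le_Cmod]; simpl; apply Rle_abs).
  assert (Hsj : INR j <= s).
  { unfold s. eapply Rle_trans; [|apply Im_le_Cmod]. simpl. pose proof (pos_INR j). eapply Rle_trans; [|apply Rle_abs]. nra. }
  assert (HA : c1 * INR (S j) <= s).
  { rewrite S_INR. pose proof (pos_INR j). pose proof (Rmin_l v 1). pose proof (Rmin_r v 1). unfold c1.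
    destruct j; [simpl INR; lra|]. assert (1 <= INR (S j)) by (rewrite S_INR; pose proof (pos_INR j); lra). nra. }
  assert (H3 := inv_cube_split s (c1 * INR (S j)) (v * INR (S m)) ltac:(split; [apply Rmult_lt_0_compat; [auto|apply INR_S_pos]|auto])
     ltac:(split; [nra|unfold t in Hst; lra])).
  rewrite !inv_scaled_z32 in H3 by auto.
  unfold B0. rewrite !Rmult_assoc. apply Rmult_le_compat_l; [lra|]. apply Rmult_le_compat_l; [lra|]. apply Rmult_le_compat_l; [apply pos_INR|].
  replace (k + 2)%nat with ((k - 1) + 3)%nat by lia. rewrite pow_add, Rinv_mult.
  apply Rmult_le_compat.
  - left; apply Rinv_0_lt_compat, pow_lt; lra.
  - left; apply Rinv_0_lt_compat, pow_lt; lra.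
  - apply Rinv_le_contravar; [apply pow_lt; lra|]. apply pow_incr; lra.
  - eapply Rle_trans; [apply H3|]. right; ring.
Qed.

(** An exchange between the sum over blocks of q frequencies and the sum over m. The double series
    is dominated only when grouped in this way; each inner sum over m is a [vertical_sum]. *)
Lemma eisenstein_transform q chi k v : is_dirichlet_character q chi -> ~ is_principal q chi ->
  is_primitive_char q chi -> Nat.Odd k -> 0 < v ->
  exists T, csums (fun n => Cconj (chi (S n)) * RtoC (esign k / 2 * / bn q n ^ S k * hk k (2 * PI * bn q n / v)))%C T /\
    csums (fun m => Cser (dual_term q chi k (INR (S m) * v))) T.
Proof.
  intros Hchi Hnp Hprim Hk Hv. assert (Hq : (1 <= q)%nat) by apply Hchi.
  assert (Hk1 : (1 <= k)%nat) by (destruct Hk; lia). assert (HP := PI_RGT_0).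
  assert (HQ : 0 < INR q) by (apply lt_0_INR; lia).
  destruct (block_bound q chi k v Hchi Hnp Hprim Hk1 Hv) as (B & PB & HB).
  assert (Htm : forall m, 0 < INR (S m) * v) by (intros m; pose proof (INR_S_pos m); nra).
  set (x := fun N => (Cconj (chi N) * RtoC (esign k / 2 * / (2 * PI * INR N / INR q) ^ S k * hk k (2 * PI * (2 * PI * INR N / INR q) / v)))%C).
  set (f := fun j m => csum1 q (fun h => dual_seq q chi k (INR (S m) * v) (q * j + h))).
  set (l := fun j => csum1 q (fun h => x (q * j + h)%nat)).
  assert (Hex : ex_series (fun j => B * z32 j)) by (apply (ex_series_scal (V:=R_NormedModule)), ex_series_z32).
  assert (HF : forall m, csums (fun j => f j m) (Cser (dual_term q chi k (INR (S m) * v)))).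
  { intros m. unfold f. apply (csums_blocks q (dual_seq q chi k (INR (S m) * v))); auto.
    eapply csums_ext; [|apply (dual_csums q chi k (INR (S m) * v)); auto]. intros n. reflexivity. }
  assert (Hl : forall j, csums (f j) (l j)).
  { intros j. unfold f, l. apply (csums_csum1 q (fun h m => dual_seq q chi k (INR (S m) * v) (q * j + h)) (fun h => x (q * j + h)%nat)).
    intros h Hh. unfold dual_seq, x. apply csums_real. apply vertical_sum; auto.
    apply Rdiv_lt_0_compat; auto. assert (0 < INR (q * j + h)) by (apply lt_0_INR; lia). nra. }
  assert (Ibz : is_integral z32 (fun g m => is_series g m) (Series z32)).
  { apply is_integral_series; [intros; left; apply z32_pos|apply ex_series_z32]. }
  destruct (csums_dom_exists (fun m => Cser (dual_term q chi k (INR (S m) * v))) (fun m => 2 * Series (fun j => B * z32 j) * z32 m)) as [L HL].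
  { intros m. assert (Pz := z32_pos m).
    replace (2 * Series (fun j => B * z32 j) * z32 m) with (2 * Series (fun j => B * z32 j * z32 m)) by (rewrite (Series_scal_r (z32 m)); ring).
    apply (Cmod_csums_le _ _ (fun j => B * z32 j * z32 m)) with (3 := HF m).
    - intros j. apply HB.
    - apply ex_series_scal_r. exact Hex. }
  { apply (ex_series_scal (V:=R_NormedModule)), ex_series_z32. }
  assert (HlL : csums l L).
  { apply (integral_csums _ _ _ Ibz f l (fun j => B * z32 j) (fun m => Cser (dual_term q chi k (INR (S m) * v)))); auto. }
  destruct (hk_bounds k Hk1) as (Bh & PBh & HBh).
  (* After summation over m the series over single frequencies converges absolutely, since [hk] is
     bounded. Its blocks are [l], so its sum is the grouped one and the grouping can be undone. *)
  destruct (csums_dom_exists (fun n => x (S n)) (fun n => 1 / 2 * Bh * (INR q ^ S k * / INR (S n) ^ 2))) as [T HT].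
  { intros n. unfold x. fold (bn q n). rewrite Cmod_mult, Cmod_conj, Cmod_R.
    assert (Hb := bn_pos q n Hq). assert (Hg := bn_ge q n Hq). assert (Hn := INR_S_pos n).
    assert (H1 : 1 <= INR (S n)) by (rewrite S_INR; pose proof (pos_INR n); lra).
    assert (A := chi_bound q chi (S n) Hchi). assert (A1 := Cmod_ge_0 (chi (S n))).
    assert (Pi : 0 < / bn q n ^ S k) by (apply Rinv_0_lt_compat, pow_lt; lra).
    assert (H2 : / bn q n ^ S k <= INR q ^ S k * / INR (S n) ^ 2).
    { apply Rle_trans with (/ (INR (S n) / INR q) ^ S k).
      - apply Rinv_le_contravar; [apply pow_lt, Rdiv_lt_0_compat; lra|]. apply pow_incr. split; auto.
        apply Rdiv_le_0_compat; lra.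
      - unfold Rdiv. rewrite Rpow_mult_distr, Rinv_mult, pow_inv, Rinv_inv, Rmult_comm.
        apply Rmult_le_compat_l; [apply pow_le; lra|].
        apply Rinv_le_contravar; [apply pow_lt; lra|]. apply Rle_pow; auto. lia. }
    rewrite !Rabs_mult, (Rabs_pos_eq (/ bn q n ^ S k)) by lra.
    assert (Hes : Rabs (esign k / 2) = 1 / 2).
    { unfold esign, Rdiv. rewrite Rabs_mult, (Rabs_pos_eq (/ 2)), pow_1_abs by lra. ring. }
    rewrite Hes. destruct (HBh (2 * PI * bn q n / v)) as [H3 _]; [apply Rdiv_lt_0_compat; nra|].
    assert (PA := Rabs_pos (hk k (2 * PI * bn q n / v))).
    apply Rle_trans with (1 * (1 / 2 * (INR q ^ S k * / INR (S n) ^ 2) * Bh)); [|right; ring].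
    apply Rmult_le_compat; auto.
    - apply Rmult_le_pos; [apply Rmult_le_pos; lra|lra].
    - apply Rmult_le_compat; auto; [nra|]. apply Rmult_le_compat_l; lra. }
  { apply (ex_series_scal (V:=R_NormedModule) (1 / 2 * Bh)). apply ex_series_dual_bound. }
  exists T. split; [exact HT|].
  replace T with L; [exact HL|]. eapply csums_unique; [exact HlL|]. apply (csums_blocks q x T Hq HT).
Qed.

(** * Rearrangement over divisors *)

Lemma lsum_filter l (p : nat -> bool) f : lsum (filter p l) f = lsum l (fun h => if p h then f h else 0%C).
Proof.
  induction l as [|a l IH]; simpl; [reflexivity|]. rewrite <- IH. destruct (p a); simpl; [reflexivity|ring].
Qed.

(** Passing to the complementary divisor puts the sums over m that come out of the exchange into the
    form of the sigma functions, indexed by d. *)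
Lemma divisor_involution n (F : nat -> nat -> C) : (1 <= n)%nat ->
  csum1 n (fun m => if Nat.eqb (n mod m) 0 then F (n / m)%nat m else 0%C) =
  csum1 n (fun d => if Nat.eqb (n mod d) 0 then F d (n / d)%nat else 0%C).
Proof.
  intros Hn. rewrite !csum1_lsum.
  rewrite <- (lsum_filter (seq 1 n) (fun m => Nat.eqb (n mod m) 0) (fun m => F (n / m)%nat m)).
  rewrite <- (lsum_filter (seq 1 n) (fun d => Nat.eqb (n mod d) 0) (fun d => F d (n / d)%nat)).
  set (l := filter (fun m => Nat.eqb (n mod m) 0) (seq 1 n)).
  assert (Hl : forall m, In m l <-> (1 <= m <= n)%nat /\ exists c, n = (c * m)%nat).
  { intros m. unfold l. rewrite filter_In, in_seq, Nat.eqb_eq, Nat.Lcm0.mod_divide. split.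
    - intros [H1 [c Hc]]. split; [lia|]. now exists c.
    - intros [H1 [c Hc]]. split; [lia|]. now exists c. }
  assert (Hdiv : forall m, In m l -> In (n / m)%nat l /\ (n / (n / m))%nat = m).
  { intros m Hm. apply Hl in Hm. destruct Hm as [Hm [c Hc]].
    assert (E : (n / m = c)%nat) by (rewrite Hc; apply Nat.div_mul; lia). rewrite E.
    assert (Hc1 : (1 <= c)%nat) by (destruct c; lia). split.
    - apply Hl. split; [nia|]. exists m. lia.
    - rewrite Hc, Nat.mul_comm. apply Nat.div_mul. lia. }
  rewrite (lsum_ext l (fun m => F (n / m)%nat m) (fun m => (fun d => F d (n / d)%nat) (n / m)%nat)).
  - rewrite <- (lsum_map l (fun m => n / m)%nat (fun d => F d (n / d)%nat)).
    apply lsum_perm. apply NoDup_Permutation_bis.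
    + apply NoDup_map_NoDup_ForallPairs.
      * intros x y Hx Hy E. destruct (Hdiv x Hx) as [_ E1]. destruct (Hdiv y Hy) as [_ E2]. rewrite <- E1, <- E2. now rewrite E.
      * apply NoDup_filter, seq_NoDup.
    + rewrite length_map. lia.
    + intros x Hx. apply in_map_iff in Hx. destruct Hx as (y & <- & Hy). now apply Hdiv.
  - intros m Hm. cbv beta. now rewrite (proj2 (Hdiv m Hm)).
Qed.

Lemma csum1_sparse M N (g : nat -> C) : (1 <= M)%nat ->
  csum1 N (fun n => if Nat.eqb (n mod M) 0 then g (n / M)%nat else 0%C) = csum1 (N / M) g.
Proof.
  intros HM. induction N as [|N IH].
  - rewrite Nat.Div0.div_0_l. reflexivity.
  - change (csum1 (S N) (fun n => if Nat.eqb (n mod M) 0 then g (n / M)%nat else 0%C)) with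
      (csum1 N (fun n => if Nat.eqb (n mod M) 0 then g (n / M)%nat else 0%C) + (if Nat.eqb (S N mod M) 0 then g (S N / M)%nat else 0))%C.
    rewrite IH.
    assert (E1 := Nat.div_mod_eq N M). assert (B1 := Nat.mod_upper_bound N M ltac:(lia)).
    assert (E2 := Nat.div_mod_eq (S N) M). assert (B2 := Nat.mod_upper_bound (S N) M ltac:(lia)).
    destruct (Nat.eqb_spec (S N mod M) 0) as [E|E].
    + assert (Ed : (S N / M = S (N / M))%nat) by nia. rewrite Ed. reflexivity.
    + assert (Ed : (S N / M = N / M)%nat) by nia. rewrite Ed. ring.
Qed.

Lemma csums_sparse M (g : nat -> C) A : (1 <= M)%nat -> csums (fun d => g (S d)) A ->
  csums (fun n => if Nat.eqb (S n mod M) 0 then g (S n / M)%nat else 0%C) A.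
Proof.
  intros HM H. apply csums_Clim in H.
  apply (csums_Clim (fun n => if Nat.eqb (n mod M) 0 then g (n / M)%nat else 0%C)).
  apply (Clim_ext (fun N => csum1 (N / M) g)); [intros; now rewrite csum1_sparse|].
  assert (Hf : filterlim (fun N => (N / M)%nat) eventually eventually).
  { intros P [N0 HN]. exists (N0 * M)%nat. intros n Hn. apply HN.
    apply Nat.div_le_lower_bound; lia. }
  destruct H as [H1 H2]. split.
  - apply (is_lim_seq_subseq (fun N => Re (csum1 N g)) (Re A) (fun N => (N / M)%nat) Hf H1).
  - apply (is_lim_seq_subseq (fun N => Im (csum1 N g)) (Im A) (fun N => (N / M)%nat) Hf H2).
Qed.

Lemma csums_finite N (f : nat -> C) : (forall n, (N < n)%nat -> f n = 0%C) -> csums (fun n => f (S n)) (csum1 N f).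
Proof.
  intros H. apply csums_Clim.
  assert (E : forall n, (N <= n)%nat -> csum1 n f = csum1 N f).
  { intros n Hn. induction Hn as [|n Hn IH]; [reflexivity|]. simpl. rewrite IH, H by lia. ring. }
  split.
  - apply (is_lim_seq_ext_loc (fun _ => Re (csum1 N f))); [|apply is_lim_seq_const]. exists N. intros n Hn. rewrite (E n Hn); reflexivity.
  - apply (is_lim_seq_ext_loc (fun _ => Im (csum1 N f))); [|apply is_lim_seq_const]. exists N. intros n Hn. rewrite (E n Hn); reflexivity.
Qed.

Lemma z32_product_bound N M : (M <= N)%nat -> / (INR (S N) ^ 2 * INR (S M)) <= z32 M * z32 N.
Proof.
  intros H. unfold z32. rewrite <- Rinv_mult.
  assert (Hn := INR_S_pos N). assert (Hm := INR_S_pos M).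
  assert (HNM : INR (S M) <= INR (S N)) by (apply le_INR; lia).
  set (n := INR (S N)) in *. set (m := INR (S M)) in *.
  assert (Pn : 0 < sqrt n) by (apply sqrt_lt_R0; lra). assert (Pm : 0 < sqrt m) by (apply sqrt_lt_R0; lra).
  assert (sqrt m <= sqrt n) by (apply sqrt_le_1; lra).
  assert (En : n = sqrt n * sqrt n) by (rewrite sqrt_sqrt; lra).
  apply Rinv_le_contravar; [repeat apply Rmult_lt_0_compat; lra|].
  replace (n ^ 2 * m) with (m * n * n) by ring.
  replace (m * sqrt m * (n * sqrt n)) with (m * n * (sqrt m * sqrt n)) by ring.
  apply Rmult_le_compat_l; [apply Rmult_le_pos; lra|]. rewrite En at 2. apply Rmult_le_compat_r; lra.
Qed.

(** A sum over pairs (d, m) regrouped by the product n = d m. Row m is spread over the multiples of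
    m, and d^(-2) m^(-3) = n^(-2) m^(-1) with m <= n is at most (m n)^(-3/2), so rows and columns
    can be exchanged. *)
Lemma hyperbola_sum (a : nat -> nat -> C) (A : nat -> C) B : 0 <= B ->
  (forall d m, (1 <= d)%nat -> (1 <= m)%nat -> Cmod (a d m) <= B * / (INR d ^ 2 * INR m ^ 3)) ->
  (forall m, (1 <= m)%nat -> csums (fun d => a (S d) m) (A m)) ->
  exists L, csums (fun m => A (S m)) L /\
    csums (fun n => csum1 (S n) (fun d => if Nat.eqb (S n mod d) 0 then a d (S n / d)%nat else 0%C)) L.
Proof.
  intros PB Ha HA.
  set (f := fun m n => if Nat.eqb (S n mod S m) 0 then a (S n / S m)%nat (S m) else 0%C).
  set (F := fun n => csum1 (S n) (fun m => if Nat.eqb (S n mod m) 0 then a (S n / m)%nat m else 0%C)).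
  assert (Hb : forall m n, Cmod (f m n) <= B * z32 m * z32 n).
  { intros m n. assert (Pm := z32_pos m). assert (Pn := z32_pos n). unfold f.
    destruct (Nat.eqb_spec (S n mod S m) 0) as [E|E].
    - apply Nat.Lcm0.mod_divide in E. destruct E as [c Hc].
      assert (Hc1 : (1 <= c)%nat) by (destruct c; lia).
      replace (S n / S m)%nat with c by (rewrite Hc; symmetry; apply Nat.div_mul; lia).
      eapply Rle_trans; [apply Ha; lia|]. rewrite Rmult_assoc. apply Rmult_le_compat_l; auto.
      eapply Rle_trans; [|apply z32_product_bound; nia].
      rewrite Hc, mult_INR. right. f_equal. ring.
    - rewrite Cmod_0. apply Rmult_le_pos; [nra|lra]. }
  assert (HF : forall n, csums (fun m => f m n) (F n)).
  { intros n. unfold f, F.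
    apply (csums_finite (S n) (fun m => if Nat.eqb (S n mod m) 0 then a (S n / m)%nat m else 0%C)).
    intros m Hm. rewrite Nat.mod_small by lia. reflexivity. }
  assert (Hf : forall m, csums (f m) (A (S m))).
  { intros m. unfold f. apply (csums_sparse (S m) (fun d => a d (S m))); [lia|]. apply HA. lia. }
  assert (Ibz : is_integral z32 (fun g m => is_series g m) (Series z32)).
  { apply is_integral_series; [intros; left; apply z32_pos|apply ex_series_z32]. }
  assert (Hex : ex_series (fun m => B * z32 m)) by (apply (ex_series_scal (V:=R_NormedModule)), ex_series_z32).
  destruct (csums_dom_exists F (fun n => 2 * Series (fun m => B * z32 m) * z32 n)) as [L HL].
  { intros n.
    replace (2 * Series (fun m => B * z32 m) * z32 n) with (2 * Series (fun m => B * z32 m * z32 n)) by (rewrite (Series_scal_r (z32 n)); ring).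
    apply (Cmod_csums_le _ _ (fun m => B * z32 m * z32 n)) with (3 := HF n); [intros; apply Hb|].
    apply ex_series_scal_r. exact Hex. }
  { apply (ex_series_scal (V:=R_NormedModule)), ex_series_z32. }
  exists L. split.
  - apply (integral_csums _ _ _ Ibz f (fun m => A (S m)) (fun m => B * z32 m) F L); auto.
  - eapply csums_ext; [|exact HL]. intros n. unfold F. apply (divisor_involution (S n) a). lia.
Qed.

Lemma sigma_theta q chi k v : is_dirichlet_character q chi -> ~ is_principal q chi ->
  is_even_char q chi -> is_primitive_char q chi -> (1 <= k)%nat -> 0 < v ->
  exists L, csums (fun m => RtoC (2 * INR (fact k) / INR q) * gauss_sum q chi * Cser (dual_term q chi k (INR (S m) * v)))%C L /\
    csums (fun n => sigma_chi k chi (S n) * RtoC (exp (- (INR (S n) * v))))%C L.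
Proof.
  intros Hchi Hnp Hev Hprim Hk Hv.
  set (B := INR (fact (k + 3)) / v ^ (k + 3)).
  assert (PB : 0 <= B) by (apply Rdiv_le_0_compat; [apply pos_INR|apply pow_lt; lra]).
  set (a := fun d m => (chi d * RtoC (INR d ^ k * exp (- (INR d * (INR m * v)))))%C).
  set (A := fun m => (RtoC (2 * INR (fact k) / INR q) * gauss_sum q chi * Cser (dual_term q chi k (INR m * v)))%C).
  destruct (hyperbola_sum a A B PB) as (L & H1 & H2).
  - intros d m Hd Hm. unfold a. rewrite Cmod_mult, Cmod_R.
    assert (A1 := chi_bound q chi d Hchi). assert (A2 := Cmod_ge_0 (chi d)).
    apply le_INR in Hd, Hm. simpl in Hd, Hm. set (x := INR d) in *. set (y := INR m) in *.
    assert (P : 0 <= x ^ k * exp (- (x * (y * v)))) by (apply Rmult_le_pos; [apply pow_le; lra|left; apply exp_pos]).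
    rewrite Rabs_pos_eq by auto.
    assert (Hxyv : 0 < x * (y * v)) by (apply Rmult_lt_0_compat; nra).
    (* The exponent k + 3 leaves d^(-3) m^(-k-3) against d^k, more than [hyperbola_sum] asks. *)
    assert (HE := exp_neg_le (k + 3) _ Hxyv).
    assert (Q : x ^ k * exp (- (x * (y * v))) <= B * / (x ^ 2 * y ^ 3)).
    { eapply Rle_trans; [apply Rmult_le_compat_l; [apply pow_le; lra|apply HE]|].
      replace (x ^ k * (INR (fact (k + 3)) / (x * (y * v)) ^ (k + 3))) with (B * / (x ^ 3 * y ^ (k + 3))).
      - apply Rmult_le_compat_l; auto. apply Rinv_le_contravar.
        + apply Rmult_lt_0_compat; apply pow_lt; lra.
        + apply Rmult_le_compat; [apply pow_le; lra|apply pow_le; lra|apply Rle_pow; [lra|lia]|apply Rle_pow; [lra|lia]].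
      - unfold B. rewrite !Rpow_mult_distr, !pow_add. field. repeat split; try apply pow_nonzero; lra. }
    nra.
  - intros m Hm. unfold a, A. apply le_INR in Hm. simpl in Hm.
    destruct (theta_transform q chi k (INR m * v)) as (G & HG & HT); auto; [nra|].
    rewrite (csums_Cser _ _ HG). exact HT.
  - exists L. split; [exact H1|]. eapply csums_ext; [|exact H2]. intros n. cbv beta. unfold sigma_chi.
    rewrite Cmult_comm, <- csum1_scal. apply csum1_ext. intros d Hd.
    destruct (Nat.eqb_spec (S n mod d) 0) as [E|E]; [|ring]. unfold a.
    apply Nat.Lcm0.mod_divide in E. destruct E as [c Hc].
    replace (S n / d)%nat with c by (rewrite Hc; symmetry; apply Nat.div_mul; lia).
    rewrite Hc, mult_INR, RtoC_mult. replace (INR d * (INR c * v)) with (INR c * INR d * v) by ring. ring.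
Qed.

(** Pulling out m gives d^k ((d m)^(-k-1) - (d m + A0)^(-k-1)) = m^(-k-1) times the d-th term of the
    phi series at A0/m, so the rows of the double sum over (d, m) are phi series. *)
Lemma sigmabar_phi q chi k A0 : is_dirichlet_character q chi -> (1 <= k)%nat -> 0 < A0 ->
  exists T, csums (fun m => Cconj (chi (S m)) * RtoC (/ INR (S m) ^ S k * Series (phi_term k (A0 / INR (S m)))))%C T /\
    csums (fun n => sigmabar_chi k (conj_char chi) (S n) * RtoC (1 / INR (S n) ^ (k + 1) - 1 / (INR (S n) + A0) ^ (k + 1)))%C T.
Proof.
  intros Hchi Hk HA.
  set (wt := fun x => 1 / x ^ S k - 1 / (x + A0) ^ S k).
  (* The difference decays one power faster than its two parts, which makes the double sum
     dominated. *)
  assert (Hwt : forall x, 0 < x -> 0 <= wt x <= INR (S k) * A0 * / x ^ (k + 2)).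
  { intros x Hx. unfold wt.
    assert (Hab : 0 <= / (x + A0) <= / x).
    { split; [left; apply Rinv_0_lt_compat; lra|apply Rinv_le_contravar; lra]. }
    assert (Hle := pow_incr _ _ (S k) Hab).
    replace (1 / x ^ S k) with ((/ x) ^ S k) by (rewrite pow_inv; unfold Rdiv; ring).
    replace (1 / (x + A0) ^ S k) with ((/ (x + A0)) ^ S k) by (rewrite pow_inv; unfold Rdiv; ring).
    split; [lra|]. destruct (pow_diff_bounds (/ x) (/ (x + A0)) k Hab) as [_ Hd].
    eapply Rle_trans; [apply Hd|]. rewrite pow_inv.
    apply Rle_trans with (INR (S k) * / x ^ k * (A0 * / x ^ 2)).
    - apply Rmult_le_compat_l; [apply Rmult_le_pos; [apply pos_INR|left; apply Rinv_0_lt_compat, pow_lt; lra]|].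
      replace (/ x - / (x + A0)) with (A0 * / (x * (x + A0))) by (field; lra).
      apply Rmult_le_compat_l; [lra|]. apply Rinv_le_contravar; [apply pow_lt; lra|]. simpl; nra.
    - right. rewrite pow_add. field. split; [lra|apply pow_nonzero; lra]. }
  set (B := INR (S k) * A0). assert (PB : 0 <= B) by (unfold B; pose proof (pos_INR (S k)); nra).
  set (a := fun d m => (Cconj (chi m) * RtoC (INR d ^ k * wt (INR d * INR m)%R))%C).
  set (A := fun m => (Cconj (chi m) * RtoC (/ INR m ^ S k * Series (phi_term k (A0 / INR m))))%C).
  destruct (hyperbola_sum a A B PB) as (L & H1 & H2).
  - intros d m Hd Hm. unfold a. rewrite Cmod_mult, Cmod_conj, Cmod_R.
    assert (A1 := chi_bound q chi m Hchi). assert (A2 := Cmod_ge_0 (chi m)).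
    apply le_INR in Hd, Hm. simpl in Hd, Hm. set (x := INR d) in *. set (y := INR m) in *.
    assert (Hxy : 0 < x * y) by nra. destruct (Hwt _ Hxy) as [W0 W1].
    assert (P : 0 <= x ^ k * wt (x * y)) by (apply Rmult_le_pos; [apply pow_le; lra|auto]).
    rewrite Rabs_pos_eq by auto.
    assert (Q : x ^ k * wt (x * y) <= B * / (x ^ 2 * y ^ 3)).
    { eapply Rle_trans; [apply Rmult_le_compat_l; [apply pow_le; lra|apply W1]|].
      replace (x ^ k * (INR (S k) * A0 * / (x * y) ^ (k + 2))) with (B * / (x ^ 2 * y ^ (k + 2))).
      - apply Rmult_le_compat_l; auto. apply Rinv_le_contravar.
        + apply Rmult_lt_0_compat; apply pow_lt; lra.
        + apply Rmult_le_compat_l; [apply pow_le; lra|]. apply Rle_pow; [lra|lia].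
      - unfold B. rewrite !Rpow_mult_distr, !pow_add. field. repeat split; try apply pow_nonzero; lra. }
    nra.
  - intros m Hm. unfold a, A. apply le_INR in Hm. simpl in Hm. apply csums_real.
    assert (Hy : 0 < A0 / INR m) by (apply Rdiv_lt_0_compat; lra).
    assert (Hs := is_series_scal (V:=R_NormedModule) (/ INR m ^ S k) _ _ (phi_series k _ Hy)).
    eapply is_series_ext; [|exact Hs]. intros d.
    change (/ INR m ^ S k * phi_term k (A0 / INR m) d = INR (S d) ^ k * wt (INR (S d) * INR m)).
    unfold phi_term, wt. assert (Hd := INR_S_pos d). set (x := INR (S d)) in *. set (y := INR m) in *.
    replace (x * y + A0) with (y * (x + A0 / y)) by (field; lra).
    assert (0 < x + A0 / y) by lra.
    rewrite !Rpow_mult_distr. set (z := x + A0 / y) in *. rewrite <- (tech_pow_Rmult x k). field.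
    repeat split; try apply pow_nonzero; lra.
  - exists L. split; [exact H1|]. eapply csums_ext; [|exact H2]. intros n. cbv beta. unfold sigmabar_chi.
    rewrite Cmult_comm, <- csum1_scal. apply csum1_ext. intros d Hd.
    destruct (Nat.eqb_spec (S n mod d) 0) as [E|E]; [|ring]. unfold a, wt, conj_char.
    apply Nat.Lcm0.mod_divide in E. destruct E as [c Hc].
    replace (S n / d)%nat with c by (rewrite Hc; symmetry; apply Nat.div_mul; lia).
    rewrite Hc, mult_INR, RtoC_mult, (Rmult_comm (INR d)). replace (k + 1)%nat with (S k) by lia. ring.
Qed.

(** * Bessel functions *)

Lemma besselK0_isI y l : isI (fun t => exp (- y * cosh t)) l -> besselK0 y = l / 2.
Proof.
  intros [Hc Hl]. set (g := fun t => exp (- y * cosh t)) in *. unfold besselK0.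
  assert (Ev : forall t, g (- t) = g t).
  { intros t. unfold g, cosh. rewrite Ropp_involutive. f_equal. f_equal. f_equal. ring. }
  assert (Hex : forall u v, ex_RInt g u v).
  { intros u v. apply (ex_RInt_continuous (V:=R_CompleteNormedModule)). intros; apply Hc. }
  assert (Half : forall b, RInt g (- b) b = 2 * RInt g 0 b).
  { intros b. assert (E := RInt_reflect g 0 b Hc). rewrite Ropp_0 in E.
    rewrite (RInt_ext _ g) in E by (intros; apply Ev).
    assert (Ch := RInt_Chasles g (- b) 0 b (Hex _ _) (Hex _ _)).
    change (RInt g (- b) 0 + RInt g 0 b = RInt g (- b) b) in Ch. rewrite <- Ch, <- E. lra. }
  apply (is_RInt_gen_unique (V:=R_CompleteNormedModule)).
  intros P [eps HP]. destruct (Hl (eps / 2)) as [M HM]; [destruct eps; simpl; lra|].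
  apply (Filter_prod _ _ _ (fun u => u = 0) (fun b => Rmax M 0 < b)).
  - reflexivity.
  - exists (Rmax M 0). auto.
  - intros u b -> Hb. exists (RInt g 0 b). split; [apply (RInt_correct (V:=R_CompleteNormedModule)), Hex|].
    apply HP. assert (M <= b) by (pose proof (Rmax_l M 0); lra).
    specialize (HM (- b) b ltac:(lra) ltac:(lra)). rewrite Half in HM.
    change (Rabs (RInt g 0 b - l / 2) < eps).
    replace (2 * RInt g 0 b - l) with (2 * (RInt g 0 b - l / 2)) in HM by lra.
    rewrite Rabs_mult, (Rabs_pos_eq 2) in HM by lra. destruct eps as [e He]; simpl in *. lra.
Qed.

(** Translating X by half of ln(c/N) equalizes the coefficients of e^X and e^(-X), and the exponent
    becomes a multiple of cosh. *)
Lemma besselK0_double_exp c N : 0 < c -> 0 < N ->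
  isI (fun X => exp (- (c * exp X) - N * exp (- X))) (2 * besselK0 (2 * sqrt (c * N))).
Proof.
  intros Hc HN. set (y := 2 * sqrt (c * N)).
  assert (Hy : 0 < y) by (unfold y; assert (0 < sqrt (c * N)) by (apply sqrt_lt_R0; nra); lra).
  destruct (isI_exists (fun t => exp (- y * cosh t)) 1 (y / 2)) as [l Hl].
  - lra.
  - intros t. apply (ex_derive_continuous (V:=R_NormedModule)). unfold cosh. auto_derive. auto.
  - intros t. rewrite Rabs_pos_eq by (left; apply exp_pos). rewrite Rmult_1_l. unfold env. apply exp_le.
    assert (Rabs t <= 2 * cosh t); [|nra]. unfold cosh.
    assert (P1 := exp_pos t). assert (P2 := exp_pos (- t)).
    assert (Q1 := exp_ineq1_le t). assert (Q2 := exp_ineq1_le (- t)). unfold Rabs. destruct (Rcase_abs t); lra.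
  - assert (E := besselK0_isI y l Hl). rewrite E. replace (2 * (l / 2)) with l by lra.
    set (s := ln (c / N) / 2).
    assert (Hs : exp s * exp s = c / N).
    { rewrite <- exp_plus. unfold s. replace (ln (c / N) / 2 + ln (c / N) / 2) with (ln (c / N)) by lra.
      apply exp_ln, Rdiv_lt_0_compat; lra. }
    assert (Ps := exp_pos s).
    assert (Hy2 : y = 2 * (N * exp s)).
    { unfold y. f_equal. replace (c * N) with ((N * exp s) * (N * exp s)).
      - apply sqrt_square. nra.
      - replace (N * exp s * (N * exp s)) with (N * N * (exp s * exp s)) by ring. rewrite Hs. field. lra. }
    eapply isI_ext; [|apply (isI_shift _ _ s Hl)]. intros X. cbv beta. f_equal. unfold cosh.
    rewrite Hy2, Ropp_plus_distr, !exp_plus, (exp_Ropp s).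
    replace c with (N * (exp s * exp s)) by (rewrite Hs; field; lra). field. lra.
Qed.

Lemma sigma_chi_bound q chi k n : is_dirichlet_character q chi ->
  Cmod (sigma_chi k chi (S n)) <= INR (S n) ^ (k + 1).
Proof.
  intros Hchi. unfold sigma_chi. rewrite Nat.add_1_r, <- tech_pow_Rmult. apply Cmod_csum1_le. intros d Hd.
  assert (P : 0 <= INR (S n) ^ k) by (apply pow_le, pos_INR).
  destruct (Nat.eqb (S n mod d) 0); [|rewrite Cmod_0; exact P].
  assert (Pd : 0 <= INR d ^ k) by (apply pow_le, pos_INR).
  rewrite Cmod_mult, Cmod_R, Rabs_pos_eq by exact Pd.
  rewrite <- (Rmult_1_r (INR (S n) ^ k)). apply Rmult_le_compat; auto; [apply Cmod_ge_0| |apply (chi_bound q chi d Hchi)].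
  apply pow_incr; split; [apply pos_INR|apply le_INR; lia].
Qed.

(* Both exponentials are traded for powers, [exp (- x) <= j! / x ^ j], with exponents chosen so that the powers of [exp X] leave [exp X] or [exp (- X)]. *)
Lemma double_exp_bound c j : 0 < c -> exists B, 0 <= B /\
  forall N X, 0 < N -> exp (- (c * exp X) - N * exp (- X)) <= B * / N ^ S j * env 1 X.
Proof.
  intros Hc.
  set (B1 := INR (fact (S j)) * INR (fact j) / c ^ j).
  set (B2 := INR (fact (S j)) * INR (fact (S (S j))) / c ^ S (S j)).
  assert (P1 : 0 <= B1). { apply Rdiv_le_0_compat; [apply Rmult_le_pos; apply pos_INR|apply pow_lt; lra]. }
  assert (P2 : 0 <= B2). { apply Rdiv_le_0_compat; [apply Rmult_le_pos; apply pos_INR|apply pow_lt; lra]. }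
  exists (B1 + B2). split; [lra|]. intros N X HN.
  assert (PN : 0 < / N ^ S j) by (apply Rinv_0_lt_compat, pow_lt; lra).
  assert (Px := exp_pos X). assert (Px' := exp_pos (- X)).
  assert (Ex : exp X * exp (- X) = 1) by (rewrite <- exp_plus, Rplus_opp_r; apply exp_0).
  assert (Ei : exp (- X) = / exp X) by apply exp_Ropp.
  assert (HE1 : exp (- (N * exp (- X))) <= INR (fact (S j)) / (N * exp (- X)) ^ S j) by (apply exp_neg_le; nra).
  assert (HE : forall i, exp (- (c * exp X) - N * exp (- X)) <= INR (fact (S j)) / (N * exp (- X)) ^ S j * (INR (fact i) / (c * exp X) ^ i)).
  { intros i. assert (HE2 : exp (- (c * exp X)) <= INR (fact i) / (c * exp X) ^ i) by (apply exp_neg_le; nra).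
    replace (- (c * exp X) - N * exp (- X)) with (- (N * exp (- X)) + - (c * exp X)) by ring.
    rewrite exp_plus. apply Rmult_le_compat; auto; left; apply exp_pos. }
  replace ((B1 + B2) * / N ^ S j * env 1 X) with ((B1 * / N ^ S j + B2 * / N ^ S j) * env 1 X) by ring.
  apply env_two; try (apply Rmult_le_pos; lra).
  - eapply Rle_trans; [apply (HE j)|]. right. unfold B1. rewrite Rmult_1_l, Ei.
    rewrite !Rpow_mult_distr, pow_inv, <- !tech_pow_Rmult. field. repeat split; try apply pow_nonzero; lra.
  - eapply Rle_trans; [apply (HE (S (S j)))|]. right. unfold B2. rewrite Rmult_1_l, Ei.
    rewrite !Rpow_mult_distr, pow_inv, <- !tech_pow_Rmult. field. repeat split; try apply pow_nonzero; lra.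
Qed.

(** The square root of [exp_decay] at 2 c; B + 1 serves in place of the square root of B. *)
Lemma exp_decay_half c : 0 < c -> exists B, 0 <= B /\ forall X, exp (- (c * exp X)) <= B * exp (- (1 / 2 * X)).
Proof.
  intros Hc. destruct (exp_decay (2 * c)) as (B & PB & HB); [lra|]. exists (B + 1). split; [lra|]. intros X.
  specialize (HB X). assert (Pu := exp_pos (- (1 / 2 * X))). assert (PE := exp_pos (- (c * exp X))).
  replace (- (2 * c * exp X)) with (- (c * exp X) + - (c * exp X)) in HB by ring.
  replace (- X) with (- (1 / 2 * X) + - (1 / 2 * X)) in HB by lra. rewrite !exp_plus in HB.
  set (E := exp (- (c * exp X))) in *. set (u := exp (- (1 / 2 * X))) in *.
  apply Rsqr_incr_0_var; [|nra]. unfold Rsqr.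
  assert (0 < u * u) by nra. assert (B <= (B + 1) * (B + 1)) by nra.
  replace ((B + 1) * u * ((B + 1) * u)) with ((B + 1) * (B + 1) * (u * u)) by ring. nra.
Qed.

Lemma hk_term_env q k c : (1 <= q)%nat -> (1 <= k)%nat -> 0 < c -> exists B, 0 <= B /\ forall n X,
  Rabs (/ bn q n ^ S k * (exp (- (c * exp X)) * hk k (2 * PI * bn q n * exp X))) <= B * z32 n * env (1 / 2) X.
Proof.
  intros Hq Hk Hc. destruct (hk_bounds k Hk) as (B & PB & HB). destruct (exp_decay_half c Hc) as (B1 & PB1 & HB1).
  apply le_INR in Hq as Hq'. simpl in Hq'. set (Q := INR q) in *.
  assert (PQ : 0 < Q ^ S k) by (apply pow_lt; lra). assert (PPI := PI_RGT_0).
  exists (Q ^ S k * B * (2 * PI) + Q ^ S k * B * B1). split.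
  { apply Rplus_le_le_0_compat; (apply Rmult_le_pos; [apply Rmult_le_pos|]); lra. }
  intros n X. assert (Hn := INR_S_pos n). assert (Hz := z32_pos n). assert (Hb := bn_pos q n Hq).
  assert (Px := exp_pos X).
  set (w := 2 * PI * bn q n * exp X). assert (Hw : 0 < w) by (unfold w; apply Rmult_lt_0_compat; [apply Rmult_lt_0_compat|]; lra).
  destruct (HB w Hw) as [H1 H2].
  assert (PE := exp_pos (- (c * exp X))). assert (LE : exp (- (c * exp X)) <= 1) by (apply exp_le_1; nra).
  set (E := exp (- (c * exp X))) in *.
  assert (Pi : 0 < / bn q n ^ S k) by (apply Rinv_0_lt_compat, pow_lt; lra).
  assert (Hi : / bn q n ^ S k <= Q ^ S k * / INR (S n) ^ 2).
  { assert (Hge := bn_ge q n Hq). fold Q in Hge.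
    apply Rle_trans with (/ (INR (S n) / Q) ^ S k).
    - apply Rinv_le_contravar; [apply pow_lt, Rdiv_lt_0_compat; lra|]. apply pow_incr. split; [left; apply Rdiv_lt_0_compat; lra|auto].
    - unfold Rdiv. rewrite Rpow_mult_distr, pow_inv. replace (/ (INR (S n) ^ S k * / Q ^ S k)) with (Q ^ S k * / INR (S n) ^ S k) by (field; split; apply pow_nonzero; lra).
      apply Rmult_le_compat_l; [lra|]. apply Rinv_le_contravar; [apply pow_lt; lra|]. apply Rle_pow; [|lia].
      rewrite S_INR. pose proof (pos_INR n). lra. }
  assert (Hsq := inv_sq_le_z32 n).
  rewrite !Rabs_mult, (Rabs_pos_eq (/ _)), (Rabs_pos_eq E) by lra.
  replace ((Q ^ S k * B * (2 * PI) + Q ^ S k * B * B1) * z32 n * env (1 / 2) X) with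
    ((Q ^ S k * B * (2 * PI) * z32 n + Q ^ S k * B * B1 * z32 n) * env (1 / 2) X) by ring.
  assert (A0 := Rabs_pos (hk k w)).
  apply env_two; try (apply Rmult_le_pos; [apply Rmult_le_pos; [apply Rmult_le_pos|]|]; lra).
  (* Interpolating between the bounds B and B w costs only sqrt n, because w is proportional to n
     e^X. The full bound B w would leave 1/n, which is not summable. *)
  - assert (Hroot : Rabs (hk k w) <= B * sqrt w).
    { destruct (Rle_lt_dec w 1) as [L|L].
      - eapply Rle_trans; [apply H2|]. apply Rmult_le_compat_l; auto.
        assert (S1 : sqrt w <= 1) by (rewrite <- sqrt_1; apply sqrt_le_1; lra).
        assert (S2 := sqrt_pos w). assert (S3 := sqrt_sqrt w ltac:(lra)). nra.
      - eapply Rle_trans; [apply H1|]. assert (1 <= sqrt w) by (rewrite <- sqrt_1; apply sqrt_le_1; lra). nra. }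
    assert (Hsw : sqrt w <= 2 * PI * sqrt (INR (S n)) * exp (1 / 2 * X)).
    { set (r := sqrt (INR (S n))). assert (Pr : 0 < r) by (apply sqrt_lt_R0; auto).
      assert (Er : INR (S n) = r * r) by (unfold r; rewrite sqrt_sqrt; lra).
      assert (Ee : exp X = exp (1 / 2 * X) * exp (1 / 2 * X)) by (rewrite <- exp_plus; f_equal; lra).
      assert (Pe := exp_pos (1 / 2 * X)). set (e := exp (1 / 2 * X)) in *.
      assert (P0 : 0 <= 2 * PI * r * e) by (apply Rmult_le_pos; [apply Rmult_le_pos|]; lra).
      rewrite <- (sqrt_square (2 * PI * r * e)) by exact P0. apply sqrt_le_1; [lra|nra|].
      unfold w, bn. fold Q. rewrite Ee, Er.
      replace (2 * PI * (2 * PI * (r * r) / Q) * (e * e)) with (2 * PI * r * e * (2 * PI * r * e) * / Q) by (field; lra).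
      rewrite <- (Rmult_1_r (2 * PI * r * e * (2 * PI * r * e))) at 2. apply Rmult_le_compat_l; [nra|].
      rewrite <- Rinv_1. apply Rinv_le_contravar; lra. }
    apply Rle_trans with (Q ^ S k * / INR (S n) ^ 2 * (1 * (B * (2 * PI * sqrt (INR (S n)) * exp (1 / 2 * X))))).
    + apply Rmult_le_compat; [lra|apply Rmult_le_pos; lra|auto|]. apply Rmult_le_compat; [lra|lra|auto|].
      eapply Rle_trans; [apply Hroot|]. apply Rmult_le_compat_l; auto.
    + right. unfold z32. set (r := sqrt (INR (S n))). assert (Pr : 0 < r) by (apply sqrt_lt_R0; auto).
      assert (Er : INR (S n) = r * r) by (unfold r; rewrite sqrt_sqrt; lra). rewrite Er. field. lra.
  - apply Rle_trans with (Q ^ S k * z32 n * (B1 * exp (- (1 / 2 * X)) * B)); [|right; ring].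
    apply Rmult_le_compat; [lra|apply Rmult_le_pos; lra| |apply Rmult_le_compat; [lra|lra|apply HB1|auto]].
    eapply Rle_trans; [apply Hi|]. apply Rmult_le_compat_l; lra.
Qed.

(** Both series are termwise integrals of expansions of the same function, up to a constant factor:
    its Eisenstein form gives kernel integrals, its divisor form Bessel functions. The integral I
    exists by domination, independently of either series. *)
Lemma bessel_sum_transform q chi k c : is_dirichlet_character q chi -> ~ is_principal q chi ->
  is_even_char q chi -> is_primitive_char q chi -> Nat.Odd k -> 0 < c ->
  exists I, csums (fun n => lam q chi k n * RtoC (ln (c / (2 * PI * bn q n)) + euler_gamma + harm k - Series (phi_term k (c / (2 * PI * bn q n)))))%C I /\
    csums (fun n => sigma_chi k chi (S n) * RtoC (besselK0 (2 * sqrt (c * INR (S n)))))%C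
      (RtoC (INR (fact k) / INR q * esign k / 2) * gauss_sum q chi * I)%C.
Proof.
  intros Hchi Hnp Hev Hprim Hodd Hc.
  assert (Hq : (1 <= q)%nat) by apply Hchi. assert (Hk : (1 <= k)%nat) by (destruct Hodd; lia).
  assert (Hq' : 0 < INR q) by (apply lt_0_INR; lia). assert (PPI := PI_RGT_0).
  destruct (hk_term_env q k c Hq Hk Hc) as (B & PB & HB).
  set (g := fun n X => / bn q n ^ S k * (exp (- (c * exp X)) * hk k (2 * PI * bn q n * exp X))) in *.
  set (h := fun n X => (Cconj (chi (S n)) * RtoC (g n X))%C).
  assert (Hh : forall n X, Cmod (h n X) <= B * z32 n * env (1 / 2) X).
  { intros n X. unfold h. rewrite Cmod_mult, Cmod_conj, Cmod_R.
    assert (A1 := chi_bound q chi (S n) Hchi). assert (A2 := Cmod_ge_0 (chi (S n))).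
    assert (A3 := Rabs_pos (g n X)). specialize (HB n X). fold (g n X) in HB. nra. }
  assert (Hex : ex_series (fun n => B * z32 n)) by (apply (ex_series_scal (V:=R_NormedModule)), ex_series_z32).
  assert (Hhc : forall n X, Cmod (h n X) <= B * z32 n).
  { intros n X. eapply Rle_trans; [apply Hh|]. assert (env (1 / 2) X <= 1) by (apply env_le_1; lra).
    assert (0 <= B * z32 n) by (apply Rmult_le_pos; [auto|left; apply z32_pos]). nra. }
  set (H := fun X => Cser (fun n => h n X)).
  assert (HH : forall X, csums (fun n => h n X) (H X)).
  { intros X. apply (Cser_correct _ (fun n => B * z32 n)); auto. }
  assert (Hcont : forall X, Ccont H X).
  { apply (Ccont_series h (fun n => B * z32 n)); auto. intros n X. unfold h.
    apply Ccont_mult; [apply Ccont_const|]. apply Ccont_real. unfold g.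
    apply (continuous_scal_r (V:=R_NormedModule)). apply (continuous_mult (K:=R_AbsRing)).
    - apply (ex_derive_continuous (V:=R_NormedModule)). auto_derive. auto.
    - assert (Hb : 0 < 2 * PI * bn q n) by (pose proof (bn_pos q n Hq); nra).
      apply (continuous_ext (fun X => hk k (exp (X + ln (2 * PI * bn q n))))).
      + intros Y. rewrite exp_plus, exp_ln by auto. f_equal. ring.
      + apply (continuous_comp (fun X => X + ln (2 * PI * bn q n)) (fun X => hk k (exp X))).
        * apply (continuous_plus (V:=R_NormedModule)); [apply continuous_id|apply continuous_const].
        * apply hk_continuous; auto. }
  assert (Hbd : forall X, Cmod (H X) <= 2 * Series (fun n => B * z32 n) * env (1 / 2) X).
  { intros X. rewrite Rmult_assoc, <- (Series_scal_r (env (1 / 2) X)).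
    apply (Cmod_csums_le (fun n => h n X)); auto. apply ex_series_scal_r. exact Hex. }
  assert (HI := CI_exists H _ (1 / 2) ltac:(lra) Hcont Hbd). set (I := CII H) in *.
  exists I. split.
  - apply (integral_csums _ _ _ (is_integral_isI (1 / 2) ltac:(lra)) h _ (fun n => B * z32 n) H I); auto.
    intros n. assert (Hb : 0 < 2 * PI * bn q n) by (pose proof (bn_pos q n Hq); nra).
    (* Shifting X by ln(2 pi b_n) normalizes the argument of [hk] and moves the frequency into y = c
       / (2 pi b_n). *)
    assert (HJ := Jfun_integral k (c / (2 * PI * bn q n)) Hk (Rdiv_lt_0_compat _ _ Hc Hb)).
    apply (isI_shift _ _ (ln (2 * PI * bn q n))) in HJ.
    apply (CI_real _ _ _ _ _ (lam q chi k n) (is_integral_isI (1 / 2) ltac:(lra))) in HJ.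
    eapply (CI_ext _ _ _ _ _ _ (is_integral_isI (1 / 2) ltac:(lra))); [|exact HJ].
    intros X. cbv beta. unfold h, g, lam, Jfun. rewrite exp_plus, exp_ln by auto.
    replace (c / (2 * PI * bn q n) * (exp X * (2 * PI * bn q n))) with (c * exp X) by (field; pose proof (bn_pos q n Hq); lra).
    replace (exp X * (2 * PI * bn q n)) with (2 * PI * bn q n * exp X) by ring.
    rewrite !RtoC_mult. ring.
  - set (D := (RtoC (2 * INR (fact k) / INR q) * gauss_sum q chi)%C).
    (* Index k + 2 yields n^(-k-3), which against [sigma_chi_bound] leaves the summable n^(-2). *)
    destruct (double_exp_bound c (k + 2) Hc) as (B2 & PB2 & HB2).
    set (f := fun n X => (sigma_chi k chi (S n) * RtoC (exp (- (c * exp X) - INR (S n) * exp (- X))))%C).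
    assert (Hf : csums (fun n => sigma_chi k chi (S n) * RtoC (2 * besselK0 (2 * sqrt (c * INR (S n)))))%C (D * RtoC (esign k / 2) * I)%C).
    { apply (integral_csums _ _ _ (is_integral_isI 1 ltac:(lra)) f _ (fun n => B2 * / INR (S n) ^ 2) (fun X => D * RtoC (esign k / 2) * H X)%C).
      - intros n. unfold f. apply (CI_real _ _ _ _ _ _ (is_integral_isI 1 ltac:(lra))).
        apply besselK0_double_exp; [auto|apply INR_S_pos].
      - intros n X. unfold f. rewrite Cmod_mult, Cmod_R, Rabs_pos_eq by (left; apply exp_pos).
        assert (Hn := INR_S_pos n). specialize (HB2 (INR (S n)) X Hn).
        apply Rle_trans with (INR (S n) ^ (k + 1) * (B2 * / INR (S n) ^ S (k + 2) * env 1 X)).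
        + apply Rmult_le_compat; [apply Cmod_ge_0|left; apply exp_pos|apply (sigma_chi_bound q); auto|auto].
        + right. rewrite (pow_add _ k 1). replace (S (k + 2)) with (k + 1 + 2)%nat by lia. rewrite !pow_add. field.
          split; [lra|apply pow_nonzero; lra].
      - apply (ex_series_scal (V:=R_NormedModule)), ex_series_inv_pow. lia.
      - intros X. assert (Pv := exp_pos (- X)).
        (* At v = e^(-X) the divisor series and the Eisenstein series expand the same number. *)
        destruct (sigma_theta q chi k (exp (- X))) as (L & HL1 & HL2); auto.
        destruct (eisenstein_transform q chi k (exp (- X))) as (T & HT1 & HT2); auto.
        assert (EL := csums_unique _ _ _ HL1 (csums_scal _ D _ HT2)).
        assert (EH : csums (fun n => RtoC (esign k / 2) * h n X)%C (RtoC (exp (- (c * exp X))) * T)%C).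
        { eapply csums_ext; [|apply (csums_scal _ (RtoC (exp (- (c * exp X)))) _ HT1)]. intros n. cbv beta. unfold h, g.
          replace (2 * PI * bn q n / exp (- X)) with (2 * PI * bn q n * exp X) by (rewrite exp_Ropp; field; pose proof (exp_pos X); lra).
          rewrite !RtoC_mult. ring. }
        assert (E := csums_unique _ _ _ EH (csums_scal _ _ _ (HH X))).
        replace (D * RtoC (esign k / 2) * H X)%C with (RtoC (exp (- (c * exp X))) * L)%C.
        2:{ rewrite EL. rewrite <- Cmult_assoc, <- E. ring. }
        eapply csums_ext; [|apply (csums_scal _ (RtoC (exp (- (c * exp X)))) _ HL2)]. intros n. cbv beta. unfold f.
        unfold Rminus. rewrite exp_plus, RtoC_mult. ring.
      - apply (CI_scal _ _ _ _ _ _ (is_integral_isI 1 ltac:(lra)) HI). }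
    apply (csums_scal _ (RtoC (/ 2))) in Hf.
    replace (RtoC (INR (fact k) / INR q * esign k / 2) * gauss_sum q chi * I)%C with (RtoC (/ 2) * (D * RtoC (esign k / 2) * I))%C.
    + eapply csums_ext; [|exact Hf]. intros n. cbv beta. rewrite !RtoC_mult.
      replace (RtoC (/ 2) * (sigma_chi k chi (S n) * (RtoC 2 * RtoC (besselK0 (2 * sqrt (c * INR (S n)))))))%C with
        (RtoC (/ 2) * RtoC 2 * (sigma_chi k chi (S n) * RtoC (besselK0 (2 * sqrt (c * INR (S n))))))%C by ring.
      rewrite <- RtoC_mult. replace (/ 2 * 2) with 1 by lra. ring.
    + unfold D. replace (INR (fact k) / INR q * esign k / 2) with (/ 2 * (2 * INR (fact k) / INR q) * (esign k / 2)) by (field; lra).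
      rewrite !(RtoC_mult (/ 2 * (2 * INR (fact k) / INR q))), (RtoC_mult (/ 2)). ring.
Qed.

(** * The summation formula *)

(** The partial sum up to N is at most 7/4 - 1/N from N = 2 on, by telescoping. A bound below 2 is
    what [lam_sum_neq_0] needs. *)
Lemma Series_inv_sq_le : Series (fun n => / INR (S n) ^ 2) <= 7 / 4.
Proof.
  assert (H : forall N, sum_n (fun n => / INR (S n) ^ 2) (S N) <= 7 / 4 - / INR (S (S N))).
  { induction N as [|N IH].
    - rewrite sum_Sn, sum_O. change (/ INR 1 ^ 2 + / INR 2 ^ 2 <= 7 / 4 - / INR 2). simpl INR. lra.
    - rewrite sum_Sn. change (sum_n (fun n => / INR (S n) ^ 2) (S N) + / INR (S (S (S N))) ^ 2 <= 7 / 4 - / INR (S (S (S N)))).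
      apply Rle_trans with (7 / 4 - / INR (S (S N)) + / INR (S (S (S N))) ^ 2); [lra|].
      rewrite (S_INR (S (S N))). assert (P := INR_S_pos (S N)). set (u := INR (S (S N))) in *.
      assert (E : / u - / (u + 1) - / (u + 1) ^ 2 = / (u * (u + 1) ^ 2)) by (field; lra).
      assert (0 < / (u * (u + 1) ^ 2)) by (apply Rinv_0_lt_compat, Rmult_lt_0_compat; [lra|apply pow_lt; lra]). lra. }
  assert (Hs := Series_correct _ (ex_series_inv_pow 2 (le_n 2))).
  apply (is_lim_seq_incr_1 (sum_n (fun n => / INR (S n) ^ 2)) (Series (fun n => / INR (S n) ^ 2))) in Hs as Hl.
  apply (is_lim_seq_le _ (fun _ => 7 / 4) _ (7 / 4)) in Hl; [exact Hl| |apply is_lim_seq_const].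
  intros N. eapply Rle_trans; [apply H|]. assert (0 < / INR (S (S N))) by (apply Rinv_0_lt_compat, INR_S_pos). lra.
Qed.

Lemma inv_bn_pow q n j : (1 <= q)%nat -> / bn q n ^ j = (INR q / (2 * PI)) ^ j * / INR (S n) ^ j.
Proof.
  intros Hq. assert (Hq' : 0 < INR q) by (apply lt_0_INR; lia). assert (PPI := PI_RGT_0). assert (Hn := INR_S_pos n).
  rewrite <- !pow_inv, <- Rpow_mult_distr. f_equal. unfold bn. field. lra.
Qed.

(* The first term dominates the sum of all the others, as [zeta(2) < 2]. *)
Lemma lam_sum_neq_0 q chi k L0 : is_dirichlet_character q chi -> (1 <= k)%nat -> csums (lam q chi k) L0 -> L0 <> 0%C.
Proof.
  intros Hchi Hk [HR _] E. subst L0. change (Re (RtoC 0)) with 0 in HR.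
  assert (Hq : (1 <= q)%nat) by apply Hchi. assert (Hq' : 0 < INR q) by (apply lt_0_INR; lia). assert (PPI := PI_RGT_0).
  set (P := (INR q / (2 * PI)) ^ S k).
  assert (HP : 0 < P) by (apply pow_lt, Rdiv_lt_0_compat; lra).
  assert (Hb : forall n, Rabs (Re (lam q chi k n)) <= P * / INR (S n) ^ 2).
  { intros n. eapply Rle_trans; [apply re_le_Cmod|].
    assert (Hn := INR_S_pos n).
    unfold lam. rewrite Cmod_mult, Cmod_conj, Cmod_R, inv_bn_pow by auto. fold P.
    assert (0 < / INR (S n) ^ S k) by (apply Rinv_0_lt_compat, pow_lt; lra).
    rewrite Rabs_pos_eq by (apply Rmult_le_pos; lra).
    assert (A1 := chi_bound q chi (S n) Hchi). assert (A2 := Cmod_ge_0 (chi (S n))).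
    assert (/ INR (S n) ^ S k <= / INR (S n) ^ 2).
    { apply Rinv_le_contravar; [apply pow_lt; lra|]. apply Rle_pow; [|lia]. rewrite S_INR. pose proof (pos_INR n). lra. }
    apply Rle_trans with (1 * (P * / INR (S n) ^ S k)); [apply Rmult_le_compat_r; [apply Rmult_le_pos; lra|auto]|].
    rewrite Rmult_1_l. apply Rmult_le_compat_l; lra. }
  assert (Ht := series_tail_le _ _ _ 0 Hb (ex_series_scal (V:=R_NormedModule) P _ (ex_series_inv_pow 2 (le_n 2))) HR).
  rewrite Series_scal_l, !sum_O in Ht. assert (Hs := Series_inv_sq_le).
  assert (E0 : Re (lam q chi k 0) = P).
  { unfold lam. rewrite inv_bn_pow by auto. fold P. destruct Hchi as (_ & _ & _ & H1 & _). rewrite H1.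
    change (INR 1) with 1. rewrite pow1, Rinv_1. simpl. ring. }
  rewrite E0 in Ht. change (INR 1) with 1 in Ht. rewrite pow1, Rinv_1 in Ht.
  replace (0 - P) with (- P) in Ht by ring. rewrite Rabs_Ropp, Rabs_pos_eq in Ht by lra. nra.
Qed.

Lemma esign_odd k : Nat.Odd k -> esign k = - (-1) ^ ((k - 1) / 2).
Proof.
  intros [j ->]. unfold esign. replace (2 * j + 1 + 1)%nat with (S j * 2)%nat by lia.
  replace (2 * j + 1 - 1)%nat with (j * 2)%nat by lia. rewrite !Nat.div_mul by lia. simpl. ring.
Qed.

Lemma RtoC_neq_0 r : r <> 0 -> RtoC r <> 0%C.
Proof. intros H E. apply H. now apply RtoC_inj. Qed.

Theorem theorem2p6 (k q : nat) (chi : nat -> C) (Lf : C -> C) (dL : C) (a x : R) :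
  Nat.Odd k ->
  is_dirichlet_character q chi ->
  ~ is_principal q chi ->
  is_even_char q chi ->
  is_primitive_char q chi ->
  is_L_function chi Lf ->
  is_derive (K := C_AbsRing) (V := C_NormedModule) Lf (RtoC (- INR k)) dL ->
  0 < a -> 0 < x ->
  let L := Lf (RtoC (- INR k)) in
  let A := a ^ 2 * INR q * x / (16 * PI ^ 2) in
  exists T : C,
    is_series (K := C_AbsRing) (V := C_NormedModule)
      (fun n => Cmult (sigmabar_chi k (conj_char chi) (S n))
                      (RtoC (1 / INR (S n) ^ (k + 1) - 1 / (INR (S n) + A) ^ (k + 1))))
      T /\
    is_series (K := C_AbsRing) (V := C_NormedModule)
      (fun n => Cmult (sigma_chi k chi (S n)) (RtoC (besselK0 (a * sqrt (INR (S n) * x)))))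
      (Cplus
        (Cplus
          (Copp (Cmult (Cdiv L (RtoC 4))
             (Cplus (Cplus (RtoC (ln (8 * PI / a ^ 2))) (Cdiv dL L)) (RtoC (- 2 * euler_gamma)))))
          (Cmult (Cdiv L (RtoC 4)) (RtoC (ln x))))
        (Cmult (RtoC ((-1) ^ ((k - 1) / 2) * INR (fact k) * INR q ^ k
                      / (2 * (2 * PI) ^ (k + 1))))
               (Cmult (gauss_sum q chi) T))).
Proof.
  intros Hodd Hchi Hnp Hev Hprim HL Hd Ha Hx L A.
  assert (Hq : (1 <= q)%nat) by apply Hchi. assert (Hk : (1 <= k)%nat) by (destruct Hodd; lia).
  assert (Hq' : 0 < INR q) by (apply lt_0_INR; lia). assert (PPI := PI_RGT_0).
  assert (Ha2 : 0 < a ^ 2) by (apply pow_lt; auto).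
  assert (HA : 0 < A).
  { apply Rdiv_lt_0_compat; [apply Rmult_lt_0_compat; [apply Rmult_lt_0_compat|]; auto|].
    apply Rmult_lt_0_compat; [lra|apply pow_lt; auto]. }
  set (c := a ^ 2 * x / 4). assert (Hc : 0 < c) by (unfold c; nra).
  destruct (mellin_L q chi k Lf dL Hchi Hnp Hev Hprim HL Hd mellin_phiG_1) as [EL EdL]. fold L in EL, EdL.
  destruct (mellin_phiF_1 q chi k Hchi Hnp Hev Hprim Hodd) as (L0 & L1 & HL0 & HL1 & M0 & M1).
  rewrite M0 in EL. rewrite M1, mellin'_phiG_1 in EdL.
  destruct (bessel_sum_transform q chi k c Hchi Hnp Hev Hprim Hodd Hc) as (I & HI & HK).
  destruct (sigmabar_phi q chi k A Hchi Hk HA) as (T & HT1 & HT2).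
  exists T. split; [apply is_series_csums; exact HT2|]. apply is_series_csums.
  set (P := (INR q / (2 * PI)) ^ S k).
  (* Since ln(c / (2 pi b_n)) = ln(c / 2 pi) - ln b_n and c / (2 pi b_n) = A / (n + 1), the terms of
     I split into those of three series already summed. *)
  assert (EI : I = (RtoC (ln (c / (2 * PI)) + euler_gamma + harm k) * L0 - L1 - RtoC P * T)%C).
  { apply (csums_unique _ _ _ HI).
    replace (RtoC (ln (c / (2 * PI)) + euler_gamma + harm k) * L0 - L1 - RtoC P * T)%C with
      (RtoC (ln (c / (2 * PI)) + euler_gamma + harm k) * L0 + ((- RtoC 1) * L1 + (- RtoC P) * T))%C by ring.
    eapply csums_ext; [|apply csums_plus; [exact (csums_scal _ _ _ HL0)|apply csums_plus; [exact (csums_scal _ _ _ HL1)|exact (csums_scal _ _ _ HT1)]]].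
    intros n. cbv beta. assert (Hb := bn_pos q n Hq). assert (Hn := INR_S_pos n).
    replace (c / (2 * PI * bn q n)) with (c / (2 * PI) / bn q n) by (field; lra).
    rewrite (ln_div (c / (2 * PI)) (bn q n)); [|apply Rdiv_lt_0_compat; lra|auto].
    replace (c / (2 * PI) / bn q n) with (A / INR (S n)) by (unfold A, c, bn; field; lra).
    set (Ph := Series (phi_term k (A / INR (S n)))).
    replace (ln (c / (2 * PI)) - ln (bn q n) + euler_gamma + harm k - Ph) with
      ((ln (c / (2 * PI)) + euler_gamma + harm k) + - ln (bn q n) + - Ph) by ring.
    rewrite !RtoC_plus, !RtoC_opp. unfold lam. rewrite inv_bn_pow by auto. fold P. rewrite !RtoC_mult. ring. }
  assert (HL0nz := lam_sum_neq_0 q chi k L0 Hchi Hk HL0).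
  assert (Htau := gauss_sum_neq_0 q chi Hchi Hnp Hev Hprim).
  assert (Hf : INR (fact k) <> 0) by apply INR_fact_neq_0.
  assert (Hes : esign k <> 0) by (apply pow_nonzero; lra).
  (* Nonvanishing of L(-k) makes dL / L a genuine quotient, so that L times it can be replaced by
     dL. *)
  assert (HLnz : L <> 0%C).
  { rewrite EL. apply Cmult_neq_0; [apply Cmult_neq_0|]; auto. apply RtoC_neq_0.
    unfold Rdiv. repeat apply Rmult_integral_contrapositive_currified; auto; try lra. apply Rinv_neq_0_compat; lra. }
  assert (Elc : ln (c / (2 * PI)) = ln x - ln (8 * PI / a ^ 2)).
  { rewrite <- ln_div; [|auto|apply Rdiv_lt_0_compat; lra]. f_equal. unfold c. field. lra. }
  assert (Econst : (-1) ^ ((k - 1) / 2) * INR (fact k) * INR q ^ k / (2 * (2 * PI) ^ (k + 1)) = - (INR (fact k) / INR q * esign k / 2) * P).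
  { rewrite esign_odd by auto. unfold P, Rdiv. rewrite (Rpow_mult_distr (INR q) (/ (2 * PI))), pow_inv, Nat.add_1_r, <- !tech_pow_Rmult.
    field. repeat split; try apply pow_nonzero; lra. }
  eapply csums_ext; [intros n; cbv beta; replace (a * sqrt (INR (S n) * x)) with (2 * sqrt (c * INR (S n))); [reflexivity|]|].
  { assert (Hn := INR_S_pos n). replace (c * INR (S n)) with ((a / 2) * (a / 2) * (INR (S n) * x)) by (unfold c; field).
    rewrite sqrt_mult, sqrt_square by nra. field. }
  match goal with |- csums _ ?r => replace r with (RtoC (INR (fact k) / INR q * esign k / 2) * gauss_sum q chi * I)%C; [exact HK|] end.
  rewrite EI, Econst, Elc.
  replace (Cdiv L (RtoC 4) * (RtoC (ln (8 * PI / a ^ 2)) + dL / L + RtoC (- 2 * euler_gamma)))%C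
    with (/ RtoC 4 * (L * (RtoC (ln (8 * PI / a ^ 2)) + RtoC (- 2 * euler_gamma)) + dL))%C by (field; exact HLnz).
  (* What remains is linear in [L0], [L1] and [T]. The harmonic number in I cancels the one in dL,
     and dL contributes + gamma L, which turns -2 gamma into the single gamma of the kernel
     integral. *)
  rewrite EdL, EL.
  replace (2 * INR (fact k) / INR q * esign k) with (4 * (INR (fact k) / INR q * esign k / 2)) by (field; lra).
  set (e := INR (fact k) / INR q * esign k / 2). set (tau := gauss_sum q chi).
  rewrite !RtoC_plus, !RtoC_minus, !RtoC_mult, !RtoC_opp.
  replace (- 2) with (- (2)) by ring. rewrite RtoC_opp.
  generalize (RtoC e) (RtoC (ln x)) (RtoC (ln (8 * PI / a ^ 2))) (RtoC euler_gamma) (RtoC (harm k)) (RtoC P).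
  intros. field.
Qed.
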